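(* Let $k$ be an algebraically closed field, $n\ge 2$, $A=k[X_1,\ldots,X_n]$ with its standard grading, $d\ge 1$, and let $f_1,\ldots,f_{n+1}\in A_d$ be homogeneous polynomials of degree $d$, not all zero. Let $I=(f_1,\ldots,f_{n+1})\subseteq A$, $X=\mathrm{Proj}(A/I)\subseteq\mathbb P^{n-1}_k$ and $B=k[T_1,\ldots,T_{n+1}]$. Assume that the rational map $\lambda:\mathbb P^{n-1}_k\dashrightarrow\mathbb P^n_k$, $x\mapsto (f_1(x):\cdots:f_{n+1}(x))$, is generically finite onto its image and that $X$ is supported on a finite (possibly empty) set of points. Assume moreover that $X$ is locally generated by at most $n$ elements, i.e. for every $x\in X$ the ideal $\mathcal I_{X,x}\subseteq\mathcal O_{\mathbb P^{n-1}_k,x}$ can be generated by $n$ elements. Let $S\subseteq X$ be the set of points at which $X$ is not locally a complete intersection, and let $G\in B$ be the extraneous factor, i.e. the homogeneous polynomial (defined up to a nonzero constant of $k$) such that $$\mathfrak S(\mathrm{Sym}_A(I)_\nu)=(G\,H^{\deg(\lambda)})\qquad\text{for all }\nu\ge\eta .$$ Then, up to multiplication by a nonzero constant of $k$, $$G=\prod_{x\in S}L_x^{\,e_x-d_x}\in B .$$ Moreover, for every $x\in S$, each syzygy $a_1T_1+\cdots+a_{n+1}T_{n+1}\in A\otimes_kB_1$ of $(f_1,\ldots,f_{n+1})$ (i.e. $\sum_i a_if_i=0$) specializes at $x$ to a multiple of $L_x$, and at least one syzygy does not specialize to $0$ at $x$.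
   Context: Notation. $\mathfrak m=(X_1,\ldots,X_n)$, $I_X:=I:_A\mathfrak m^\infty$, $\eta:=(n-1)(d-1)-\mathrm{indeg}(I_X)$, where $\mathrm{indeg}(N)$ is the smallest degree in which a graded module $N$ is nonzero. $H\in B$ is an irreducible homogeneous equation of the closed image $\mathcal H$ of $\lambda$ (a hypersurface of $\mathbb P^n_k$), and $\deg(\lambda)$ is the degree of $\lambda$ onto its image (degree of the corresponding extension of function fields). $\mathrm{Sym}_A(I)_\nu$ is the $B$-module which is the image of $B\otimes_kA_\nu$ under the canonical surjection $A\otimes_kB=A[T_1,\ldots,T_{n+1}]\to\mathrm{Sym}_A(I)$, $T_i\mapsto f_i\in\mathrm{Sym}^1_A(I)=I$. Equivalently, it is the degree $\nu$ part in the variables $X$ of $A[T_1,\ldots,T_{n+1}]$ modulo the ideal generated by all $\sum a_iT_i$ with $a_i\in A$, $\sum a_if_i=0$. $\mathfrak S(M)$ denotes the MacRae invariant of a finitely generated torsion $B$-module $M$: the principal ideal $\prod_{\mathfrak q}\mathfrak q^{\,\ell_{B_{\mathfrak q}}(M_{\mathfrak q})}$ over height one primes $\mathfrak q$ of $B$; $\mathfrak S(M):=0$ if $M$ is not torsion. It is known (prior result) that if $f_1,\ldots,f_{n+1}\in A_d$ are not all zero, $\lambda$ is generically finite onto its image, $X$ is supported on a finite (possibly empty) set of points, and for every $x\in X$ the ideal $\mathcal I_{X,x}\subseteq\mathcal O_{\mathbb P^{n-1}_k,x}$ can be generated by $n$ elements, then for all $\nu\ge\eta$, the ideal $\mathfrak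 S(\mathrm{Sym}_A(I)_\nu)$ is nonzero, equal to $\mathfrak S(\mathrm{Sym}_A(I)_\eta)$, and contained in $(H^{\deg(\lambda)})$; this is what makes $G$ well defined. For $x\in X$: $d_x:=\ell_{\mathcal O_{\mathbb P^{n-1}_k,x}}(\mathcal O_{X,x})$, and $e_x$ is the Hilbert–Samuel multiplicity of $\mathcal I_{X,x}$ in the $(n-1)$-dimensional local ring $\mathcal O_{\mathbb P^{n-1}_k,x}$, i.e. $\ell(\mathcal I_{X,x}^{t-1}/\mathcal I_{X,x}^{t})$ is, for $t\gg0$, a polynomial in $t$ with leading term $e_x\,t^{n-2}/(n-2)!$. $X$ is locally a complete intersection at $x$ if $\mathcal I_{X,x}$ is generated by a regular sequence. Linear forms $L_x$: let $x\in S$. Then $\mathcal I_{X,x}$ is minimally generated by $n$ elements, so among the $n+1$ local generators induced by $f_1,\ldots,f_{n+1}$ (after dividing each by $l^d$ for a linear form $l\in A_1$ with $l(x)\ne0$) one can be written as a combination of the others with coefficients in $\mathcal O_{\mathbb P^{n-1}_k,x}$. This gives a relation $\sum_i c_i f_i/l^d=0$ with $c_i\in\mathcal O_{\mathbb P^{n-1}_k,x}$ and some $c_i$ invertible, and $L_x:=\sum_i c_i(x)T_i\in B_1$, a nonzero linear form which is unique up to a nonzero constant. The specialization of $\sum a_iT_i$ at $x$ is $\sum a_i(\hat x)T_i\in B_1$, where $\hat x\in k^n\setminus\{0\}$ is a vector of homogeneous coordinates of $x$. *)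

(* Defs.v *)
From HB Require Import structures.
From mathcomp Require Import all_boot all_order all_algebra.
From mathcomp Require Import mpoly.
From mathcomp Require Import boolp classical_sets cardinality fsbigop.

Set Implicit Arguments.
Unset Strict Implicit.
Unset Printing Implicit Defensive.

Import GRing.Theory.

Local Open Scope classical_set_scope.
Local Open Scope ring_scope.

Local Notation "x %:F" := (tofrac x).

(* Natural-number invariants are total functions: [xget 0 P] is an element of
   [P], or [0] when [P] is empty (for instance, a length that is infinite).    *)

(* Modules over a subring [R] of [F] are subquotients [N / P] of an [F]-module
   [V].  This covers localisations, [F] being then a field of fractions.       *)
Definition is_submodule (F : nzRingType) (V : lmodType F) (R : set F)
    (M : set V) : Prop :=
  [/\ M 0, forall u v, M u -> M v -> M (u + v)
    & forall a v, R a -> M v -> M (a *: v)].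

Definition has_chain (F : nzRingType) (V : lmodType F) (R : set F)
    (N P : set V) (l : nat) : Prop :=
  exists C : nat -> set V,
    [/\ forall i, (i <= l)%N -> is_submodule R (C i),
        P `<=` C 0%N, C l `<=` N
      & forall i, (i < l)%N -> C i `<` C i.+1].

(* Length of the R-module N / P. *)
Definition mod_length (F : nzRingType) (V : lmodType F) (R : set F)
    (N P : set V) : nat :=
  xget 0%N [set l | has_chain R N P l
                    /\ forall m, has_chain R N P m -> (m <= l)%N].

(* Ideals of a subring [R] of [F]; [R] is [setT] for the ideals of [F]. *)
Definition is_ideal (F : comNzRingType) (R I : set F) : Prop :=
  @is_submodule F F^o R I.

Definition gen_ideal (F : comNzRingType) (R G : set F) : set F :=
  smallest (is_ideal R) G.

Definition idealM (F : comNzRingType) (R I J : set F) : set F :=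
  gen_ideal R [set a * b | a in I & b in J].

Definition idealX (F : comNzRingType) (R I : set F) (m : nat) : set F :=
  iter m (idealM R I) R.

Definition is_prime_ideal (F : comNzRingType) (q : set F) : Prop :=
  [/\ is_ideal setT q, ~ q 1 & forall a b, q (a * b) -> q a \/ q b].

(* In a domain the zero ideal is prime. *)
Definition height_one (F : idomainType) (q : set F) : Prop :=
  [/\ is_prime_ideal q, q <> [set 0]
    & forall p, is_prime_ideal p -> p `<` q -> p = [set 0]].

Definition is_regular_seq (F : comNzRingType) (R : set F) (g : seq F) : Prop :=
  (forall i, (i < size g)%N -> forall a, R a ->
     gen_ideal R [set` take i g] (g`_i * a) -> gen_ideal R [set` take i g] a)
  /\ ~ gen_ideal R [set` g] 1.

Section MacRae.
Variables (B : idomainType).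
Local Notation K := {fraction B}.

Definition loc_ring (q : set B) : set K :=
  [set z | exists a s, ~ q s /\ z = a%:F / s%:F].

(* [N] is a [B]-submodule of the [K]-vector space [V], so that its localisation
   [N_q] embeds in [V]; by exactness [(N / P)_q = N_q / P_q]. *)
Definition loc_mod (V : lmodType K) (q : set B) (N : set V) : set V :=
  [set v | exists s w, [/\ ~ q s, N w & v = (s%:F)^-1 *: w]].

Definition is_torsion (V : lmodType K) (N P : set V) : Prop :=
  forall v, N v -> exists b : B, b != 0 /\ P (b%:F *: v).

(* MacRae invariant of the B-module N / P; the iterated operation with
   finite support ignores the primes at which the length vanishes. *)
Definition macrae (V : lmodType K) (N P : set V) : set B :=
  if `[< is_torsion N P >] then
    \big[idealM setT/setT]_(q \in @height_one B)
       idealX setT q (mod_length (loc_ring q) (loc_mod q N) (loc_mod q P))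
  else [set 0].

End MacRae.

(* Degree of the extension E / F of subfields of K. *)
Definition ext_degree (K : fieldType) (E F : set K) : nat :=
  xget 0%N [set m : nat | exists b : 'I_m -> K,
    [/\ forall i, E (b i),
        forall z, E z -> exists c : 'I_m -> K,
          (forall i, F (c i)) /\ z = \sum_i c i * b i
      & forall c : 'I_m -> K, (forall i, F (c i)) ->
          \sum_i c i * b i = 0 -> forall i, c i = 0]].

(* Closed points of the projective space of dimension [n - 1], each represented
   by its unique vector of coordinates whose first nonzero entry is [1]. *)
Definition normalized (k : fieldType) (n : nat) (v : 'rV[k]_n) : bool :=
  [exists i, (v 0 i == 1) && [forall j : 'I_n, (j < i)%N ==> (v 0 j == 0)]].

Record ppoint (k : fieldType) (n : nat) :=
  PPoint { pcoord :> 'rV[k]_n; _ : normalized pcoord }.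
HB.instance Definition _ (k : fieldType) (n : nat) :=
  [isSub for @pcoord k n].
HB.instance Definition _ (k : fieldType) (n : nat) :=
  [Choice of ppoint k n by <:].

Definition homog_coords (k : fieldType) (n : nat) (x : ppoint k n)
    (v : 'rV[k]_n) : Prop :=
  exists t : k, t != 0 /\ v = t *: pcoord x.

Definition mev (k : fieldType) (n : nat) (p : {mpoly k[n]}) (v : 'rV[k]_n) : k :=
  p.@[v 0].

Section LocalRing.
Variables (k : fieldType) (n : nat) (x : ppoint k n).
Local Notation A := {mpoly k[n]}.

(* Local ring of the projective space at [x], in the field of fractions of A. *)
Definition stalk : set {fraction A} :=
  [set z | exists e (p q : A),
     [/\ p \is e.-homog, q \is e.-homog, mev q x != 0 & z = p%:F / q%:F]].

(* Stalk at [x] of the ideal sheaf of the homogeneous ideal [I]. *)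
Definition stalk_ideal (I : set A) : set {fraction A} :=
  [set z | exists e (p q : A),
     [/\ p \is e.-homog, q \is e.-homog, mev q x != 0, I p & z = p%:F / q%:F]].

(* The value at [x] of an element of the local ring. *)
Definition value_at (z : {fraction A}) : k :=
  xget 0 [set c | exists e (p q : A),
     [/\ p \is e.-homog, q \is e.-homog, mev q x != 0, z = p%:F / q%:F
       & c = mev p x / mev q x]].

End LocalRing.

Definition indeg (k : fieldType) (n : nat) (N : set {mpoly k[n]}) : nat :=
  let P := [set i : nat | exists p, [/\ N p, p \is i.-homog & p != 0]] in
  xget 0%N [set i | P i /\ forall j, P j -> (i <= j)%N].

Definition irrelevant (k : fieldType) (n : nat) : set {mpoly k[n]} :=
  gen_ideal setT [set 'X_i | i in [set: 'I_n]].

Definition saturation (k : fieldType) (n : nat) (I : set {mpoly k[n]}) :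
    set {mpoly k[n]} :=
  [set p | exists s, forall q, idealX setT (@irrelevant k n) s q -> I (p * q)].

Definition irreducible_elt (R : idomainType) (p : R) : Prop :=
  [/\ p != 0, p \isn't a GRing.unit
    & forall a b, p = a * b -> a \is a GRing.unit \/ b \is a GRing.unit].

Section System.
Variables (k : fieldType) (n : nat) (f : n.+1.-tuple {mpoly k[n]}).
Local Notation A := {mpoly k[n]}.
Local Notation B := {mpoly k[n.+1]}.

Definition base_ideal : set A := gen_ideal setT [set` (f : seq A)].

Definition base_points : set (ppoint k n) :=
  [set x | forall i, mev (tnth f i) x = 0].

(* Of use for [nu >= eta] with [nu] natural only, which truncation does not
   affect. *)
Definition eta (d : nat) : nat :=
  ((n.-1) * (d.-1) - indeg (saturation base_ideal))%N.

(* The rational map lambda is defined at x with value y; this forces x to lie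
   outside of the base points. *)
Definition lambda_at (x : ppoint k n) (y : ppoint k n.+1) : Prop :=
  homog_coords y (\row_i mev (tnth f i) x).

Definition lambda_image : set (ppoint k n.+1) :=
  [set y | exists x : ppoint k n, lambda_at x y].

Definition lambda_closed_image : set (ppoint k n.+1) :=
  [set y : ppoint k n.+1 | forall D (P : B), P \is D.-homog ->
     (forall z : ppoint k n.+1, lambda_image z -> mev P z = 0) -> mev P y = 0].

(* The fibres over a nonempty (basic) open subset of the image are finite. *)
Definition generically_finite : Prop :=
  exists D (P : B),
    [/\ P \is D.-homog,
        exists2 y : ppoint k n.+1, lambda_image y & mev P y != 0
      & forall y : ppoint k n.+1, mev P y != 0 -> finite_set [set x | lambda_at x y]].

Definition is_image_equation (H : B) : Prop :=
  [/\ irreducible_elt H, exists D, H \is D.-homog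
    & lambda_closed_image = [set y : ppoint k n.+1 | mev H y = 0]].

Definition function_field : set {fraction A} :=
  [set z | exists e (p q : A),
     [/\ p \is e.-homog, q \is e.-homog, q != 0 & z = p%:F / q%:F]].

(* Function field of the closed image, embedded by pull-back along lambda. *)
Definition image_function_field : set {fraction A} :=
  [set z | exists e (P Q : B),
     [/\ P \is e.-homog, Q \is e.-homog, Q \mPo f != 0
       & z = (P \mPo f)%:F / (Q \mPo f)%:F]].

Definition lambda_degree : nat :=
  ext_degree function_field image_function_field.

Definition is_syzygy (a : 'I_n.+1 -> A) : Prop :=
  \sum_i a i * tnth f i = 0.

Definition specialize (a : 'I_n.+1 -> A) (v : 'rV[k]_n) : B :=
  \sum_i mev (a i) v *: 'X_i.

(* [A (x) B] is encoded as [{mpoly B[n]}], i.e. B[X_1, ..., X_n]. *)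
Definition syzygy_form (a : 'I_n.+1 -> A) : {mpoly B[n]} :=
  \sum_i ('X_i : B) *: map_mpoly (@mpolyC n.+1 k) (a i).

Definition sym_ideal : set {mpoly B[n]} :=
  gen_ideal setT [set syzygy_form a | a in is_syzygy].

Local Notation to_frac := (map_mpoly (@tofrac B)).

(* [Sym_A(I)_nu] is presented as [sym_gens nu / sym_rels nu] inside of the
   vector space [{mpoly {fraction B}[n]}]. *)
Definition sym_gens (nu : nat) : set {mpoly {fraction B}[n]} :=
  to_frac @` [set u : {mpoly B[n]} | u \is nu.-homog].

Definition sym_rels (nu : nat) : set {mpoly {fraction B}[n]} :=
  to_frac @` [set u : {mpoly B[n]} | u \is nu.-homog /\ sym_ideal u].

Definition sym_macrae (nu : nat) : set B :=
  macrae (sym_gens nu) (sym_rels nu).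

Section AtPoint.
Variable x : ppoint k n.

Local Notation O := (stalk x).

Definition base_stalk : set {fraction A} := stalk_ideal x base_ideal.

Definition locally_generated (m : nat) : Prop :=
  exists g : 'I_m -> {fraction A}, base_stalk = gen_ideal O (range g).

Definition locally_complete_intersection : Prop :=
  exists g : seq {fraction A},
    is_regular_seq O g /\ base_stalk = gen_ideal O [set` g].

Definition local_degree : nat :=
  @mod_length _ {fraction A}^o O O base_stalk.

Definition local_multiplicity : nat :=
  xget 0%N [set e : nat | exists P : {poly rat},
    [/\ exists t0, forall t, (t0 <= t)%N ->
          P.[t.+1%:R] = (@mod_length _ {fraction A}^o O
            (idealX O base_stalk t) (idealX O base_stalk t.+1))%:R,
        size P = n.-1
      & lead_coef P = e%:R / (n.-2)`!%:R]].

(* [L] is a linear form L_x read off a relation among the local generators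
   [f_i / l^d] having an invertible coefficient. *)
Definition is_relation_form (d : nat) (L : B) : Prop :=
  exists (l : A) (c : 'I_n.+1 -> {fraction A}),
    [/\ l \is 1.-homog, mev l x != 0,
        forall i, O (c i),
        \sum_i c i * ((tnth f i)%:F / (l ^+ d)%:F) = 0
      & (exists i, c i != 0 /\ O (c i)^-1)
        /\ L = \sum_i value_at x (c i) *: 'X_i].

End AtPoint.

Definition non_lci_points : set (ppoint k n) :=
  [set x | base_points x /\ ~ locally_complete_intersection x].

End System.

(* Main.v *)
(* Let [I] be the ideal of the [f_i], [J] the ideal of relations of [Sym_A(I)]
   in [B[X]] and [P] the kernel of [B -> A], [T_i |-> f_i].  The length of
   [Sym_nu = (B[X] / J)_nu] at a prime [q] of height one is found, for [nu] large,
   by interposing [J + I^m] with [m] large.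

   [B[X] / (J + I^m)] lives over the base points.  Where the base scheme is a
   local complete intersection there are two independent relations, and nothing
   is left at [q].  At another point [x] only [q = (L_x)] matters; eliminating
   one [T_j] by means of the relation [L_x] turns the fibre into the quotient of
   the local ring, over a field [k(T)], by the values [sum a_i T_i] of the
   syzygies.  This ideal is [g : f_n], where [g] is generated by the [n - 1]
   elements [T_n f_i - T_i f_n].  As [g] is a reduction of [I], generated by as
   many elements as there are variables, its colength is [e_x], whence the
   length [e_x - d_x].

   [(J + I^m) / J] is killed by [P].  At [P], [T_i |-> f_i] is injective on it
   for [nu] and [m] large, and identifies it with a vector space spanned by the
   numerators of a basis of the function field of the source over the one of the
   image; its length is [deg(lambda)].

   Hence [S(Sym_nu)] is the product of the [(L_x)^(e_x - d_x)] and of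
   [P^deg(lambda)], or of the [(L_x)^(e_x - d_x)] only should [P] not have height
   one.  Since the [L_x] are prime, comparing it with [(G H^deg(lambda))] needs no
   more than [H] being irreducible and [P] lying between [(H)] and its radical. *)
From HB Require Import structures.
Require Import Defs.
From mathcomp Require Import all_boot all_order all_algebra.
From mathcomp Require Import mpoly.
From mathcomp Require Import boolp classical_sets cardinality fsbigop.
From mathcomp Require Import ring lra zify.

Set Implicit Arguments.
Unset Strict Implicit.
Unset Printing Implicit Defensive.

Import GRing.Theory.
Local Open Scope classical_set_scope.
Local Open Scope ring_scope.

(** * Composition series *)

(** Quotients are pairs of subsets, so a length is carried by a chain of subsets ([clen]), and
    chains travel between rings along a relation between representatives instead of a map of
    quotients ([clen_preim]).

    The number [e_x] is defined over [k], whereas the reduction [g] lives over [k(T)]. The bridge is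
    a squeeze of Samuel functions: extending scalars keeps dimensions, powers of [g] lie in powers
    of [I], and conversely with a bounded shift. That [g] is a reduction comes from counting: [n]
    elements in [n - 1] variables are algebraically dependent, and the lowest form of a dependence
    does not vanish at the generic point [T]. For the exact colengths of the powers of [g], where
    one would quote a Cohen-Macaulay property, large powers of the variables are added to the
    generators: the polynomial ring is then visibly free over the subring they generate.

    The MacRae invariant is a product over all primes of height one, so one bound on [nu] must serve
    them all. Away from [P] and the [L_x], a killing element is built in degrees that do not depend
    on [q]; finitely many primes are left. Mostly [n] appears as [N.+2], and charts have [N.+1]
    variables. *)

Definition is_subring (F : comNzRingType) (R : set F) : Prop :=
  [/\ R 1, forall a b, R a -> R b -> R (a - b)
    & forall a b, R a -> R b -> R (a * b)].

(* [m] plays the role of the maximal ideal of a local ring [R]. *)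
Definition is_local (F : comNzRingType) (R m : set F) : Prop :=
  [/\ is_subring R, m `<=` R, m 0
    & forall a, R a -> m a \/ exists2 b, R b & m (1 - b * a)].

Section CompositionSeries.
Variables (F : comNzRingType) (V : lmodType F) (R m : set F).
Implicit Types (M N P D : set V).

Definition adjoin M (v : V) : set V := [set u | exists2 r, R r & M (u - r *: v)].

(* [N / P] has a composition series of length [l] whose factors are killed by
   [m] and generated by one element. *)
Inductive clen P : set V -> nat -> Prop :=
| clen_nil : is_submodule R P -> clen P P 0
| clen_step M v l : clen P M l -> ~ M v -> (forall r, m r -> M (r *: v)) ->
    clen P (adjoin M v) l.+1.

Hypothesis Rm : is_local R m.
Lemma local_subring : is_subring R. Proof. by case: Rm. Qed.

Lemma subring1 : R 1. Proof. by have [] := local_subring. Qed.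
Lemma subringB a b : R a -> R b -> R (a - b).
Proof. by have [_ + _] := local_subring; apply. Qed.
Lemma subringM a b : R a -> R b -> R (a * b).
Proof. by have [_ _] := local_subring; apply. Qed.
Lemma subring0 : R 0. Proof. by rewrite -(subrr 1); apply: subringB; apply: subring1. Qed.
Lemma subringN a : R a -> R (- a).
Proof. by move=> ?; rewrite -sub0r; apply: subringB => //; apply: subring0. Qed.
Lemma subringD a b : R a -> R b -> R (a + b).
Proof. by move=> ? ?; rewrite -[b]opprK; apply: subringB => //; apply: subringN. Qed.

Lemma submod0 M : is_submodule R M -> M 0. Proof. by case. Qed.
Lemma submodD M u v : is_submodule R M -> M u -> M v -> M (u + v).
Proof. by case=> _ + _; apply. Qed.
Lemma submodZ M a v : is_submodule R M -> R a -> M v -> M (a *: v).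
Proof. by case=> _ _; apply. Qed.
Lemma submodN M v : is_submodule R M -> M v -> M (- v).
Proof. by move=> sM Mv; rewrite -scaleN1r; apply: submodZ => //; apply/subringN/subring1. Qed.
Lemma submodB M u v : is_submodule R M -> M u -> M v -> M (u - v).
Proof. by move=> sM Mu Mv; apply: submodD => //; apply: submodN. Qed.
Lemma submod_sum M (I : Type) (r : seq I) (p : pred I) (G : I -> V) :
  is_submodule R M -> (forall i, p i -> M (G i)) -> M (\sum_(i <- r | p i) G i).
Proof.
move=> sM MG; apply: (big_ind M) => //; first exact: submod0.
by move=> u v; apply: submodD.
Qed.

Lemma submodI M N : is_submodule R M -> is_submodule R N ->
  is_submodule R (M `&` N).
Proof.
move=> sM sN; split; first by split; apply: submod0.
- by move=> u v [? ?] [? ?]; split; apply: submodD.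
- by move=> a v ? [? ?]; split; apply: submodZ.
Qed.

Lemma adjoin_sub M v : M `<=` adjoin M v.
Proof. by move=> u Mu; exists 0; [exact: subring0|rewrite scale0r subr0]. Qed.

Lemma adjoin_mem M v : is_submodule R M -> adjoin M v v.
Proof. by move=> sM; exists 1; [exact: subring1|rewrite scale1r subrr; apply: submod0]. Qed.

Lemma adjoin_submod M v : is_submodule R M -> is_submodule R (adjoin M v).
Proof.
move=> sM; split; first by apply: adjoin_sub; apply: submod0.
- move=> u w [r Rr Mu] [s Rs Mw]; exists (r + s); first exact: subringD.
  by rewrite scalerDl opprD addrACA; apply: submodD.
- move=> a u Ra [r Rr Mu]; exists (a * r); first exact: subringM.
  by rewrite -scalerA -scalerBr; apply: submodZ.
Qed.

Lemma adjoin_min M v N : is_submodule R N -> M `<=` N -> N v -> adjoin M v `<=` N.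
Proof.
move=> sN MN Nv u [r Rr Mu]; rewrite -(subrK (r *: v) u).
by apply: submodD => //; [exact: MN|exact: submodZ].
Qed.

Lemma adjoin_id M v : is_submodule R M -> M v -> adjoin M v = M.
Proof. by move=> sM Mv; apply/seteqP; split; [exact: adjoin_min sM (@subset_refl _ M) Mv|exact: adjoin_sub]. Qed.

Lemma clen_sub P N l : clen P N l ->
  [/\ is_submodule R P, is_submodule R N & P `<=` N].
Proof.
elim=> [sP|M v {}l _ [sP sM PM] _ _]; split=> //; first exact: adjoin_submod.
exact: subset_trans PM (@adjoin_sub _ _).
Qed.

Lemma clen0 P N : clen P N 0 -> N = P.
Proof. by move E : 0%N => l c; case: c E. Qed.

Lemma clen_cat P M N l1 l2 : clen P M l1 -> clen M N l2 -> clen P N (l1 + l2).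
Proof.
move=> c1; elim=> [_|M' v l _ c Mv mv]; first by rewrite addn0.
by rewrite addnS; apply: clen_step.
Qed.

End CompositionSeries.
Arguments submod_sum {F V R M I r p G}.

(** * Composition series pulled back along a relation *)

Section Transport.
Variables (F F' : comNzRingType) (V : lmodType F) (V' : lmodType F').
Variables (R m : set F) (R' m' : set F') (rel : V -> V' -> Prop).
Variables (N : set V) (N' P' : set V').
Hypotheses (Rm : is_local R m) (Rm' : is_local R' m').
Hypothesis sN : is_submodule R N.
Hypothesis sP' : is_submodule R' P'.
Hypothesis rel_surj : forall w, N' w -> exists2 v, N v & rel v w.
Hypothesis relD : forall v1 v2 w1 w2, rel v1 w1 -> rel v2 w2 -> rel (v1 + v2) (w1 + w2).
Hypothesis relN : forall v w, rel v w -> rel (- v) (- w).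
Hypothesis rel_ker : forall w, rel 0 w -> P' w.
Hypothesis relZ : forall r v w, R r -> rel v w ->
  exists r', [/\ R' r', m r -> m' r' & rel (r *: v) (r' *: w)].
Hypothesis rel_residue : forall r' v w, R' r' -> rel v w ->
  exists r r'', [/\ R r, R' r'', m' (r' - r'') & rel (r *: v) (r'' *: w)].

Definition preim (C : set V') : set V := [set v | N v /\ exists2 w, C w & rel v w].

Lemma preim_submod C : is_submodule R' C -> P' `<=` C -> N' 0 -> is_submodule R (preim C).
Proof.
move=> sC PC N'0; split.
- split; first exact: (submod0 sN).
  have [v Nv rv] := rel_surj N'0; exists 0; first exact: (submod0 sC).
  by have := relD rv (relN rv); rewrite !subrr.
- move=> u v [Nu [w Cw ru]] [Nv [w' Cw' rv]]; split; first exact: submodD sN _ _.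
  by exists (w + w'); [exact: submodD sC _ _|exact: relD].
- move=> a v Ra [Nv [w Cw rv]]; split; first exact: submodZ sN _ _.
  have [r' [R'r' _ rv']] := relZ Ra rv.
  by exists (r' *: w) => //; apply: submodZ sC _ _.
Qed.

(** Each generator of the series on the right is replaced by a related element on the left. Scalars
    need to correspond only modulo [m'] ([rel_residue]), since every factor is killed by [m']; so
    the two rings may differ as long as their residues match. *)
Lemma clen_preim C l : clen R' m' P' C l -> C `<=` N' -> clen R m (preim P') (preim C) l.
Proof.
elim=> [_ PN|M v {}l c IH Mv mv adjN].
  by apply/clen_nil/preim_submod => //; apply/PN/(submod0 sP').
have [_ sM PM] := clen_sub Rm' c.
have MN : M `<=` N' by move=> w Mw; apply: adjN; apply: (adjoin_sub Rm').
have N'v : N' v by apply: adjN; apply: (adjoin_mem Rm').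
have [u Nu ru] := rel_surj N'v.
have -> : preim (adjoin R' M v) = adjoin R (preim M) u.
  apply/seteqP; split=> [x [Nx [w [r' R'r' Mw] rx]]|x [r Rr [Nx [w Mw rx]]]].
    have [r [r'' [Rr R'r'' mr rr]]] := rel_residue R'r' ru.
    exists r => //; split; first by apply: (submodB Rm sN) => //; apply: (submodZ sN).
    exists (w - r'' *: v); last by apply: relD => //; apply: relN.
    rewrite -(subrK (r' *: v) w) -addrA -scalerBl.
    by apply: (submodD sM) => //; apply: mv.
  split; first by rewrite -(subrK (r *: u) x); apply: submodD sN _ _ => //; apply: submodZ sN _ _.
  have [r' [R'r' _ rv']] := relZ Rr ru.
  exists (w + r' *: v); first by exists r' => //; rewrite addrK.
  by rewrite -(subrK (r *: u) x); apply: relD.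
apply: clen_step; first exact: IH.
- case=> _ [w Mw rw]; apply: Mv; have := relD ru (relN rw).
  rewrite subrr => /rel_ker /PM Mvw; rewrite -(subrK w v).
  exact: (submodD sM).
- move=> r mr; have [_ mR _ _] := Rm; split; first by apply: (submodZ sN) => //; apply: mR.
  have [r' [_ mr' rr]] := relZ (mR _ mr) ru.
  by exists (r' *: v) => //; apply: mv; apply: mr'.
Qed.

End Transport.

Section JordanHolder.
Variables (F : comNzRingType) (V : lmodType F) (R m : set F).
Hypothesis Rm : is_local R m.
Implicit Types (M N P D : set V).

Lemma local_max0 : m 0. Proof. by have [] := Rm. Qed.

(** The second isomorphism theorem for [M + D] over [D], the relation being congruence modulo
    [D]. *)
Lemma clen_second_iso D M l : is_submodule R D -> is_submodule R M ->
  clen R m (M `&` D) M l -> clen R m D [set v | exists2 w, M w & D (v - w)] l.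
Proof.
move=> sD sM c; set N := [set v | _].
pose rel (v w : V) := M w /\ D (v - w).
have [sMD _ _] := clen_sub Rm c.
have sN : is_submodule R N.
  split; first by exists 0; [exact: submod0 sM|rewrite subr0; exact: submod0 sD].
  - move=> u v [w Mw Du] [w' Mw' Dv]; exists (w + w'); first exact: (submodD sM).
    by rewrite opprD addrACA; apply: (submodD sD).
  - move=> a u Ra [w Mw Du]; exists (a *: w); first exact: (submodZ sM).
    by rewrite -scalerBr; apply: (submodZ sD).
have cp : clen R m (preim rel N (M `&` D)) (preim rel N M) l.
  apply: (clen_preim (rel := rel) (N := N) (N' := M) Rm Rm sN sMD _ _ _ _ _ _ c) => //.
  - move=> w Mw; exists w; first by exists w => //; rewrite subrr; apply: submod0 sD.
    by split=> //; rewrite subrr; apply: submod0 sD.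
  - move=> v1 v2 w1 w2 [M1 D1] [M2 D2]; split; first exact: (submodD sM).
    by rewrite opprD addrACA; apply: (submodD sD).
  - move=> v w [Mw Dv]; split; first exact: (submodN Rm sM).
    by rewrite -opprD; apply: (submodN Rm sD).
  - move=> w [Mw]; rewrite sub0r => /(submodN Rm sD); rewrite opprK => Dw.
    by split.
  - move=> r v w Rr [Mw Dv]; exists r; split=> //; split; first exact: (submodZ sM).
    by rewrite -scalerBr; apply: (submodZ sD).
  - move=> r v w Rr [Mw Dv]; exists r, r; split=> //; first by rewrite subrr; exact: local_max0.
    split; first exact: (submodZ sM).
    by rewrite -scalerBr; apply: (submodZ sD).
have -> : D = preim rel N (M `&` D).
  apply/seteqP; split=> [v Dv|v [_ [w [_ Dw] [_ Dvw]]]].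
    split; first by exists 0; [exact: submod0 sM|rewrite subr0].
    exists 0; first by split; [exact: submod0 sM|exact: submod0 sD].
    by split; [exact: submod0 sM|rewrite subr0].
  by rewrite -(subrK w v); apply: (submodD sD).
suff eN : preim rel N M = N by move: cp; rewrite eN.
by apply/seteqP; split=> [v []//|v [w Mw Dv]]; split; exists w.
Qed.

(** Induction on the series. If [D] is not contained in the last but one term [M], some [w] in [D]
    is [r *: v] modulo [M] with [r] outside of [m], hence invertible modulo [m]. The last factor is
    then generated by [w] and is moved into [D], while [N = M + D] has the same factors over [D] as
    [M] has over its intersection with [D]. *)
Lemma clen_split P N D l : clen R m P N l -> is_submodule R D -> P `<=` D ->
  D `<=` N -> exists a b, [/\ clen R m P D a, clen R m D N b & (a + b)%N = l].
Proof.
move=> c; elim: c D => [sP|M v {}l c IH Mv mv] D sD PD DN.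
  have -> : D = P by apply/seteqP.
  by exists 0%N, 0%N; split=> //; apply: clen_nil.
have [sP sM PM] := clen_sub Rm c.
case: (pselect (D `<=` M)) => [DM|nDM].
  have [a [b [c1 c2 e]]] := IH _ sD PD DM.
  by exists a, b.+1; rewrite addnS e; split=> //; apply: clen_step.
have [w Dw nMw] : exists2 w, D w & ~ M w.
  apply: contrapT => h; apply: nDM => w Dw; apply: contrapT => nMw.
  by apply: h; exists w.
have [r Rr Mwr] := DN _ Dw.
have [_ _ _ /(_ r Rr) [mr|[r' Rr' mrr']]] := Rm.
  by case: nMw; rewrite -(subrK (r *: v) w); apply: (submodD sM) => //; apply: mv.
have Mvw : M (v - r' *: w).
  have -> : v - r' *: w = (1 - r' * r) *: v - r' *: (w - r *: v).
    by rewrite scalerBl scale1r scalerBr scalerA opprB addrA subrK.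
  by apply: (submodB Rm sM); [exact: mv|exact: (submodZ sM)].
have sI := submodI sM sD.
have [a [b [c1 c2 e]]] : exists a b, [/\ clen R m P (M `&` D) a,
    clen R m (M `&` D) M b & (a + b)%N = l].
  by apply: IH => [//|x Px|x []//]; split; [apply: PM|apply: PD].
exists a.+1, b; split; last by rewrite addSn e.
  have -> : D = adjoin R (M `&` D) w.
    apply/seteqP; split=> [u Du|]; last by apply: (adjoin_min sD) => // ? [].
    have [s Rs Mus] := DN _ Du; exists (s * r'); first exact: (subringM Rm).
    split; last by apply: (submodB Rm sD) => //; apply: (submodZ sD) => //; apply: (subringM Rm).
    rewrite -(subrK (s *: v) u) -addrA -scalerA -scalerBr.
    by apply: (submodD sM) => //; apply: (submodZ sM).
  apply: clen_step => //; first by case.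
  move=> t mt; have [_ mR _ _] := Rm; split; last by apply: (submodZ sD) => //; apply: mR.
  rewrite -(subrK (t *: (r *: v)) (t *: w)) -scalerBr; apply: (submodD sM).
    by apply: (submodZ sM) => //; apply: mR.
  rewrite scalerA mulrC -scalerA; apply: (submodZ sM) => //; exact: mv.
have -> : adjoin R M v = [set v | exists2 w, M w & D (v - w)].
  apply/seteqP; split=> [u [s Rs Mus]|u [x Mx Dux]].
    exists (u - (s * r') *: w); last first.
      rewrite opprB addrC subrK; apply: (submodZ sD) => //; exact: (subringM Rm).
    rewrite -(subrK (s *: v) u) -addrA -scalerA -scalerBr.
    by apply: (submodD sM) => //; apply: (submodZ sM).
  rewrite -(subrK x u); apply: (submodD (adjoin_submod Rm v sM)); last exact: (adjoin_sub Rm).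
  exact: DN.
exact: clen_second_iso.
Qed.

(** Splitting the series at the successive terms of the chain shows that each strict inclusion
    raises the length over [P]. *)
Lemma clen_chain P N l : clen R m P N l -> forall i, has_chain R N P i -> (i <= l)%N.
Proof.
move=> c i [C [sC PC CN Clt]].
have [sP sN PN] := clen_sub Rm c.
have mono j a : (j + a <= i)%N -> C j `<=` C (j + a)%N.
  elim: a => [|a IH]; first by rewrite addn0 => _ x.
  rewrite addnS => h; apply: subset_trans (IH (ltnW h)) _.
  by have [] := Clt _ h.
have P_C j : (j <= i)%N -> P `<=` C j by move=> ji; apply: subset_trans PC (mono 0%N j ji).
have len j : (j <= i)%N -> forall a, clen R m P (C j) a -> (j <= a)%N.
  elim: j => [//|j IH] ji a ca; have [Cs nCs] := Clt _ ji.
  have [a1 [b [c1 c2 <-]]] := clen_split ca (sC _ (ltnW ji)) (P_C _ (ltnW ji)) Cs.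
  have := IH (ltnW ji) _ c1; case: b c2 => [/clen0 e|b _]; last by lia.
  by case: nCs; rewrite e.
have [a [b [c1 _ <-]]] := clen_split c (sC i (leqnn _)) (P_C _ (leqnn _)) CN.
exact: leq_trans (len _ (leqnn _) _ c1) (leq_addr _ _).
Qed.

Lemma clen_has_chain P N l : clen R m P N l -> has_chain R N P l.
Proof.
suff h : clen R m P N l -> exists C : nat -> set V,
    [/\ forall i, (i <= l)%N -> is_submodule R (C i),
        P `<=` C 0%N, C l = N & forall i, (i < l)%N -> C i `<` C i.+1].
  by case/h => C [? ? e ?]; exists C; split=> //; rewrite e.
elim=> [sP|M v {}l c [C [sC PC CM Clt]] Mv mv].
  by exists (fun=> P); split.
exists (fun i => if (i <= l)%N then C i else adjoin R M v); split=> //.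
- move=> i il; case: ifP => [/sC //|_]; apply: (adjoin_submod Rm).
  by case: (clen_sub Rm c).
- by rewrite ltnn.
move=> i; rewrite ltnS => il; rewrite il; case: ltnP => [/Clt //|li].
have -> : i = l by lia.
rewrite CM; split; first exact: (adjoin_sub Rm).
move=> /(_ v) h; apply: Mv; apply: h; apply: (adjoin_mem Rm).
by case: (clen_sub Rm c).
Qed.

Lemma clen_mod_length P N l : clen R m P N l -> mod_length R N P = l.
Proof.
move=> c; have hc := clen_has_chain c; have bd := clen_chain c.
rewrite /mod_length; set S := [set _ | _].
have Sl : S l by split.
have [Sx Smax] : S (xget 0%N S) by apply: xgetI Sl.
by apply/eqP; rewrite eqn_leq bd //= Smax.
Qed.

Lemma clen_uniq P N l l' : clen R m P N l -> clen R m P N l' -> l = l'.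
Proof. by move=> /clen_mod_length <- /clen_mod_length. Qed.

Fixpoint adjoins M (s : seq V) : set V :=
  if s is v :: s' then adjoins (adjoin R M v) s' else M.

Lemma adjoins_submod M s : is_submodule R M -> is_submodule R (adjoins M s).
Proof. by elim: s M => //= v s IH M sM; apply/IH/(adjoin_submod Rm). Qed.

Lemma adjoins_min M s N : is_submodule R N -> M `<=` N -> {in s, forall v, N v} ->
  adjoins M s `<=` N.
Proof.
move=> sN; elim: s M => //= v s IH M MN sv; apply: IH => [|w ws].
  by apply: adjoin_min => //; apply: sv; rewrite mem_head.
by apply: sv; rewrite inE ws orbT.
Qed.

Lemma adjoins_sub M s : M `<=` adjoins M s.
Proof.
by elim: s M => [M x|v s IH M] //=; apply: subset_trans (IH _); apply: (adjoin_sub Rm).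
Qed.

Lemma adjoins_mem M s v : is_submodule R M -> v \in s -> adjoins M s v.
Proof.
elim: s M => //= w s IH M sM; rewrite inE => /orP[/eqP ->|vs].
  by apply: adjoins_sub; apply: (adjoin_mem Rm).
by apply: IH => //; apply: (adjoin_submod Rm).
Qed.

(** Elements of [m] are multiples of [p], as in a discrete valuation ring; so the submodules
    generated by the [p ^+ i *: v] have successive quotients killed by [m]. *)
Lemma clen_adjoin_nilp P v p e : is_submodule R P -> R p ->
  (forall r, m r -> exists2 s, R s & r = p * s) -> P (p ^+ e *: v) ->
  exists l, clen R m P (adjoin R P v) l.
Proof.
move=> sP Rp mp; elim: e v => [|e IH] v.
  by rewrite expr0 scale1r => Pv; exists 0%N; rewrite (adjoin_id Rm) //; apply: clen_nil.
rewrite exprSr -scalerA => /IH [l c].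
have sA := adjoin_submod Rm (p *: v) sP.
have Av : adjoin R P v v by apply: (adjoin_mem Rm).
have sAv := adjoin_submod Rm v sP.
have e1 : adjoin R (adjoin R P (p *: v)) v = adjoin R P v.
  apply/seteqP; split; last first.
    apply: (adjoin_min (adjoin_submod Rm v sA)); last exact: (adjoin_mem Rm).
    by move=> u Pu; do 2!apply: (adjoin_sub Rm).
  apply: (adjoin_min sAv) => //; apply: (adjoin_min sAv); first exact: (adjoin_sub Rm).
  exact: (submodZ sAv).
case: (pselect (adjoin R P (p *: v) v)) => [Apv|nA].
  by exists l; rewrite -e1 (adjoin_id Rm).
exists l.+1; rewrite -e1; apply: clen_step => // r /mp [s Rs ->].
rewrite mulrC -scalerA; apply: (submodZ sA) => //; exact: (adjoin_mem Rm).
Qed.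

Lemma clen_adjoins_nilp P s p e : is_submodule R P -> R p ->
  (forall r, m r -> exists2 s, R s & r = p * s) ->
  {in s, forall v, P (p ^+ e *: v)} ->
  exists l, clen R m P (adjoins P s) l.
Proof.
move=> sP Rp mp; elim: s P sP => [P sP _|v s IH P sP h] /=.
  by exists 0%N; apply: clen_nil.
have [l1 c1] := clen_adjoin_nilp sP Rp mp (h v (mem_head _ _)).
have [|w ws|l2 c2] := IH (adjoin R P v); first exact: (adjoin_submod Rm).
  by apply: (adjoin_sub Rm); apply: h; rewrite inE ws orbT.
by exists (l1 + l2)%N; apply: clen_cat c1 c2.
Qed.

End JordanHolder.

Lemma field_local (F : fieldType) : is_local (@setT F) [set 0].
Proof.
split=> // a _; case: (eqVneq a 0) => [->|a0]; first by left.
by right; exists a^-1 => //=; rewrite mulVf // subrr.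
Qed.

Section Dimension.
Variables (F : fieldType) (V : lmodType F).
Implicit Types (P N : set V).
Local Notation dimq := (clen setT [set 0 : F]).
Let Fl := field_local F.

(** Over a field with maximal ideal zero, [clen] is a dimension; this is the dictionary with
    bases. *)
Lemma dimqP P N l : is_submodule setT P ->
  dimq P N l <-> exists v : 'I_l -> V,
   (forall u, N u <-> exists c : 'I_l -> F, P (u - \sum_i c i *: v i)) /\
   (forall c : 'I_l -> F, P (\sum_i c i *: v i) -> forall i, c i = 0).
Proof.
move=> sP; split.
  elim=> [_|M v {}l c [w [Mw iw]] Mv _].
    exists (fun=> 0); split=> [u|c _ []//].
    split=> [Pu|[c]]; last by rewrite big_ord0 subr0.
    by exists (fun=> 0); rewrite big_ord0 subr0.
  have [_ sM _] := clen_sub Fl c.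
  exists (fun i => if unlift ord0 i is Some j then w j else v).
  have E (a : 'I_l.+1 -> F) : \sum_i a i *: (if unlift ord0 i is Some j then w j else v) =
     a ord0 *: v + \sum_(i < l) a (lift ord0 i) *: w i.
    rewrite big_ord_recl unlift_none; congr (_ + _).
    by apply: eq_bigr => i _; rewrite liftK.
  split=> [u|a].
    split=> [[r _ /Mw [a Pa]]|[a]].
      exists (fun i => if unlift ord0 i is Some j then a j else r).
      rewrite E unlift_none opprD addrA; congr (P (_ - _)): Pa.
      by apply: eq_bigr => i _; rewrite liftK.
    rewrite E opprD addrA => Pa; exists (a ord0) => //.
    by apply/Mw; exists (fun i => a (lift ord0 i)).
  rewrite E => Pa; have a0 : a ord0 = 0.
    apply/eqP; apply/negPn/negP => a0; apply: Mv.
    have : M (a ord0 *: v).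
      apply/Mw; exists (fun i => - a (lift ord0 i)); rewrite -sumrN in Pa *.
      under eq_bigr do rewrite scaleNr opprK.
      by [].
    move/(submodZ sM (a := (a ord0)^-1) I).
    by rewrite scalerA mulVf // scale1r.
  move=> i; case: (unliftP ord0 i) => [j ->|-> //].
  by move: Pa; rewrite a0 scale0r add0r => /iw; apply.
case=> v [Nv iv].
elim: l v N Nv iv => [|l IH] v N Nv iv.
  have -> : N = P.
    apply/seteqP; split=> u; first by case/Nv => c; rewrite big_ord0 subr0.
    by move=> Pu; apply/Nv; exists (fun=> 0); rewrite big_ord0 subr0.
  exact: clen_nil.
pose M : set V := [set u | exists c : 'I_l -> F, P (u - \sum_i c i *: v (lift ord0 i))].
have E (a : F) (c : 'I_l -> F) :
    \sum_i (if unlift ord0 i is Some j then c j else a) *: v i =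
    a *: v ord0 + \sum_(i < l) c i *: v (lift ord0 i).
  rewrite big_ord_recl unlift_none; congr (_ + _).
  by apply: eq_bigr => i _; rewrite liftK.
have c : dimq P M l.
  apply: (IH (fun i => v (lift ord0 i))) => // a Pa i.
  have := iv (fun i => if unlift ord0 i is Some j then a j else 0).
  by rewrite E scale0r add0r => /(_ Pa (lift ord0 i)); rewrite liftK.
have -> : N = adjoin setT M (v ord0).
  apply/seteqP; split=> u.
    case/Nv => a Pa; exists (a ord0) => //; exists (fun i => a (lift ord0 i)).
    by move: Pa; rewrite big_ord_recl opprD addrA.
  case=> a _ [b Pb]; apply/Nv; exists (fun i => if unlift ord0 i is Some j then b j else a).
  by rewrite E opprD addrA.
have [_ sM _] := clen_sub Fl c.
apply: clen_step => // [[a Pa]|r /= ->]; last by rewrite scale0r; apply: submod0 sM.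
have := iv (fun i => if unlift ord0 i is Some j then - a j else 1).
rewrite E scale1r; under eq_bigr do rewrite scaleNr.
rewrite sumrN => /(_ Pa ord0); rewrite unlift_none => /eqP; by rewrite oner_eq0.
Qed.

End Dimension.

(** * Ideals and local algebra at the origin *)

Section Ideals.
Variable F : comNzRingType.
Implicit Types (E I J K : set F) (a b u v : F).

Local Notation ideal := (is_ideal setT).

Lemma idealP E : ideal E <-> [/\ E 0, forall u v, E u -> E v -> E (u + v)
  & forall a v, E v -> E (a * v)].
Proof. by split=> [[E0 ED EZ]|[E0 ED EZ]]; split=> // a v; [apply: EZ|move=> _; apply: EZ]. Qed.

Lemma ideal0 E : ideal E -> E 0. Proof. by case/idealP. Qed.
Lemma idealD E u v : ideal E -> E u -> E v -> E (u + v). Proof. by case/idealP => _ + _; apply. Qed.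
Lemma idealMl E a v : ideal E -> E v -> E (a * v). Proof. by case/idealP => _ _; apply. Qed.
Lemma idealMr E a v : ideal E -> E v -> E (v * a). Proof. by rewrite mulrC; apply: idealMl. Qed.
Lemma idealN E v : ideal E -> E v -> E (- v). Proof. by rewrite -mulN1r; apply: idealMl. Qed.
Lemma idealB E u v : ideal E -> E u -> E v -> E (u - v).
Proof. by move=> iE Eu Ev; apply: idealD => //; apply: idealN. Qed.
Lemma ideal_sum E (T : Type) (r : seq T) (p : pred T) (G : T -> F) :
  ideal E -> (forall i, p i -> E (G i)) -> E (\sum_(i <- r | p i) G i).
Proof.
move=> iE EG; apply: (big_ind E) => //; first exact: ideal0.
by move=> u v; apply: idealD.
Qed.
Lemma idealBr E u v : ideal E -> E (u - v) -> E v -> E u.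
Proof. by move=> iE Euv Ev; rewrite -(subrK v u); apply: idealD. Qed.

Lemma idealT : ideal (@setT F). Proof. by []. Qed.

Lemma colon_ideal E a : ideal E -> ideal [set u | E (a * u)].
Proof.
move=> iE; apply/idealP; split=> [|u v hu hv|b u hu] /=; first by rewrite mulr0; exact: ideal0.
  by rewrite mulrDr; exact: idealD.
by rewrite mulrCA; exact: idealMl.
Qed.

Lemma gen_ideal_sub (R G : set F) : G `<=` gen_ideal R G.
Proof. by move=> u Gu I [_]; apply. Qed.

Lemma gen_ideal_min (R G I : set F) : is_ideal R I -> G `<=` I -> gen_ideal R G `<=` I.
Proof. by move=> iI GI u; apply. Qed.

Lemma gen_ideal_ideal (R G : set F) : is_ideal R (gen_ideal R G).
Proof.
split; first by move=> I [[]].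
- by move=> u v Gu Gv I [iI GI]; have [_ + _] := iI; apply; [apply: Gu|apply: Gv].
- by move=> a v Ra Gv I [iI GI]; have [_ _] := iI; apply=> //; apply: Gv.
Qed.

Lemma gen_ideal_mono (R G G' : set F) : G `<=` G' -> gen_ideal R G `<=` gen_ideal R G'.
Proof.
move=> GG'; apply: gen_ideal_min; first exact: gen_ideal_ideal.
exact: subset_trans GG' (@gen_ideal_sub _ _).
Qed.

Definition lin (T : finType) (g : T -> F) : set F :=
  [set u | exists c : T -> F, u = \sum_i c i * g i].

Lemma lin_ideal (T : finType) (g : T -> F) : ideal (lin g).
Proof.
apply/idealP; split.
- by exists (fun=> 0); rewrite big1 // => i _; rewrite mul0r.
- move=> _ _ [c ->] [c' ->]; exists (fun i => c i + c' i).
  by rewrite -big_split; apply: eq_bigr => i _; rewrite mulrDl.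
- move=> a _ [c ->]; exists (fun i => a * c i).
  by rewrite mulr_sumr; apply: eq_bigr => i _; rewrite mulrA.
Qed.

Lemma lin_gen (T : finType) (g : T -> F) i : lin g (g i).
Proof.
exists (fun j => (j == i)%:R); rewrite (bigD1 i) //= eqxx mul1r big1 ?addr0 //.
by move=> j /negbTE ->; rewrite mul0r.
Qed.

Lemma lin_min (T : finType) (g : T -> F) E : ideal E -> (forall i, E (g i)) -> lin g `<=` E.
Proof. by move=> iE Eg _ [c ->]; apply: ideal_sum => // i _; apply: idealMl. Qed.

Lemma gen_ideal_lin (T : finType) (g : T -> F) : gen_ideal setT (range g) = lin g.
Proof.
apply/seteqP; split.
  by apply: gen_ideal_min; [exact: lin_ideal|move=> _ [i _ <-]; exact: lin_gen].
by apply: lin_min; [exact: gen_ideal_ideal|move=> i; apply: gen_ideal_sub; exists i].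
Qed.

Lemma gen_ideal1P a u : gen_ideal setT [set a] u <-> exists b, u = b * a.
Proof.
split=> [|[b ->]]; last first.
  by apply: (idealMl _ (gen_ideal_ideal _ _)); apply: gen_ideal_sub.
suff : gen_ideal setT [set a] `<=` [set u | exists b, u = b * a] by apply.
apply: gen_ideal_min; last by move=> _ ->; exists 1; rewrite mul1r.
apply/idealP; split; first by exists 0; rewrite mul0r.
- by move=> _ _ [b ->] [c ->]; exists (b + c); rewrite mulrDl.
- by move=> c _ [b ->]; exists (c * b); rewrite mulrA.
Qed.

Local Notation "I *i J" := (idealM setT I J) (at level 40).

Lemma idealM_ideal I J : ideal (I *i J). Proof. exact: gen_ideal_ideal. Qed.
Lemma idealM_mem I J a b : I a -> J b -> (I *i J) (a * b).
Proof. by move=> Ia Jb; apply: gen_ideal_sub; exists a => //; exists b. Qed.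
Lemma idealM_min I J E : ideal E -> (forall a b, I a -> J b -> E (a * b)) -> I *i J `<=` E.
Proof. by move=> iE h; apply: gen_ideal_min => // _ [a Ia [b Jb <-]]; apply: h. Qed.
Lemma idealM_mono I J I' J' : I `<=` I' -> J `<=` J' -> I *i J `<=` I' *i J'.
Proof.
move=> II JJ; apply: (idealM_min (idealM_ideal _ _)).
by move=> a b /II ? /JJ ?; apply: idealM_mem.
Qed.
Lemma idealMC I J : I *i J = J *i I.
Proof.
suff h (A B : set F) : A *i B `<=` B *i A by apply/seteqP; split; apply: h.
apply: (idealM_min (idealM_ideal _ _)) => a b Aa Bb.
by rewrite mulrC; apply: idealM_mem.
Qed.
Lemma idealMA I J K : I *i (J *i K) = (I *i J) *i K.
Proof.
suff h (A B C : set F) : A *i (B *i C) `<=` (A *i B) *i C.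
  apply/seteqP; split; first exact: h.
  by rewrite idealMC [I *i J]idealMC [I *i _]idealMC [J *i K]idealMC; apply: h.
apply: (idealM_min (idealM_ideal _ _)).
move=> a u Aa BCu; pose X := [set v | ((A *i B) *i C) (a * v)].
suff : B *i C `<=` X by apply.
apply: idealM_min => [|b c Bb Cc]; last first.
  by rewrite /X /= mulrA; apply: idealM_mem => //; apply: idealM_mem.
apply/idealP; split; rewrite /X /=.
- by rewrite mulr0; apply: ideal0; apply: idealM_ideal.
- by move=> x y; rewrite mulrDr; apply: idealD; apply: idealM_ideal.
- by move=> c v; rewrite mulrCA; apply: idealMl; apply: idealM_ideal.
Qed.
Lemma idealMT I : ideal I -> setT *i I = I.
Proof.
move=> iI; apply/seteqP; split; first by apply: idealM_min => // a b _ Ib; apply: idealMl.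
by move=> u Iu; rewrite -[u]mul1r; apply: idealM_mem.
Qed.
Lemma idealM_subr I J : ideal J -> I *i J `<=` J.
Proof. by move=> iJ; apply: idealM_min => // a b _ Jb; apply: idealMl. Qed.

Lemma idealXS I t : idealX setT I t.+1 = I *i idealX setT I t. Proof. by []. Qed.
Lemma idealX_ideal I t : ideal (idealX setT I t).
Proof. by case: t => [|t]; [exact: idealT|exact: idealM_ideal]. Qed.
Lemma idealX_mono I J t : I `<=` J -> idealX setT I t `<=` idealX setT J t.
Proof. by move=> IJ; elim: t => // t IH; rewrite !idealXS; apply: idealM_mono. Qed.
Lemma idealXD I s t : idealX setT I (s + t) = idealX setT I s *i idealX setT I t.
Proof.
elim: s => [|s IH]; first by rewrite add0n idealMT //; exact: idealX_ideal.
by rewrite addSn !idealXS IH idealMA.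
Qed.
Lemma idealX_sub I s t : (s <= t)%N -> idealX setT I t `<=` idealX setT I s.
Proof. by move=> st; rewrite -(subnK st) idealXD; apply: idealM_subr; apply: idealX_ideal. Qed.
Lemma idealX_mem I a t : I a -> idealX setT I t (a ^+ t).
Proof. by move=> Ia; elim: t => // t IH; rewrite idealXS exprS; apply: idealM_mem. Qed.
Lemma idealX1 I : ideal I -> idealX setT I 1 = I.
Proof. by move=> iI; rewrite idealXS idealMC idealMT. Qed.

End Ideals.

Section HomogSplit.
Variables (n : nat) (F : comNzRingType).

Lemma mdegS_split (m : 'X_{1..n}) t : mdeg m = t.+1 ->
  exists2 i, (U_(i) <= m)%MM & mdeg (m - U_(i)) = t.
Proof.
move=> dm; have [i mi] : exists i, m i != 0%N.
  apply/existsP; apply: contraT => /existsPn h; move: dm; rewrite mdegE big1 // => i _.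
  by move: (h i) => /negPn/eqP.
have le : (U_(i) <= m)%MM by rewrite lep1mP.
by exists i => //; have := congr1 mdeg (submK le); rewrite mdegD mdeg1 dm addn1 => -[].
Qed.

Lemma mdegD_split (m : 'X_{1..n}) c r : mdeg m = (c + r)%N ->
  exists m1 m2, [/\ m = (m1 + m2)%MM, mdeg m1 = c & mdeg m2 = r].
Proof.
elim: c m => [|c IH] m; first by exists 0%MM, m; rewrite add0m mdeg0.
case/mdegS_split => i le /IH [m1 [m2 [e d1 d2]]].
exists (U_(i) + m1)%MM, m2; split=> //; last by rewrite mdegD mdeg1 d1.
by rewrite -addmA -e addmC submK.
Qed.

Lemma homogS_split t (a : {mpoly F[n]}) : a \is t.+1.-homog ->
  exists b : 'I_n -> {mpoly F[n]}, (forall i, b i \is t.-homog) /\ a = \sum_i b i * 'X_i.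
Proof.
move=> ha; rewrite [a]mpolyE.
have : {subset msupp a <= msupp a} by [].
elim: {-2}(msupp a) => [_|m s IH sub].
  by exists (fun=> 0); rewrite big_nil big1 ?rpred0 // => i _; rewrite mul0r.
have [|b [hb eb]] := IH _; first by move=> x xs; apply: sub; rewrite inE xs orbT.
have dm : mdeg m = t.+1 by apply: (dhomogP _ _ _ ha); apply: sub; rewrite mem_head.
have [i le di] := mdegS_split dm.
exists (fun j => (if j == i then a@_m *: 'X_[m - U_(i)] else 0) + b j); split=> [j|].
  rewrite rpredD //; case: eqP => _; last exact: rpred0.
  by rewrite rpredZ // dhomogX; apply/eqP.
rewrite big_cons eb; under [RHS]eq_bigr do rewrite mulrDl.
rewrite big_split /=; congr (_ + _).
rewrite (bigD1 i) //= eqxx big1 ?addr0 => [|j /negbTE ->]; last by rewrite mul0r.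
by rewrite -scalerAl -mpolyXD submK.
Qed.

Lemma idealX_linP (g : 'I_n -> F) t u : idealX setT (lin g) t u <->
  exists2 a : {mpoly F[n]}, a \is t.-homog & u = a.@[g].
Proof.
elim: t u => [|t IH] u.
  by split=> // _; exists u%:MP; rewrite ?mevalC // -[u%:MP]mulr1 mul_mpolyC rpredZ // dhomog1.
rewrite idealXS; split.
  suff : idealM setT (lin g) (idealX setT (lin g) t) `<=`
    [set u | exists2 a : {mpoly F[n]}, a \is t.+1.-homog & u = a.@[g]] by apply.
  apply: idealM_min => [|_ b [c ->] /IH [a ha ->]].
    apply/idealP; split; first by exists 0; rewrite ?rpred0 ?meval0.
    - by move=> _ _ [a ha ->] [b hb ->]; exists (a + b); rewrite ?rpredD ?mevalD.
    - by move=> c _ [a ha ->]; exists (c *: a); rewrite ?rpredZ ?mevalZ.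
  exists (\sum_i c i *: 'X_i * a).
    rewrite rpred_sum // => i _; rewrite -add1n; apply: dhomogM => //.
    by rewrite rpredZ // dhomogX /= mdeg1.
  rewrite mulr_suml raddf_sum; apply: eq_bigr => i _ /=.
  by rewrite mevalM mevalZ mevalXU.
case=> _ /homogS_split [b [hb ->]] ->; rewrite raddf_sum.
apply: ideal_sum => [|i _]; first exact: idealM_ideal.
rewrite /= mevalM mulrC mevalXU; apply: idealM_mem; first exact: lin_gen.
by apply/IH; exists (b i).
Qed.

End HomogSplit.

Section LocalClosure.
Variables (F : fieldType) (N : nat).
Local Notation W := {mpoly F[N]}.
Local Notation ideal := (@is_ideal W setT).
Implicit Types (E I J : set W) (s u v w : W).

(** The [c]-th power of the ideal of the origin, read on the coefficients. *)
Definition mpow c : set W := [set u | forall m : 'X_{1..N}, (mdeg m < c)%N -> u@_m = 0].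

Lemma mpow_ideal c : ideal (mpow c).
Proof.
apply/idealP; split=> [m _|u v hu hv m mc|a v hv m mc]; rewrite ?mcoeff0 //.
  by rewrite mcoeffD hu ?hv ?addr0.
rewrite mcoeffM big1 // => -[k l] /= /eqP e; rewrite hv ?mulr0 //.
by move: mc (congr1 mdeg e); rewrite mdegD; lia.
Qed.

Lemma mpowM a b u v : mpow a u -> mpow b v -> mpow (a + b) (u * v).
Proof.
move=> hu hv m mab; rewrite mcoeffM big1 // => -[k l] /= /eqP e.
case: (ltnP (mdeg k) a) => [ka|ka]; first by rewrite hu ?mul0r.
rewrite hv ?mulr0 //; move: mab (congr1 mdeg e); rewrite mdegD; lia.
Qed.

Lemma mpow_sub a b : (a <= b)%N -> mpow b `<=` mpow a.
Proof. by move=> ab u hu m ma; apply: hu; apply: leq_trans ma ab. Qed.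

Lemma mpow1P u : mpow 1 u <-> u@_0 = 0.
Proof. by split=> [->|u0 m]; rewrite ?mdeg0 // ltnS leqn0 mdeg_eq0 => /eqP ->. Qed.

Lemma mpowX c u : mpow 1 u -> mpow c (u ^+ c).
Proof. by move=> hu; elim: c => // c IH; rewrite exprS -add1n; apply: mpowM. Qed.

Lemma mpow_mon c E : ideal E -> (forall m : 'X_{1..N}, mdeg m = c -> E 'X_[m]) -> mpow c `<=` E.
Proof.
move=> iE Em u hu; rewrite [u]mpolyE; apply: ideal_sum => // m _.
case: (ltnP (mdeg m) c) => [/hu ->|]; first by rewrite scale0r; apply: ideal0.
move=> cm; rewrite -mul_mpolyC; apply: idealMl => //.
have [|m1 [m2 [-> d1 _]]] := @mdegD_split _ m c (mdeg m - c)%N; first by rewrite subnKC.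
by rewrite addmC mpolyXD; apply: idealMl => //; apply: Em.
Qed.

(** A truncated geometric series in [t = 1 - s / s(0)], which vanishes at the origin. *)
Lemma inv_mod c s : s@_0 != 0 -> exists s', mpow c (1 - s' * s).
Proof.
move=> s0; pose t := 1 - (s@_0)^-1 *: s.
exists ((s@_0)^-1 *: \sum_(i < c) t ^+ i).
have -> : 1 - (s@_0)^-1 *: (\sum_(i < c) t ^+ i) * s = t ^+ c.
  have : 1 - t ^+ c = (1 - t) * \sum_(i < c) t ^+ i.
    by rewrite -{1}(expr1n _ c) subrXX; congr (_ * _); apply: eq_bigr => i _; rewrite expr1n mul1r.
  rewrite /t subKr -!scalerAl mulrC => <-; by rewrite subKr.
apply: mpowX; apply/mpow1P.
by rewrite /t mcoeffB mcoeff1 eqxx mcoeffZ mulVf // subrr.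
Qed.

(** The contraction to the polynomial ring of the ideal that [E] generates in the local ring at the
    origin. It avoids fractions; an ideal containing some [mpow c] is its own contraction
    ([loc_id]). *)
Definition loc E : set W := [set u | exists2 s, s@_0 != 0 & E (s * u)].

Lemma unitM s t : s@_0 != 0 -> t@_0 != 0 -> (s * t)@_(0 : 'X_{1..N}) != 0.
Proof. by move=> s0 t0; rewrite (rmorphM (mcoeff 0)) mulf_neq0. Qed.

Lemma loc_sub E : E `<=` loc E.
Proof. by move=> u Eu; exists 1; rewrite ?mul1r // mcoeff1 eqxx oner_neq0. Qed.

Lemma loc_mono E E' : E `<=` E' -> loc E `<=` loc E'.
Proof. by move=> EE u [s s0 /EE]; exists s. Qed.

Lemma loc_ideal E : ideal E -> ideal (loc E).
Proof.
move=> iE; apply/idealP; split; first by apply: loc_sub; apply: ideal0.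
- move=> u v [s s0 Eu] [t t0 Ev]; exists (s * t); first exact: unitM.
  by rewrite mulrDr; apply: idealD => //; rewrite -?mulrA; [rewrite mulrCA|]; apply: idealMl.
- by move=> a v [s s0 Ev]; exists s => //; rewrite mulrCA; apply: idealMl.
Qed.

Lemma loc_unit E s u : s@_0 != 0 -> loc E (s * u) -> loc E u.
Proof. by move=> s0 [t t0]; rewrite mulrA => Eu; exists (t * s) => //; apply: unitM. Qed.

Lemma loc_loc E : loc (loc E) = loc E.
Proof.
apply/seteqP; split; last exact: loc_sub.
by move=> u [s s0]; apply: loc_unit.
Qed.

Lemma loc_min E E' : ideal E' -> E `<=` loc E' -> loc E `<=` loc E'.
Proof. by move=> iE' EE; rewrite -(loc_loc E'); apply: loc_mono. Qed.

Lemma loc_id E c : ideal E -> mpow c `<=` E -> loc E = E.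
Proof.
move=> iE mE; apply/seteqP; split; last exact: loc_sub.
move=> u [s s0 Esu]; have [s' hs'] := inv_mod c s0.
have -> : u = s' * (s * u) + (1 - s' * s) * u by rewrite mulrBl mul1r mulrA addrCA subrr addr0.
by apply: idealD => //; [exact: idealMl|by apply: idealMr => //; apply: mE].
Qed.

Lemma locM I J : idealM setT (loc I) (loc J) `<=` loc (idealM setT I J).
Proof.
apply: idealM_min; first by apply/loc_ideal/idealM_ideal.
move=> u v [s s0 Iu] [t t0 Jv]; exists (s * t); first exact: unitM.
by rewrite mulrACA; apply: idealM_mem.
Qed.

Lemma locX I t : idealX setT (loc I) t `<=` loc (idealX setT I t).
Proof.
elim: t => [|t IH]; first by move=> u _; apply: loc_sub.
rewrite !idealXS; apply: subset_trans (@locM _ _); exact: idealM_mono.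
Qed.

Lemma mpow_idealX c t : mpow (c * t) `<=` idealX setT (mpow c) t.
Proof.
elim: t => [//|t IH]; rewrite mulnS idealXS.
apply: mpow_mon => [|m dm]; first exact: idealM_ideal.
have [m1 [m2 [-> d1 d2]]] := mdegD_split dm.
rewrite mpolyXD; apply: idealM_mem.
  by move=> k kc; rewrite mcoeffX; case: eqP kc => // <-; rewrite d1 ltnn.
by apply: IH => k kc; rewrite mcoeffX; case: eqP kc => // <-; rewrite d2 ltnn.
Qed.

Definition mI := mpow 1.

Lemma mI_local : is_local (@setT W) mI.
Proof.
split=> //; first exact: (ideal0 (mpow_ideal 1)).
move=> a _; case: (eqVneq a@_0 0) => [a0|a0]; [left|right].
  by apply/mpow1P.
exists (a@_0)^-1%:MP => //; apply/mpow1P.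
by rewrite mcoeffB mcoeff1 eqxx mul_mpolyC mcoeffZ mulVf // subrr.
Qed.

Local Notation clenW := (@clen W W^o setT mI).
Local Notation dimq := (@clen F W setT [set 0]).
Let Fl := field_local F.

Lemma ideal_submod E : ideal E -> @is_submodule F W setT E.
Proof.
move=> iE; split; [exact: ideal0|by move=> *; apply: idealD|].
by move=> a v _ Ev; rewrite -mul_mpolyC; apply: idealMl.
Qed.

(** A polynomial acts on a factor killed by the ideal of the origin through its constant term, so
    the generator of the factor spans it over [F]. *)
Lemma clenW_dim P N' l : clenW P N' l -> dimq P N' l.
Proof.
elim=> [sP|M v {}l c IH Mv mv]; first by apply/clen_nil/ideal_submod.
have [_ sM _] := clen_sub mI_local c.
have -> : @adjoin W W^o setT M v = @adjoin F W setT M v.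
  apply/seteqP; split=> u [r _ Mu].
    exists r@_0 => //; have -> : u - r@_0 *: v = (u - r * v) + (r - (r@_0)%:MP) * v.
      by rewrite mulrBl mul_mpolyC addrA subrK.
    apply: idealD => //; apply: (mv (r - (r@_0)%:MP)).
    by apply/mpow1P; rewrite mcoeffB mcoeffC eqxx mulr1 subrr.
  by exists r%:MP => //; rewrite -[_ *: v]/(_ * v) mul_mpolyC.
by apply: clen_step => // r ->; rewrite scale0r; apply: (ideal0 sM).
Qed.

Lemma dimq_mpow c P : ideal P -> mpow c `<=` P -> exists l, dimq P setT l.
Proof.
move=> iP mP; have sP := ideal_submod iP.
pose s := [seq 'X_[m] : W | m <- [seq val m | m : 'X_{1..N < c}]].
have [|||l cl] := @clen_adjoins_nilp F W setT [set 0] Fl P s 0 1 sP.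
- by [].
- by move=> r ->; exists 0; rewrite ?mulr0.
- by move=> v _; rewrite expr1 scale0r; apply: ideal0.
exists l; congr (dimq P _ l): cl; apply/seteqP; split=> // u _.
have sA := adjoins_submod Fl s sP.
rewrite [u]mpolyE; apply: (submod_sum sA) => m _; apply: (submodZ sA) => //.
case: (ltnP (mdeg m) c) => mc.
  by apply: (adjoins_mem Fl sP); apply: map_f; apply/mapP; exists (BMultinom mc) => //; rewrite mem_enum.
apply: (adjoins_sub Fl); apply: mP => k kc; rewrite mcoeffX; case: eqP kc => // <-.
by rewrite ltnNge mc.
Qed.

(** Induction on the dimension of [N' / P]. Among the elements of [N'] outside of [P], all of order
    less than [c], one takes [w] of largest order: its products with polynomials without constant
    term lie in [P], so [w] generates a first factor. *)
Lemma clenW_exists c P N' : ideal P -> mpow c `<=` P -> ideal N' -> P `<=` N' ->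
  exists l, clenW P N' l.
Proof.
move=> iP mP iN PN; have [l0 c0] := dimq_mpow iP mP.
have [d [_ [cd _ _]]] := clen_split Fl c0 (ideal_submod iN) PN (@subsetT _ _).
elim: d P iP mP PN cd {c0} => [|d IH] P iP mP PN cd.
  by exists 0%N; rewrite (clen0 cd); apply: clen_nil.
have exw : exists i, `[< exists w, [/\ N' w, ~ P w & mpow i w] >].
  exists 0%N; apply/asboolP; apply: contrapT => h.
  suff e : N' = P by rewrite e in cd; have := clen_uniq Fl cd (clen_nil _ (ideal_submod iP)).
  apply/seteqP; split=> // w Nw; apply: contrapT => nPw; by apply: h; exists w; split.
have bd i : `[< exists w, [/\ N' w, ~ P w & mpow i w] >] -> (i <= c)%N.
  move=> /asboolP [w [_ nPw mw]]; rewrite leqNgt; apply/negP => ci; apply: nPw.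
  by apply/mP/(mpow_sub (ltnW ci)).
case: (ex_maxnP exw bd) => i /asboolP [w [Nw nPw mw]] imax.
have mw' r : mI r -> P (r *: (w : W^o)).
  move=> mr; apply: contrapT => nP; have := imax i.+1; rewrite ltnn => h.
  apply: notF; apply: h; apply/asboolP; exists (r * w); split=> //; first exact: idealMl.
  by rewrite -add1n; apply: mpowM.
pose P' := @adjoin W W^o setT P w.
have c1 : clenW P P' 1 by apply: clen_step => //; apply: clen_nil.
have [_ iP' PP'] := clen_sub mI_local c1.
have P'N : P' `<=` N' by apply: (@adjoin_min W W^o).
have [a [b [ca cb e]]] := clen_split Fl cd (ideal_submod iP') PP' P'N.
have ea := clen_uniq Fl ca (clenW_dim c1); subst a.
have eb : b = d by lia.
rewrite eb in cb.
have [l cl] := IH P' iP' (subset_trans mP PP') P'N cb.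
by exists (1 + l)%N; apply: clen_cat c1 cl.
Qed.

Lemma dim_clenW c P N' l : ideal P -> mpow c `<=` P -> ideal N' -> P `<=` N' ->
  dimq P N' l -> clenW P N' l.
Proof.
move=> iP mP iN PN cd; have [l' c'] := clenW_exists iP mP iN PN.
by have -> := clen_uniq Fl cd (clenW_dim c').
Qed.

End LocalClosure.

Section MonomialSums.
Variables (n : nat) (R : comNzRingType).

Lemma big_msupp_sub (V : nmodType) (p : {mpoly R[n]}) (s : seq 'X_{1..n}) (G : R -> 'X_{1..n} -> V) :
  uniq s -> {subset msupp p <= s} -> (forall m, G 0 m = 0) ->
  \sum_(m <- s) G p@_m m = \sum_(m <- msupp p) G p@_m m.
Proof.
move=> us ps G0; rewrite (bigID (mem (msupp p))) /= [X in _ + X]big1 ?addr0; last first.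
  by move=> m /memN_msupp_eq0 ->.
rewrite -big_filter; apply: perm_big; apply: uniq_perm; rewrite ?filter_uniq ?msupp_uniq //.
move=> m; rewrite mem_filter; case: (boolP (m \in msupp p)) => //= h.
exact: ps.
Qed.

Lemma mcoeffMX_le (p : {mpoly R[n]}) m k :
  (p * 'X_[m])@_k = if (m <= k)%MM then p@_(k - m) else 0.
Proof.
case: ifPn => [le|nle]; first by rewrite -{1}(submK le) addmC mcoeffMX.
apply/memN_msupp_eq0; apply: contra nle; rewrite (perm_mem (msuppMX p m)).
by case/mapP => l _ ->; rewrite lem_addr.
Qed.

Lemma meval_msupp (h : 'I_n -> R) (a : {mpoly R[n]}) :
  a.@[h] = \sum_(m <- msupp a) a@_m * mmap1 h m.
Proof. by []. Qed.

End MonomialSums.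

(* Perturbing [g_i] into [g_i + 'X_i ^+ D] with [D] large does not change the
   ideal at the origin, and makes the polynomial ring free over the subring
   generated by the new family, with basis the monomials with all exponents
   less than [D]: the matrix of [triang] is unitriangular for the degree. *)
Section Perturbation.
Variables (F : fieldType) (N : nat).
Local Notation W := {mpoly F[N]}.
Local Notation ideal := (@is_ideal W setT).
Variables (g : 'I_N -> W) (D : nat).
Hypothesis D_gt0 : (0 < D)%N.
Hypothesis gD : forall i, (msize (g i) <= D)%N.

Definition pert i : W := g i + 'X_i ^+ D.
Local Notation h := pert.

(** The part of highest degree of [p] is the monomial ['X_[a]]. *)
Definition good (a : 'X_{1..N}) (p : W) := (msize (p - 'X_[a]) <= mdeg a)%N.

Lemma good_msize a p : good a p -> (msize p <= (mdeg a).+1)%N.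
Proof.
move=> ga; rewrite -(subrK 'X_[a] p); apply: leq_trans (msizeD_le _ _) _.
by rewrite geq_max msizeX leqnn andbT; apply: leq_trans ga _.
Qed.

Lemma goodM a b p q : good a p -> good b q -> good (a + b)%MM (p * q).
Proof.
move=> ga gb; rewrite /good.
have -> : p * q - 'X_[a + b] = (p - 'X_[a]) * q + 'X_[a] * (q - 'X_[b]).
  by rewrite mulrBl mulrBr mpolyXD addrA subrK.
have M1 (u v : W) x y : (msize u <= x)%N -> (msize v <= y.+1)%N -> (msize (u * v) <= x + y)%N.
  move=> ux vy; case: (eqVneq u 0) => [->|u0]; first by rewrite mul0r msize0.
  case: (eqVneq v 0) => [->|v0]; first by rewrite mulr0 msize0.
  by rewrite msizeM //; have := leq_add ux vy; rewrite addnS; case: (_ + _)%N.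
apply: leq_trans (msizeD_le _ _) _; rewrite geq_max mdegD M1 //; last exact: good_msize.
by rewrite mulrC addnC M1 // msizeX.
Qed.

Lemma good1 : good 0%MM 1.
Proof. by rewrite /good mpolyX0 subrr msize0. Qed.

Lemma good_pert i : good (U_(i) *+ D)%MM (h i).
Proof. by rewrite /good /pert mpolyXn addrK mdegMn mdeg1 mul1n. Qed.

Definition mmod (m : 'X_{1..N}) := [multinom (m i %% D)%N | i < N].
Definition mdiv (m : 'X_{1..N}) := [multinom (m i %/ D)%N | i < N].

Lemma mmod_div m : (mmod m + mdiv m *+ D)%MM = m.
Proof. by apply/mnmP => i; rewrite mnmDE mulmnE !mnmE addnC -divn_eq. Qed.

Lemma good_prod m : good (m *+ D)%MM (mmap1 h m).
Proof.
have -> : (m *+ D)%MM = (\sum_i (U_(i) *+ D) *+ m i)%MM.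
  apply/mnmP => j; rewrite mnm_sumE mulmnE (bigD1 j) //= big1 ?addn0.
    by rewrite !mulmnE mnm1E eqxx mul1n mulnC.
  by move=> i ij; rewrite !mulmnE mnm1E (negbTE ij).
rewrite /mmap1; apply: (big_ind2 good); [exact: good1|by move=> *; apply: goodM|].
move=> i _; elim: (m i) => [|k IH]; first by rewrite expr0 mulm0n; apply: good1.
by rewrite exprS mulmS; apply: goodM => //; apply: good_pert.
Qed.

(** The candidate basis over the subring generated by the [h i], indexed so that [bx m] has ['X_[m]]
    as its part of highest degree. *)
Definition bx m : W := 'X_[mmod m] * mmap1 h (mdiv m).

Lemma good_bx m : good m (bx m).
Proof.
rewrite -{1}(mmod_div m); apply: goodM; last exact: good_prod.
by rewrite /good subrr msize0.
Qed.

Definition triang (p : W) : W := \sum_(m <- msupp p) p@_m *: bx m.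

Lemma theta_sub (s : seq 'X_{1..N}) p : uniq s -> {subset msupp p <= s} ->
  triang p = \sum_(m <- s) p@_m *: bx m.
Proof.
move=> us ps; rewrite /triang -(big_msupp_sub (G := fun c m => c *: bx m) us ps) //.
by move=> m; rewrite scale0r.
Qed.

Lemma theta_linear : linear triang.
Proof.
move=> a p q; pose s := undup (msupp p ++ msupp q ++ msupp (a *: p + q)).
have us : uniq s := undup_uniq _.
rewrite !(theta_sub us); first last.
- by move=> m mp; rewrite mem_undup !mem_cat mp !orbT.
- by move=> m mp; rewrite mem_undup !mem_cat mp.
- by move=> m mp; rewrite mem_undup !mem_cat mp orbT.
rewrite scaler_sumr -big_split; apply: eq_bigr => m _ /=.
by rewrite mcoeffD mcoeffZ scalerDl scalerA.
Qed.
HB.instance Definition _ := GRing.isLinear.Build F W W *:%R triang theta_linear.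

Lemma thetaX m : triang 'X_[m] = bx m.
Proof. by rewrite /triang msuppX big_seq1 mcoeffX eqxx scale1r. Qed.

Lemma theta_deg p : (msize (triang p - p) <= (msize p).-1)%N.
Proof.
rewrite {2}[p]mpolyE /triang -sumrB; apply: leq_trans (msize_sum _ _ _) _.
rewrite big_seq; apply: (big_ind (fun x => (x <= (msize p).-1)%N)) => // [x y|m mp].
  by rewrite geq_max => -> ->.
rewrite -scalerBr; apply: leq_trans (msizeZ_le _ _) _.
apply: leq_trans (good_bx m) _; have := msize_mdeg_lt mp; lia.
Qed.

Lemma theta_inj : injective triang.
Proof.
apply: raddf_inj => p tp; apply/eqP; rewrite -msize_poly_eq0.
have := theta_deg p; rewrite tp sub0r msizeN; lia.
Qed.

Lemma theta_surj w : exists p, triang p = w.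
Proof.
have [k] := ubnP (msize w); elim: k w => // k IH w wk.
case: (eqVneq w 0) => [->|w0]; first by exists 0; rewrite raddf0.
have [|p' tp'] := IH (triang w - w).
  have := theta_deg w; have := mpolySpred mdeg w0; lia.
by exists (w - p'); rewrite raddfB /= tp' subKr.
Qed.

(** Only the quotients of the exponents by [D] change. Under [triang] the monomials in the
    ['X_i ^+ D] thus act as the monomials in the [h i], and relations between the [h i] can be read
    off exponents. *)
Lemma thetaM al p : triang (p * 'X_[al *+ D]) = triang p * mmap1 h al.
Proof.
rewrite {1}[p]mpolyE /triang -/(triang _) mulr_suml raddf_sum mulr_suml.
apply: eq_bigr => m _ /=; rewrite -scalerAl linearZ /= -mpolyXD thetaX -scalerAl; congr (_ *: _).
rewrite /bx -mulrA -commr_mmap1_M; last by move=> i ?; apply: mulrC.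
have -> : mmod (m + al *+ D) = mmod m.
  by apply/mnmP => i; rewrite !mnmE mulmnE addnC modnMDl.
suff -> : mdiv (m + al *+ D) = (mdiv m + al)%MM by [].
by apply/mnmP => i; rewrite !mnmE mulmnE addnC divnMDl // addnC.
Qed.

Lemma theta_gen (p : W) (E : set W) : ideal E ->
  (forall m, p@_m != 0 -> exists2 j, (D <= m j)%N & E (h j)) -> E (triang p).
Proof.
move=> iE hp; rewrite [p]mpolyE raddf_sum; apply: ideal_sum => // m _ /=.
case: (eqVneq p@_m 0) => [->|/hp [j Dj Ej]]; first by rewrite scale0r raddf0; apply: ideal0.
have le : (U_(j) *+ D <= m)%MM.
  by apply/mnm_lepP => i; rewrite mulmnE mnm1E; case: eqP => [<-|_]; rewrite ?mul1n.
rewrite linearZ /= -mul_mpolyC; apply: idealMl => //.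
by rewrite -(submK le) mpolyXD thetaM mmap1U; apply: idealMl.
Qed.

(** All coefficients are pulled back by [triang], which turns [h i] into ['X_i ^+ D]. A monomial
    with exponents less than [D], shifted by [be *+ D] with [be] of degree [t], meets on the left
    only the coefficient of index [be], and nothing on the right, where indices have degree [t.+1].
    So every monomial of that coefficient is divisible by some ['X_j ^+ D]. *)
Lemma pert_quasiregular t (a : {mpoly W[N]}) : a \is t.-homog ->
  idealX setT (lin h) t.+1 a.@[h] -> forall al, lin h a@_al.
Proof.
move=> ha /idealX_linP [b hb eab].
have [P thP] := choice (fun al => theta_surj a@_al).
have [Q thQ] := choice (fun al => theta_surj b@_al).
have eqPQ : \sum_(al <- msupp a) P al * 'X_[al *+ D] = \sum_(al <- msupp b) Q al * 'X_[al *+ D].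
  apply: theta_inj; rewrite !raddf_sum /=.
  under eq_bigr do rewrite thetaM thP; under [RHS]eq_bigr do rewrite thetaM thQ.
  by rewrite -!meval_msupp.
move=> be; case: (boolP (be \in msupp a)) => [bea|/memN_msupp_eq0 ->]; last first.
  exact: ideal0 (lin_ideal _).
have dbe := dhomogP _ _ _ ha _ bea.
rewrite -thP; apply: theta_gen; first exact: lin_ideal.
move=> m Pm; apply: contrapT => nm; move: Pm; apply/negP; rewrite negbK.
have mD i : (m i < D)%N.
  by rewrite ltnNge; apply/negP => Dm; apply: nm; exists i => //; apply: lin_gen.
have le_iff al : (al *+ D <= m + be *+ D)%MM = (al <= be)%MM.
  apply/mnm_lepP/mnm_lepP => le i.
    have := le i; rewrite mnmDE !mulmnE => h'.
    have : (al i * D < (be i).+1 * D)%N by rewrite mulSn; have := mD i; lia.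
    by rewrite ltn_pmul2r.
  by rewrite mnmDE !mulmnE; have := le i; rewrite -(leq_pmul2r D_gt0); lia.
have := congr1 (mcoeff (m + be *+ D)%MM) eqPQ; rewrite !raddf_sum /=.
rewrite (bigD1_seq be) ?msupp_uniq //= addmC mcoeffMX.
rewrite big_seq_cond big1 ?addr0 => [->|al /andP [ala ne]]; last first.
  rewrite mcoeffMX_le addmC le_iff; case: ifP => // le; case/eqP: ne.
  have dal := dhomogP _ _ _ ha _ ala.
  have := congr1 mdeg (submK le); rewrite mdegD dbe dal => e.
  have /eqP : mdeg (be - al) = 0%N by lia.
  by rewrite mdeg_eq0 => /eqP e0; rewrite -(submK le) e0 add0m.
rewrite big_seq big1 // => al alb; rewrite mcoeffMX_le addmC le_iff; case: ifP => // le.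
have dal := dhomogP _ _ _ hb _ alb.
by have := congr1 mdeg (submK le); rewrite mdegD dbe dal; lia.
Qed.

Definition trunc (f : 'I_N -> W) (i : nat) (j : 'I_N) : W := if (j < i)%N then f j else 0.

(** Under [triang] this is the regularity of ['X_i ^+ D] modulo the previous ['X_j ^+ D], a
    statement on exponents. *)
Lemma pert_regular (i : 'I_N) w : lin (trunc h i) (w * h i) -> lin (trunc h i) w.
Proof.
case=> c ec; have [p tp] := theta_surj w.
have [Q thQ] := choice (fun j => theta_surj (c j)).
have eQ : p * 'X_[U_(i) *+ D] = \sum_(j < N | (j < i)%N) Q j * 'X_[U_(j) *+ D].
  apply: theta_inj; rewrite thetaM tp mmap1U ec raddf_sum /= [RHS]big_mkcond.
  apply: eq_bigr => j _; rewrite /trunc; case: ifP => _; rewrite ?mulr0 //.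
  by rewrite thetaM thQ mmap1U.
rewrite -tp; apply: theta_gen; first exact: lin_ideal.
move=> m pm; have := congr1 (mcoeff (U_(i) *+ D + m)%MM) eQ.
rewrite mcoeffMX raddf_sum /= => e.
have [j ji] : exists2 j : 'I_N, (j < i)%N & (U_(j) *+ D <= U_(i) *+ D + m)%MM.
  apply: contrapT => nj; case/eqP: pm; rewrite e big1 // => j ji.
  rewrite mcoeffMX_le; case: ifP => // le; case: nj; by exists j.
move/mnm_lepP/(_ j); rewrite mnmDE !mulmnE !mnm1E eqxx mul1n => le; exists j.
  by move: le; case: eqP => [ij|_]; [rewrite ij ltnn in ji|rewrite mul0n].
by have := lin_gen (trunc h i) j; rewrite /trunc ji.
Qed.

(** As [D] exceeds [c], the power ['X_i ^+ D.-1] lies locally in the ideal of [g]; the remaining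
    factor ['X_i] makes the perturbation a combination of the [g j] with coefficients vanishing at
    the origin. The matrix from [g] to [h], up to units, has a determinant that is nonzero at the
    origin, and its adjugate gives [g] back. *)
Lemma pert_loc c : (c < D)%N -> mpow c `<=` loc (lin g) -> loc (lin h) = loc (lin g).
Proof.
move=> cD mg.
have XD i : loc (lin g) ('X_i ^+ D.-1).
  apply: mg; apply: (@mpow_sub _ _ c D.-1); first lia.
  by apply: mpowX; apply/mpow1P; rewrite mcoeffX mnm1_eq0.
apply/seteqP; split; apply: loc_min; try exact: lin_ideal.
  apply: lin_min => [|i]; first exact/loc_ideal/lin_ideal.
  apply: idealD; first exact/loc_ideal/lin_ideal.
    by apply: loc_sub; apply: lin_gen.
  rewrite -(prednK D_gt0) exprS; apply: idealMl => //; exact/loc_ideal/lin_ideal.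
have H i : exists sb : W * ('I_N -> W), sb.1@_0 != 0 /\ sb.1 * 'X_i ^+ D.-1 = \sum_j sb.2 j * g j.
  by have [s s0 [b eb]] := XD i; exists (s, b).
have {H} [sb Hsb] := choice H.
pose s i := (sb i).1; pose b i := (sb i).2.
pose M : 'M[W]_N := \matrix_(i, j) ((s i) *+ (i == j) + 'X_i * b i j).
have Mg i : \sum_j M i j * g j = s i * h i.
  under eq_bigr do rewrite mxE mulrDl; rewrite big_split /=.
  rewrite (bigD1 i) //= eqxx big1 ?addr0 => [|j /negbTE ij]; last by rewrite eq_sym ij mul0r.
  rewrite /h mulrDr; congr (_ + _); under eq_bigr do rewrite -mulrA.
  rewrite -mulr_sumr; have [_ /esym] := Hsb i; rewrite -/(s i) -/(b i) => ->.
  by rewrite mulrCA -exprS prednK.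
have detM : (\det M)@_0 != 0.
  have -> : (\det M)@_0 = \det (map_mx (mcoeff 0%MM) M).
    by rewrite -(det_map_mx (mcoeff 0%MM)).
  have -> : map_mx (mcoeff 0%MM) M = diag_mx (\row_i (s i)@_0).
    apply/matrixP => i j; rewrite !mxE mcoeffD mcoeffMn (rmorphM (mcoeff 0%MM)) /=.
    by rewrite mcoeffX mnm1_eq0 mul0r addr0.
  rewrite det_diag; apply/prodf_neq0 => i _; rewrite mxE; by have [] := Hsb i.
apply: lin_min => [|i]; first exact/loc_ideal/lin_ideal.
exists (\det M) => //.
have := mul_adj_mx M => /matrixP E.
have -> : \det M * g i = \sum_k \adj M i k * (s k * h k).
  under eq_bigr do rewrite -Mg mulr_sumr.
  rewrite exchange_big /= (bigD1 i) //= [X in _ = _ + X]big1 ?addr0.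
    rewrite -[\det M]mulr1n; have := E i i; rewrite !mxE eqxx => <-.
    by rewrite mulr_suml; apply: eq_bigr => k _; rewrite mulrA.
  move=> j /negbTE ji; under eq_bigr do rewrite mulrA.
  by rewrite -mulr_suml; have := E i j; rewrite !mxE eq_sym ji mulr0n => ->; rewrite mul0r.
apply: ideal_sum => [|k _]; first exact: lin_ideal.
by do 2!apply: (idealMl _ (lin_ideal _)); apply: lin_gen.
Qed.

End Perturbation.

(** Stands for the theorem that a system of parameters of a regular local ring is a regular
    sequence. *)
Lemma quasiregular_generators (F : fieldType) (N c : nat) (g : 'I_N -> {mpoly F[N]}) :
  mpow c `<=` loc (lin g) -> exists h : 'I_N -> {mpoly F[N]},
  [/\ loc (lin h) = loc (lin g),
      forall t (a : {mpoly {mpoly F[N]}[N]}), a \is t.-homog ->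
        idealX setT (lin h) t.+1 a.@[h] -> forall al, lin h a@_al
    & forall (i : 'I_N) w, lin (trunc h i) (w * h i) -> lin (trunc h i) w].
Proof.
move=> mg; pose D := maxn c.+1 (\max_i msize (g i)).
have D0 : (0 < D)%N by rewrite leq_max.
have gD i : (msize (g i) <= D)%N.
  by rewrite leq_max (@leq_bigmax _ (fun i => msize (g i)) i) orbT.
exists (pert g D); split.
- by apply: (@pert_loc _ _ _ _ D0 c) => //; rewrite leq_max leqnn.
- exact: pert_quasiregular.
- exact: pert_regular.
Qed.

(** * Hilbert functions *)

Section Monomials.

Definition mcons r (j : nat) (m : 'X_{1..r}) : 'X_{1..r.+1} :=
  [multinom if unlift ord0 i is Some i' then m i' else j | i < r.+1].

Definition mtail r (m : 'X_{1..r.+1}) : 'X_{1..r} := [multinom m (lift ord0 i) | i < r].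

Lemma mcons_head r j (m : 'X_{1..r}) : mcons j m ord0 = j.
Proof. by rewrite mnmE unlift_none. Qed.

Lemma mconsK r (m : 'X_{1..r.+1}) : mcons (m ord0) (mtail m) = m.
Proof.
apply/mnmP => i; rewrite mnmE; case: unliftP => [i' ->|-> //].
by rewrite mnmE.
Qed.

Lemma mtailK r j (m : 'X_{1..r}) : mtail (mcons j m) = m.
Proof. by apply/mnmP => i; rewrite !mnmE liftK. Qed.

Lemma mdeg_mcons r j (m : 'X_{1..r}) : mdeg (mcons j m) = (j + mdeg m)%N.
Proof.
rewrite !mdegE big_ord_recl mcons_head; congr addn.
by apply: eq_bigr => i _; rewrite mnmE liftK.
Qed.

Lemma mcons_le r j j' (m m' : 'X_{1..r}) :
  (mcons j m <= mcons j' m')%MM = (j <= j')%N && (m <= m')%MM.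
Proof.
apply/mnm_lepP/andP => [h|[jj /mnm_lepP mm] i].
  split; first by have := h ord0; rewrite !mcons_head.
  by apply/mnm_lepP => i; have := h (lift ord0 i); rewrite !mnmE liftK.
by rewrite !mnmE; case: unliftP.
Qed.

Definition mons r t : seq 'X_{1..r} :=
  [seq val m | m <- enum [pred m : 'X_{1..r < t.+1} | mdeg m == t]].

Lemma mem_mons r t m : (m \in mons r t) = (mdeg m == t).
Proof.
apply/mapP/idP => [[b]|/eqP dm]; first by rewrite mem_enum inE => + ->.
have bm : (mdeg m < t.+1)%N by rewrite dm.
by exists (BMultinom bm) => //; rewrite mem_enum inE /= dm.
Qed.

Lemma mons_uniq r t : uniq (mons r t).
Proof. by rewrite map_inj_uniq ?enum_uniq //; apply: val_inj. Qed.

Lemma perm_mons r t : perm_eq (mons r.+1 t)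
  (flatten [seq [seq mcons j m | m <- mons r (t - j)] | j <- iota 0 t.+1]).
Proof.
apply: uniq_perm; first exact: mons_uniq.
  rewrite -[flatten _]/(flatten _); have : uniq (iota 0 t.+1) := iota_uniq _ _.
  elim: (iota 0 t.+1) => //= j s IH /andP [js us]; rewrite cat_uniq IH // andbT.
  rewrite map_inj_uniq ?mons_uniq /=; last first.
    by move=> m m' /(congr1 (@mtail r)); rewrite !mtailK.
  apply/hasPn => m /flatten_mapP [j' j's /mapP [m' _ ->]]; apply/mapP => -[m'' _].
  by move/(congr1 (fun m : 'X_{1..r.+1} => m ord0)); rewrite !mcons_head => e; rewrite -e j's in js.
move=> m; rewrite mem_mons; apply/eqP/flatten_mapP => [dm|[j]].
  have h : mdeg m = (m ord0 + mdeg (mtail m))%N by rewrite -{1}(mconsK m) mdeg_mcons.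
  exists (m ord0); first by rewrite mem_iota; lia.
  by apply/mapP; exists (mtail m); rewrite ?mconsK // mem_mons; apply/eqP; lia.
rewrite mem_iota => jt /mapP [m' + ->]; rewrite mem_mons mdeg_mcons => /eqP ->; lia.
Qed.

Lemma count_mons r (P : pred 'X_{1..r.+1}) t :
  count P (mons r.+1 t) = (\sum_(j < t.+1) count (fun m => P (mcons j m)) (mons r (t - j)))%N.
Proof.
rewrite (permP (perm_mons r t)) count_flatten -map_comp sumnE big_map.
rewrite -[X in \big[_/_]_(_ <- X) _]/(index_iota 0 t.+1) big_mkord.
by apply: eq_bigr => j _ /=; rewrite count_map.
Qed.

(** Induction on the number of variables. The projection forgetting the first exponent is covered by
    finitely many elements, which settles first exponents at least [J]; each of the finitely many
    smaller ones gives a slice in fewer variables. *)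
Lemma dickson r (S : set 'X_{1..r}) : exists s : seq 'X_{1..r},
  (forall m, m \in s -> S m) /\ forall m, S m -> exists2 a, a \in s & (a <= m)%MM.
Proof.
elim: r S => [|r IH] S.
  case: (pselect (exists m, S m)) => [[m Sm]|nS].
    exists [:: m]; split=> [m'|m' _]; first by rewrite inE => /eqP ->.
    by exists m; rewrite ?mem_head //; apply/mnm_lepP => -[].
  by exists [::]; split=> // m Sm; case: nS; exists m.
have [s' [sS cov]] := IH [set m | exists j, S (mcons j m)].
have [jf Hj] : exists jf : 'X_{1..r} -> nat, forall m, m \in s' -> S (mcons (jf m) m).
  have [jf Hj] : exists jf : 'X_{1..r} -> nat, forall m, m \in s' -> S (mcons (jf m) m).
    have h (m : 'X_{1..r}) : exists j, m \in s' -> S (mcons j m).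
      by case: (boolP (m \in s')) => [/sS [j Sj]|_]; [exists j|exists 0%N].
    by have [jf Hj] := choice h; exists jf.
  by exists jf.
have [ss Hss] := choice (fun j => IH [set m | S (mcons j m)]).
pose J := (\max_(m <- s') jf m)%N.
exists ([seq mcons (jf m) m | m <- s'] ++
        flatten [seq [seq mcons j m | m <- ss j] | j <- iota 0 J]); split=> [m|m Sm].
  rewrite mem_cat => /orP [/mapP [m' /Hj ? ->] //|/flatten_mapP [j _ /mapP [m' m's ->]]].
  by have [+ _] := Hss j; apply.
case: (ltnP (m ord0) J) => mJ.
  have [_ /(_ (mtail m))] := Hss (m ord0); rewrite /= mconsK => /(_ Sm) [a as_ am].
  exists (mcons (m ord0) a); last by rewrite -{2}(mconsK m) mcons_le leqnn.
  rewrite mem_cat; apply/orP; right; apply/flatten_mapP; exists (m ord0).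
    by rewrite mem_iota.
  by apply/mapP; exists a.
have [|a as' am] := cov (mtail m); first by exists (m ord0); rewrite mconsK.
exists (mcons (jf a) a); first by rewrite mem_cat; apply/orP; left; apply/mapP; exists a.
rewrite -(mconsK m) mcons_le am andbT; apply: leq_trans mJ.
exact: leq_bigmax_seq.
Qed.

End Monomials.

(** * Finite differences and functions that are eventually polynomial *)

Section DiscreteCalculus.
Implicit Types p q : {poly rat}.

Definition pdiff q : {poly rat} := q \Po ('X + 1%:P) - q.

Lemma pdiff_horner q x : (pdiff q).[x] = q.[x + 1] - q.[x].
Proof. by rewrite /pdiff hornerD hornerN horner_comp !hornerE. Qed.

Lemma pdiffD q q' : pdiff (q + q') = pdiff q + pdiff q'.
Proof. by rewrite /pdiff comp_polyD opprD addrACA. Qed.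

Lemma pdiffZ c q : pdiff (c *: q) = c *: pdiff q.
Proof. by rewrite /pdiff comp_polyZ scalerBr. Qed.

Lemma pdiffXn m : (size (pdiff 'X^(m.+1) - m.+1%:R *: 'X^m)%R <= m)%N.
Proof.
rewrite /pdiff comp_Xn_poly exprDn big_ord_recl subn0 expr1n mulr1 bin0 mulr1n.
rewrite big_ord_recl /= /bump /= addn0 subn1 /= expr1n mulr1 bin1.
rewrite [_ + (_ + _)]addrC addrK -scaler_nat addrC addKr.
apply: (leq_trans (size_sum _ _ _)); apply/bigmax_leqP => i _.
rewrite expr1n mulr1 -scaler_nat; apply: leq_trans (size_scale_leq _ _) _.
by rewrite size_polyXn /bump /=; have := ltn_ord i; lia.
Qed.

Lemma pdiff_surj p : exists2 q, pdiff q = p & (size q <= (size p).+1)%N.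
Proof.
have [k] := ubnP (size p); elim: k p => // k IH p pk.
case: (eqVneq p 0) => [->|p0].
  by exists 0; rewrite ?size_poly0 // /pdiff comp_poly0 subr0.
have ps : (0 < size p)%N by rewrite size_poly_gt0.
pose m := (size p).-1; pose q0 := (lead_coef p / m.+1%:R) *: 'X^(m.+1) : {poly rat}.
have Hs : (size (p - pdiff q0)%R <= m)%N.
  rewrite /q0 pdiffZ.
  have -> : p - (lead_coef p / m.+1%:R) *: pdiff 'X^(m.+1) =
    (p - lead_coef p *: 'X^m) - (lead_coef p / m.+1%:R) *: (pdiff 'X^(m.+1) - m.+1%:R *: 'X^m).
    rewrite [X in _ = _ - X]scalerBr scalerA divfK; last by rewrite Num.Theory.pnatr_eq0.
    by rewrite opprB addrA addrNK.
  apply: leq_trans (size_polyD _ _) _; rewrite geq_max size_polyN; apply/andP; split.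
    apply/leq_sizeP => j mj; rewrite coefB coefZ coefXn.
    case: eqP => [->|jm]; first by rewrite mulr1 subrr.
    by rewrite mulr0 subr0 nth_default // -(prednK ps) ltn_neqAle mj andbT eq_sym; apply/eqP.
  by apply: leq_trans (size_scale_leq _ _) (pdiffXn m).
have [|q eq sq] := IH (p - pdiff q0); first by rewrite /m in Hs; lia.
exists (q + q0); first by rewrite pdiffD eq subrK.
apply: leq_trans (size_polyD _ _) _; rewrite geq_max; apply/andP; split.
  by apply: leq_trans sq _; rewrite ltnS (leq_trans Hs) // leq_pred.
apply: leq_trans (size_scale_leq _ _) _; rewrite size_polyXn /m; lia.
Qed.

Lemma pdiff_size q : (size (pdiff q) <= (size q).-1)%N.
Proof.
have -> : q = \poly_(i < size q) q`_i by rewrite coefK.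
rewrite poly_def; set s := \sum_(i < _) _.
have -> : pdiff s = \sum_(i < size q) q`_i *: pdiff 'X^i.
  rewrite /s; apply: (big_ind2 (fun x y => pdiff x = y)) => [|x1 x2 y1 y2 <- <-|i _].
  - by rewrite /pdiff comp_poly0 subr0.
  - exact: pdiffD.
  - exact: pdiffZ.
have -> : size s = size q by rewrite /s -poly_def coefK.
apply: (leq_trans (size_sum _ _ _)); apply/bigmax_leqP => -[[|i] /= iq] _.
  by apply: leq_trans (size_scale_leq _ _) _; rewrite /pdiff expr0 comp_polyC subrr size_poly0.
apply: leq_trans (size_scale_leq _ _) _.
rewrite -(subrK (i.+1%:R *: 'X^i) (pdiff _)); apply: leq_trans (size_polyD _ _) _.
rewrite geq_max; apply/andP; split; first by apply: leq_trans (pdiffXn i) _; lia.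
by apply: leq_trans (size_scale_leq _ _) _; rewrite size_polyXn; lia.
Qed.

Lemma poly_eq_large p q t0 : (forall t, (t0 <= t)%N -> p.[t%:R] = q.[t%:R]) -> p = q.
Proof.
move=> h; apply/eqP; rewrite -subr_eq0; apply/eqP; apply: contraTeq isT => ne.
pose s := [seq i%:R : rat | i <- iota t0 (size (p - q))].
have us : uniq s by rewrite map_inj_uniq ?iota_uniq // => i j /eqP; rewrite Num.Theory.eqr_nat => /eqP.
have : all (root (p - q)) s.
  by apply/allP => _ /mapP [i + ->]; rewrite mem_iota => /andP [ti _]; rewrite rootE hornerD hornerN h // subrr.
by move/max_poly_roots => /(_ ne us); rewrite size_map size_iota ltnn.
Qed.

Definition evpoly (f : nat -> nat) := exists p : {poly rat}, exists t0 : nat,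
  forall t, (t0 <= t)%N -> (f t)%:R = p.[t%:R].

Lemma evpoly_const c : evpoly (fun=> c).
Proof. by exists c%:R%:P, 0%N => t _; rewrite hornerC. Qed.

Lemma evpoly_ext f g t0 : (forall t, (t0 <= t)%N -> f t = g t) -> evpoly g -> evpoly f.
Proof.
move=> fg [p [t1 h]]; exists p, (maxn t0 t1) => t; rewrite geq_max => /andP [? ?].
by rewrite fg // h.
Qed.

Lemma evpolyD f g : evpoly f -> evpoly g -> evpoly (fun t => (f t + g t)%N).
Proof.
move=> [p [t0 hp]] [q [t1 hq]]; exists (p + q), (maxn t0 t1) => t.
by rewrite geq_max => /andP [? ?]; rewrite natrD hornerD hp // hq.
Qed.

Lemma evpoly_sum (I : Type) (r : seq I) (f : I -> nat -> nat) :
  (forall i, evpoly (f i)) -> evpoly (fun t => \sum_(i <- r) f i t)%N.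
Proof.
move=> h; elim: r => [|i r IH].
  by apply: (@evpoly_ext _ (fun=> 0%N) 0) (evpoly_const _) => t _; rewrite big_nil.
apply: (@evpoly_ext _ (fun t => (f i t + \sum_(j <- r) f j t)%N) 0) => [t _|].
  by rewrite big_cons.
exact: evpolyD.
Qed.

Lemma evpoly_shift f j : evpoly f -> evpoly (fun t => f (t - j)%N).
Proof.
move=> [p [t0 hp]]; exists (p \Po ('X - j%:R%:P)), (t0 + j)%N => t tj.
rewrite hp; last lia.
by rewrite horner_comp !hornerE natrB //; lia.
Qed.

Lemma evpoly_cum f : evpoly f -> evpoly (fun t => \sum_(i < t.+1) f i)%N.
Proof.
move=> [p [t0 hp]]; have [q eq _] := pdiff_surj p.
pose c : rat := (\sum_(i < t0.+1) f i)%:R - q.[(t0.+1)%:R].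
have E t : ((q \Po ('X + 1%:P)) + c%:P).[t%:R] = q.[t.+1%:R] + c.
  by rewrite hornerD hornerC horner_comp hornerD hornerX hornerC natr1.
exists ((q \Po ('X + 1%:P)) + c%:P), t0 => t tt; rewrite E -(subnK tt).
elim: (t - t0)%N => [|k IH]; first by rewrite add0n /c addrC subrK.
rewrite addSn big_ord_recr /= natrD IH hp; last lia.
rewrite -eq pdiff_horner natr1; ring.
Qed.

End DiscreteCalculus.

Section HilbertFunction.

Definition upcl r (U : set 'X_{1..r}) := forall m m', U m -> (m <= m')%MM -> U m'.

(** Monomials are sliced by their first exponent. By Dickson's lemma the slices of [U] are constant
    from [J] on, so the count is a finite sum of shifted counts in fewer variables plus the
    cumulative sum of one of them. *)
Lemma evpoly_count r (U : set 'X_{1..r}) : upcl U ->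
  evpoly (fun t => count (fun m => ~~ `[< U m >]) (mons r t)).
Proof.
elim: r U => [|r IH] U upU.
  apply: (@evpoly_ext _ (fun=> 0%N) 1) (evpoly_const _) => t t1.
  suff -> : mons 0 t = [::] by [].
  case E : (mons 0 t) => [//|m s].
  have : m \in mons 0 t by rewrite E mem_head.
  by rewrite mem_mons mdegE big_ord0; lia.
pose Uj j := [set m | U (mcons j m)].
have upUj j : upcl (Uj j) by move=> m m' Um mm; apply: upU Um _; rewrite mcons_le leqnn.
have [s [sU cov]] := dickson U.
pose J := (\max_(m <- s) m ord0)%N.
have UJ j m : (J <= j)%N -> Uj j m = Uj J m.
  move=> Jj; apply/propext; split=> [/cov [a as_ am]|Um]; last first.
    by apply: upU Um _; rewrite mcons_le Jj lepm_refl.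
  apply: (upU a); first exact: sU.
  move: am; rewrite -{1 2}(mconsK a) !mcons_le => /andP [_ ->]; rewrite andbT.
  exact: (@leq_bigmax_seq _ s xpredT (fun m : 'X_{1..r.+1} => m ord0)).
pose c j t := count (fun m => ~~ `[< Uj j m >]) (mons r t).
apply: (@evpoly_ext _ (fun t => \sum_(j < J) c j (t - j)%N + \sum_(i < (t - J).+1) c J i)%N J).
  move=> t Jt; rewrite count_mons -/(c _ _).
  transitivity (\sum_(0 <= j < t.+1) c j (t - j))%N; first by rewrite big_mkord.
  rewrite (@big_cat_nat _ _ _ J) //= ?leqW // big_mkord; congr (_ + _)%N.
  rewrite big_nat_rev /= -{1}[J]add0n big_addn subSn // big_mkord.
  apply: eq_bigr => i _; have := ltn_ord i; rewrite ltnS => it.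
  have -> : (J + t.+1 - (i + J).+1 = t - i)%N by lia.
  rewrite /c (_ : t - (t - i) = i)%N; last lia.
  by apply: eq_count => m; rewrite UJ //; lia.
apply: evpolyD.
  rewrite -[fun t => _]/(fun t => \sum_(j < J) (fun t => c (val j) (t - val j)%N) t)%N.
  by apply: evpoly_sum => j; apply: (evpoly_shift (f := c j)); apply: IH.
by apply: (evpoly_shift (f := fun t => \sum_(i < t.+1) c J i)%N); apply: evpoly_cum; apply: IH.
Qed.

Variables (F : fieldType) (r : nat).

Lemma mpolyX_neq0 (m : 'X_{1..r}) : 'X_[F, m] != 0.
Proof. by rewrite -msize_poly_eq0 msizeX. Qed.

Local Notation W := {mpoly F[r]}.
Local Notation dimq := (@clen F W setT [set 0]).
Let Fl := field_local F.

Lemma adjoins_rcons (M : set W) s v :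
  adjoins setT M (rcons s v) = adjoin setT (adjoins setT M s) v.
Proof. by elim: s M => //= w s IH M. Qed.

Definition homset t : set W := [set u | u \is t.-homog].

Lemma homset_submod t : is_submodule setT (homset t).
Proof. by split=> [|u v|a v _]; [exact: rpred0|exact: rpredD|exact: rpredZ]. Qed.

Lemma homog_lead (p : W) t : p != 0 -> p \is t.-homog -> mdeg (mlead p) = t.
Proof. by move=> p0 hp; apply: (dhomogP _ _ _ hp); apply: mlead_supp. Qed.

(** Monomials are adjoined to [U] in increasing order. A new one is already present, modulo the
    smaller ones, exactly when it is the leading monomial of an element of [U]; each of the others
    adds one dimension. *)
Lemma dim_homog_quot t (U : set W) : is_submodule setT U -> U `<=` homset t ->
  dimq U (homset t)
    (count (fun m => ~~ `[< exists2 p, U p /\ p != 0 & mlead p = m >]) (mons r t)).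
Proof.
move=> sU Ut; set Pm := fun m => ~~ _.
pose s := sort <=%O (mons r t).
have ps : perm_eq s (mons r t) by rewrite perm_sort.
rewrite -(permP ps).
have us : uniq s by rewrite (perm_uniq ps) mons_uniq.
have ss : sorted <%O s by rewrite Order.POrderTheory.lt_sorted_uniq_le us Order.TotalTheory.sort_le_sorted.
have -> : homset t = adjoins setT U [seq 'X_[m] | m <- s].
  have sA := adjoins_submod Fl [seq 'X_[m] : W | m <- s] sU.
  apply/seteqP; split=> [u hu|].
    rewrite [u]mpolyE big_seq; apply: (submod_sum sA) => m mu; apply: (submodZ sA) => //.
    apply: (adjoins_mem Fl sU); apply: map_f; rewrite (perm_mem ps) mem_mons.
    by apply/eqP; apply: (dhomogP _ _ _ hu).
  apply: (adjoins_min (homset_submod t) Ut) => _ /mapP [m ms ->].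
  by move: ms; rewrite (perm_mem ps) mem_mons /homset /= dhomogX.
have : forall m m', m \in s -> mdeg m' = t -> (m' < m)%O -> (m' \in s).
  by move=> m m' _ dm _; rewrite (perm_mem ps) mem_mons dm.
have : {in s, forall m, mdeg m = t}.
  by move=> m; rewrite (perm_mem ps) mem_mons => /eqP.
elim/last_ind: s ss {us ps} => [_ _ _|s m IH ss ds low].
  exact: clen_nil.
have ssm : sorted <%O s by move: ss; rewrite -cats1 => /cat_sorted2 [].
have ltm m' : m' \in s -> (m' < m)%O.
  move: ss; rewrite -cats1 Order.POrderTheory.lt_sorted_pairwise pairwise_cat => /and3P [+ _ _].
  by move/allrelP => h m's; apply: h => //; rewrite mem_head.
have low' m' : mdeg m' = t -> (m' < m)%O -> m' \in s.
  move=> dm' m'm; have := low m m'; rewrite mem_rcons mem_head => /(_ isT dm' m'm).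
  by rewrite mem_rcons inE => /orP [/eqP e|//]; rewrite e Order.POrderTheory.ltxx in m'm.
have cs : dimq U (adjoins setT U [seq 'X_[m] | m <- s]) (count Pm s).
  apply: IH => // [m' m's|m1 m2 m1s d2 lt]; first by apply: ds; rewrite mem_rcons inE m's orbT.
  exact: low' (Order.POrderTheory.lt_trans lt (ltm _ m1s)).
set A := adjoins _ _ _ in cs; have [_ sA _] := clen_sub Fl cs.
have subA u : (forall k, k \in msupp u -> k \in s) -> A u.
  move=> h; rewrite [u]mpolyE big_seq; apply: (submod_sum sA) => k ku; apply: (submodZ sA) => //.
  by apply: (adjoins_mem Fl sU); apply: map_f; apply: h.
rewrite map_rcons adjoins_rcons -/A -cats1 count_cat /= addn0.
case: (boolP (Pm m)) => [nLM|/negPn/asboolP [p [Up p0] pm]]; last first.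
  rewrite addn0 (adjoin_id Fl) //.
  pose q := 'X_[m] - (mleadc p)^-1 *: p.
  have -> : 'X_[m] = q + (mleadc p)^-1 *: p by rewrite subrK.
  apply: (submodD sA); last by apply: (submodZ sA) => //; apply: (adjoins_sub Fl).
  have lp : mleadc p != 0 by rewrite mleadc_eq0.
  apply: subA => k; rewrite mcoeff_msupp => qk; apply: low'.
    have hq : q \is t.-homog.
      apply: rpredB; last by apply: rpredZ; apply: Ut.
      by rewrite dhomogX; apply/eqP/ds; rewrite mem_rcons mem_head.
    by apply: (dhomogP _ _ _ hq); rewrite mcoeff_msupp.
  rewrite Order.TotalTheory.ltNge; apply: contra qk; rewrite Order.POrderTheory.le_eqVlt.
  rewrite /q mcoeffB mcoeffX mcoeffZ => /orP [/eqP <-|mk].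
    by rewrite -pm mulVf // eqxx subrr.
  have /negbTE -> : m != k by rewrite (Order.POrderTheory.lt_eqF mk).
  have -> : p@_k = 0 by apply: mcoeff_gt_mlead; rewrite pm.
  by rewrite mulr0 subrr.
rewrite addn1; apply: clen_step => // [Am|a /= ->]; last by rewrite scale0r; apply: submod0 sA.
case/negP: nLM; apply/asboolP.
have [u Uu hu] : exists2 u, U u & forall k, ('X_[m] - u)@_k != 0 -> k \in s.
  have : A `<=` [set v | exists2 u, U u & forall k, (v - u)@_k != 0 -> k \in s].
    apply: adjoins_min => [|u Uu|_ /mapP [k ks ->]].
    - split; first by exists 0; [exact: submod0 sU|move=> k; rewrite subrr mcoeff0 eqxx].
      + move=> u1 u2 [v1 Uv1 h1] [v2 Uv2 h2]; exists (v1 + v2); first exact: (submodD sU).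
        move=> k; rewrite opprD addrACA mcoeffD => h.
        case: (eqVneq (u1 - v1)@_k 0) => [e|/h1 //]; apply: h2.
        by move: h; rewrite e add0r.
      + move=> b u1 _ [v1 Uv1 h1]; exists (b *: v1); first exact: (submodZ sU).
        move=> k; rewrite -scalerBr mcoeffZ => h; apply: h1.
        by apply: contra_neq h => ->; rewrite mulr0.
    - by exists u => // k; rewrite subrr mcoeff0 eqxx.
    - exists 0; first exact: submod0 sU.
      by move=> k'; rewrite subr0 mcoeffX; case: (k =P k') => [<-|_] //; rewrite eqxx.
  by apply.
have um : u@_m = 1.
  apply/eqP; rewrite eq_sym -subr_eq0; apply: contraT => h.
  have /ltm : m \in s by apply: hu; rewrite mcoeffB mcoeffX eqxx.
  by rewrite Order.POrderTheory.ltxx.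
have u0 : u != 0 by apply: contra_eq_neq um => ->; rewrite mcoeff0 eq_sym oner_neq0.
exists u => //; apply/eqP; rewrite Order.POrderTheory.eq_le; apply/andP; split; last first.
  by apply: msupp_le_mlead; rewrite mcoeff_msupp um oner_neq0.
rewrite Order.TotalTheory.leNgt; apply/negP => lt.
have /ltm : mlead u \in s.
  apply: hu; rewrite mcoeffB mcoeffX (Order.POrderTheory.lt_eqF lt) sub0r oppr_eq0 mleadc_eq0 //.
by move/(Order.POrderTheory.lt_trans lt); rewrite Order.POrderTheory.ltxx.
Qed.

(** Leading monomials are stable under multiplication by monomials, so the count of the remaining
    ones falls under [evpoly_count]. *)
Lemma hilbert_function (U : nat -> set W) :
  (forall t, is_submodule setT (U t)) -> (forall t, U t `<=` homset t) ->
  (forall t m p, U t p -> U (t + mdeg m)%N (p * 'X_[m])) ->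
  exists h, evpoly h /\ forall t, dimq (U t) (homset t) (h t).
Proof.
move=> sU Ut UX.
pose V : set 'X_{1..r} := [set m | exists2 p, U (mdeg m) p /\ p != 0 & mlead p = m].
have upV : upcl V.
  move=> m m' [p [Up p0] pm] mm'.
  have dm' : (mdeg m + mdeg (m' - m))%N = mdeg m' by rewrite -{2}(submK mm') mdegD addnC.
  exists (p * 'X_[m' - m]).
    by rewrite -dm'; split; [exact: UX|rewrite mulf_neq0 // mpolyX_neq0].
  by rewrite mleadM ?mpolyX_neq0 // mleadXm pm addmC submK.
eexists; split; first exact: evpoly_count upV.
move=> t; have := dim_homog_quot (sU t) (@Ut t); congr (dimq _ _).
apply: eq_in_count => m; rewrite mem_mons => /eqP dm; congr (~~ _).
by apply/asboolP/asboolP; rewrite /V /= dm.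
Qed.

(** By Dickson's lemma finitely many elements have leading monomials dividing all others. They
    generate: cancelling leading terms ends because the monomial order is well founded. *)
Lemma hilbert_basis (E : set W) : is_ideal setT E -> exists s : seq W,
  (forall p, p \in s -> E p) /\ forall p, E p -> lin (fun i : 'I_(size s) => s`_i) p.
Proof.
move=> iE; have [sm [smE cov]] := dickson [set m | exists2 p, E p /\ p != 0 & mlead p = m].
have [P HP] : exists P : 'X_{1..r} -> W, forall m, m \in sm -> [/\ E (P m), P m != 0 & mlead (P m) = m].
  have h (m : 'X_{1..r}) : exists p, m \in sm -> [/\ E p, p != 0 & mlead p = m].
    by case: (boolP (m \in sm)) => [/smE [p [? ?] ?]|_]; [exists p|exists 0].
  by have [P HP] := choice h; exists P.
exists [seq P m | m <- sm]; split=> [_ /mapP [m /HP [? _ _] ->] //|p].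
set L := lin _; have iL : is_ideal setT L := lin_ideal _.
have LP m : m \in sm -> L (P m).
  move=> ms; have ps : P m \in [seq P m | m <- sm] by apply: map_f.
  have := lin_gen (fun i : 'I_(size [seq P m | m <- sm]) => [seq P m | m <- sm]`_i).
  by move: ps; rewrite -index_mem => ps /(_ (Ordinal ps)); rewrite /= nth_index -?index_mem.
have [m em] : exists m, mlead p = m by exists (mlead p).
elim/(well_founded_ind (@ltom_wf r)): m p em => m IH p pm Ep.
case: (eqVneq p 0) => [->|p0]; first exact: ideal0.
have [|a as_ am] := cov m; first by exists p.
have [Ea a0 la] := HP _ as_.
pose u : W := (mleadc p / mleadc (P a)) *: (P a * 'X_[m - a]).
have Lu : L u.
  by rewrite /u -mul_mpolyC; apply: idealMl => //; rewrite mulrC; apply: idealMl => //; apply: LP.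
apply: (idealBr (v := u) iL) => //.
case: (eqVneq (p - u) 0) => [->|pu0]; first exact: ideal0.
have lu : mlead (P a * 'X_[m - a]) = m.
  by rewrite mleadM ?mpolyX_neq0 // mleadXm la addmC submK.
apply: (IH (mlead (p - u))) => //; last first.
  apply: idealB => //; rewrite /u -mul_mpolyC; apply: idealMl => //; rewrite mulrC.
  exact: idealMl.
rewrite Order.POrderTheory.lt_neqAle; apply/andP; split.
  apply/negP => /eqP e; have : mleadc (p - u) != 0 by rewrite mleadc_eq0.
  have pm' : p@_m = mleadc p by rewrite pm.
  have Pm : (P a * 'X_[m - a])@_m = mleadc (P a) by have := mcoeffMX (P a) (m - a) a; rewrite submK // la.
  by rewrite e mcoeffB mcoeffZ pm' Pm divfK ?subrr ?eqxx // mleadc_eq0.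
apply: Order.POrderTheory.le_trans (mleadB_le _ _) _.
rewrite Order.JoinTheory.leUx pm Order.POrderTheory.lexx /=.
by apply: Order.POrderTheory.le_trans (mleadZ_le _ _) _; rewrite lu.
Qed.

End HilbertFunction.

(** * Linear and algebraic dependence by counting monomials *)

Section Dependence.
Variable (k : fieldType).

(** A monomial of degree less than [b] has all its exponents less than [b], so there are at most
    [b ^ N] of them. *)
Lemma lin_dep N (I : finType) (p : I -> {mpoly k[N]}) b :
  (forall i, (msize (p i) <= b)%N) -> (b ^ N < #|I|)%N ->
  exists c : I -> k, (exists i, c i != 0) /\ \sum_i c i *: p i = 0.
Proof.
move=> pb cI.
have cardX : (#|{: 'X_{1..N < b}}| <= b ^ N)%N.
  rewrite -[b in (b ^ N)%N]card_ord -[N in (_ ^ N)%N]card_ord -card_ffun.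
  have ltb (m : 'X_{1..N < b}) (i : 'I_N) : (m i < b)%N.
    by apply: leq_ltn_trans (bmdeg m); rewrite mdegE (bigD1 i) //= leq_addr.
  apply: (leq_card (fun m : 'X_{1..N < b} => [ffun i => Ordinal (ltb m i)])).
  move=> m m' /ffunP e; apply/val_inj/mnmP => i.
  by have := e i; rewrite !ffunE => -[].
pose M : 'M[k]_(#|I|, #|{: 'X_{1..N < b}}|) :=
  \matrix_(i, j) (p (enum_val i))@_(enum_val j : 'X_{1..N < b}).
have : kermx M != 0.
  rewrite kermx_eq0 /row_free; apply: contraL cI => /eqP e; rewrite -leqNgt.
  by apply: leq_trans cardX; rewrite -e rank_leq_col.
case/rowV0Pn => v /sub_kermxP vM v0.
exists (fun i => v 0 (enum_rank i)); split.
  have /existsP [j vj] : [exists j, v 0 j != 0].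
    apply: contraNT v0 => /existsPn h; apply/eqP/rowP => j; rewrite mxE.
    by apply/eqP/negPn.
  by exists (enum_val j); rewrite enum_valK.
apply/mpolyP => m; rewrite mcoeff0 raddf_sum /=.
case: (ltnP (mdeg m) b) => mb; last first.
  rewrite big1 // => i _; rewrite mcoeffZ memN_msupp_eq0 ?mulr0 //.
  by apply/msize_mdeg_ge/(leq_trans (pb i)).
have := congr1 (fun A : 'M_(_, _) => A 0 (enum_rank (BMultinom mb))) vM.
rewrite !mxE => vM0; transitivity (\sum_j v 0 j * M j (enum_rank (BMultinom mb))); last exact: vM0.
rewrite (reindex_onto (@enum_val I predT) enum_rank) /=; last first.
  by move=> i _; rewrite enum_rankK.
apply: eq_big => [i|i _]; first by rewrite enum_valK eqxx.
by rewrite mcoeffZ enum_valK !mxE enum_rankK.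
Qed.

Lemma msize_expM N (p q : {mpoly k[N]}) a b :
  (msize p <= a.+1)%N -> (msize q <= b.+1)%N -> (msize (p * q) <= (a + b).+1)%N.
Proof.
move=> pa qb; case: (eqVneq p 0) => [->|p0]; first by rewrite mul0r msize0.
case: (eqVneq q 0) => [->|q0]; first by rewrite mulr0 msize0.
by rewrite msizeM //; have := leq_add pa qb; rewrite addnS; case: (_ + _)%N => // c; rewrite !ltnS.
Qed.

Lemma msize_mmap1 N n (phi : 'I_n -> {mpoly k[N]}) d (m : 'X_{1..n}) :
  (forall i, (msize (phi i) <= d.+1)%N) -> (msize (mmap1 phi m) <= (mdeg m * d).+1)%N.
Proof.
move=> pd; rewrite /mmap1 mdegE big_distrl /=.
apply: (big_ind2 (fun (p : {mpoly k[N]}) a => (msize p <= a.+1)%N)).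
- by rewrite msize1.
- by move=> *; apply: msize_expM.
move=> i _; elim: (m i) => [|j IH]; first by rewrite expr0 msize1.
by rewrite exprS mulSn; apply: msize_expM.
Qed.

Lemma alg_dep N (phi : 'I_N.+1 -> {mpoly k[N]}) :
  exists2 F : {mpoly k[N.+1]}, F != 0 & mmap (@mpolyC N k) phi F = 0.
Proof.
pose d := (\max_i msize (phi i))%N.
have pd i : (msize (phi i) <= d.+1)%N.
  by apply: leqW; apply: (@leq_bigmax _ (fun i => msize (phi i))).
(* The [t ^ N.+1] monomials with exponents less than [t] take values of size at most [t * B], hence
   in a space of dimension at most [t ^ N * B ^ N]; this [t] makes the former number larger. *)
pose B := (N.+1 * d).+1; pose t := (B ^ N).+1.
pose mn (a : {ffun 'I_N.+1 -> 'I_t}) : 'X_{1..N.+1} := [multinom (a i : nat) | i < N.+1].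
have mn_inj : injective mn.
  move=> a b /mnmP e; apply/ffunP => i; apply/val_inj.
  by have := e i; rewrite !mnmE.
have [||c [[a ca] cE]] := @lin_dep N _ (fun a => mmap1 phi (mn a)) (t * B)%N.
- move=> a; apply: leq_trans (msize_mmap1 _ pd) _.
  have : (mdeg (mn a) <= N.+1 * t)%N.
    rewrite mdegE -[X in (_ <= X * _)%N](card_ord N.+1) -sum_nat_const.
    by apply: leq_sum => i _; rewrite mnmE ltnW.
  move=> h; have : (mdeg (mn a) * d <= N.+1 * t * d)%N by rewrite leq_mul2r h orbT.
  rewrite /B; have : (0 < t)%N by []. nia.
- rewrite card_ffun !card_ord expnMn expnSr ltn_pmul2l ?expn_gt0 //.
exists (\sum_a c a *: 'X_[mn a]).
  apply: contra_neq ca => /(congr1 (mcoeff (mn a))); rewrite raddf_sum mcoeff0 /=.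
  rewrite (bigD1 a) //= mcoeffZ mcoeffX eqxx mulr1 big1 ?addr0 // => b ba.
  by rewrite mcoeffZ mcoeffX (inj_eq mn_inj) (negbTE ba) mulr0.
rewrite raddf_sum -[RHS]cE; apply: eq_bigr => b _ /=.
by rewrite mmapZ mmapX mul_mpolyC.
Qed.

End Dependence.

(** * Leading terms of Samuel functions *)

Section Asymptotics.
Import Order.TTheory Num.Theory.
Implicit Types p q : {poly rat}.

Lemma pdiff_coef q i : (size q <= i.+2)%N -> (pdiff q)`_i = i.+1%:R * q`_i.+1.
Proof.
move=> sq; pose q' := q - q`_i.+1 *: 'X^(i.+1).
have sq' : (size q' <= i.+1)%N.
  apply/leq_sizeP => j ij; rewrite coefB coefZ coefXn.
  case: (eqVneq j i.+1) => [->|ne]; first by rewrite mulr1 subrr.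
  by rewrite mulr0 subr0 nth_default // (leq_trans sq) // ltn_neqAle eq_sym ne.
rewrite -{1}(subrK (q`_i.+1 *: 'X^(i.+1)) q) -/q' pdiffD pdiffZ coefD coefZ.
rewrite nth_default ?add0r; last by apply: leq_trans (pdiff_size _) _; lia.
rewrite mulrC; congr (_ * _).
rewrite -(subrK (i.+1%:R *: 'X^i) (pdiff _)) coefD nth_default ?pdiffXn // add0r.
by rewrite coefZ coefXn eqxx mulr1.
Qed.

Lemma poly_pos_large q : 0 < lead_coef q -> exists2 c, 0 < c &
  exists t0, forall t, (t0 <= t)%N -> c <= q.[t%:R].
Proof.
have [k] := ubnP (size q); elim: k q => // k IH q qk lq.
have q0 : q != 0 by rewrite -lead_coef_eq0 gt_eqF.
have sq : (0 < size q)%N by rewrite size_poly_gt0.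
case E : (size q) => [|[|s]]; first by rewrite E in sq.
  exists (lead_coef q) => //; exists 0%N => t _.
  have /size1_polyC e : (size q <= 1)%N by rewrite E.
  by rewrite lead_coefE E [in leRHS]e hornerC.
have c1 : (pdiff q)`_s = s.+1%:R * lead_coef q by rewrite pdiff_coef ?E // lead_coefE E.
have c1pos : 0 < (pdiff q)`_s by rewrite c1 mulr_gt0 // ltr0Sn.
have sd : size (pdiff q) = s.+1.
  apply/eqP; rewrite eqn_leq; apply/andP; split; first by have := pdiff_size q; rewrite E.
  by rewrite ltnNge; apply/negP => /leq_sizeP /(_ s (leqnn _)) e; rewrite e ltxx in c1pos.
have [||c c0 [t0 h]] := IH (pdiff q); first by rewrite sd; move: qk; rewrite E; lia.
  by rewrite lead_coefE sd.
exists 1 => //; have [M hM] : exists M : nat, (1 - q.[t0%:R]) / c <= M%:R.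
  exists (Num.truncn ((1 - q.[t0%:R]) / c)).+1.
  case: (ltP ((1 - q.[t0%:R]) / c) 0) => h1; first exact: le_trans (ltW h1) (ler0n _ _).
  by apply/ltW; rewrite Num.Theory.truncnS_gt.
exists (t0 + M)%N => t tM.
have step j : q.[t0%:R] + j%:R * c <= q.[(t0 + j)%:R].
  elim: j => [|j IHj]; first by rewrite mul0r addr0 addn0.
  have := h (t0 + j)%N (leq_addr _ _); rewrite pdiff_horner natr1 -addnS => hj.
  rewrite -natr1 mulrDl mul1r addrA; apply: le_trans (lerD IHj hj) _.
  by rewrite addrC subrK.
rewrite -(subnKC (leq_trans (leq_addr _ _) tM)); apply: le_trans (step _).
rewrite -lerBlDl -ler_pdivrMr //; apply: le_trans hM _; rewrite ler_nat; lia.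
Qed.

Lemma poly_squeeze (e u l : {poly rat}) N t0 : (size u <= N)%N -> (size l <= N)%N ->
  (forall t, (t0 <= t)%N -> l.[t%:R] <= e.[t%:R] <= u.[t%:R]) -> (size e <= N)%N.
Proof.
move=> su sl h; rewrite leqNgt; apply/negP => Ne.
have e0 : e != 0 by rewrite -size_poly_gt0; lia.
have key (w : {poly rat}) s : (size w <= N)%N -> 0 < s * lead_coef e -> s != 0 ->
    exists t, (t0 <= t)%N /\ 0 < (s *: (e - w)).[t%:R].
  move=> sw pos s0; have lw : lead_coef (s *: (e - w)) = s * lead_coef e.
    by rewrite lead_coefZ lead_coefDl // size_polyN; apply: leq_ltn_trans sw Ne.
  have [|c c0 [t1 ht]] := @poly_pos_large (s *: (e - w)); first by rewrite lw.
  exists (maxn t0 t1); split; first by rewrite leq_max leqnn.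
  by apply: lt_le_trans c0 (ht _ _); rewrite leq_max leqnn orbT.
case: (ltgtP 0 (lead_coef e)) => le; last by move/eqP: le; rewrite eq_sym lead_coef_eq0 (negbTE e0).
  have [||t [tt]] := key u 1 su; rewrite ?mul1r ?oner_eq0 //.
  by rewrite scale1r hornerD hornerN subr_gt0 ltNge; case/andP: (h t tt) => _ ->.
have [||t [tt]] := key l (-1) sl; rewrite ?mulN1r ?oppr_gt0 ?oppr_eq0 ?oner_eq0 //.
rewrite scaleN1r hornerN hornerD hornerN opprB subr_gt0 ltNge.
by case/andP: (h t tt) => ->.
Qed.

Definition nmon N t := size (mons N t).

Lemma nmonS N t : nmon N.+1 t = (\sum_(i < t.+1) nmon N i)%N.
Proof.
rewrite /nmon -(count_predT (mons N.+1 t)) count_mons (reindex_inj rev_ord_inj) /=.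
by apply: eq_bigr => i _; rewrite count_predT subSS subKn // -ltnS.
Qed.

Lemma nmon0 t : nmon 0 t = (t == 0%N).
Proof.
rewrite /nmon; case: (eqVneq t 0%N) => [->|t0].
  have : perm_eq (mons 0 0) [:: 0%MM].
    apply: uniq_perm; rewrite ?mons_uniq // => m.
    by rewrite mem_mons inE mdeg_eq0.
  by move/perm_size.
case E : (mons 0 t) => [//|m s]; have : m \in mons 0 t by rewrite E mem_head.
by rewrite mem_mons mdegE big_ord0 eq_sym (negbTE t0).
Qed.

(** [b] is the binomial coefficient of [t + N] over [N], obtained by summing the previous one. *)
Lemma nmon_poly N : exists b : {poly rat},
  [/\ size b = N.+1, lead_coef b = 1 / N`!%:R & forall t, (nmon N.+1 t)%:R = b.[t%:R]].
Proof.
elim: N => [|N [b [sb lb hb]]].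
  exists 1; rewrite size_poly1 lead_coef1 fact0 divr1; split=> // t.
  rewrite hornerC nmonS big_ord_recl nmon0 big1 // => i _.
  by rewrite nmon0.
have [q eq sq] := pdiff_surj b.
have cq : q`_N.+1 = 1 / N.+1`!%:R.
  have := pdiff_coef (q := q) (i := N); rewrite eq => /(_ (leq_trans sq _)).
  rewrite sb => /(_ (leqnn _)) e.
  have : b`_N = 1 / N`!%:R by rewrite -lb lead_coefE sb.
  rewrite e factS natrM => /(congr1 (fun x => N.+1%:R^-1 * x)).
  rewrite mulKf ?pnatr_eq0 // => ->.
  by rewrite mulrCA -invfM.
have sq2 : size (q \Po ('X + 1%:P) - q.[0]%:P) = N.+2.
  have s1 : size (q \Po ('X + 1%:P)) = size q by rewrite size_comp_poly2 // size_XaddC.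
  have s2 : size q = N.+2.
    apply/eqP; rewrite eqn_leq -{1}sb sq /= ltnNge; apply/negP => /leq_sizeP /(_ _ (leqnn _)).
    by rewrite cq => /eqP; rewrite div1r invr_eq0 pnatr_eq0 eqn0Ngt fact_gt0.
  by rewrite size_polyDl s1 s2 // size_polyN (leq_ltn_trans (size_polyC_leq1 _)).
exists (q \Po ('X + 1%:P) - q.[0]%:P); split=> //.
  have e : q \Po ('X + 1%:P) - q.[0]%:P = b + q - q.[0]%:P by rewrite -eq /pdiff subrK.
  rewrite lead_coefE sq2 e /= coefB coefD coefC subr0 nth_default ?sb // add0r.
  exact: cq.
move=> t; rewrite hornerD hornerN hornerC horner_comp hornerD hornerX hornerC natr1.
elim: t => [|t IH]; rewrite nmonS.
  by rewrite big_ord_recl big_ord0 addn0 hb -eq pdiff_horner add0r.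
by rewrite big_ord_recr /= natrD -nmonS IH hb -eq pdiff_horner natr1; ring.
Qed.

(** A shift by [r] alters a polynomial of degree [N.+1] only in degrees at most [N]. The two bounds
    thus give the sums of [h] the same leading term as [D] times the sums of [nmon]; taking
    differences yields the leading term of [h]. *)
Lemma multiplicity_asymptotics N (h : nat -> nat) D r : evpoly h ->
  (forall t, \sum_(s < t) h s <= D * \sum_(s < t) nmon N.+1 s)%N ->
  (forall t, D * \sum_(s < t) nmon N.+1 s <= \sum_(s < t + r) h s)%N -> (0 < D)%N ->
  exists p : {poly rat}, exists t0, [/\ forall t, (t0 <= t)%N -> (h t)%:R = p.[t%:R],
    size p = N.+1 & lead_coef p = D%:R / N`!%:R].
Proof.
move=> [p [t0 hp]] up lo D0; have [b [sb lb hb]] := nmon_poly N.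
have [q eq _] := pdiff_surj p; have [B eB sB] := pdiff_surj (D%:R *: b).
have HB t : (D * \sum_(s < t) nmon N.+1 s)%:R = B.[t%:R] - B.[0].
  elim: t => [|t IH]; first by rewrite big_ord0 muln0 subrr.
  rewrite big_ord_recr /= mulnDr natrD IH natrM hb.
  have : (pdiff B).[t%:R] = D%:R * b.[t%:R] by rewrite eB hornerZ.
  by rewrite pdiff_horner natr1 => <-; ring.
pose c := (\sum_(s < t0) h s)%:R - q.[t0%:R].
have HS t : (t0 <= t)%N -> (\sum_(s < t) h s)%:R = q.[t%:R] + c.
  move=> tt; rewrite -(subnK tt); elim: (t - t0)%N => [|j IH]; first by rewrite add0n /c; ring.
  rewrite addSn big_ord_recr /= natrD IH hp; last lia.
  by rewrite -eq pdiff_horner natr1; ring.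
(* For large arguments [e] is the sum of the values of [h] minus [D] times that of [nmon]; it is
   squeezed between [l] and zero. *)
clearbody c; pose e := q + c%:P - (B - B.[0]%:P).
pose l := (B \Po ('X - r%:R%:P)) - B.
have sBN : (size B <= N.+2)%N.
  by apply: leq_trans sB _; rewrite size_scale ?sb // pnatr_eq0 -lt0n.
have sl : (size l <= N.+1)%N.
  have -> : l = - ((B \Po ('X - r%:R%:P)) \Po ('X + r%:R%:P) - (B \Po ('X - r%:R%:P))).
    rewrite /l -comp_polyA comp_polyB comp_polyX comp_polyC addrK comp_polyXr opprB //.
  rewrite size_polyN; set B' := B \Po _.
  have sB' : (size B' <= N.+2)%N by rewrite /B' size_comp_poly2 // size_XsubC.
  clearbody B'; elim: (r) => [|j IHj].
    by rewrite addr0 comp_polyXr subrr size_poly0.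
  have -> : B' \Po ('X + j.+1%:R%:P) - B' =
     (pdiff B') \Po ('X + j%:R%:P) + (B' \Po ('X + j%:R%:P) - B').
    rewrite /pdiff comp_polyB -comp_polyA comp_polyD comp_polyX comp_polyC.
    by rewrite -natr1 polyCD addrA [RHS]addrA subrK.
  apply: leq_trans (size_polyD _ _) _; rewrite geq_max IHj andbT size_comp_poly2 ?size_XaddC //.
  by apply: leq_trans (pdiff_size _) _; lia.
have se : (size e <= N.+1)%N.
  apply: (@poly_squeeze e 0 l _ (t0 + r)); rewrite ?size_poly0 // => t tt.
  apply/andP; split.
    have := lo (t - r)%N; rewrite subnK; last lia.
    rewrite -(ler_nat rat) HB HS; last lia.
    rewrite /e /l !hornerE horner_comp !hornerE natrB; last lia.
    by move=> hh; lra.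
  have := up t; rewrite -(ler_nat rat) HB HS; last lia.
  by rewrite /e !hornerE => hh; lra.
have ep : pdiff e = p - D%:R *: b.
  have -> : e = q + (c + B.[0])%:P + (-1) *: B by rewrite /e polyCD scaleN1r; ring.
  by rewrite !pdiffD pdiffZ eq eB {1}/pdiff comp_polyC subrr addr0 scaleN1r.
have sp : (size (p - D%:R *: b)%R <= N)%N.
  by rewrite -ep; apply: leq_trans (pdiff_size _) _; lia.
have D0' : D%:R != 0 :> rat by rewrite pnatr_eq0 -lt0n.
exists p, t0; rewrite -(subrK (D%:R *: b) p); split; rewrite ?subrK //.
  by rewrite -{1}(subrK (D%:R *: b) p) addrC size_polyDl size_scale // sb ltnS.
rewrite -{1}(subrK (D%:R *: b) p) addrC lead_coefDl; last by rewrite size_scale // sb ltnS.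
by rewrite lead_coefZ lb mul1r.
Qed.

End Asymptotics.

(** * The local theorem *)

Local Notation "x %:F" := (tofrac x).

Lemma idealZ (R : comNzRingType) n (E : set {mpoly R[n]}) c u :
  is_ideal setT E -> E u -> E (c *: u).
Proof. by rewrite -mul_mpolyC; exact: idealMl. Qed.

Lemma fracP (R : idomainType) (z : {fraction R}) : exists a b : R, b != 0 /\ z = a%:F / b%:F.
Proof.
elim/quotW: z => r; exists \n_r, \d_r; have d0 := denom_ratioP r; split=> //.
have d0F : (\d_r)%:F != 0 :> {fraction R} by rewrite tofrac_eq0.
apply: (mulIf d0F); rewrite divfK //.
rewrite /GRing.mul /=; unlock tofrac; rewrite !piE /=.
apply/eqmodP => /=; rewrite /equivf /FracField.equivf /= /FracField.mulf !numden_Ratio ?mulf_neq0 ?oner_eq0 //.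
by rewrite !mulr1 mulrC.
Qed.

Lemma common_denom (R : idomainType) (T : finType) (c : T -> {fraction R}) :
  exists b (a : T -> R), b != 0 /\ forall i, (a i)%:F = b%:F * c i.
Proof.
have [ab Hab] : exists ab : T -> R * R, forall i, (ab i).2 != 0 /\ c i = (ab i).1%:F / (ab i).2%:F.
  have h i : exists ab : R * R, ab.2 != 0 /\ c i = ab.1%:F / ab.2%:F.
    by have [a [b [b0 e]]] := fracP (c i); exists (a, b).
  by have [ab Hab] := choice h; exists ab.
exists (\prod_i (ab i).2), (fun i => (ab i).1 * \prod_(j | j != i) (ab j).2).
split=> [|i]; first by apply/prodf_neq0 => i _; have [] := Hab i.
have [b0 ->] := Hab i; have -> : \prod_j (ab j).2 = (ab i).2 * \prod_(j | j != i) (ab j).2.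
  by rewrite (bigD1 i).
have aux (F : fieldType) (x y z : F) : y != 0 -> x * z = y * z * (x / y).
  by move=> y0; field.
by rewrite !rmorphM /=; apply: aux; rewrite tofrac_eq0.
Qed.

(** * Extension of scalars from [k] to rational functions in the parameters *)

Section BaseChange.
Variables (k : fieldType) (n N : nat).
Local Notation T := {mpoly k[n]}.
Local Notation K := {fraction T}.
Local Notation W := {mpoly k[N]}.
Local Notation WT := {mpoly T[N]}.
Local Notation WK := {mpoly K[N]}.

Definition cst : k -> K := @tofrac T \o @mpolyC n k.
HB.instance Definition _ := GRing.RMorphism.on cst.
Definition frac_ext : W -> WK := map_mpoly cst.
HB.instance Definition _ := GRing.RMorphism.on frac_ext.
Definition tf : WT -> WK := map_mpoly (@tofrac T).
HB.instance Definition _ := GRing.RMorphism.on tf.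
Definition poly_ext : W -> WT := map_mpoly (@mpolyC n k).
HB.instance Definition _ := GRing.RMorphism.on poly_ext.
(** The coefficient of the parameter monomial [al], polynomials over [T] being read as polynomials
    in the parameters over [W]. *)
Definition cf (al : 'X_{1..n}) : WT -> W := map_mpoly (mcoeff al).
HB.instance Definition _ al := GRing.Additive.on (cf al).

Lemma cst_eq0 c : (cst c == 0) = (c == 0).
Proof. by rewrite /cst /= tofrac_eq0 mpolyC_eq0. Qed.

Lemma mcoeff_cb p m : (frac_ext p)@_m = cst p@_m. Proof. exact: mcoeff_map_mpoly. Qed.
Lemma mcoeff_tf w m : (tf w)@_m = (w@_m)%:F. Proof. exact: mcoeff_map_mpoly. Qed.
Lemma mcoeff_up p m : (poly_ext p)@_m = (p@_m)%:MP. Proof. exact: mcoeff_map_mpoly. Qed.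
Lemma mcoeff_cf al w m : (cf al w)@_m = (w@_m)@_al. Proof. exact: mcoeff_map_mpoly. Qed.

Lemma cbX m : frac_ext 'X_[m] = 'X_[m]. Proof. exact: map_mpolyX. Qed.
Lemma tfX m : tf 'X_[m] = 'X_[m]. Proof. exact: map_mpolyX. Qed.
Lemma upX m : poly_ext 'X_[m] = 'X_[m]. Proof. exact: map_mpolyX. Qed.
Lemma tfZ c w : tf (c *: w) = c%:F *: tf w. Proof. exact: map_mpolyZ. Qed.
Lemma cbZ c w : frac_ext (c *: w) = cst c *: frac_ext w. Proof. exact: map_mpolyZ. Qed.
#[local] Opaque frac_ext tf poly_ext cf.

Lemma tf_up p : tf (poly_ext p) = frac_ext p.
Proof.
apply/mpolyP => m; apply: etrans (mcoeff_tf (poly_ext p) m) _.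
exact: etrans (congr1 _ (mcoeff_up p m)) (esym (mcoeff_cb p m)).
Qed.

Lemma tf_inj : injective tf.
Proof.
apply: raddf_inj => w e; apply/mpolyP => m; have := congr1 (mcoeff m) e.
by rewrite mcoeff_tf !mcoeff0 => /eqP; rewrite tofrac_eq0 => /eqP.
Qed.

Lemma cf_up al p w : cf al (poly_ext p * w) = p * cf al w.
Proof.
apply/mpolyP => m; rewrite mcoeff_cf !mcoeffM raddf_sum; apply: eq_bigr => -[i j] _ /=.
by rewrite mcoeff_up mcoeff_cf mul_mpolyC mcoeffZ.
Qed.

Lemma clear_denom (u : WK) : exists b w, b != 0 /\ tf w = b%:F *: u.
Proof.
have [b [a [b0 E]]] := common_denom (fun m : 'X_{1..N < msize u} => u@_m).
exists b, (\sum_(m : 'X_{1..N < msize u}) a m *: 'X_[m]); split=> //.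
transitivity (b%:F *: \sum_(m : 'X_{1..N < msize u}) u@_m *: 'X_[m]); last by rewrite -mpolywE.
rewrite scaler_sumr raddf_sum; apply: eq_bigr => m _ /=.
by rewrite tfZ E scalerA tfX.
Qed.

(** The extension of the ideal [E] to the polynomials over [T]. *)
Definition coefs_in (E : set W) : set WT := [set w | forall al, E (cf al w)].

Lemma coefs_in_ideal E : is_ideal setT E -> is_ideal setT (coefs_in E).
Proof.
move=> iE; have D u v : coefs_in E u -> coefs_in E v -> coefs_in E (u + v).
  by move=> hu hv al; rewrite /= raddfD; apply: (idealD iE); [apply: hu|apply: hv].
apply/idealP; split=> // [al|a v hv]; first by rewrite raddf0; apply: ideal0.
have S (c : T) w : coefs_in E w -> coefs_in E (c *: w).
  move=> hw al.
  have -> : cf al (c *: w) = \sum_(x : 'X_{1..n < (mdeg al).+1, (mdeg al).+1} | al == (x.1 + x.2)%MM)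
      c@_(x.1) *: cf x.2 w.
    apply/mpolyP => m; rewrite mcoeff_cf mcoeffZ mcoeffM raddf_sum; apply: eq_bigr => x _ /=.
    by rewrite mcoeffZ mcoeff_cf.
  by apply: ideal_sum => // x _; rewrite -mul_mpolyC; apply: idealMl.
rewrite [a]mpolyE mulr_suml; apply: (big_ind (coefs_in E)) => // [al|m _].
  by rewrite raddf0; apply: ideal0.
rewrite -scalerAl; apply: S => al.
have -> : 'X_[m] = poly_ext 'X_[m] by rewrite upX.
by rewrite cf_up; apply: idealMl.
Qed.

(* The ideal of [WK] generated by the ideal [E] of [W]. *)
Definition extI (E : set W) : set WK :=
  [set u | exists b w, [/\ b != 0, tf w = b%:F *: u & coefs_in E w]].

Lemma extI_ideal E : is_ideal setT E -> is_ideal setT (extI E).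
Proof.
move=> iE; have iS := coefs_in_ideal iE; apply/idealP; split.
- exists 1, 0; rewrite raddf0 scaler0 oner_neq0; split=> //; exact: ideal0.
- move=> u v [b [w [b0 e hw]]] [b' [w' [b0' e' hw']]].
  exists (b * b'), (b' *: w + b *: w'); split; first by rewrite mulf_neq0.
    by rewrite raddfD /= !tfZ e e' tofracM scalerDr !scalerA [b'%:F * _]mulrC.
  by apply: (idealD iS); rewrite -mul_mpolyC; apply: (idealMl _ iS).
move=> a v [b [w [b0 e hw]]]; have [b' [a' [b0' e']]] := clear_denom a.
exists (b' * b), (a' * w); split; first by rewrite mulf_neq0.
  by rewrite rmorphM /= e e' -scalerAl -scalerAr scalerA tofracM.
exact: idealMl _ iS hw.
Qed.

Lemma coefs_in_up E p : is_ideal setT E -> E p -> coefs_in E (poly_ext p).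
Proof.
move=> iE Ep al; rewrite -[poly_ext p]mulr1 cf_up; exact: idealMr.
Qed.

Lemma extI_cb E p : is_ideal setT E -> E p -> extI E (frac_ext p).
Proof.
move=> iE Ep; exists 1, (poly_ext p); rewrite oner_neq0 tofrac1 scale1r tf_up; split=> //.
exact: coefs_in_up.
Qed.

Lemma tf_decomp w : exists s : seq 'X_{1..n}, forall s', uniq s' -> {subset s <= s'} ->
  tf w = \sum_(al <- s') ('X_[al])%:F *: frac_ext (cf al w).
Proof.
exists (flatten [seq msupp w@_m | m <- msupp w]) => s us ss.
apply/mpolyP => m; rewrite mcoeff_tf raddf_sum /=.
under eq_bigr do rewrite mcoeffZ mcoeff_cb mcoeff_cf.
have sub : {subset msupp w@_m <= s}.
  move=> al alm; apply: ss; apply/flatten_mapP; exists m => //.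
  by rewrite mcoeff_msupp; apply: contraTneq alm => ->; rewrite msupp0.
rewrite {1}[w@_m]mpolyE raddf_sum /=.
rewrite -(big_msupp_sub (G := fun c al => (c *: 'X_[al])%:F) us sub); last first.
  by move=> al; rewrite scale0r tofrac0.
by apply: eq_bigr => al _; rewrite -mul_mpolyC tofracM mulrC.
Qed.

Lemma tf_decomp_fam (I : finType) (w : I -> WT) : exists s : seq 'X_{1..n}, forall i,
  tf (w i) = \sum_(al <- s) ('X_[al])%:F *: frac_ext (cf al (w i)).
Proof.
have [s Hs] := choice (fun i => tf_decomp (w i)).
exists (undup (flatten [seq s i | i <- enum I])) => i; apply: Hs; first exact: undup_uniq.
move=> al ali; rewrite mem_undup; apply/flatten_mapP; exists i => //.
by rewrite mem_enum.
Qed.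

Lemma extI_min E E' : is_ideal setT E' -> (forall p, E p -> E' (frac_ext p)) -> extI E `<=` E'.
Proof.
move=> iE' h u [b [w [b0 e hw]]].
have : E' (tf w).
  have [s /(_ tt) ->] := tf_decomp_fam (fun _ : unit => w);
  apply: ideal_sum => // al _.
  by rewrite -mul_mpolyC; apply: idealMl => //; apply: h.
rewrite e -mul_mpolyC => /(idealMl (b%:F)^-1%:MP iE').
by rewrite mulrA -mpolyCM mulVf ?tofrac_eq0 // mul1r.
Qed.

Lemma extI_mono E E' : E `<=` E' -> extI E `<=` extI E'.
Proof. by move=> EE u [b [w [? ? hw]]]; exists b, w; split=> // al; apply/EE/hw. Qed.

Lemma extI_idealX (r : nat) (phi : 'I_r -> W) t :
  extI (idealX setT (lin phi) t) = idealX setT (lin (frac_ext \o phi)) t.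
Proof.
apply/seteqP; split.
  apply: extI_min; first exact: idealX_ideal.
  move=> _ /idealX_linP [a ha ->]; apply/idealX_linP; exists (map_mpoly frac_ext a).
    apply/dhomogP => m; rewrite mcoeff_msupp mcoeff_map_mpoly => am.
    apply: (dhomogP _ _ _ ha); rewrite mcoeff_msupp; apply: contra_neq am => ->.
    exact: raddf0.
  rewrite !meval_msupp raddf_sum /=.
  rewrite -(big_msupp_sub (G := fun c m => c * mmap1 (frac_ext \o phi) m) (msupp_uniq a)); first last.
  - by move=> m; rewrite mul0r.
  - move=> m; rewrite !mcoeff_msupp mcoeff_map_mpoly; apply: contra_neq => ->.
    exact: raddf0.
  apply: eq_bigr => m _; rewrite rmorphM /= mcoeff_map_mpoly; congr (_ * _).
  by rewrite /mmap1 rmorph_prod; apply: eq_bigr => i _; rewrite rmorphXn.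
elim: t => [|t IH]; first by move=> u _; have [b [w [b0 e]]] := clear_denom u; exists b, w.
rewrite idealXS; apply: idealM_min; first exact/extI_ideal/idealX_ideal.
move=> _ v [c ->] /IH [b [w [b0 e hw]]].
rewrite mulr_suml; apply: ideal_sum => [|i _]; first exact/extI_ideal/idealX_ideal.
rewrite -mulrA; apply: idealMl; first exact/extI_ideal/idealX_ideal.
exists b, (poly_ext (phi i) * w); split=> // [|al].
  by rewrite rmorphM /= tf_up e scalerAr.
by rewrite cf_up idealXS; apply: idealM_mem; [exact: lin_gen|exact: hw].
Qed.

Lemma extI_mpow E c : is_ideal setT E -> mpow c `<=` E -> mpow c `<=` extI E.
Proof.
move=> iE mE; apply: mpow_mon => [|m mc]; first exact: extI_ideal.
have -> : 'X_[m] = frac_ext 'X_[m] by rewrite cbX.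
apply: extI_cb => //; apply: mE => l lc; rewrite mcoeffX.
by case: eqP lc => // <-; rewrite mc ltnn.
Qed.

(** The extension of [loc E] contains a power of the ideal of the origin, so by [loc_id] it is
    already local. *)
Lemma extI_loc E c : is_ideal setT E -> mpow c `<=` loc E -> extI (loc E) = loc (extI E).
Proof.
move=> iE mE; have iL := loc_ideal iE; apply/seteqP; split.
  apply: extI_min; first exact/loc_ideal/extI_ideal.
  move=> p [s s0 Esp]; exists (frac_ext s); first by rewrite mcoeff_cb cst_eq0.
  by rewrite -rmorphM; apply: extI_cb.
rewrite -(loc_id (extI_ideal iL) (extI_mpow iL mE)).
by apply: loc_mono; apply: extI_mono; apply: loc_sub.
Qed.

(** A basis of [W / P] over [k] stays one over [K]: once denominators are cleared, a relation splits
    into one relation over [k] for each parameter monomial. *)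
Lemma dim_extI P d : is_ideal setT P ->
  @clen k W setT [set 0] P setT d -> @clen K WK setT [set 0] (extI P) setT d.
Proof.
move=> iP; have iX := extI_ideal iP.
case/(dimqP _ _ (ideal_submod iP)) => v [gen ind].
apply/(dimqP _ _ (ideal_submod iX)); exists (fun i => frac_ext (v i)); split=> [u|c].
  split=> // _; rewrite [u]mpolyE.
  apply: (big_ind (fun u => exists c : 'I_d -> K, extI P (u - \sum_i c i *: frac_ext (v i)))).
  - by exists (fun=> 0); rewrite big1 ?subr0 => [|i _]; [exact: ideal0|rewrite scale0r].
  - move=> x y [c hx] [c' hy]; exists (fun i => c i + c' i).
    under eq_bigr do rewrite scalerDl; rewrite big_split opprD addrACA; exact: idealD.
  move=> m _; have [+ _] := gen 'X_[m] => /(_ I) [c hc].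
  exists (fun i => u@_m * cst (c i)).
  under eq_bigr do rewrite -scalerA; rewrite -scaler_sumr -scalerBr -mul_mpolyC.
  apply: idealMl => //; have := extI_cb iP hc; congr (extI P _).
  rewrite [LHS]raddfB /= cbX; apply: (congr1 (fun x => _ - x)).
  by rewrite raddf_sum; apply: eq_bigr => i _; apply: cbZ.
case=> b [w [b0 e hw]] i0.
have [b' [a [b0' ea]]] := common_denom c.
have ew : b' *: w = \sum_i (b * a i) *: poly_ext (v i).
  apply: tf_inj; rewrite tfZ e [RHS]raddf_sum /= !scaler_sumr.
  apply: eq_bigr => i _; rewrite tfZ tf_up !scalerA tofracM ea; congr (_ *: _); ring.
have hbw : coefs_in P (b' *: w) by rewrite -mul_mpolyC; exact: idealMl _ (coefs_in_ideal iP) hw.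
have a0 : b * a i0 = 0.
  apply/mpolyP => al; rewrite mcoeff0; apply: (ind (fun i => (b * a i)@_al)).
  have := hbw al; rewrite ew raddf_sum; congr (P _); apply: eq_bigr => i _ /=.
  apply/mpolyP => m; rewrite mcoeff_cf !mcoeffZ mcoeff_up [_ * (_)%:MP]mulrC mul_mpolyC mcoeffZ.
  by rewrite mulrC.
have : b'%:F * c i0 = 0.
  by rewrite -ea; move/eqP: a0; rewrite mulf_eq0 (negbTE b0) /= => /eqP ->; rewrite tofrac0.
by move/eqP; rewrite mulf_eq0 tofrac_eq0 (negbTE b0') /= => /eqP.
Qed.

End BaseChange.

(** * Colengths of the powers of a quasi-regular ideal *)

Section QuasiRegularDimension.
Variables (F : fieldType) (N : nat).
Local Notation W := {mpoly F[N]}.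
Local Notation ideal := (@is_ideal W setT).
Local Notation dimq := (@clen F W setT [set 0]).
Let Fl := field_local F.

Lemma loc_setT : loc (@setT W) = setT.
Proof. by apply/seteqP; split=> // u _; apply: loc_sub. Qed.

Lemma mpow_locX (E : set W) c t : mpow c `<=` loc E -> mpow (c * t) `<=` loc (idealX setT E t).
Proof.
move=> mE; apply: subset_trans (@locX _ _ _ _).
exact: subset_trans (@mpow_idealX _ _ _ _) (idealX_mono mE).
Qed.

Lemma loc_inv_mod (E E' : set W) c : ideal E -> mpow c `<=` loc E ->
  loc E' `<=` [set u | exists2 v, E' v & exists w, loc E (u - w * v)].
Proof.
move=> iE mE u [s s0 Esu]; have [s' hs'] := inv_mod c s0.
exists (s * u) => //; exists s'.
have -> : u - s' * (s * u) = (1 - s' * s) * u by rewrite mulrBl mul1r mulrA.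
by apply: (idealMr _ (loc_ideal iE)); apply: mE.
Qed.

(** The quotient of consecutive powers is free over [W / I] on the monomials of degree [t] in the
    [h i]. These are adjoined one by one; quasi-regularity makes each step contribute a full copy of
    [W / I]. *)
Lemma dim_quasiregular (h : 'I_N -> W) c D t :
  (forall (a : {mpoly W[N]}), a \is t.-homog ->
        idealX setT (lin h) t.+1 a.@[h] -> forall al, lin h a@_al) ->
  mpow c `<=` loc (lin h) -> dimq (loc (lin h)) setT D ->
  dimq (loc (idealX setT (lin h) t.+1)) (loc (idealX setT (lin h) t)) (nmon N t * D)%N.
Proof.
move=> qr mh cD; set I := lin h; have iI : ideal I := lin_ideal _.
set E := loc (idealX setT I t.+1).
have iE : ideal E by apply: loc_ideal; apply: idealX_ideal.
pose S (s : seq 'X_{1..N}) : set W :=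
  [set u | exists w : 'X_{1..N} -> W, E (u - \sum_(al <- s) w al * mmap1 h al)].
have iS s : ideal (S s).
  apply/idealP; split.
  - by exists (fun=> 0); rewrite big1 ?subr0 => [|al _]; [exact: (ideal0 iE)|rewrite mul0r].
  - move=> u v [w hw] [w' hw']; exists (fun al => w al + w' al).
    under eq_bigr do rewrite mulrDl; rewrite big_split opprD addrACA; exact: (idealD iE).
  move=> a u [w hw]; exists (fun al => a * w al).
  under eq_bigr do rewrite -mulrA; rewrite -mulr_sumr -mulrBr; exact: (idealMl _ iE).
have hX al : mdeg al = t -> idealX setT I t (mmap1 h al).
  move=> dal; apply/idealX_linP; exists 'X_[al]; first by rewrite dhomogX /= dal.
  by rewrite /meval mmapX.
have step al s : mdeg al = t -> al \notin s -> uniq s -> {in s, forall be, mdeg be = t} ->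
    dimq (S s) (S (al :: s)) D.
  move=> dal als us ds; pose rel (u w : W) := S s (u - w * mmap1 h al).
  have cp := @clen_preim F F W W setT [set 0] setT [set 0] rel (S (al :: s)) setT (loc I)
    Fl Fl (ideal_submod (iS _)) (ideal_submod (loc_ideal iI)) _ _ _ _ _ _ _ _ cD (@subsetT _ _).
  have e1 : preim rel (S (al :: s)) (loc I) = S s.
    apply/seteqP; split=> [u [_ [w [s0 s00 Isw] hw]]|u [w hw]].
      apply: (idealBr (iS s) hw); exists (fun=> 0); rewrite big1 ?subr0 => [|be _]; last by rewrite mul0r.
      by exists s0 => //; rewrite mulrA idealXS; apply: idealM_mem => //; apply: hX.
    split; last by exists 0; [exact: ideal0 (loc_ideal iI)|rewrite /rel mul0r subr0; exists w].
    exists (fun be => if be \in s then w be else 0).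
    rewrite big_cons (negbTE als) mul0r add0r; congr (E (_ - _)): hw.
    by apply: eq_big_seq => be ->.
  have e2 : preim rel (S (al :: s)) setT = S (al :: s).
    apply/seteqP; split=> [u []//|u Su]; split=> //; have [w hw] := Su.
    exists (w al) => //; exists w; by move: hw; rewrite big_cons opprD addrA.
  rewrite e1 e2 in cp; apply: cp.
  - move=> w _; exists (w * mmap1 h al); last by rewrite /rel subrr; apply: (ideal0 (iS s)).
    exists (fun be => if be == al then w else 0); rewrite big_cons eqxx.
    have -> : \sum_(be <- s) (if be == al then w else 0) * mmap1 h be = 0.
      by rewrite big_seq big1 // => be bes; case: eqP bes als => [->->|_ _ _] //; rewrite mul0r.
    rewrite addr0 subrr; exact: (ideal0 iE).
  - move=> v1 v2 w1 w2 h1 h2; rewrite /rel mulrDl opprD addrACA; exact: (idealD (iS s)).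
  - by move=> v w hv; rewrite /rel mulNr -opprD; apply: (idealN (iS s)).
  - move=> w; rewrite /rel sub0r => -[w' [s0 s00 hs]].
    pose a : {mpoly W[N]} := - (s0 * w) *: 'X_[al] - \sum_(be <- s) (s0 * w' be) *: 'X_[be].
    have ha : a \is t.-homog.
      apply: rpredB; first by rewrite rpredZ // dhomogX /= dal.
      by rewrite big_seq; apply: rpred_sum => be bes; rewrite rpredZ // dhomogX /= (ds _ bes).
    have ea : a.@[h] = s0 * (- (w * mmap1 h al) - \sum_(be <- s) w' be * mmap1 h be).
      have eS : (\sum_(be <- s) (s0 * w' be) *: 'X_[be] : {mpoly W[N]}).@[h] =
          \sum_(be <- s) s0 * w' be * mmap1 h be.
        by rewrite (raddf_sum (meval h)); apply: eq_bigr => be _ /=; rewrite mevalZ /meval mmapX.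
      rewrite /a raddfB /= eS mevalZ /meval mmapX mulrBr mulr_sumr mulrN mulNr mulrA.
      by congr (_ - _); apply: eq_bigr => be _; rewrite mulrA.
    have := qr a ha; rewrite ea => /(_ hs al).
    rewrite mcoeffB mcoeffZ mcoeffX eqxx mulr1 raddf_sum big_seq big1 ?subr0 => [|be bes] /=.
      by move/(idealN iI); rewrite opprK; exists s0.
    rewrite mcoeffZ mcoeffX; case: eqP bes als => [->->|_ _ _] //.
    by rewrite mulr0.
  - move=> r v w _ hv; exists r; split=> //; rewrite /rel -scalerAl -scalerBr -mul_mpolyC.
    exact: (idealMl _ (iS s)).
  - move=> r v w _ hv; exists r, r; split=> //; first by rewrite /= subrr.
    rewrite /rel -scalerAl -scalerBr -mul_mpolyC; exact: (idealMl _ (iS s)).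
have e0 : E = S [::].
  by apply/seteqP; split=> [u Eu|u [w]]; [exists (fun=> 0)|]; rewrite big_nil subr0.
have e1 : loc (idealX setT I t) = S (mons N t).
  apply/seteqP; split=> [u hu|u [w]].
    have [v + [w hw]] := @loc_inv_mod _ (idealX setT I t) _ (@idealX_ideal _ I t.+1) (@mpow_locX I c t.+1 mh) _ hu.
    case/idealX_linP => a ha ea; exists (fun al => w * a@_al).
    move: hw; rewrite ea meval_msupp mulr_sumr; congr (E (_ - _)).
    under eq_bigr do rewrite mulrA.
    rewrite -(big_msupp_sub (G := fun c m => w * c * mmap1 h m) (mons_uniq N t)) //.
      by move=> m ma; rewrite mem_mons; apply/eqP; apply: (dhomogP _ _ _ ha).
    by move=> m; rewrite mulr0 mul0r.
  have iL : ideal (loc (idealX setT I t)) by apply: loc_ideal; apply: idealX_ideal.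
  move=> hw; apply: (idealBr (v := \sum_(al <- mons N t) w al * mmap1 h al) iL).
    by move: hw; apply: loc_mono; apply: idealX_sub.
  rewrite big_seq; apply: (ideal_sum _ iL) => al; rewrite mem_mons => /eqP dal.
  by apply: (idealMl _ iL); apply: loc_sub; apply: hX.
rewrite e0 e1 /nmon.
have : uniq (mons N t) := mons_uniq N t.
have : {in mons N t, forall be, mdeg be = t} by move=> be; rewrite mem_mons => /eqP.
elim: (mons N t) => [_ _|al s IH ds /= /andP [als us]].
  by apply: clen_nil; apply: ideal_submod.
have ds' : {in s, forall be, mdeg be = t} by move=> be bes; apply: ds; rewrite inE bes orbT.
rewrite mulSn addnC; apply: clen_cat (IH ds' us) _.
by apply: step => //; apply: ds; rewrite mem_head.
Qed.

Lemma dim_parameter_powers (g : 'I_N -> W) c : mpow c `<=` loc (lin g) ->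
  exists D, dimq (loc (lin g)) setT D /\
  forall t, dimq (loc (idealX setT (lin g) t)) setT (D * \sum_(s < t) nmon N s)%N.
Proof.
move=> mg; have [h [lhg qr _]] := quasiregular_generators mg.
have [D cD] := dimq_mpow (loc_ideal (lin_ideal g)) mg; exists D; split=> // t.
have eX s : loc (idealX setT (lin g) s) = loc (idealX setT (lin h) s).
  have sub (a b : 'I_N -> W) : loc (lin a) `<=` loc (lin b) ->
      loc (idealX setT (lin a) s) `<=` loc (idealX setT (lin b) s).
    move=> ab; apply: loc_min; first exact: idealX_ideal.
    apply: subset_trans (@locX _ _ _ _); apply: idealX_mono.
    exact: subset_trans (@loc_sub _ _ _) ab.
  by apply/seteqP; split; apply: sub; rewrite lhg.
elim: t => [|t IH]; first by rewrite big_ord0 muln0 loc_setT; apply: clen_nil.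
rewrite big_ord_recr mulnDr addnC; apply: clen_cat IH; rewrite !eX mulnC.
have mh : mpow c `<=` loc (lin h) by rewrite lhg.
have cDh : dimq (loc (lin h)) setT D by rewrite lhg.
exact: dim_quasiregular (qr t) mh cDh.
Qed.

End QuasiRegularDimension.

Lemma map_mpoly_meval (R S : comNzRingType) (n : nat) (u : {rmorphism R -> S})
    (h : 'I_n -> S) (p : {mpoly R[n]}) : (map_mpoly u p).@[h] = mmap u h p.
Proof.
rewrite meval_msupp -(big_msupp_sub (G := fun c m => c * mmap1 h m) (msupp_uniq p)).
- by rewrite /mmap; apply: eq_bigr => m _ /=; rewrite mcoeff_map_mpoly.
- by move=> m; rewrite !mcoeff_msupp mcoeff_map_mpoly; apply: contra_neq => ->; rewrite raddf0.
- by move=> m; rewrite mul0r.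
Qed.

Lemma map_mpoly_homog (R S : comNzRingType) (n : nat) (u : {rmorphism R -> S}) t
    (p : {mpoly R[n]}) : p \is t.-homog -> map_mpoly u p \is t.-homog.
Proof.
move=> hp; apply/dhomogP => m; rewrite mcoeff_msupp mcoeff_map_mpoly => am.
apply: (dhomogP _ _ _ hp); rewrite mcoeff_msupp; apply: contra_neq am => ->.
exact: raddf0.
Qed.

(** * The minors against a fixed vector form a reduction *)

Section Reduction.
Variables (K : fieldType) (M r : nat).
Local Notation W := {mpoly K[M]}.
Local Notation ideal := (@is_ideal W setT).
Variables (phi : 'I_r.+1 -> W) (th : 'I_r.+1 -> K).
Hypothesis th0 : th ord_max != 0.
Hypothesis phi_m : forall i, mpow 1 (phi i).
Local Notation mx := (@ord_max r).

(** The two-by-two minors of the rows [phi] and [th] that involve the last column; for generic [th]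
    these are the elements [T_n f_i - T_i f_n]. *)
Definition minors (i : 'I_r) : W := th mx *: phi (lift mx i) - th (lift mx i) *: phi mx.
Local Notation I := (lin phi).
Local Notation g := minors.

(** The ideal of the minors times the power [t - 1] of [I]; the value zero at [t = 0] lets the
    induction of [form_congr] start there. *)
Definition redI t : set W := if t is s.+1 then idealM setT (lin g) (idealX setT I s) else [set 0].

Lemma redI_ideal t : ideal (redI t).
Proof.
case: t => [|t]; last exact: idealM_ideal.
by apply/idealP; split=> [//|u v -> ->|a v ->]; rewrite /= ?addr0 ?mulr0.
Qed.

Lemma minor_mem i : lin g (th mx *: phi i - th i *: phi mx).
Proof.
case: (unliftP mx i) => [j ->|->]; first exact: (lin_gen g j).
by rewrite subrr; apply: (ideal0 (lin_ideal g)).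
Qed.

Lemma redI_mul t i v : redI t v -> redI t.+1 (phi i * v).
Proof.
case: t => [->|t]; first by rewrite mulr0; apply: (ideal0 (redI_ideal 1)).
move=> hv; have : idealM setT I (redI t.+1) (phi i * v) by apply: idealM_mem => //; apply: lin_gen.
by rewrite /redI idealXS !idealMA [idealM _ _ (lin g)]idealMC.
Qed.

Fact form_congr_step (R : comNzRingType) (T T' bp bt ti pj pi pjt : R) :
  T * T' * (bp * pi) - bt * ti * (pj * pjt) =
  (T * pi - ti * pj) * (T' * bp) + ti * (pj * (T' * bp - bt * pjt)).
Proof. by ring. Qed.

(** Modulo the minors, [phi] is proportional to [th]. Replacing the arguments of a form of degree
    [t] one at a time costs a minor times a product of [t - 1] elements of [I]. *)
Lemma form_congr t (a : {mpoly W[r.+1]}) : a \is t.-homog ->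
  redI t (th mx ^+ t *: a.@[phi] - a.@[fun i => (th i)%:MP] * phi mx ^+ t).
Proof.
elim: t a => [|t IH] a.
  move=> ha; suff -> : a = (a@_0)%:MP by rewrite !mevalC !expr0 scale1r mulr1 /= subrr.
  apply/mpolyP => m; rewrite mcoeffC; case: eqP => [<-|m0]; rewrite ?mulr1 ?mulr0 //.
  apply: memN_msupp_eq0; apply/negP => /(dhomogP _ _ _ ha)/eqP; rewrite mdeg_eq0.
  by move/eqP => e; apply: m0.
move=> /homogS_split [b [hb ->]]; rewrite !(raddf_sum (meval _)) /= scaler_sumr mulr_suml -sumrB.
apply: (ideal_sum _ (redI_ideal t.+1)) => i _.
rewrite !mevalM !mevalXU.
have -> : th mx ^+ t.+1 *: ((b i).@[phi] * phi i) -
    (b i).@[fun i => (th i)%:MP] * (th i)%:MP * phi mx ^+ t.+1 =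
  (th mx *: phi i - th i *: phi mx) * (th mx ^+ t *: (b i).@[phi]) +
   (th i)%:MP * (phi mx * (th mx ^+ t *: (b i).@[phi] - (b i).@[fun i => (th i)%:MP] * phi mx ^+ t)).
  by rewrite -!mul_mpolyC !exprS !mpolyCM; apply: form_congr_step.
apply: (idealD (redI_ideal t.+1)).
  apply: idealM_mem; first exact: minor_mem.
  rewrite -mul_mpolyC; apply: (idealMl _ (idealX_ideal _ _)).
  by apply/idealX_linP; exists (b i).
exact: (idealMl _ (redI_ideal t.+1) (redI_mul mx (IH _ (hb i)))).
Qed.

(** [F(phi)] is also the value of a form of degree [t] with coefficients in [I]. The difference of
    the two forms vanishes at [phi], and its value at [th] is [F(th)] plus terms vanishing at the
    origin, a local unit. So by [form_congr] the power [phi mx ^+ t] lies locally in [redI t], hence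
    so does the power [t] of [I]; this inclusion is iterated. *)
Lemma reduction t (F : {mpoly K[r.+1]}) : F \is t.-homog -> F.@[th] != 0 ->
  idealX setT I t.+1 (mmap (@mpolyC M K) phi F) ->
  exists r0, forall s, idealX setT I (r0 + s) `<=` loc (idealX setT (lin g) s).
Proof.
move=> hF F0 /idealX_linP [a0 /homogS_split [b [hb ->]] ea].
pose Fh : {mpoly W[r.+1]} := map_mpoly (@mpolyC M K) F.
have hFh : Fh \is t.-homog.
  exact: map_mpoly_homog.
have eFh (h : 'I_r.+1 -> W) : Fh.@[h] = mmap (@mpolyC M K) h F by exact: map_mpoly_meval.
pose a : {mpoly W[r.+1]} := Fh - \sum_i phi i *: b i.
have hS : \sum_i phi i *: b i \is t.-homog.
  by apply: rpred_sum => i _; exact: rpredZ (hb i).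
have ha : a \is t.-homog by exact: rpredB hFh hS.
have ea0 : a.@[phi] = 0.
  rewrite /a raddfB /= eFh ea !(raddf_sum (meval phi)) /= -sumrB big1 // => i _.
  by rewrite mevalM mevalXU mevalZ mulrC subrr.
have := form_congr ha; rewrite ea0 scaler0 sub0r => /(idealN (redI_ideal t)); rewrite opprK => hJ.
have ath : (a.@[fun i => (th i)%:MP])@_0 != 0.
  have eS : (\sum_i phi i *: b i).@[fun i => (th i)%:MP] = \sum_i phi i * (b i).@[fun i => (th i)%:MP].
    by rewrite (raddf_sum (meval _)); apply: eq_bigr => i _; rewrite /= mevalZ.
  have -> : a.@[fun i => (th i)%:MP]@_0 = Fh.@[fun i => (th i)%:MP]@_0.
    rewrite /a mevalB mcoeffB eS.
    suff -> : (\sum_i phi i * (b i).@[fun i => (th i)%:MP])@_0 = 0 by rewrite subr0.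
    apply/mpow1P; apply: (ideal_sum _ (@mpow_ideal K M 1)) => i _.
    by apply: (idealMr _ (@mpow_ideal K M 1)); apply: phi_m.
  rewrite eFh; suff -> : mmap (@mpolyC M K) (fun i => (th i)%:MP) F = (F.@[th])%:MP.
    by rewrite mcoeffC eqxx mulr1.
  rewrite /meval /mmap raddf_sum; apply: eq_bigr => m _ /=.
  rewrite mpolyCM; congr (_ * _).
  by rewrite /mmap1 rmorph_prod; apply: eq_bigr => i _; rewrite rmorphXn.
have hphi : loc (redI t) (phi mx ^+ t) by exists (a.@[fun i => (th i)%:MP]).
have It : idealX setT I t `<=` loc (redI t).
  move=> u /idealX_linP [e he ->].
  have iL := loc_ideal (redI_ideal t).
  have : loc (redI t) (th mx ^+ t *: e.@[phi]).
    apply: (idealBr iL (loc_sub (form_congr he))); exact: (idealMl _ iL).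
  rewrite -mul_mpolyC => /(idealMl ((th mx ^+ t)^-1)%:MP iL).
  by rewrite mulrA -mpolyCM mulVf ?expf_neq0 // mul1r.
(* For [t = 0] the zero ideal would locally contain 1; otherwise [r0] is [t - 1]. *)
clear hS; case: t hF F0 ea hb hFh ha hJ hphi It => [|r0] _ _ _ _ _ _ _ hphi It.
  by case: hphi => s s0; rewrite mulr1 /= => e; rewrite e raddf0 eqxx in s0.
exists r0.
suff h s : idealX setT I (r0 + s) `<=` loc (idealM setT (idealX setT (lin g) s) (idealX setT I r0)).
  move=> s; apply: subset_trans (h s) _; apply: loc_mono; rewrite idealMC.
  by apply: idealM_subr; apply: idealX_ideal.
elim: s => [|s IH].
  by rewrite addn0 idealMT; [exact: loc_sub|exact: idealX_ideal].
have iX := @idealM_ideal _ (idealX setT (lin g) s.+1) (idealX setT I r0).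
rewrite addnS idealXS.
apply: idealM_min => [|u v Iu Iv]; first exact: loc_ideal.
have [s0 s00 hv] := IH _ Iv; apply: (loc_unit s00); rewrite mulrCA.
have {hv} : idealM setT I (idealM setT (idealX setT (lin g) s) (idealX setT I r0)) (u * (s0 * v)).
  exact: idealM_mem.
rewrite idealMA [idealM _ I _]idealMC -idealMA => hv.
apply: (@loc_min _ _ (idealM setT (idealX setT (lin g) s) (loc (redI r0.+1))) _ iX).
  apply: (idealM_min (loc_ideal iX)) => x y hx [s1 s10 hy]; exists s1 => //.
  rewrite mulrCA idealXS [idealM _ (lin g) _]idealMC -idealMA; exact: idealM_mem.
by apply: loc_sub; apply: idealM_mono hv.
Qed.

Lemma minors_m i : mpow 1 (g i).
Proof.
by rewrite /minors -!mul_mpolyC; apply: (idealB (@mpow_ideal K M 1)); apply: (idealMl _ (@mpow_ideal K M 1)); apply: phi_m.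
Qed.

Lemma minors_sub : lin g `<=` I.
Proof.
apply: lin_min => [|i]; first exact: lin_ideal.
by rewrite /minors -!mul_mpolyC; apply: (idealB (lin_ideal phi));
  apply: (idealMl _ (lin_ideal phi)); apply: lin_gen.
Qed.

Lemma minors_adjoin i : lin g ((th mx)%:MP * phi i - (th i)%:MP * phi mx).
Proof. by rewrite !mul_mpolyC; apply: minor_mem. Qed.

End Reduction.

(** * The Samuel function is eventually polynomial *)

Section SamuelFunction.
Variables (k : fieldType) (N n c : nat) (phi : 'I_n -> {mpoly k[N]}).
Local Notation W := {mpoly k[N]}.
Local Notation Z := {mpoly k[n]}.
Local Notation dimq := (@clen k W setT [set 0]).
Local Notation Phi t := (loc (idealX setT (lin phi) t)).
Hypothesis mphi : mpow c `<=` loc (lin phi).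
Let Fl := field_local k.
Local Notation ev := (mmap (@mpolyC N k) phi).

Let iPhi t : is_ideal setT (Phi t). Proof. exact/loc_ideal/idealX_ideal. Qed.

Lemma ev_mem t a : a \is t.-homog -> Phi t (ev a).
Proof.
move=> ha; apply: loc_sub; rewrite /mmap big_seq; apply: ideal_sum => [|m ma]; first exact: idealX_ideal.
apply: idealMl; first exact: idealX_ideal.
apply/idealX_linP; exists 'X_[m]; last by rewrite /meval mmapX.
by rewrite dhomogX /=; apply/eqP; apply: (dhomogP _ _ _ ha).
Qed.

Lemma PhiM s t u v : Phi s u -> Phi t v -> Phi (s + t) (u * v).
Proof. by move=> hu hv; rewrite idealXD; apply: locM; apply: idealM_mem. Qed.

Lemma Phi_sub s t : (s <= t)%N -> Phi t `<=` Phi s.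
Proof. by move=> st; apply/loc_mono/idealX_sub. Qed.

Section Filtration.
Variables (d : nat) (v : 'I_d -> W).
Hypothesis vgen : forall u : W, exists a : 'I_d -> k, loc (lin phi) (u - \sum_i a i *: v i).

(** With [v] spanning [W / I] over [k], the power [t] of [I] is, modulo the next one, the sum of the
    [v j] times values at [phi] of forms of degree [t] over [k]. Restricting to [j < i] filters it,
    and each factor is a quotient of the space of forms by a piece of a graded ideal ([filU]), to
    which [hilbert_function] applies. *)
Definition fil (i t : nat) : set W := [set u | exists a : 'I_d -> Z,
  (forall j, a j \is t.-homog) /\ Phi t.+1 (u - \sum_(j < d | (j < i)%N) v j * ev (a j))].

Lemma fil_submod i t : @is_submodule k W setT (fil i t).
Proof.
split.
- exists (fun=> 0); split=> [j|]; first exact: rpred0.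
  by rewrite big1 ?subr0 => [|j _]; [exact: ideal0 (iPhi _)|rewrite raddf0 mulr0].
- move=> u w [a [ha hu]] [b [hb hw]]; exists (fun j => a j + b j); split=> [j|].
    by rewrite rpredD.
  under eq_bigr do rewrite raddfD mulrDr.
  rewrite big_split /= opprD addrACA; exact: (idealD (iPhi _) hu hw).
- move=> x u _ [a [ha hu]]; exists (fun j => x *: a j); split=> [j|]; first by rewrite rpredZ.
  under eq_bigr do rewrite mmapZ mulrCA.
  by rewrite -mulr_sumr -mul_mpolyC -mulrBr; apply: (idealMl _ (iPhi _)).
Qed.

Lemma fil0 t : fil 0 t = Phi t.+1.
Proof.
apply/seteqP; split=> [u [a [_]]|u hu]; first by rewrite big_pred0 ?subr0.
by exists (fun=> 0); split=> [j|]; [exact: rpred0|rewrite big_pred0 ?subr0].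
Qed.

Lemma fil_max t : fil d t = Phi t.
Proof.
apply/seteqP; split=> [u [a [ha hu]]|u hu].
  apply: (idealBr (iPhi t) (Phi_sub (leqnSn t) hu)); apply: (ideal_sum _ (iPhi t)) => j _.
  by apply: (idealMl _ (iPhi t)); apply: ev_mem.
have mI : mpow (c * t.+1) `<=` loc (idealX setT (lin phi) t.+1) by apply: mpow_locX.
have [w + [w' hw']] := loc_inv_mod (idealX_ideal _ _) mI hu.
move=> /idealX_linP [a ha ew].
have sF := fil_submod d t.
have hP : Phi t.+1 `<=` fil d t.
  move=> x hx; exists (fun=> 0); split=> [j|]; first exact: rpred0.
  by rewrite big1 ?subr0 // => j _; rewrite raddf0 mulr0.
rewrite -(subrK (w' * w) u); apply: (submodD sF); first exact: hP.
rewrite ew meval_msupp mulr_sumr big_seq; apply: (submod_sum sF) => m ma.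
rewrite mulrA; have [e he] := vgen (w' * a@_m).
have dm : mdeg m = t by apply: (dhomogP _ _ _ ha).
have hm : ('X_[m] : Z) \is t.-homog by rewrite dhomogX /= dm.
rewrite -(subrK (\sum_i e i *: v i) (w' * a@_m)) mulrDl; apply: (submodD sF).
  apply: hP; rewrite -add1n; apply: PhiM; first by rewrite idealX1 //; apply: lin_ideal.
  by have := ev_mem hm; rewrite mmapX.
exists (fun i => e i *: 'X_[m]); split=> [j|]; first by rewrite rpredZ.
rewrite mulr_suml [X in _ - X](eq_bigl xpredT); last by move=> j; rewrite ltn_ord.
rewrite -sumrB big1 => [|j _]; first exact: ideal0 (iPhi _).
by rewrite mmapZ mmapX -mul_mpolyC mulrCA mulrA subrr.
Qed.

Definition filU (i : 'I_d) t : set Z := [set a | a \is t.-homog /\ fil i t (v i * ev a)].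

Lemma fil_step (i : 'I_d) : exists h, evpoly h /\ forall t, dimq (fil i t) (fil i.+1 t) (h t).
Proof.
have [||t m p [hp hf]|h [eh hh]] := @hilbert_function k n (filU i).
- move=> t; have sF := fil_submod i t; split.
  + by split; [exact: rpred0|rewrite raddf0 mulr0; apply: (submod0 sF)].
  + move=> a b [ha fa] [hb fb]; split; first exact: rpredD.
    by rewrite raddfD /= mulrDr; apply: (submodD sF).
  + move=> x a _ [ha fa]; split; first exact: rpredZ.
    rewrite mmapZ mulrCA mul_mpolyC; exact: (submodZ sF).
- by move=> t a [].
- have hm : ('X_[m] : Z) \is (mdeg m).-homog by rewrite dhomogX.
  split; first exact: dhomogM.
  have [a [ha hu]] := hf; exists (fun j => a j * 'X_[m]); split=> [j|]; first exact: dhomogM.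
  rewrite rmorphM /= mulrA; under eq_bigr do rewrite rmorphM /= mulrA.
  by have := PhiM hu (ev_mem hm); rewrite mulrBl mulr_suml.
exists h; split=> // t.
pose rel (u : W) (a : Z) := a \is t.-homog /\ fil i t (u - v i * ev a).
have sF := fil_submod i t.
have cp := @clen_preim k k W Z setT [set 0] setT [set 0] rel (fil i.+1 t) (homset t) (filU i t)
  Fl Fl (fil_submod _ _) _ _ _ _ _ _ _ _ _ (hh t) (@subset_refl _ _).
have mono : fil i t `<=` fil i.+1 t.
  move=> u [a [ha hu]]; exists (fun j : 'I_d => if (j < i)%N then a j else 0); split=> [j|].
    by case: ifP => _ //; exact: rpred0.
  suff <- : \sum_(j < d | (j < i)%N) v j * ev (a j) =
    \sum_(j < d | (j < i.+1)%N) v j * ev (if (j < i)%N then a j else 0) by [].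
  rewrite big_mkcond [RHS]big_mkcond; apply: eq_bigr => j _.
  case: ltnP => ji; first by rewrite ltnS ltnW.
  by rewrite raddf0 mulr0; case: ifP.
have memi a : a \is t.-homog -> fil i.+1 t (v i * ev a).
  move=> ha; exists (fun j => if j == i then a else 0); split=> [j|].
    by case: ifP => _ //; exact: rpred0.
  rewrite (bigD1 i) /= ?ltnS // eqxx big1 ?addr0 ?subrr => [|j /andP [_ /negbTE ->]].
    exact: (ideal0 (iPhi t.+1)).
  by rewrite raddf0 mulr0.
have e1 : preim rel (fil i.+1 t) (filU i t) = fil i t.
  apply/seteqP; split=> [u [_ [a [_ hf] [_ hr]]]|u hu].
    by rewrite -(subrK (v i * ev a) u); apply: (submodD sF).
  split; first exact: mono.
  exists 0; split; rewrite ?rpred0 ?raddf0 ?mulr0 ?subr0 //; exact: (submod0 sF).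
have e2 : preim rel (fil i.+1 t) (homset t) = fil i.+1 t.
  apply/seteqP; split=> [u []//|u hu]; split=> //; have [a [ha hu']] := hu.
  exists (a i); [exact: ha|split=> //]; exists a; split=> //.
  move: hu'; rewrite (bigD1 i) ?ltnS //= opprD addrA.
  suff -> : \sum_(j < d | (j < i.+1)%N && (j != i)) v j * ev (a j) =
    \sum_(j < d | (j < i)%N) v j * ev (a j) by [].
  apply: eq_bigl => j.
  by rewrite ltnS ltn_neqAle andbC.
rewrite e1 e2 in cp; apply: cp.
- split; first by split; [exact: rpred0|rewrite raddf0 mulr0; apply: (submod0 sF)].
  + move=> a b [ha fa] [hb fb]; split; first exact: rpredD.
    by rewrite raddfD /= mulrDr; apply: (submodD sF).
  + move=> x a _ [ha fa]; split; first exact: rpredZ.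
    rewrite mmapZ mulrCA mul_mpolyC; exact: (submodZ sF).
- move=> a ha; exists (v i * ev a); first exact: memi.
  by split=> //; rewrite subrr; apply: (submod0 sF).
- move=> v1 v2 a b [ha fa] [hb fb]; split; first exact: rpredD.
  rewrite raddfD /= mulrDr opprD addrACA; exact: (submodD sF fa fb).
- move=> v1 a [ha fa]; split; first by rewrite rpredN.
  by rewrite raddfN /= mulrN -opprD; apply: (submodN Fl sF).
- move=> a [ha]; rewrite sub0r => /(submodN Fl sF); rewrite opprK => fa; by split.
- move=> x u a _ [ha fa]; exists x; split; [exact: I|by []|split; first exact: rpredZ].
  rewrite mmapZ mulrCA mul_mpolyC -scalerBr; exact: (submodZ sF).
- move=> x u a _ [ha fa]; exists x, x; split; [exact: I|exact: I|by rewrite /= subrr|].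
  split; first exact: rpredZ.
  rewrite mmapZ mulrCA mul_mpolyC -scalerBr; exact: (submodZ sF).
Qed.

End Filtration.

Lemma samuel_function : exists h, evpoly h /\ forall t, dimq (Phi t.+1) (Phi t) (h t).
Proof.
have [d cd] := dimq_mpow (loc_ideal (lin_ideal phi)) mphi.
have [v [vgen _]] := (dimqP _ _ (ideal_submod (loc_ideal (lin_ideal phi)))).1 cd.
have vgen' u : exists a : 'I_d -> k, loc (lin phi) (u - \sum_i a i *: v i) by apply/vgen.
have [h Hh] := choice (fun i : 'I_d => fil_step v i).
exists (fun t => \sum_(i < d) h i t)%N; split; first by apply: evpoly_sum => i; have [] := Hh i.
move=> t; rewrite -(fil0 v) -(fil_max vgen').
suff H i (id : (i <= d)%N) : dimq (fil v 0 t) (fil v i t) (\sum_(j < i) h (widen_ord id j) t)%N.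
  by have := H d (leqnn _); congr (clen _ _ _ _ _); apply: eq_bigr => j _; congr h; apply: val_inj.
elim: i id => [|i IH] id.
  by rewrite big_ord0; apply: clen_nil; apply: fil_submod.
rewrite big_ord_recr /=; apply: clen_cat.
  by have := IH (ltnW id); congr (clen _ _ _ _ _); apply: eq_bigr => j _; congr h; apply: val_inj.
have [_ /(_ t)] := Hh (widen_ord id ord_max); exact.
Qed.

End SamuelFunction.

(** * Colength of the values of the syzygies *)

Section Elimination.
Variables (K : fieldType) (nv nr : nat) (phi : 'I_nr.+1 -> {mpoly K[nv]}) (th : 'I_nr.+1 -> K).
Local Notation W := {mpoly K[nv]}.
Local Notation mx := (@ord_max nr).
Local Notation g := (minors phi th).
Local Notation dimq := (@clen K W setT [set 0]).
Hypothesis th0 : th mx != 0.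
Let Fl := field_local K.

Definition syz_values : set W :=
  [set u | exists2 b : 'I_nr.+1 -> W, \sum_i b i * phi i = 0 & u = \sum_i th i *: b i].

Lemma syz_values_ideal : is_ideal setT syz_values.
Proof.
apply/idealP; split.
- by exists (fun=> 0); rewrite big1 // => i _; rewrite ?mul0r ?scaler0.
- move=> _ _ [b hb ->] [c hc ->]; exists (fun i => b i + c i).
    by under eq_bigr do rewrite mulrDl; rewrite big_split /= hb hc addr0.
  by under [RHS]eq_bigr do rewrite scalerDr; rewrite big_split.
- move=> a _ [b hb ->]; exists (fun i => a * b i).
    by under eq_bigr do rewrite -mulrA; rewrite -mulr_sumr hb mulr0.
  by rewrite mulr_sumr; apply: eq_bigr => i _; rewrite scalerAr.
Qed.

Lemma minors_ideal : is_ideal setT (loc (lin g)). Proof. exact/loc_ideal/lin_ideal. Qed.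

(** Modulo the minors, [th mx *: phi i] is [th i *: phi mx]; so [phi mx] times the value of a syzygy
    is in their ideal. Conversely an expression of [phi mx * u] by the minors is itself a syzygy of
    [phi], whose value is [u] up to a constant. *)
Lemma loc_syz_valuesP u : loc syz_values u <-> loc (lin g) (phi mx * u).
Proof.
have iL := minors_ideal; split.
  case=> s s0 [a ha e]; exists s => //; rewrite mulrCA e.
  have e0 : \sum_i (th mx)%:MP * phi i * a i = 0.
    transitivity ((th mx)%:MP * \sum_i a i * phi i); last by rewrite ha mulr0.
    rewrite mulr_sumr; apply: eq_bigr => i _.
    by rewrite -mulrA [phi i * _]mulrC.
  have -> : phi mx * \sum_i th i *: a i =
      - (\sum_i (th mx)%:MP * phi i * a i - phi mx * \sum_i th i *: a i).
    by rewrite e0 sub0r opprK.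
  rewrite mulr_sumr -sumrB.
  apply: (idealN (lin_ideal g)); apply: (ideal_sum _ (lin_ideal g)) => i _.
  rewrite -mul_mpolyC mulrA -mulrBl [phi mx * _]mulrC.
  exact: (idealMr _ (lin_ideal g) (minors_adjoin phi th i)).
case=> s s0 [w e].
exists s => //.
(* The coefficients of the [phi i] in the combination [w] of the minors minus [s * u * phi mx]. *)
pose b i : W := if unlift mx i is Some j then th mx *: w j
  else - (\sum_j th (lift mx j) *: w j) - s * u.
have bl j : b (lift mx j) = th mx *: w j by rewrite /b liftK.
have bm : b mx = - (\sum_j th (lift mx j) *: w j) - s * u by rewrite /b unlift_none.
have split_sum (G : 'I_nr.+1 -> W) : \sum_i G i = G mx + \sum_j G (lift mx j).
  by rewrite (bigD1_ord mx).
have hb : \sum_i b i * phi i = 0.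
  rewrite split_sum; under eq_bigr do rewrite bl; rewrite bm.
  rewrite mulrBl mulNr addrAC -mulrA [u * _]mulrC [s * _]mulrC.
  rewrite [phi mx * u * s]mulrC e mulr_suml -sumrN -big_split -sumrB big1 // => j _ /=.
  have -> : w j * g j = th mx *: w j * phi (lift mx j) - th (lift mx j) *: w j * phi mx.
    by rewrite /minors mulrBr -!scalerAl -!scalerAr.
  by rewrite [- _ + _]addrC subrr.
have : syz_values (\sum_i th i *: b i) by exists b.
rewrite split_sum; under eq_bigr do rewrite bl; rewrite bm.
rewrite scalerBr scalerN scaler_sumr addrAC -sumrN -big_split /= big1 => [|j _]; last first.
  by rewrite !scalerA [th mx * _]mulrC addNr.
rewrite add0r -mul_mpolyC => /(idealN syz_values_ideal); rewrite opprK.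
move=> /(idealMl ((th mx)^-1)%:MP syz_values_ideal).
by rewrite (mulrA ((th mx)^-1)%:MP (th mx)%:MP) -mpolyCM mulVf ?th0 // mul1r.
Qed.

(** Multiplication by [phi mx] identifies the quotient by the colon ideal with the quotient of
    [(g, phi mx)] by [g]. As [th mx] is invertible, [(g, phi mx)] is the ideal of [phi]; the length
    is a difference of colengths. *)
Lemma dim_syz_values d D e : dimq (loc (lin phi)) setT d -> dimq (loc (lin g)) setT D ->
  mpow e `<=` loc (lin g) ->
  (d <= D)%N /\ dimq (loc syz_values) setT (D - d).
Proof.
move=> cd cD me; have iL := minors_ideal.
pose M : set W := [set u | exists w, loc (lin g) (u - phi mx * w)].
have iM : is_ideal setT M.
  apply/idealP; split.
  - by exists 0; rewrite mulr0 subrr; apply: (ideal0 iL).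
  - by move=> u v [w hw] [w' hw']; exists (w + w'); rewrite mulrDr opprD addrACA; apply: (idealD iL).
  - by move=> a u [w hw]; exists (a * w); rewrite mulrCA -mulrBr; apply: (idealMl _ iL).
have gM : loc (lin g) `<=` M by move=> u hu; exists 0; rewrite mulr0 subr0.
have eM : M = loc (lin phi).
  have iI := loc_ideal (lin_ideal phi).
  apply/seteqP; split.
    move=> u [w hw]; apply: (idealBr iI (v := phi mx * w)).
      by move: hw; apply/loc_mono/minors_sub.
    by apply: (idealMr _ iI); apply: loc_sub; apply: lin_gen.
  have <- : loc M = M by apply: (loc_id iM (c := e)); apply: subset_trans gM.
  apply: loc_mono; apply: (lin_min iM) => i.
  exists (((th mx)^-1 * th i)%:MP); apply: loc_sub.
  have := idealMl ((th mx)^-1)%:MP (lin_ideal g) (minors_adjoin phi th i).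
  rewrite mulrBr !mulrA -!mpolyCM mulVf ?th0 // mul1r.
  by rewrite [phi mx * _]mulrC.
have cdK : dimq M setT d by rewrite eM.
have [a [b [ca cb' eab]]] := clen_split Fl cD (ideal_submod iM) gM (@subsetT _ _).
have eb : b = d by apply: (clen_uniq Fl cb' cdK).
split; first by rewrite -eab eb leq_addl.
have -> : (D - d = a)%N by rewrite -eab eb addnK.
pose rel (u w : W) := loc (lin g) (w - phi mx * u).
have cp := @clen_preim K K W W setT [set 0] setT [set 0] rel setT M (loc (lin g))
  Fl Fl (ideal_submod (@idealT _)) (ideal_submod iL) _ _ _ _ _ _ _ _ ca (@subset_refl _ _).
have e1 : preim rel setT (loc (lin g)) = loc syz_values.
  apply/seteqP; split=> [u [_ [w hw hr]]|u /loc_syz_valuesP hu].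
    by apply/loc_syz_valuesP; rewrite -[_ * u](subKr w); apply: (idealB iL).
  by split=> //; exists 0; [exact: (ideal0 iL)|rewrite /rel sub0r; apply: (idealN iL)].
have e2 : preim rel setT M = setT.
  apply/seteqP; split=> // u _; split=> //; exists (phi mx * u).
    by exists u; rewrite subrr; apply: (ideal0 iL).
  by rewrite /rel subrr; apply: (ideal0 iL).
rewrite e1 e2 in cp; apply: cp.
- by move=> w [u hu]; exists u.
- by move=> v1 v2 w1 w2 h1 h2; rewrite /rel mulrDr opprD addrACA; apply: (idealD iL).
- by move=> v w hv; rewrite /rel mulrN -opprD; apply: (idealN iL).
- by move=> w; rewrite /rel mulr0 subr0.
- move=> r v w _ hv; exists r; split=> //; rewrite /rel -scalerAr -scalerBr -mul_mpolyC.
  exact: (idealMl _ iL).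
- move=> r v w _ hv; exists r, r; split=> //; first by rewrite /= subrr.
  rewrite /rel -scalerAr -scalerBr -mul_mpolyC; exact: (idealMl _ iL).
Qed.

End Elimination.

Section LocalTheorem.
Variables (k : fieldType) (N c : nat) (phi : 'I_N.+2 -> {mpoly k[N.+1]}).
Hypothesis phi_m : forall i, mpow 1 (phi i).
Hypothesis mphi : mpow c `<=` loc (lin phi).
Local Notation T := {mpoly k[N.+2]}.
Local Notation K := {fraction T}.
Local Notation W := {mpoly k[N.+1]}.
Local Notation WT := {mpoly T[N.+1]}.
Local Notation WK := {mpoly K[N.+1]}.
Local Notation cb := (@frac_ext k N.+2 N.+1).
Local Notation mx := (@ord_max N.+1).
Local Notation "x %:F" := (tofrac x).
#[local] Opaque frac_ext tf poly_ext cf.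

Definition theta i : K := ('X_i)%:F.
Definition phiK i : WK := cb (phi i).

(* The specialisation to the local ring of the ideal of syzygies. *)
Definition Jstar : set WK := gen_ideal setT
  [set u | exists2 a : 'I_N.+2 -> W, \sum_i a i * phi i = 0 & u = \sum_i theta i *: cb (a i)].

Local Notation g := (minors phiK theta).

Lemma theta_neq0 i : theta i != 0.
Proof. by rewrite tofrac_eq0 mpolyX_neq0. Qed.

Lemma phiK_m i : mpow 1 (phiK i).
Proof. by move=> m /(phi_m i) e; rewrite mcoeff_cb e rmorph0. Qed.

Lemma extI_lin : extI (lin phi) = lin phiK.
Proof.
rewrite -[lin phi](idealX1 (lin_ideal phi)) extI_idealX idealX1 //; exact: lin_ideal.
Qed.

Lemma mphiK : mpow c `<=` loc (lin phiK).
Proof.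
rewrite -extI_lin -(extI_loc _ (lin_ideal phi) mphi).
exact: extI_mpow (loc_ideal (lin_ideal phi)) mphi.
Qed.

Lemma Jstar_ideal : is_ideal setT Jstar. Proof. exact: gen_ideal_ideal. Qed.

(** Syzygies over [K] come from syzygies over [k]: after clearing denominators, the coefficients of
    each parameter monomial form a syzygy of [phi]. *)
Lemma Jstar_flat (b : 'I_N.+2 -> WK) : \sum_i b i * phiK i = 0 -> Jstar (\sum_i theta i *: b i).
Proof.
move=> hb; have iJ := Jstar_ideal.
have [be [w [be0 hw]]] : exists be (w : 'I_N.+2 -> WT), be != 0 /\ forall i, tf (w i) = be%:F *: b i.
  have [bw Hbw] : exists bw : 'I_N.+2 -> T * WT, forall i, (bw i).1 != 0 /\ tf (bw i).2 = (bw i).1%:F *: b i.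
    have h i : exists bw : T * WT, bw.1 != 0 /\ tf bw.2 = bw.1%:F *: b i.
      by have [x [y [x0 e]]] := clear_denom (b i); exists (x, y).
    by have [bw Hbw] := choice h; exists bw.
  exists (\prod_i (bw i).1), (fun i => (\prod_(j | j != i) (bw j).1) *: (bw i).2); split.
    by apply/prodf_neq0 => i _; have [] := Hbw i.
  move=> i; rewrite tfZ; have [_ ->] := Hbw i.
  by rewrite [in RHS](bigD1 i) //= mulrC tofracM scalerA.
have sw : \sum_i w i * poly_ext _ (phi i) = 0.
  apply: (@tf_inj k N.+2 N.+1); rewrite raddf_sum raddf0 /=.
  transitivity (be%:F *: \sum_i b i * phiK i); last by rewrite hb scaler0.
  rewrite scaler_sumr; apply: eq_bigr => i _.
  by rewrite rmorphM /= hw tf_up scalerAl.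
have scf al : \sum_i cf al (w i) * phi i = 0.
  have := congr1 (cf al) sw; rewrite raddf_sum raddf0 /= => e; rewrite -[RHS]e.
  by apply: eq_bigr => i _; rewrite [w i * _]mulrC cf_up mulrC.
have [s hs] := tf_decomp_fam w.
have hJ : Jstar (\sum_i theta i *: tf (w i)).
  under eq_bigr do rewrite hs scaler_sumr; rewrite exchange_big /=.
  apply: (ideal_sum _ iJ) => al _.
  have -> : \sum_i theta i *: (('X_[al])%:F *: cb (cf al (w i))) =
    (('X_[al])%:F)%:MP * \sum_i theta i *: cb (cf al (w i)).
    by rewrite mulr_sumr; apply: eq_bigr => i _; rewrite mul_mpolyC !scalerA mulrC.
  apply: (idealMl _ iJ); apply: gen_ideal_sub; by exists (fun i => cf al (w i)).
have -> : \sum_i theta i *: b i = (be%:F)^-1%:MP * \sum_i theta i *: tf (w i).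
  rewrite mulr_sumr; apply: eq_bigr => i _.
  by rewrite hw mul_mpolyC !scalerA -mulrA mulrCA mulVf ?mulr1 // tofrac_eq0.
exact: (idealMl _ iJ).
Qed.

Lemma JstarE : Jstar = syz_values phiK theta.
Proof.
apply/seteqP; split; last by move=> _ [b hb ->]; apply: Jstar_flat.
apply: gen_ideal_min => [|_ [a ha ->]]; first exact: syz_values_ideal.
exists (fun i => cb (a i)) => //.
rewrite -[RHS](raddf0 cb) -ha raddf_sum; apply: eq_bigr => i _ /=.
by rewrite rmorphM.
Qed.

Local Notation dimk := (@clen k W setT [set 0]).
Local Notation dimK := (@clen K WK setT [set 0]).
Let Fl := field_local K.

(** [Ft] is the lowest form of an algebraic relation [F] between the [phi i]. Its value at [phi] is
    minus that of the higher forms, hence in the power [t.+1] of [I]; its value at the generic point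
    [theta] is [Ft] itself, seen in [K], hence nonzero. *)
Lemma minors_reduction : exists r0, forall s,
  idealX setT (lin phiK) (r0 + s) `<=` loc (idealX setT (lin g) s).
Proof.
have [F F0 hF] := alg_dep phi.
have exm : exists t, has (fun m => mdeg m == t) (msupp F).
  exists (mdeg (mlead F)); apply/hasP; exists (mlead F) => //; exact: mlead_supp.
case: (ex_minnP exm) => t /hasP [m0 m0F /eqP dm0] tmin.
pose Ft := \sum_(m <- msupp F | mdeg m == t) F@_m *: 'X_[m].
have hFt : Ft \is t.-homog.
  by apply: rpred_sum => m dm; rewrite rpredZ // dhomogX.
have Ft0 : Ft != 0.
  apply/eqP => /(congr1 (mcoeff m0)); rewrite (raddf_sum (mcoeff m0)) mcoeff0 /= big_mkcond (bigD1_seq m0) ?msupp_uniq //=.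
  rewrite dm0 eqxx mcoeffZ mcoeffX eqxx mulr1 big1 ?addr0 => [|m /negbTE mm0].
    by move/eqP; rewrite mcoeff_eq0 m0F.
  by case: ifP => // _; rewrite mcoeffZ mcoeffX mm0 mulr0.
pose G : {mpoly K[N.+2]} := map_mpoly (@cst k N.+2) Ft.
have red := reduction (theta_neq0 mx) phiK_m.
apply: (red t G).
- exact: map_mpoly_homog.
- suff -> : G.@[theta] = Ft%:F by rewrite tofrac_eq0.
  rewrite map_mpoly_meval [in RHS](mpolyE Ft) (raddf_sum (@tofrac T)) /mmap.
  apply: eq_bigr => m _ /=; rewrite -mul_mpolyC tofracM; congr (_ * _).
  by rewrite mpolyXE_id rmorph_prod /mmap1; apply: eq_bigr => i _; rewrite rmorphXn.
have -> : mmap (@mpolyC N.+1 K) phiK G = cb (mmap (@mpolyC N.+1 k) phi Ft).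
  rewrite {1}/mmap -(big_msupp_sub (G := fun c m => (c%:MP : WK) * mmap1 phiK m) (msupp_uniq Ft)).
  + rewrite /mmap raddf_sum; apply: eq_bigr => m _ /=.
    rewrite mcoeff_map_mpoly rmorphM /=; congr (_ * _).
      by apply/mpolyP => m'; rewrite mcoeff_cb !mcoeffC; case: eqP; rewrite ?mulr1 ?mulr0 ?rmorph0.
    rewrite /mmap1 rmorph_prod; apply: eq_bigr => i _; exact: (esym (rmorphXn _ _ _)).
  + by move=> m; rewrite !mcoeff_msupp mcoeff_map_mpoly; apply: contra_neq => ->; rewrite raddf0.
  + by move=> m; rewrite mpolyC0 mul0r.
suff h : idealX setT (lin phi) t.+1 (mmap (@mpolyC N.+1 k) phi Ft).
  have := extI_cb N.+2 (@idealX_ideal _ _ _) h; by rewrite extI_idealX.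
have eF : mmap (@mpolyC N.+1 k) phi Ft =
    - mmap (@mpolyC N.+1 k) phi (\sum_(m <- msupp F | mdeg m != t) F@_m *: 'X_[m]).
  apply/eqP; rewrite -addr_eq0 -raddfD /=.
  suff -> : Ft + \sum_(m <- msupp F | mdeg m != t) F@_m *: 'X_[m] = F by apply/eqP.
  by rewrite [in RHS](mpolyE F) [in RHS](bigID (fun m => mdeg m == t)).
have iX := @idealX_ideal _ (lin phi) t.+1.
rewrite eF; apply: (idealN iX); rewrite raddf_sum.
rewrite big_seq_cond; apply: (ideal_sum _ iX) => m /andP [mF mt] /=.
rewrite mmapZ mmapX; apply: (idealMl _ iX).
have tm : (t < mdeg m)%N.
  by rewrite ltn_neqAle eq_sym mt /= tmin //; apply/hasP; exists m.
apply: (idealX_sub tm); apply/idealX_linP; exists 'X_[m]; last by rewrite /meval mmapX.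
by rewrite dhomogX.
Qed.

(** [d] is the colength of [I] and [D] that of the minors. Powers of the minors lie in those of [I],
    and conversely with the shift [r0]; so the sums of the Samuel function [h] grow like [D] times
    the number of monomials, and [D] is the multiplicity. *)
Theorem local_theorem : exists d D h,
  [/\ dimk (loc (lin phi)) setT d, (d <= D)%N, dimK (loc Jstar) setT (D - d)%N,
      forall t, dimk (loc (idealX setT (lin phi) t.+1)) (loc (idealX setT (lin phi) t)) (h t)
    & exists p : {poly rat}, exists t0, [/\ forall t, (t0 <= t)%N -> (h t)%:R = p.[t%:R],
        size p = N.+1 & lead_coef p = D%:R / N`!%:R]].
Proof.
have [d cd] := dimq_mpow (loc_ideal (lin_ideal phi)) mphi.
have [r0 hr] := minors_reduction.
have mg : mpow (c * (r0 + 1)) `<=` loc (lin g).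
  apply: subset_trans (mpow_locX mphiK) _.
  have := hr 1%N; rewrite idealX1; last exact: lin_ideal.
  move=> h; apply: loc_min => //; exact: lin_ideal.
have [D [cD cDt]] := dim_parameter_powers mg.
have cdK : dimK (loc (lin phiK)) setT d.
  rewrite -extI_lin -(extI_loc _ (lin_ideal phi) mphi).
  exact: dim_extI (loc_ideal (lin_ideal phi)) cd.
have [dD cJ] := dim_syz_values (theta_neq0 mx) cdK cD mg; rewrite -JstarE in cJ.
have [h [eh ch]] := samuel_function mphi.
exists d, D, h; split=> //.
have cH t : dimk (loc (idealX setT (lin phi) t)) setT (\sum_(s < t) h s).
  elim: t => [|t IH]; first by rewrite big_ord0 loc_setT; apply: clen_nil; apply: ideal_submod.
  rewrite big_ord_recr /= addnC; exact: clen_cat (ch t) IH.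
have cHK t : dimK (loc (idealX setT (lin phiK) t)) setT (\sum_(s < t) h s).
  have := dim_extI N.+2 (loc_ideal (@idealX_ideal _ (lin phi) t)) (cH t).
  by rewrite (extI_loc _ (@idealX_ideal _ _ _) (mpow_locX mphi)) extI_idealX.
have le E E' a b : is_ideal setT E -> is_ideal setT E' -> E `<=` E' -> dimK E setT a ->
    dimK E' setT b -> (b <= a)%N.
  move=> iE iE' EE ca cb'.
  have [x [y [_ cy <-]]] := clen_split Fl ca (ideal_submod iE') EE (@subsetT _ _).
  by rewrite (clen_uniq Fl cb' cy) leq_addl.
have iX (J : set WK) t : is_ideal setT (loc (idealX setT J t)) by apply/loc_ideal/idealX_ideal.
apply: (multiplicity_asymptotics (r := r0)) eh _ _ _ => [t|t|].
- apply: le (iX _ _) (iX _ _) _ (cDt t) (cHK t).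
  by apply/loc_mono/idealX_mono/minors_sub.
- apply: le (iX _ _) (iX _ _) _ (cHK _) (cDt t).
  rewrite addnC; apply: loc_min; [exact: idealX_ideal|exact: hr].
rewrite lt0n; apply/eqP => D0; move: cD; rewrite D0 => /clen0 e.
have : loc (lin g) 1 by rewrite -e.
case=> s s0; rewrite mulr1 => hs; move/eqP: s0; apply.
apply/mpow1P; have : lin g `<=` mpow 1; last by apply.
by apply: lin_min => [|i]; [exact: mpow_ideal|apply: minors_m; apply: phiK_m].
Qed.

End LocalTheorem.

(** * Local rings of the projective space *)

Section Localization.
Variables (k : fieldType) (M : nat) (L : fieldType) (psi : {rmorphism {mpoly k[M]} -> L}).
Hypothesis psi_inj : injective psi.
Local Notation W := {mpoly k[M]}.

(* The extension to the local ring at the origin, inside of [L]. *)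
Definition extO (E : set W) : set L :=
  [set z | exists u s, [/\ E u, s@_0 != 0 & z = psi u / psi s]].
Local Notation O := (extO setT).

Lemma psi0 u : (psi u == 0) = (u == 0).
Proof. by rewrite -(inj_eq psi_inj) rmorph0. Qed.

Lemma coef0_neq0 (s : W) : s@_0 != 0 -> s != 0.
Proof. by apply: contra_neq => ->; rewrite mcoeff0. Qed.

Lemma psi_coef0 s : s@_0 != 0 -> psi s != 0.
Proof. by move=> /coef0_neq0; rewrite psi0. Qed.

Lemma extO_mono E E' : E `<=` E' -> extO E `<=` extO E'.
Proof. by move=> EE _ [u [s [/EE Eu s0 ->]]]; exists u, s. Qed.

Lemma extO_mem E u : E u -> extO E (psi u).
Proof. by move=> Eu; exists u, 1; rewrite mcoeff1 eqxx oner_neq0 rmorph1 divr1. Qed.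

Lemma extO_loc E : extO (loc E) = extO E.
Proof.
apply/seteqP; split; last by apply: extO_mono; apply: loc_sub.
move=> _ [u [s [[t t0 Etu] s0 ->]]]; exists (t * u), (t * s); split=> //; first exact: unitM.
by rewrite !rmorphM -mulf_div divff ?mul1r // psi_coef0.
Qed.

Lemma add_div (a b c e : L) : b != 0 -> e != 0 -> a / b + c / e = (e * a + b * c) / (b * e).
Proof. by move=> b0 e0; rewrite addf_div // [a * e]mulrC [c * b]mulrC. Qed.

Lemma extO_ideal E : is_ideal setT E -> is_ideal O (extO E).
Proof.
move=> iE; split.
- by rewrite -(rmorph0 psi); exact: extO_mem (ideal0 iE).
- move=> _ _ [u [s [Eu s0 ->]]] [v [t [Ev t0 ->]]].
  exists (t * u + s * v), (s * t); split; last by rewrite add_div ?psi_coef0 // rmorphD !rmorphM.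
    by apply: (idealD iE); apply: (idealMl _ iE).
  exact: unitM.
- move=> _ _ [a [b [_ b0 ->]]] [u [s [Eu s0 ->]]].
  exists (a * u), (b * s); split; [exact: (idealMl _ iE)|exact: unitM|].
  by rewrite !rmorphM -mulf_div.
Qed.

Lemma extO_local : is_local O (extO (@mI k M)).
Proof.
have iI : is_ideal setT (@mI k M) by apply: mpow_ideal.
split.
- split; first by rewrite -(rmorph1 psi); apply: extO_mem.
  + move=> _ _ [u [s [_ s0 ->]]] [v [t [_ t0 ->]]].
    exists (t * u - s * v), (s * t); split=> //; first exact: unitM.
    by rewrite -mulNr add_div ?psi_coef0 // mulrN rmorphB !rmorphM.
  + move=> _ _ [u [s [_ s0 ->]]] [v [t [_ t0 ->]]].
    exists (u * v), (s * t); split=> //; first exact: unitM.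
    by rewrite !rmorphM -mulf_div.
- exact: extO_mono.
- by rewrite -(rmorph0 psi); exact: extO_mem (ideal0 iI).
move=> _ [u [s [_ s0 ->]]]; case: (eqVneq u@_0 0) => [/mpow1P u0|u0]; [left|right].
  by exists u, s.
exists (psi s / psi u); first by exists s, u.
rewrite mulf_div [psi s * _]mulrC divff ?subrr ?mulf_neq0 ?psi_coef0 //.
by rewrite -(rmorph0 psi); exact: extO_mem (ideal0 iI).
Qed.

Lemma extO_idealM I J : idealM O (extO I) (extO J) = extO (idealM setT I J).
Proof.
apply/seteqP; split.
  apply: gen_ideal_min; first exact/extO_ideal/idealM_ideal.
  move=> _ [_ [u [s [Iu s0 ->]]] [_ [v [t [Jv t0 ->]]] <-]].
  exists (u * v), (s * t); split; [exact: idealM_mem|exact: unitM|].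
  by rewrite !rmorphM -mulf_div.
have [g0 gD gZ] := gen_ideal_ideal O [set a * b | a in extO I & b in extO J].
suff h : idealM setT I J `<=` [set u | idealM O (extO I) (extO J) (psi u)].
  move=> _ [u [s [/h hu s0 ->]]]; rewrite mulrC; apply: (gZ (psi s)^-1 (psi u)) hu.
  by exists 1, s; rewrite rmorph1 div1r.
apply: idealM_min => [|a b Ia Jb /=].
  apply/idealP; split=> /=; first by rewrite rmorph0.
    by move=> u v hu hv; rewrite rmorphD; apply: gD.
  by move=> a v hv; rewrite rmorphM; apply: gZ => //; apply: extO_mem.
rewrite rmorphM; apply: gen_ideal_sub; exists (psi a); first exact: extO_mem.
by exists (psi b) => //; apply: extO_mem.
Qed.

Lemma extO_idealX I t : idealX O (extO I) t = extO (idealX setT I t).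
Proof. by elim: t => [//|t IH]; rewrite idealXS -extO_idealM -IH. Qed.

(** A fraction [u / s] is related to [w] when [s * w] is [u] modulo [E]; since [E] contains
    [mpow c], denominators are invertible modulo [E]. *)
Lemma clen_extO c E E' l : is_ideal setT E -> is_ideal setT E' -> mpow c `<=` E ->
  loc E = E -> loc E' = E' -> @clen W W^o setT (@mI k M) E E' l ->
  @clen L L^o O (extO (@mI k M)) (extO E) (extO E') l.
Proof.
move=> iE iE' mE eE eE' cl.
have [_ _ EE'] := clen_sub (@mI_local k M) cl.
pose rel (z : L^o) (w : W^o) := exists u s : W, [/\ s@_0 != 0, z = psi u / psi s & E (s * w - u)].
have Ol := extO_local.
have cp := @clen_preim L W L^o W^o O (extO (@mI k M)) setT (@mI k M) rel (extO E') E' E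
  Ol (@mI_local k M) (extO_ideal iE') iE _ _ _ _ _ _ _ _ cl (@subset_refl _ _).
have e1 : preim rel (extO E') E = extO E.
  apply/seteqP; split=> [z [_ [w Ew [u [s [s0 -> hE]]]]]|_ [u [s [Eu s0 ->]]]].
    exists u, s; split=> //; rewrite -[u](subKr (s * w)).
    by apply: (idealB iE) => //; apply: (idealMl _ iE).
  split; first by exists u, s; split=> //; apply: EE'.
  have [s' hs'] := inv_mod c s0.
  exists (s' * u); first exact: (idealMl _ iE).
  exists u, s; split=> //; apply: (idealB iE) => //; by do 2 apply: (idealMl _ iE).
have e2 : preim rel (extO E') E' = extO E'.
  apply/seteqP; split=> [z []//|z Ez]; split=> //.
  have [u [s [Eu s0 ->]]] := Ez; have [s' hs'] := inv_mod c s0.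
  exists (s' * u); first exact: (idealMl _ iE').
  exists u, s; split=> //.
  have -> : s * (s' * u) - u = - ((1 - s' * s) * u) by rewrite mulrBl mul1r opprB mulrA [s * s']mulrC.
  by apply: (idealN iE); apply: (idealMr _ iE); apply: mE.
rewrite e1 e2 in cp; apply: cp.
- move=> w Ew; exists (psi w); first exact: extO_mem.
  exists w, 1; rewrite mcoeff1 eqxx oner_neq0 rmorph1 divr1 mul1r subrr; split=> //; exact: (ideal0 iE).
- move=> _ _ w1 w2 [u [s [s0 -> h1]]] [v [t [t0 -> h2]]].
  exists (t * u + s * v), (s * t); split; first exact: unitM.
    by rewrite add_div ?psi_coef0 // rmorphD !rmorphM.
  have -> : s * t * (w1 + w2) - (t * u + s * v) = t * (s * w1 - u) + s * (t * w2 - v).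
    by ring.
  by apply: (idealD iE); apply: (idealMl _ iE).
- move=> _ w [u [s [s0 -> h]]]; exists (- u), s; split=> //; first by rewrite rmorphN mulNr.
  by rewrite mulrN -opprD; apply: (idealN iE).
- move=> w [u [s [s0 e h]]]; rewrite -eE; exists s => //.
  have : psi u / psi s == 0 by rewrite -e.
  rewrite mulf_eq0 invr_eq0 (negbTE (psi_coef0 s0)) orbF psi0 => /eqP u0.
  by move: h; rewrite u0 subr0.
- move=> _ _ w [a [b [_ b0 ->]]] [u [s [s0 -> h]]]; have [b' hb'] := inv_mod c b0.
  exists (b' * a); split=> //.
    move=> [a1 [b1 [ma1 b10 e]]]; apply: (idealMl _ (@mpow_ideal k M 1)).
    have e' : a * b1 = a1 * b.
      apply: psi_inj; rewrite !rmorphM; apply/eqP; rewrite -eqr_div ?psi_coef0 //; exact/eqP.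
    apply/mpow1P/eqP; have : (a * b1)@_0 == 0.
      by rewrite e'; apply/eqP/mpow1P; apply: (idealMr _ (@mpow_ideal k M 1)).
    by rewrite (rmorphM (mcoeff 0)) mulf_eq0 (negbTE b10) orbF.
  exists (a * u), (b * s); split; first exact: unitM.
    by rewrite [_ *: _]mulf_div !rmorphM.
  rewrite [_ *: _]/(_ * _).
  have -> : b * s * (b' * a * w) - a * u = a * (s * w - u) - (1 - b' * b) * (a * s * w) by ring.
  apply: (idealB iE); first exact: (idealMl _ iE).
  by apply: (idealMr _ iE); apply: mE.
- move=> r' _ w _ [u [s [s0 -> h]]]; exists (psi r'), r'; split=> //; first exact: extO_mem.
    by rewrite subrr; exact: (ideal0 (@mpow_ideal k M 1)).
  exists (r' * u), s; split=> //; first by rewrite [_ *: _]mulrA rmorphM.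
  by rewrite [_ *: _]/(_ * _) mulrCA -mulrBr; apply: (idealMl _ iE).
Qed.

Lemma mod_length_extO c E E' l : is_ideal setT E -> is_ideal setT E' -> mpow c `<=` E ->
  E `<=` E' -> loc E = E -> loc E' = E' -> @clen k W setT [set 0] E E' l ->
  @mod_length L L^o O (extO E') (extO E) = l.
Proof.
move=> iE iE' mE EE eE eE' cl; apply: (clen_mod_length extO_local).
exact: clen_extO mE eE eE' (dim_clenW iE mE iE' EE cl).
Qed.

End Localization.

Lemma homogX (R : comNzRingType) n e (i : 'I_n) : ('X_i : {mpoly R[n]}) ^+ e \is e.-homog.
Proof.
have h : ('X_i : {mpoly R[n]}) \is 1.-homog by rewrite dhomogX /= mdeg1.
by have := dhomogMn e h; rewrite mul1n.
Qed.

(** * The affine chart centred at a point *)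

Section Chart.
Variables (k : fieldType) (M : nat) (x : ppoint k M.+1) (i0 : 'I_M.+1).
Local Notation A := {mpoly k[M.+1]}.
Local Notation W := {mpoly k[M]}.
Local Notation L := {fraction A}.
Local Notation "p %:F" := (tofrac p).
Local Notation v := (pcoord x).
Hypothesis v0 : v 0 i0 = 1.

Definition chart_gen (i : 'I_M.+1) : W :=
  (v 0 i)%:MP + (if unlift i0 i is Some j then 'X_j else 0).
(* Dehomogenisation at [X_i0], the origin being the point [x]. *)
Definition chart : A -> W := mmap (@mpolyC M k) chart_gen.
HB.instance Definition _ := GRing.RMorphism.on chart.

Lemma chartX i : chart 'X_i = chart_gen i.
Proof. by rewrite /chart mmapX mmap1U. Qed.

Lemma chartZ c p : chart (c *: p) = c *: chart p.
Proof. by rewrite /chart mmapZ mul_mpolyC. Qed.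

Lemma chart_coord j : chart 'X_(lift i0 j) = (v 0 (lift i0 j))%:MP + 'X_j.
Proof. by rewrite chartX /chart_gen liftK. Qed.

Lemma chart1 : chart 'X_i0 = 1.
Proof. by rewrite chartX /chart_gen unlift_none v0 addr0. Qed.

Lemma chart0 p : (chart p)@_0 = mev p v.
Proof.
rewrite /chart /mmap (raddf_sum (mcoeff 0)) /mev meval_msupp; apply: eq_bigr => m _ /=.
rewrite (rmorphM (mcoeff 0)) /= mcoeffC eqxx mulr1; congr (_ * _).
rewrite /mmap1 (rmorph_prod (mcoeff 0)); apply: eq_bigr => i _ /=.
rewrite (rmorphXn (mcoeff 0)); congr (_ ^+ _) => /=.
rewrite /chart_gen mcoeffD mcoeffC eqxx mulr1; case: unlift => [j|]; last by rewrite mcoeff0 addr0.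
by rewrite mcoeffX -mdeg_eq0 mdeg1 addr0.
Qed.

(** The inverse of the chart, with values in fractions of degree zero; it realises the stalk as the
    local ring of [W] at the origin ([stalkE]). *)
Definition unchart : W -> L :=
  mmap (@tofrac A \o @mpolyC M.+1 k) (fun j => ('X_(lift i0 j))%:F / ('X_i0)%:F - (v 0 (lift i0 j))%:MP%:F).
HB.instance Definition _ := GRing.RMorphism.on unchart.

Lemma fX0 : ('X_i0)%:F != 0 :> L.
Proof. by rewrite tofrac_eq0 mpolyX_neq0. Qed.

Lemma unchartC c : unchart c%:MP = c%:MP%:F.
Proof. by rewrite /unchart mmapC. Qed.

Lemma unchart_gen i : unchart (chart_gen i) = ('X_i)%:F / ('X_i0)%:F.
Proof.
rewrite /chart_gen rmorphD /= unchartC; case: unliftP => [j ->|->].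
  by rewrite /unchart mmapX mmap1U addrC subrK.
by rewrite v0 rmorph0 addr0 divff ?fX0 // tofrac1.
Qed.

Lemma unchart_homog e p : p \is e.-homog -> unchart (chart p) = p%:F / ('X_i0 ^+ e)%:F.
Proof.
move=> hp; rewrite {1}/chart /mmap rmorph_sum [in RHS](mpolyE p) (raddf_sum (@tofrac A)) mulr_suml.
rewrite [LHS]big_seq [RHS]big_seq; apply: eq_bigr => m mp /=.
have <- : mdeg m = e by apply: (dhomogP _ _ _ hp).
rewrite rmorphM /= unchartC -mul_mpolyC rmorphM /= -mulrA; congr (_ * _).
rewrite /mmap1 rmorph_prod mpolyXE_id rmorph_prod mdegE -prodrXr rmorph_prod -prodf_div.
by apply: eq_bigr => i _; rewrite !rmorphXn /= unchart_gen expr_div_n.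
Qed.

Lemma homog_lift w e : (msize w <= e.+1)%N -> exists2 p, p \is e.-homog & chart p = w.
Proof.
move=> we.
pose y j : A := 'X_(lift i0 j) - v 0 (lift i0 j) *: 'X_i0.
exists (\sum_(m <- msupp w) w@_m *: (mmap1 y m * 'X_i0 ^+ (e - mdeg m))).
  rewrite big_seq; apply: rpred_sum => m mw; rewrite rpredZ //.
  have le : (mdeg m <= e)%N by have := msize_mdeg_lt mw; lia.
  rewrite -{2}(subnKC le); apply: dhomogM; last first.
    by apply: homogX.
  rewrite /mmap1 mdegE; apply: (big_ind2 (fun (p : A) d => p \is d.-homog)).
  - exact: dhomog1.
  - by move=> p1 d1 p2 d2 h1 h2; apply: dhomogM.
  move=> j _; have hy : y j \is 1.-homog by rewrite rpredB ?rpredZ // dhomogX /= mdeg1.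
  by have := dhomogMn (m j) hy; rewrite mul1n.
rewrite rmorph_sum [RHS]mpolyE; apply: eq_bigr => m _ /=.
rewrite chartZ rmorphM rmorphXn /= chart1 expr1n mulr1; congr (_ *: _).
rewrite /mmap1 rmorph_prod mpolyXE_id; apply: eq_bigr => j _; rewrite rmorphXn; congr (_ ^+ _).
by rewrite /y /= rmorphB /= chartZ chart1 chart_coord -mul_mpolyC mulr1 addrC addKr.
Qed.

Lemma unchart_inj : injective unchart.
Proof.
apply: raddf_inj => w e; have [p hp ep] := @homog_lift w (msize w) (leqnSn _).
have : unchart (chart p) = 0 by rewrite ep.
rewrite (unchart_homog hp) => /eqP; rewrite mulf_eq0 invr_eq0.
rewrite [X in _ || X]tofrac_eq0 expf_eq0 (negbTE (mpolyX_neq0 _ _)) andbF orbF tofrac_eq0.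
by move/eqP => p0; rewrite -ep p0 rmorph0.
Qed.

Lemma chart_inj e p : p \is e.-homog -> chart p = 0 -> p = 0.
Proof.
move=> hp e0; have := unchart_homog hp; rewrite e0 rmorph0 => /esym/eqP.
rewrite mulf_eq0 invr_eq0 [X in _ || X]tofrac_eq0 expf_eq0 (negbTE (mpolyX_neq0 _ _)) andbF orbF.
by rewrite tofrac_eq0 => /eqP.
Qed.

Local Notation ext := (extO unchart).

Lemma chart_frac e p q : p \is e.-homog -> q \is e.-homog -> q != 0 ->
  p%:F / q%:F = unchart (chart p) / unchart (chart q).
Proof.
move=> hp hq q0; rewrite (unchart_homog hp) (unchart_homog hq) invf_div mulrA divfK //.
by rewrite tofrac_eq0 expf_eq0 (negbTE (mpolyX_neq0 _ _)) andbF.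
Qed.

Lemma mev_neq0 (q : A) : mev q v != 0 -> q != 0.
Proof. by apply: contra_neq => ->; rewrite /mev meval0. Qed.

Lemma stalkE : stalk x = ext setT.
Proof.
apply/seteqP; split=> [_ [e [p [q [hp hq q0 ->]]]]|_ [u [s [_ s0 ->]]]].
  exists (chart p), (chart q); rewrite chart0; split=> //.
  by apply: chart_frac hp hq _; apply: mev_neq0.
pose e := (msize u + msize s)%N.
have [p hp ep] := @homog_lift u e (leq_trans (leq_addr _ _) (leqnSn _)).
have [q hq eq] := @homog_lift s e (leq_trans (leq_addl _ _) (leqnSn _)).
have q0 : mev q v != 0 by rewrite -chart0 eq.
by exists e, p, q; split=> //; rewrite (chart_frac hp hq (mev_neq0 q0)) ep eq.
Qed.

Lemma stalk_idealE (I : set A) E : (forall e p, I p -> p \is e.-homog -> loc E (chart p)) ->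
  (forall u, E u -> exists e p, [/\ I p, p \is e.-homog & chart p = u]) ->
  (forall a p, I p -> I (a * p)) -> stalk_ideal x I = ext E.
Proof.
move=> h1 h2 h3; apply/seteqP; split=> [_ [e [p [q [hp hq q0 Ip ->]]]]|_ [u [s [Eu s0 ->]]]].
  rewrite -(extO_loc unchart_inj); exists (chart p), (chart q); rewrite chart0; split=> //.
    exact: h1 Ip hp.
  by apply: chart_frac hp hq _; apply: mev_neq0.
have [e [p [Ip hp ep]]] := h2 _ Eu.
have [q hq eq] := @homog_lift s (msize s + e)%N (leq_trans (leq_addr _ _) (leqnSn _)).
have q0 : mev q v != 0 by rewrite -chart0 eq.
have hX : ('X_i0 : A) ^+ msize s \is (msize s).-homog by apply: homogX.
exists (msize s + e)%N, ('X_i0 ^+ msize s * p), q; split=> //; first exact: dhomogM.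
  exact: h3.
rewrite (chart_frac (dhomogM hX hp) hq (mev_neq0 q0)) rmorphM rmorphXn /= chart1 expr1n mul1r.
by rewrite ep eq.
Qed.

End Chart.

Lemma base_idealE (k : fieldType) (n : nat) (f : n.+1.-tuple {mpoly k[n]}) :
  base_ideal f = lin (tnth f).
Proof.
rewrite /base_ideal -gen_ideal_lin; congr (gen_ideal _ _).
apply/seteqP; split=> [p /= /tnthP [i ->]|_ [i _ <-]]; first by exists i.
exact: mem_tnth.
Qed.

Lemma homog_lifts (k : fieldType) M (x : ppoint k M.+1) (i0 : 'I_M.+1) (v0 : pcoord x 0 i0 = 1)
    (T : finType) (w : T -> {mpoly k[M]}) :
  exists e (p : T -> {mpoly k[M.+1]}), forall i, p i \is e.-homog /\ chart x i0 (p i) = w i.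
Proof.
pose e := (\sum_i msize (w i))%N.
have h i : exists p, p \is e.-homog /\ chart x i0 p = w i.
  have [|p hp ep] := @homog_lift k M x i0 v0 (w i) e; last by exists p.
  by rewrite /e (bigD1 i) //=; apply: leq_trans (leq_addr _ _) (leqnSn _).
by have [p hp] := choice h; exists e, p.
Qed.

Section StalkInvariants.
Variables (k : fieldType) (N d : nat) (f : N.+3.-tuple {mpoly k[N.+2]}) (x : ppoint k N.+2).
Variable i0 : 'I_N.+2.
Hypothesis v0 : pcoord x 0 i0 = 1.
Hypothesis fd : forall i, tnth f i \is d.-homog.
Local Notation A := {mpoly k[N.+2]}.
Local Notation W := {mpoly k[N.+1]}.
Local Notation ch := (chart x i0).

Definition local_gens i : W := ch (tnth f i).
Local Notation E := (lin local_gens).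
Local Notation ext := (extO (unchart x i0)).
Let uinj := unchart_inj v0.

Lemma chart_base_ideal p : base_ideal f p -> E (ch p).
Proof.
rewrite base_idealE => -[c ->]; exists (fun i => ch (c i)).
by rewrite rmorph_sum; apply: eq_bigr => i _; rewrite rmorphM.
Qed.

Lemma base_stalkE : base_stalk f x = ext E.
Proof.
apply: (stalk_idealE v0) => [e p Ip _|u [c ->]|a p].
- exact/loc_sub/chart_base_ideal.
- have [e [p hp]] := homog_lifts v0 c.
  exists (e + d)%N, (\sum_i p i * tnth f i); split.
  + by rewrite base_idealE; exists p.
  + by apply: rpred_sum => i _; apply: dhomogM => //; case: (hp i).
  + by rewrite rmorph_sum; apply: eq_bigr => i _; rewrite rmorphM /=; have [_ ->] := hp i.
by apply: idealMl; apply: gen_ideal_ideal.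
Qed.

Variables (c : nat) (mE : mpow c `<=` loc E).
Let iE t : is_ideal setT (loc (idealX setT E t)). Proof. exact/loc_ideal/idealX_ideal. Qed.

Lemma local_degreeE l : @clen k W setT [set 0] (loc E) setT l -> local_degree f x = l.
Proof.
move=> cl; rewrite /local_degree base_stalkE (stalkE v0) -(extO_loc uinj E).
apply: (mod_length_extO uinj (loc_ideal (lin_ideal _)) (@idealT _) mE) => //.
- exact: loc_loc.
- exact: loc_setT.
Qed.

Lemma samuel_lengthE t l :
  @clen k W setT [set 0] (loc (idealX setT E t.+1)) (loc (idealX setT E t)) l ->
  @mod_length _ {fraction A}^o (stalk x)
    (idealX (stalk x) (base_stalk f x) t) (idealX (stalk x) (base_stalk f x) t.+1) = l.
Proof.
move=> cl; rewrite base_stalkE (stalkE v0) !(extO_idealX uinj).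
rewrite -(extO_loc uinj (idealX setT E t)) -(extO_loc uinj (idealX setT E t.+1)).
apply: (mod_length_extO uinj (iE _) (iE _) (mpow_locX mE)) => //; try exact: loc_loc.
by apply/loc_mono/idealX_sub.
Qed.

Lemma local_multiplicityE (h : nat -> nat) (p : {poly rat}) t0 D :
  (forall t, @clen k W setT [set 0] (loc (idealX setT E t.+1)) (loc (idealX setT E t)) (h t)) ->
  (forall t, (t0 <= t)%N -> (h t)%:R = p.[t%:R]) -> size p = N.+1 ->
  lead_coef p = D%:R / N`!%:R -> local_multiplicity f x = D.
Proof.
move=> ch ph sp lp; rewrite /local_multiplicity; set S := [set e | _].
have fN : (N`!%:R : rat) != 0 by rewrite Num.Theory.pnatr_eq0 -lt0n fact_gt0.
(* The multiplicity is defined through the length of the quotient of the powers [t - 1] and [t],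
   hence a shift by one, which keeps the leading coefficient. *)
pose q : {poly rat} := 'X - 1%:P.
have sq : size q = 2%N by rewrite size_XsubC.
have eS P : (exists t1, forall t, (t1 <= t)%N ->
          P.[t.+1%:R] = (@mod_length _ {fraction A}^o (stalk x)
            (idealX (stalk x) (base_stalk f x) t) (idealX (stalk x) (base_stalk f x) t.+1))%:R) <->
    P = p \Po q.
  split=> [[t1 hP]|->].
    apply: (@poly_eq_large _ _ (maxn t0 t1).+1) => -[//|t]; rewrite ltnS geq_max => /andP [h0 h1].
    rewrite hP // (samuel_lengthE (ch t)) horner_comp ph //; congr (p.[_]).
    by rewrite /q hornerXsubC -natr1 addrK.
  exists t0 => t h0; rewrite (samuel_lengthE (ch t)) horner_comp ph //; congr (p.[_]).
  by rewrite /q hornerXsubC -natr1 addrK.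
have SD : S D.
  exists (p \Po q); split; first exact/eS.
    by rewrite size_comp_poly2 // size_XsubC.
  by rewrite lead_coef_comp ?sq // lead_coefXsubC expr1n mulr1 lp.
have [P [/eS eP _ lP]] : S (xget 0%N S) by apply: xgetI SD.
move: lP; rewrite eP lead_coef_comp ?sq // lead_coefXsubC expr1n mulr1 lp /=.
by move/(mulIf (invr_neq0 fN))/eqP; rewrite Num.Theory.eqr_nat => /eqP.
Qed.

End StalkInvariants.

(** * The Nullstellensatz *)

Lemma mpoly_rmorph (K : comNzRingType) (n : nat) (R : comNzRingType) (u : {rmorphism {mpoly K[n]} -> R}) p :
  u p = \sum_(m <- msupp p) u (p@_m)%:MP * \prod_i u 'X_i ^+ m i.
Proof.
rewrite [in LHS](mpolyE p) rmorph_sum; apply: eq_bigr => m _ /=.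
rewrite -mul_mpolyC rmorphM mpolyXE_id rmorph_prod; congr (_ * _).
by apply: eq_bigr => i _; rewrite rmorphXn.
Qed.

Lemma mpoly_rmorph_ext (K : comNzRingType) (n : nat) (R : comNzRingType)
    (u v : {rmorphism {mpoly K[n]} -> R}) :
  (forall c, u c%:MP = v c%:MP) -> (forall i, u 'X_i = v 'X_i) -> u =1 v.
Proof.
move=> hc hX p; rewrite (mpoly_rmorph u) (mpoly_rmorph v); apply: eq_bigr => m _; rewrite hc; congr (_ * _).
by apply: eq_bigr => i _; rewrite hX.
Qed.

(** * Nagata's change of variables *)

Section Nagata.
Variables (K : fieldType) (n D : nat).
Local Notation A := {mpoly K[n.+1]}.
Local Notation S := {mpoly K[n]}.

(** The variable of index 0 becomes the indeterminate of the polynomials over [S], and its power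
    [D ^ i] is added to the variable of index [i > 0]. *)
Definition nagata_base (o : option 'I_n) : {poly S} := if o is Some j then ('X_j)%:P else 0.
Definition nagata_gen (i : 'I_n.+1) : {poly S} := nagata_base (unlift ord0 i) + 'X^(D ^ i).
Definition nagata : A -> {poly S} := mmap (polyC \o @mpolyC n K) nagata_gen.
HB.instance Definition _ := GRing.RMorphism.on nagata.

Definition unnagata_coef : S -> A :=
  mmap (@mpolyC n.+1 K) (fun j => 'X_(lift ord0 j) - 'X_ord0 ^+ (D ^ lift ord0 j)).
HB.instance Definition _ := GRing.RMorphism.on unnagata_coef.
Definition unnagata : {poly S} -> A := horner_eval ('X_ord0) \o map_poly unnagata_coef.
HB.instance Definition _ := GRing.RMorphism.on unnagata.

Lemma nagataX i : nagata 'X_i = nagata_gen i.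
Proof. by rewrite /nagata mmapX mmap1U. Qed.

Lemma nagataC c : nagata c%:MP = c%:MP%:P.
Proof. by rewrite /nagata mmapC. Qed.

Lemma nagataK : cancel nagata unnagata.
Proof.
apply: (mpoly_rmorph_ext (u := unnagata \o nagata) (v := idfun)) => [c|i] /=.
  rewrite nagataC /unnagata /= map_polyC /horner_eval hornerC /= /unnagata_coef mmapC; by [].
rewrite nagataX /nagata_gen /nagata_base rmorphD /= rmorphXn /=.
have -> : unnagata 'X = 'X_ord0 by rewrite /unnagata /= map_polyX /horner_eval hornerX.
case: unliftP => [j ->|->].
  by rewrite /unnagata /= map_polyC /horner_eval hornerC /= /unnagata_coef mmapX mmap1U subrK.
by rewrite rmorph0 add0r expn0 expr1.
Qed.

Definition topc (p : {poly S}) a (c : K) := (size p <= a.+1)%N /\ p`_a = c%:MP.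

Lemma topcM p q a b c d : topc p a c -> topc q b d -> topc (p * q) (a + b) (c * d).
Proof.
move=> [sp ep] [sq eq]; split.
  apply: leq_trans (size_polyMleq _ _) _.
  by rewrite -subn1 leq_subLR add1n; apply: leq_trans (leq_add sp sq) _; rewrite addnS addSn.
have la : (a < (a + b).+1)%N by rewrite ltnS leq_addr.
rewrite coefM (bigD1 (Ordinal la)) //= addKn ep eq -mpolyCM big1 ?addr0 // => i /eqP ia.
case: (ltngtP i a) => [lt|lt|e]; last by case: ia; apply: val_inj.
  rewrite [q`_ _]nth_default ?mulr0 //; apply: leq_trans sq _.
  by have := ltn_ord i; lia.
by rewrite nth_default ?mul0r //; apply: leq_trans sp lt.
Qed.

Lemma topcX p a c e : topc p a c -> topc (p ^+ e) (a * e) (c ^+ e).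
Proof.
move=> hp; elim: e => [|e IH]; first by rewrite muln0 !expr0; split; rewrite ?size_poly1 ?coef1.
by rewrite !exprS mulnS; apply: topcM.
Qed.

Definition wt (m : 'X_{1..n.+1}) := (\sum_(i < n.+1) D ^ i * m i)%N.

Lemma nagata_mon m : (0 < D)%N -> topc (nagata 'X_[m]) (wt m) 1.
Proof.
move=> D0; rewrite mpolyXE_id rmorph_prod /wt.
have e1 : (1 : K) = \prod_(i < n.+1) 1 by rewrite big1.
rewrite e1; apply: (big_ind3 (fun p a c => topc p a c)) => [||i _].
- by split; rewrite ?size_poly1 ?coef1.
- by move=> p1 a1 c1 p2 a2 c2; apply: topcM.
have Di : (0 < D ^ i)%N by rewrite expn_gt0 D0.
suff h1 : topc (nagata_gen i) (D ^ i) 1.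
  by have := topcX (m i) h1; rewrite expr1n rmorphXn /= nagataX.
rewrite /nagata_gen; move: (D ^ i)%N Di => w w0; split.
  apply: leq_trans (size_polyD _ _) _; rewrite geq_max size_polyXn leqnn andbT.
  case: unlift => [j|]; rewrite /nagata_base; last by rewrite size_poly0.
  exact: leq_trans (size_polyC_leq1 _) (ltn0Sn _).
have h0 o : (nagata_base o)`_w = 0.
  case: o => [j|]; last by rewrite coef0.
  by rewrite coefC eqn0Ngt w0.
by rewrite coefD coefXn eqxx h0 add0r.
Qed.

Lemma wt_inj (m m' : 'X_{1..n.+1}) : (forall i, m i < D)%N -> (forall i, m' i < D)%N ->
  wt m = wt m' -> m = m'.
Proof.
move=> hm hm' e; apply/mnmP; move: e; rewrite /wt.
have : forall r (a b : 'I_r -> nat), (forall i, a i < D)%N -> (forall i, b i < D)%N ->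
    (\sum_(i < r) D ^ i * a i = \sum_(i < r) D ^ i * b i)%N -> forall i, a i = b i; last by apply.
elim=> [|r IH] a b ha hb; first by move=> _ [].
have eS (c : 'I_r.+1 -> nat) : (\sum_(i < r.+1) D ^ i * c i = (\sum_(i < r) D ^ i * c (lift ord0 i)) * D + c ord0)%N.
  rewrite big_ord_recl expn0 mul1n addnC big_distrl /=; congr (_ + _)%N.
  by apply: eq_bigr => i _; rewrite /bump /= add1n expnS -mulnA mulnC.
rewrite !eS => e.
have D0 : (0 < D)%N := leq_ltn_trans (leq0n _) (ha ord0).
have e0 : a ord0 = b ord0.
  by have := congr1 (modn^~ D) e; rewrite !modnMDl !modn_small.
have e1 : forall i, a (lift ord0 i) = b (lift ord0 i).
  apply: IH => [i|i|]; rewrite ?ha ?hb //.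
  by have := congr1 (divn^~ D) e; rewrite !divnMDl // !divn_small // !addn0.
by move=> i; case: (unliftP ord0 i) => [j ->|->].
Qed.

End Nagata.

(** With [D] above all exponents, the degrees [wt] of the transformed monomials are expansions in
    base [D]; they are distinct, so the largest one does not cancel. *)
Lemma nagata_monic (K : fieldType) n (g : {mpoly K[n.+1]}) : g != 0 ->
  exists D a c, c != 0 /\ topc (nagata D g) a c.
Proof.
move=> g0; pose D := msize g; exists D.
have D0 : (0 < D)%N by rewrite lt0n msize_poly_eq0.
have sD m : m \in msupp g -> forall i, (m i < D)%N.
  move=> mg i; apply: leq_ltn_trans (msize_mdeg_lt mg).
  by rewrite mdegE (bigD1 i) //= leq_addr.
have [m0 m0g m0max] : exists2 m, m \in msupp g & forall m', m' \in msupp g -> (wt D m' <= wt D m)%N.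
  have exw : exists w, has (fun m => wt D m == w) (msupp g).
    by exists (wt D (mlead g)); apply/hasP; exists (mlead g) => //; apply: mlead_supp.
  have bd w : has (fun m => wt D m == w) (msupp g) -> (w <= \sum_(m <- msupp g) wt D m)%N.
    by move/hasP => [m mg /eqP <-]; rewrite (bigD1_seq m) ?msupp_uniq //= leq_addr.
  case: (ex_maxnP exw bd) => w /hasP [m mg /eqP ew] hmax; exists m => // m' mg'.
  by rewrite ew; apply: hmax; apply/hasP; exists m'.
exists (wt D m0), g@_m0; split; first by rewrite -mcoeff_msupp.
have term m : nagata D (g@_m *: 'X_[m]) = (g@_m)%:MP%:P * nagata D 'X_[m].
  by rewrite -mul_mpolyC rmorphM /= nagataC.
rewrite [X in nagata D X]mpolyE rmorph_sum; split.
  apply: leq_trans (size_sum _ _ _) _; apply/bigmax_leqP_seq => m mg _ /=.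
  rewrite term mul_polyC; apply: leq_trans (size_scale_leq _ _) _.
  by have [h _] := @nagata_mon K n D m D0; apply: leq_trans h _; rewrite ltnS m0max.
rewrite coef_sum (bigD1_seq m0) ?msupp_uniq //= big1_seq ?addr0 => [|m /andP [mm0 mg]].
  by rewrite term coefCM; have [_ ->] := @nagata_mon K n D m0 D0; rewrite mulr1.
rewrite term coefCM; have [h _] := @nagata_mon K n D m D0; rewrite nth_default ?mulr0 //.
apply: leq_trans h _; rewrite ltn_neqAle m0max // andbT.
by apply: contra_neq mm0; apply: wt_inj; apply: sD.
Qed.

Section DeterminantTrick.
Variables (K : fieldType) (n : nat) (a : 'I_n -> K).
Local Notation S := {mpoly K[n]}.
Local Notation ev := (map_poly (meval a)).
Variable J : set {poly S}.
Hypothesis iJ : is_ideal setT J.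

Lemma fiber_proper G p : J G -> G \is monic -> J p -> ev p = 1 ->
  exists s : S, J s%:P /\ s.@[a] != 0.
Proof.
move=> JG Gm Jp ep; pose e := (size G).-1.
have sG : size G = e.+1 by rewrite /e prednK // lt0n size_poly_eq0 monic_neq0.
have sevG : size (ev G) = e.+1.
  by rewrite size_map_poly_id0 // (monicP Gm) /= meval1 oner_neq0.
case: e sG sevG => [sG _|e sG sevG].
  exists 1; rewrite meval1 oner_neq0; split=> //; move: JG.
  by rewrite [G]size1_polyC ?sG //; move/monicP: Gm; rewrite lead_coefE sG => ->.
pose w (j : 'I_e.+1) : {poly S} := 'X^j * (1 - p).
pose q j := Pdiv.CommonRing.rdivp (w j) G; pose r j := Pdiv.CommonRing.rmodp (w j) G.
have ew j : w j = q j * G + r j by apply: Pdiv.RingMonic.rdivp_eq.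
have sr j : (size (r j) <= e.+1)%N.
  by have := Pdiv.Ring.ltn_rmodpN0 (w j) (monic_neq0 Gm); rewrite sG ltnS.
have evr j : ev (r j) = 0.
  have : ev (w j) = 0 by rewrite rmorphM rmorphB rmorph1 /= ep subrr mulr0.
  rewrite ew rmorphD rmorphM /= => h.
  have [q0|q0] := eqVneq (ev (q j)) 0; first by move: h; rewrite q0 mul0r add0r.
  have := congr1 (fun z : {poly K} => size z) (addr0_eq h).
  have G0 : ev G != 0 by rewrite -size_poly_eq0 sevG.
  rewrite size_polyN size_mul // sevG addnS /= => hs.
  have : (size (ev (r j)) <= e.+1)%N by apply/leq_sizeP => l hl; rewrite coef_map (nth_default _ (leq_trans (sr j) hl)) /= meval0.
  by rewrite -hs -{2}(add0n e.+1) leq_add2r leqn0 size_poly_eq0 (negbTE q0).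
have Jr (j : 'I_e.+1) : J ('X^j - r j).
  have -> : 'X^j - r j = 'X^j * p + q j * G.
    have := ew j; rewrite /w mulrBr mulr1 => h.
    by apply/eqP; rewrite subr_eq -addrA -h addrC subrK.
  by apply: (idealD iJ); apply: (idealMl _ iJ).
pose U : 'M[S]_e.+1 := \matrix_(j, i) ((j == i)%:R - (r j)`_i).
exists (\det U); split; last first.
  rewrite -det_map_mx; suff -> : map_mx (meval a) U = 1%:M by rewrite det1 oner_neq0.
  apply/matrixP => j i; rewrite !mxE rmorphB rmorph_nat /=.
  by have := congr1 (fun z : {poly K} => z`_i) (evr j); rewrite coef_map coef0 => ->; rewrite subr0.
have JU j : J (\sum_i (U j i)%:P * 'X^i).
  suff -> : \sum_i (U j i)%:P * 'X^i = 'X^j - r j by [].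
  under eq_bigr do rewrite mxE rmorphB mulrBl; rewrite sumrB; congr (_ - _).
    rewrite (bigD1 j) //= eqxx mul1r big1 ?addr0 // => i /negbTE ij.
    by rewrite eq_sym ij mul0r.
  apply/polyP => i; rewrite coef_sum; case: (ltnP i e.+1) => ie.
    rewrite (bigD1 (Ordinal ie)) //= coefCM coefXn eqxx mulr1 big1 ?addr0 // => l il.
    rewrite coefCM coefXn; case: eqP => [eil|]; last by rewrite mulr0.
    by case/eqP: il; apply: val_inj.
  rewrite [RHS]nth_default ?(leq_trans (sr j)) // big1 // => l _.
  rewrite coefCM coefXn; case: eqP => [eil|]; last by rewrite mulr0.
  by move: (ltn_ord l); rewrite -eil ltnNge ie.
have : J (\sum_j (\adj U ord0 j)%:P * \sum_i (U j i)%:P * 'X^i).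
  by apply: (ideal_sum _ iJ) => j _; apply: (idealMl _ iJ).
suff -> : \sum_j (\adj U ord0 j)%:P * \sum_i (U j i)%:P * 'X^i = (\det U)%:P by [].
under eq_bigr do rewrite mulr_sumr; rewrite exchange_big /=.
transitivity (\sum_i ((\adj U *m U) ord0 i)%:P * 'X^i).
  apply: eq_bigr => i _; rewrite mxE rmorph_sum mulr_suml; apply: eq_bigr => j _.
  by rewrite rmorphM mulrA.
rewrite mul_adj_mx (bigD1 ord0) //= mxE eqxx expr0 mulr1 big1 ?addr0 // => i i0.
by rewrite mxE eq_sym (negbTE i0) mul0r.
Qed.

End DeterminantTrick.

Section Nullstellensatz.
Variable K : closedFieldType.

Local Notation ev a := (map_poly (meval a)).

(** Induction on [n]. After Nagata's change of variables the ideal contains a monic polynomial. Its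
    contraction to [S] has a zero [a] by induction, and [fiber_proper] shows that the ideal of the
    fibre over [a] is generated by a nonconstant polynomial, which has a root. *)
Lemma weak_nullstellensatz n (I : set {mpoly K[n]}) : is_ideal setT I -> ~ I 1 ->
  exists c : 'I_n -> K, forall p, I p -> p.@[c] = 0.
Proof.
elim: n I => [|n IH] I iI nI1.
  exists (fun=> 0) => p Ip.
  have ep : p = (p@_0)%:MP.
    by apply/mpolyP => m; have -> : m = 0%MM by [apply/mnmP => -[]]; rewrite mcoeffC eqxx mulr1.
  rewrite ep mevalC; apply/eqP; apply: contra_notT nI1 => p0.
  have := idealMl (p@_0)^-1%:MP iI Ip; by rewrite {2}ep -mpolyCM mulVf.
case: (pselect (forall p, I p -> p = 0)) => [h|h].
  by exists (fun=> 0) => p /h ->; rewrite meval0.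
have [g Ig g0] : exists2 g, I g & g != 0.
  apply: contrapT => h'; apply: h => p Ip; apply: contrapT => /eqP p0; apply: h'; by exists p.
have [D [e [c [c0 [sg cg]]]]] := nagata_monic g0.
pose J : set {poly {mpoly K[n]}} := [set q | I (unnagata D q)].
have iJ : is_ideal setT J.
  apply/idealP; split; rewrite /J /=; first by rewrite rmorph0; apply: ideal0.
  - by move=> u v; rewrite rmorphD; apply: (idealD iI).
  - by move=> u v; rewrite rmorphM; apply: (idealMl _ iI).
have JN p : I p -> J (nagata D p) by rewrite /J /= nagataK.
pose G := c^-1%:MP%:P * nagata D g.
have JG : J G by apply: (idealMl _ iJ); apply: JN.
have Gm : G \is monic.
  have eG : G`_e = 1 by rewrite coefCM cg -mpolyCM mulVf.
  have sG : (size G <= e.+1)%N by rewrite /G mul_polyC; apply: leq_trans (size_scale_leq _ _) sg.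
  apply/monicP; rewrite lead_coefE; suff -> : size G = e.+1 by [].
  apply/eqP; rewrite eqn_leq sG /=; apply: contraT; rewrite -leqNgt => h1.
  by move: eG; rewrite nth_default // => /esym/eqP; rewrite oner_eq0.
have [a ha] : exists a : 'I_n -> K, forall s : {mpoly K[n]}, J s%:P -> s.@[a] = 0.
  apply: (IH [set s | J s%:P]) => /=.
    apply/idealP; split; rewrite /=; first by rewrite polyC0; apply: ideal0.
    - by move=> u v; rewrite polyCD; apply: (idealD iJ).
    - by move=> u v; rewrite polyCM; apply: (idealMl _ iJ).
  by rewrite /J /= polyC1 rmorph1.
have evG : ev a G != 0.
  by apply: monic_neq0; apply: monic_map.
have exs : exists i, `[< exists q, [/\ J q, ev a q != 0 & size (ev a q) = i] >].
  by exists (size (ev a G)); apply/asboolP; exists G.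
case: (ex_minnP exs) => i /asboolP [h0 [Jh h0n sh]] imin.
have dvd q : J q -> ev a h0 %| ev a q.
  move=> Jq; rewrite /dvdp; apply: contraT => r0.
  pose hq := map_poly (@mpolyC n K) (ev a q %/ ev a h0).
  have evh : ev a hq = ev a q %/ ev a h0.
    by apply/polyP => l; rewrite !coef_map /= mevalC.
  have er : ev a (q - hq * h0) = ev a q %% ev a h0.
    by rewrite rmorphB rmorphM /= evh {1}(divp_eq (ev a q) (ev a h0)) addrAC subrr add0r.
  have := imin (size (ev a q %% ev a h0)); rewrite -sh leqNgt ltn_modp h0n => h1.
  apply: h1; apply/asboolP; exists (q - hq * h0); rewrite er; split=> //.
  by apply: (idealB iJ) => //; apply: (idealMl _ iJ).
have [b rb] : exists b, root (ev a h0) b.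
  apply/closed_rootP; apply/negP => /size_poly1P [z z0 ez].
  have [||s [Js sa]] := @fiber_proper _ _ a J iJ G (z^-1%:MP%:P * h0) JG Gm.
  - exact: (idealMl _ iJ).
  - by rewrite rmorphM /= map_polyC /= mevalC ez -polyCM mulVf.
  by rewrite ha ?eqxx in sa.
pose pt (l : 'I_n.+1) : K := (if unlift ord0 l is Some j then a j else 0) + b ^+ (D ^ l).
exists pt => p Ip.
have epe : horner_eval b (ev a (nagata D p)) = p.@[pt].
  apply: (mpoly_rmorph_ext (u := horner_eval b \o ev a \o nagata D) (v := meval pt)) => [z|l] /=.
    by rewrite nagataC mevalC map_polyC /= mevalC /horner_eval hornerC.
  rewrite nagataX mevalXU /nagata_gen /nagata_base /pt rmorphD /= map_polyXn.
  rewrite /horner_eval hornerD hornerXn; congr (_ + _).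
  case: unlift => [j|]; last by rewrite rmorph0 horner0.
  by rewrite map_polyC /= mevalXU hornerC.
rewrite -epe /horner_eval; have /dvdpP [z ->] := dvd _ (JN _ Ip).
by rewrite hornerM (rootP rb) mulr0.
Qed.

Fact common_den (R : comNzRingType) (H1 H2 f1 f2 a1 a2 : R) : H1 * f1 = a1 -> H2 * f2 = a2 ->
  H1 * H2 * (f1 + f2) = H2 * a1 + H1 * a2.
Proof. by move=> <- <-; ring. Qed.

Definition rab_up n : {mpoly K[n]} -> {mpoly K[n.+1]} :=
  mmap (@mpolyC n.+1 K) (fun j => 'X_(lift ord0 j)).
HB.instance Definition _ n := GRing.RMorphism.on (@rab_up n).

Lemma rab_up_eval n (c : 'I_n.+1 -> K) p : (rab_up p).@[c] = p.@[fun j => c (lift ord0 j)].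
Proof.
apply: (mpoly_rmorph_ext (u := meval c \o @rab_up n) (v := meval (fun j => c (lift ord0 j)))) => [z|l] /=.
  by rewrite /rab_up mmapC !mevalC.
by rewrite /rab_up mmapX mmap1U !mevalXU.
Qed.

(** Rabinowitsch's trick: the additional variable, of index 0, stands for the inverse of [h]. *)
Definition rab_frac n (h : {mpoly K[n]}) : {mpoly K[n.+1]} -> {fraction {mpoly K[n]}} :=
  mmap (@tofrac {mpoly K[n]} \o @mpolyC n K)
    (fun l => if unlift ord0 l is Some j then tofrac 'X_j else (tofrac h)^-1).
HB.instance Definition _ n h := GRing.RMorphism.on (@rab_frac n h).

Lemma rab_fracX n (h : {mpoly K[n]}) : rab_frac h 'X_ord0 = (tofrac h)^-1.
Proof. by rewrite /rab_frac mmapX mmap1U unlift_none. Qed.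

Lemma rab_frac_lift n (h : {mpoly K[n]}) j : rab_frac h 'X_(lift ord0 j) = tofrac 'X_j.
Proof. by rewrite /rab_frac mmapX mmap1U liftK. Qed.

Lemma rab_fracC n (h : {mpoly K[n]}) c : rab_frac h c%:MP = tofrac c%:MP.
Proof. by rewrite /rab_frac mmapC. Qed.

Lemma rab_frac_up n (h p : {mpoly K[n]}) : rab_frac h (rab_up p) = tofrac p.
Proof.
apply: (mpoly_rmorph_ext (u := rab_frac h \o @rab_up n) (v := @tofrac {mpoly K[n]})) => [z|l] /=.
  by rewrite /rab_up mmapC rab_fracC.
by rewrite /rab_up mmapX mmap1U rab_frac_lift.
Qed.

Lemma nullstellensatz n (T : finType) (g : T -> {mpoly K[n]}) h :
  (forall c : 'I_n -> K, (forall i, (g i).@[c] = 0) -> h.@[c] = 0) ->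
  exists r, lin g (h ^+ r).
Proof.
move=> hz; have [->|h0] := eqVneq h 0.
  by exists 1%N; rewrite expr1; apply: ideal0; apply: lin_ideal.
pose gg (o : option T) := if o is Some i then rab_up (g i) else 1 - 'X_ord0 * rab_up h.
have [u e1] : lin gg 1.
  apply: contrapT => /(weak_nullstellensatz (lin_ideal gg)) [c hc].
  have hc0 : h.@[fun j => c (lift ord0 j)] = 0.
    by apply: hz => i; rewrite -rab_up_eval; apply: (hc _ (lin_gen gg (Some i))).
  have := hc _ (lin_gen gg None); rewrite /= mevalB meval1 mevalM rab_up_eval hc0 mulr0 subr0.
  by move/eqP; rewrite oner_eq0.
have hF : tofrac h != 0 by rewrite tofrac_eq0.
have den p : exists r a, tofrac (h ^+ r) * rab_frac h p = tofrac a.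
  rewrite [p]mpolyE; apply: (big_ind (fun p => exists r a, tofrac (h ^+ r) * rab_frac h p = tofrac a)).
  - by exists 0%N, 0; rewrite rmorph0 mulr0 tofrac0.
  - move=> p1 p2 [r1 [a1 e1']] [r2 [a2 e2]]; exists (r1 + r2)%N, (h ^+ r2 * a1 + h ^+ r1 * a2).
    rewrite rmorphD exprD tofracD !tofracM; exact: common_den e1' e2.
  move=> m _; exists (m ord0), (p@_m *: \prod_j 'X_j ^+ m (lift ord0 j)).
  rewrite -mul_mpolyC rmorphM mpolyXE_id rmorph_prod big_ord_recl /=.
  rewrite [rab_frac h ('X_ord0 ^+ _)]rmorphXn /= rab_fracX mulrCA mulrA -mul_mpolyC [in RHS]tofracM rmorph_prod /=.
  rewrite rab_fracC.
  rewrite -!mulrA; congr (_ * _); rewrite mulrA exprVn [tofrac (h ^+ _)]rmorphXn divff ?expf_neq0 // mul1r.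
  apply: eq_bigr => j _; rewrite !rmorphXn; congr (_ ^+ _).
  by rewrite /= rab_frac_lift.
have [r hr] := choice (fun o => den (u o)).
have [a ha] := choice hr.
exists (\sum_i r (Some i))%N.
exists (fun i => a (Some i) * h ^+ (\sum_(j | j != i) r (Some j))).
apply/eqP; rewrite -tofrac_eq; apply/eqP; rewrite rmorph_sum /=.
have := congr1 (rab_frac h) e1; rewrite rmorph1 rmorph_sum /= => e1'.
rewrite -[LHS]mulr1 e1' mulr_sumr (bigD1 None) //= rmorphM rmorphB rmorphM rmorph1 /= rab_frac_up rab_fracX mulVf //.
rewrite subrr !mulr0 add0r.
rewrite (reindex_omap Some id) /=; last by case.
rewrite (eq_bigl xpredT) => [|i]; last by rewrite eqxx.
apply: eq_bigr => i _; rewrite (bigD1 i) //= exprD !rmorphM /= -ha rab_frac_up.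
by rewrite mulrACA mulrA.
Qed.

End Nullstellensatz.

(** * Base points and their relations *)

Lemma homog_scale (k : comNzRingType) n e (p : {mpoly k[n]}) (t : k) (c : 'I_n -> k) :
  p \is e.-homog -> p.@[fun i => t * c i] = t ^+ e * p.@[c].
Proof.
move=> hp; rewrite !meval_msupp mulr_sumr big_seq [RHS]big_seq; apply: eq_bigr => m mp.
have <- : mdeg m = e by apply: (dhomogP _ _ _ hp).
rewrite mulrCA; congr (_ * _); rewrite /mmap1 mdegE -prodrXr -big_split.
by apply: eq_bigr => i _ /=; rewrite exprMn.
Qed.

Section Points.
Variables (k : fieldType) (n : nat).
Implicit Types (x z : ppoint k n).

Lemma normP x : exists i, pcoord x 0 i = 1 /\ forall j : 'I_n, (j < i)%N -> pcoord x 0 j = 0.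
Proof.
case: x => v /= /existsP [i /andP [/eqP vi /forallP h]]; exists i; split=> // j ji.
by have := h j; rewrite ji => /eqP.
Qed.

Lemma ppoint_prop x z (t : k) : pcoord x = t *: pcoord z -> x = z.
Proof.
move=> e; have [i [xi xlt]] := normP x; have [j [zj zlt]] := normP z.
have ei l : pcoord x 0 l = t * pcoord z 0 l by rewrite e mxE.
have t0 : t != 0 by apply/eqP => t0; have := ei i; rewrite t0 mul0r xi => /eqP; rewrite oner_eq0.
have eij : i = j.
  apply: val_inj; apply/eqP; rewrite eqn_leq; apply/andP; split; rewrite leqNgt; apply/negP => lt.
    by have := ei j; rewrite (xlt _ lt) zj mulr1 => /esym/eqP; rewrite (negbTE t0).
  by have := ei i; rewrite (zlt _ lt) xi mulr0 => /eqP; rewrite oner_eq0.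
have t1 : t = 1 by have := ei i; rewrite xi eij zj mulr1.
by apply: val_inj; rewrite /= e t1 scale1r.
Qed.

Lemma separating_form x z : x != z -> exists2 m : {mpoly k[n]}, m \is 1.-homog &
  mev m (pcoord z) = 0 /\ mev m (pcoord x) != 0.
Proof.
move=> xz; have [i [zi _]] := normP z.
have [j hj] : exists j, pcoord x 0 j - pcoord x 0 i * pcoord z 0 j != 0.
  apply/existsP; apply: contra_neqT xz => /existsPn h.
  apply: (@ppoint_prop _ _ (pcoord x 0 i)); apply/rowP => j; rewrite mxE.
  by apply/eqP; rewrite -subr_eq0; apply/negPn/h.
exists ('X_j - pcoord z 0 j *: 'X_i); first by rewrite rpredB ?rpredZ // dhomogX /= mdeg1.
rewrite /mev !mevalB !mevalZ !mevalXU zi mulr1 subrr; split=> //.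
by rewrite mulrC.
Qed.

Lemma ppoint_of (c : 'I_n -> k) : (exists i, c i != 0) ->
  exists x (t : k), t != 0 /\ forall i, c i = t * pcoord x 0 i.
Proof.
case=> i0 ci0; have exi : exists i : nat, [exists j : 'I_n, (j == i :> nat) && (c j != 0)].
  by exists i0; apply/existsP; exists i0; rewrite eqxx.
case: (ex_minnP exi) => i /existsP [j /andP [/eqP ji cj]] imin.
pose v : 'rV[k]_n := \row_l ((c j)^-1 * c l).
have nv : normalized v.
  apply/existsP; exists j; rewrite mxE mulVf // eqxx /=; apply/forallP => l; apply/implyP => lj.
  rewrite mxE; case: (eqVneq (c l) 0) => [->|cl]; first by rewrite mulr0.
  have : (i <= l)%N by apply: imin; apply/existsP; exists l; rewrite eqxx.
  by rewrite -ji leqNgt lj.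
exists (PPoint nv), (c j); split=> // l; by rewrite mxE mulrA mulfV // mul1r.
Qed.

End Points.

Section Graded.
Variables (R : comNzRingType) (n : nat).
Local Notation A := {mpoly R[n]}.
Local Notation ideal := (@is_ideal A setT).

Lemma pihomogMX D (m : 'X_{1..n}) (p : A) : pihomog mdeg D ('X_[m] * p) =
  if (mdeg m <= D)%N then 'X_[m] * pihomog mdeg (D - mdeg m) p else 0.
Proof.
rewrite [p in LHS]mpolyE mulr_sumr raddf_sum; case: ifP => mD.
  transitivity ('X_[m] * \sum_(i <- msupp p)
      (if mdeg i == (D - mdeg m)%N then p@_i *: 'X_[i] else 0)); last by rewrite -big_mkcond pihomogE.
  rewrite mulr_sumr; apply: eq_bigr => i _ /=.
  rewrite -scalerAr -mpolyXD linearZ /= pihomogX /= mdegD -{1}(subnKC mD) eqn_add2l.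
  by case: ifP => _; rewrite ?scaler0 ?mulr0 // mpolyXD scalerAr.
rewrite big1 // => i _ /=; rewrite -scalerAr -mpolyXD linearZ /= pihomogX /= mdegD.
by case: eqP => [e|_]; rewrite ?scaler0 //; move: mD; rewrite -e leq_addr.
Qed.

Lemma pihomogM_homog d D (a p : A) : (d <= D)%N -> a \is d.-homog ->
  pihomog mdeg D (a * p) = a * pihomog mdeg (D - d) p.
Proof.
move=> dD ha; rewrite [a]mpolyE !mulr_suml raddf_sum /= big_seq [RHS]big_seq.
apply: eq_bigr => m ma; have dm : mdeg m = d by apply: (dhomogP _ _ _ ha).
by rewrite -!scalerAl linearZ /= pihomogMX dm dD.
Qed.

Definition graded (E : set A) := forall u D, E u -> E (pihomog mdeg D u).

Lemma graded_mul (E : set A) a u D : ideal E -> (forall D, E (pihomog mdeg D u)) ->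
  E (pihomog mdeg D (a * u)).
Proof.
move=> iE hu; rewrite [a]mpolyE mulr_suml raddf_sum; apply: (ideal_sum _ iE) => m _ /=.
rewrite -scalerAl linearZ /= pihomogMX -mul_mpolyC; apply: (idealMl _ iE).
by case: ifP => _; [apply: (idealMl _ iE)|apply: (ideal0 iE)].
Qed.

Lemma graded_gen (G : set A) : (forall u D, G u -> gen_ideal setT G (pihomog mdeg D u)) ->
  graded (gen_ideal setT G).
Proof.
move=> h; suff s : gen_ideal setT G `<=` [set u | forall D, gen_ideal setT G (pihomog mdeg D u)].
  by move=> u D /s.
have iG := gen_ideal_ideal setT G.
apply: gen_ideal_min => [|u Gu D]; last exact: h.
apply/idealP; split=> [D|u v hu hv D|a v hv D] /=.
- by rewrite raddf0; apply: (ideal0 iG).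
- by rewrite raddfD; exact: (idealD iG (hu D) (hv D)).
- exact: graded_mul.
Qed.

Lemma graded_lin (T : finType) (g : T -> A) : (forall i, exists d, g i \is d.-homog) ->
  graded (lin g).
Proof.
move=> hg; rewrite -gen_ideal_lin; apply: graded_gen => _ D [i _ <-].
have [d hd] := hg i; have iG := gen_ideal_ideal setT (range g).
have [<-|dD] := eqVneq d D; first by rewrite pihomog_dE //; apply: gen_ideal_sub; exists i.
by rewrite (pihomog_ne0 dD hd); apply: (ideal0 iG).
Qed.

Lemma pihomog_expand (u : A) : exists K, u = \sum_(e < K) pihomog mdeg e u.
Proof. by exists (msize u); apply: pihomog_partitionE. Qed.

Lemma graded_idealM (I J : set A) : graded I -> graded J -> graded (idealM setT I J).
Proof.
move=> gI gJ; apply: graded_gen => _ D [a Ia [b Jb <-]].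
have iG := @idealM_ideal _ I J.
have [K ->] := pihomog_expand a; rewrite mulr_suml raddf_sum; apply: (ideal_sum _ iG) => e _ /=.
have [eD|De] := leqP e D.
  rewrite (pihomogM_homog _ eD (pihomogP _ _ _)); apply: idealM_mem; [exact: gI|exact: gJ].
have [K' ->] := pihomog_expand b; rewrite mulr_sumr raddf_sum; apply: (ideal_sum _ iG) => e' _ /=.
have h : pihomog mdeg e a * pihomog mdeg e' b \is (e + e').-homog.
  by apply: dhomogM; apply: pihomogP.
rewrite (pihomog_ne0 _ h); first exact: (ideal0 iG).
by rewrite gtn_eqF //; apply: leq_trans De (leq_addr _ _).
Qed.

Lemma graded_idealX (I : set A) m : graded I -> graded (idealX setT I m).
Proof. by move=> gI; elim: m => [//|m IH]; rewrite idealXS; apply: graded_idealM. Qed.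

Lemma idealX_add1 (I E : set A) (l : A) r m : ideal I ->
  (forall a, E a -> exists i c, [/\ I i & a = i + c * l]) ->
  idealX setT E (r + m) `<=` [set u | exists a b, u = l ^+ r * a + b /\ idealX setT I m b].
Proof.
move=> iI hE; have [s] := ubnP (r + m); elim: s r m => // s IH r m; rewrite ltnS => rs.
case: r rs => [|r] rs; first by move=> u _; exists u, 0; rewrite mul1r addr0; split=> //; apply: (ideal0 (@idealX_ideal _ I m)).
case: m rs => [|m] rs; first by move=> u _; exists 0, u; rewrite mulr0 add0r.
have iX := @idealX_ideal _ I m.+1.
rewrite addSn idealXS; apply: idealM_min.
  apply/idealP; split.
  - by exists 0, 0; rewrite mulr0 addr0; split=> //; apply: (ideal0 iX).
  - move=> _ _ [a [b [-> hb]]] [a' [b' [-> hb']]]; exists (a + a'), (b + b').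
    by rewrite mulrDr addrACA; split=> //; apply: (idealD iX).
  - move=> c _ [a [b [-> hb]]]; exists (c * a), (c * b).
    by rewrite mulrDr mulrCA; split=> //; apply: (idealMl _ iX).
move=> u v /hE [i [c [Ii ->]]] hv.
have [a1 [b1 [e1 h1]]] : exists a b, v = l ^+ r.+1 * a + b /\ idealX setT I m b.
  by apply: (IH r.+1 m); [rewrite addSn -addnS; exact: rs|rewrite addSn -addnS].
have [a2 [b2 [e2 h2]]] : exists a b, v = l ^+ r * a + b /\ idealX setT I m.+1 b.
  by apply: (IH r m.+1); [move: rs; rewrite addSn|].
exists (i * a1 + c * a2), (i * b1 + c * l * b2); split; last first.
  by apply: (idealD iX); [rewrite idealXS; exact: idealM_mem|exact: (idealMl _ iX)].
rewrite mulrDl {1}e1 e2 exprS; ring.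
Qed.

End Graded.

Section BaseLocus.
Variables (k : closedFieldType) (N d : nat) (f : N.+3.-tuple {mpoly k[N.+2]}).
Hypothesis fd : forall i, tnth f i \is d.-homog.
Hypothesis finX : finite_set (base_points f).
Local Notation A := {mpoly k[N.+2]}.
Local Notation I := (lin (tnth f)).
Local Notation X := (base_points f).

Definition vanishing : set A :=
  [set a | forall c : 'I_N.+2 -> k, (forall i, (tnth f i).@[c] = 0) -> a.@[c] = 0].

Lemma vanishing_ideal : is_ideal setT vanishing.
Proof.
apply/idealP; split=> [c _|u v hu hv c hc|a v hv c hc]; first by rewrite meval0.
  by rewrite mevalD hu // hv // addr0.
by rewrite mevalM hv // mulr0.
Qed.

Lemma vanishing_homog e a : (0 < e)%N -> a \is e.-homog -> (forall x, X x -> mev a (pcoord x) = 0) ->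
  vanishing a.
Proof.
move=> e0 ha h c hc; case: (pselect (exists i, c i != 0)) => [/ppoint_of [x [t [t0 ec]]]|nc].
  have ev p e' : p \is e'.-homog -> p.@[c] = t ^+ e' * mev p (pcoord x).
    move=> hp; rewrite -(homog_scale t _ hp); apply: meval_eq => i; exact: ec.
  rewrite (ev _ _ ha) h ?mulr0 // => i; have := hc i; rewrite (ev _ _ (fd i)).
  by move/eqP; rewrite mulf_eq0 expf_eq0 (negbTE t0) andbF => /eqP.
have ec : a.@[c] = a.@[fun i => 0 * c i].
  apply: meval_eq => i; rewrite mul0r; apply/eqP; apply: contra_notT nc => ci.
  by exists i.
by rewrite ec (homog_scale _ _ ha) expr0n (gtn_eqF e0) mul0r.
Qed.

(** The vanishing ideal has finitely many generators, each with a power in [I]; a monomial of large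
    degree in them contains a high enough power of one of them. *)
Lemma vanishing_pow m : exists R, idealX setT vanishing R `<=` idealX setT I m.
Proof.
have [s [sV Vs]] := hilbert_basis vanishing_ideal.
have h (i : 'I_(size s)) : exists r, I (s`_i ^+ r).
  by apply: nullstellensatz => c hc; apply: (sV s`_i) => //; apply: mem_nth.
have [r hr] := choice h.
pose rm := (\sum_i r i)%N.
exists (size s * (rm * m)).+1 => u hu.
have hu' : idealX setT (lin (fun i : 'I_(size s) => s`_i)) (size s * (rm * m)).+1 u.
  by apply: idealX_mono hu.
case/idealX_linP: hu' => a ha ->; rewrite meval_msupp big_seq.
apply: (ideal_sum _ (@idealX_ideal _ I m)) => al ala; apply: (idealMl _ (@idealX_ideal _ I m)).
have dal : mdeg al = (size s * (rm * m)).+1 by apply: (dhomogP _ _ _ ha).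
have [i hi] : exists i, (rm * m <= al i)%N.
  apply/existsP; apply: contraTT (eq_leq (esym dal)) => /existsPn h'; rewrite -ltnNge ltnS mdegE.
  have -> : (size s * (rm * m) = \sum_(i < size s) rm * m)%N by rewrite sum_nat_const card_ord.
  by apply: leq_sum => i _; apply: ltnW; rewrite ltnNge h'.
rewrite /mmap1 (bigD1 i) //=; apply: (idealMr _ (@idealX_ideal _ I m)).
have le : (r i * m <= al i)%N.
  by apply: leq_trans hi; rewrite leq_mul2r /rm (bigD1 i) //= leq_addr orbT.
rewrite -(subnK le) exprD exprM; apply: (idealMl _ (@idealX_ideal _ I m)).
exact/idealX_mem.
Qed.

Lemma base_seq : exists xs : seq (ppoint k N.+2), uniq xs /\ forall x, X x <-> x \in xs.
Proof.
have /finite_seqP [s es] := finX; exists (undup s); rewrite undup_uniq; split=> // x.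
by rewrite mem_undup es.
Qed.

Lemma isolating_form x : exists D (p : A), [/\ p \is D.-homog, mev p (pcoord x) != 0
  & forall z, X z -> z != x -> mev p (pcoord z) = 0].
Proof.
have [xs [_ hxs]] := base_seq.
have [D [p [hp px pz]]] : exists D (p : A), [/\ p \is D.-homog, mev p (pcoord x) != 0
    & forall z, z \in xs -> z != x -> mev p (pcoord z) = 0].
  elim: xs {hxs} => [|y s [D [p [hp px pz]]]].
    by exists 0%N, 1; split; rewrite ?dhomog1 // /mev meval1 oner_neq0.
  have [->|xy] := eqVneq y x.
    by exists D, p; split=> // z; rewrite inE => /predU1P [->|/pz//]; rewrite eqxx.
  rewrite eq_sym in xy; have [m hm [my mx]] := separating_form xy.
  exists (1 + D)%N, (m * p); split; first exact: dhomogM.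
    by rewrite /mev mevalM mulf_neq0.
  move=> z; rewrite inE /mev mevalM => /predU1P [->|/pz h] zx; first by rewrite [m.@[_]]my mul0r.
  by rewrite [p.@[_]]h ?mulr0.
by exists D, p; split=> // z /hxs; apply: pz.
Qed.

(** A base point lies on the hyperplane with coefficients [1, t, t ^+ 2, ...] only if [t] is a root
    of a nonzero polynomial; some [t] avoids the roots for all base points. *)
Lemma nonvanishing_form : exists2 l : A, l \is 1.-homog & forall x, X x -> mev l (pcoord x) != 0.
Proof.
have [xs [ux hxs]] := base_seq.
pose P (x : ppoint k N.+2) : {poly k} := \poly_(i < N.+2) (pcoord x 0 (inord i)).
have [t /rootPf ht] : exists t, ~~ root (\prod_(x <- xs) P x) t.
  apply/closed_nonrootP; rewrite prodf_seq_neq0; apply/allP => x _ /=.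
  have [i [xi _]] := normP x; apply/eqP => /(congr1 (fun p : {poly k} => p`_i)).
  by rewrite coef_poly ltn_ord inord_val xi coef0 => /eqP; rewrite oner_eq0.
exists (\sum_(i < N.+2) t ^+ i *: 'X_i).
  by apply: rpred_sum => i _; rewrite rpredZ // dhomogX /= mdeg1.
move=> x /hxs xx; apply: contraFneq ht => h.
rewrite horner_prod (bigD1_seq x xx ux) /= mulf_eq0; apply/orP; left.
rewrite horner_poly; apply/eqP; rewrite -[RHS]h /mev (raddf_sum (meval _)); apply: eq_bigr => i _ /=.
by rewrite mevalZ mevalXU inord_val mulrC.
Qed.

(** A coordinate centred at [x] times a form [p] isolating [x] vanishes on all base points, so one
    of its powers lies in [I]; in the chart [p] is a unit at the origin. *)
Lemma chart_nilpotent x (i0 : 'I_N.+2) (v0 : pcoord x 0 i0 = 1) : X x -> exists c,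
  mpow c `<=` loc (lin (local_gens f x i0)).
Proof.
move=> Xx; set E := lin _; have iE : is_ideal setT (loc E) by apply/loc_ideal/lin_ideal.
have [D [p [hp px pz]]] := isolating_form x.
have hj (j : 'I_N.+1) : exists r, loc E ('X_j ^+ r).
  pose h : A := 'X_(lift i0 j) - pcoord x 0 (lift i0 j) *: 'X_i0.
  have hh : h \is 1.-homog by rewrite rpredB ?rpredZ // dhomogX /= mdeg1.
  have hx : mev h (pcoord x) = 0 by rewrite /mev mevalB mevalZ !mevalXU v0 mulr1 subrr.
  have ch : chart x i0 h = 'X_j.
    by rewrite rmorphB /= chartZ (chart1 v0) chart_coord -mul_mpolyC mulr1 addrC addKr.
  have vh : vanishing (h * p).
    apply: (@vanishing_homog (1 + D)) => [//||z Xz]; first exact: dhomogM.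
    rewrite /mev mevalM; have [->|zx] := eqVneq z x; first by rewrite [h.@[_]]hx mul0r.
    by rewrite [p.@[_]](pz z Xz zx) mulr0.
  have [r hr] : exists r, I ((h * p) ^+ r) by apply: nullstellensatz => c hc; apply: vh.
  exists r; apply: (@loc_unit _ _ _ (chart x i0 p ^+ r)).
    by rewrite (rmorphXn (mcoeff 0)) expf_neq0 //= chart0.
  apply: loc_sub; rewrite -ch -!rmorphXn -rmorphM /= -exprMn mulrC.
  by apply: chart_base_ideal; rewrite base_idealE.
have [r hr] := choice hj; pose rm := (\sum_j r j)%N.
exists (N.+1 * rm).+1; apply: mpow_mon => // m dm.
have [j hj'] : exists j, (rm <= m j)%N.
  apply/existsP; apply: contraTT (eq_leq (esym dm)) => /existsPn h'; rewrite -ltnNge ltnS mdegE.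
  have -> : (N.+1 * rm = \sum_(i < N.+1) rm)%N by rewrite sum_nat_const card_ord.
  by apply: leq_sum => i _; apply: ltnW; rewrite ltnNge h'.
have le : (r j <= m j)%N by apply: leq_trans hj'; rewrite /rm (bigD1 j) //= leq_addr.
rewrite mpolyXE_id (bigD1 j) //=; apply: (idealMr _ iE).
by rewrite -(subnK le) exprD; apply: (idealMl _ iE).
Qed.

(** The [f i] and [l] vanish together only at the origin of the cone, so powers of all variables lie
    in the ideal they generate. A form of large degree lies in its power [r + m], and there each
    product has [r] factors [l] or [m] factors from [I]. *)
Lemma large_degree (l : A) : l \is 1.-homog -> (forall x, X x -> mev l (pcoord x) != 0) ->
  exists e, forall r m nu u, (e * (r + m) < nu)%N -> u \is nu.-homog ->
    exists a b, [/\ u = l ^+ r * a + b, a \is (nu - r).-homog, b \is nu.-homog & idealX setT I m b].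
Proof.
move=> hl lX.
pose g (o : option 'I_N.+3) := if o is Some i then tnth f i else l.
have hi (i : 'I_N.+2) : exists e, lin g ('X_i ^+ e.+1).
  suff [e he] : exists e, lin g ('X_i ^+ e).
    by exists e; rewrite exprS; apply: (idealMl _ (lin_ideal g)).
  apply: nullstellensatz => c hc; rewrite mevalXU; apply/eqP.
  have hf j : (tnth f j).@[c] = 0 by apply: (hc (Some j)).
  apply: contraT => ci; have [|x [t [t0 ec]]] := ppoint_of (c := c); first by exists i.
  have ev p e' : p \is e'.-homog -> p.@[c] = t ^+ e' * mev p (pcoord x).
    move=> hp; rewrite -(homog_scale t _ hp); apply: meval_eq => i'; exact: ec.
  have Xx : X x.
    move=> j; have := hf j; rewrite (ev _ _ (fd j)).
    by move/eqP; rewrite mulf_eq0 expf_eq0 (negbTE t0) andbF => /eqP.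
  have := hc None; rewrite /= (ev _ _ hl) expr1 => /eqP; rewrite mulf_eq0 (negbTE t0) /=.
  by rewrite (negbTE (lX _ Xx)).
have [e he] := choice hi; pose em := (\sum_i (e i).+1)%N.
exists (N.+2 * em)%N => r m nu u lt hu.
pose E : set A := [set u | exists a b, u = l ^+ r * a + b /\ idealX setT I m b].
have iX := @idealX_ideal _ I m.
have iE : is_ideal setT E.
  apply/idealP; split.
  - by exists 0, 0; rewrite mulr0 addr0; split=> //; apply: ideal0.
  - move=> _ _ [a [b [-> hb]]] [a' [b' [-> hb']]]; exists (a + a'), (b + b').
    by rewrite mulrDr addrACA; split=> //; apply: (idealD iX).
  - move=> c _ [a [b [-> hb]]]; exists (c * a), (c * b).
    by rewrite mulrDr mulrCA; split=> //; apply: (idealMl _ iX).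
have gE : idealX setT (lin g) (r + m) `<=` E.
  move=> v /(idealX_add1 (lin_ideal (tnth f))) h; apply: h => a [c ->].
  rewrite (bigD1 None) //= (reindex_omap Some id) /=; last by case.
  exists (\sum_i c (Some i) * tnth f i), (c None); rewrite addrC; split=> //.
    by exists (fun i => c (Some i)).
  by congr (_ + _); apply: eq_bigl => i; rewrite eqxx.
have [a [b [eu hb]]] : E u.
  rewrite [u]mpolyE big_seq; apply: (ideal_sum _ iE) => al ala.
  rewrite -mul_mpolyC; apply: (idealMl _ iE); apply: gE.
  have dal : mdeg al = nu by apply: (dhomogP _ _ _ hu).
  have [i hi'] : exists i, (em * (r + m) <= al i)%N.
    apply/existsP; move: lt; rewrite -dal; apply: contraTT => /existsPn h'; rewrite -leqNgt mdegE.
    have -> : (N.+2 * em * (r + m) = \sum_(i < N.+2) em * (r + m))%N.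
      by rewrite sum_nat_const card_ord mulnA.
    by apply: leq_sum => i _; apply: ltnW; rewrite ltnNge h'.
  have le : ((e i).+1 * (r + m) <= al i)%N.
    by apply: leq_trans hi'; rewrite leq_mul2r /em (bigD1 i) //= leq_addr orbT.
  have iY := @idealX_ideal _ (lin g) (r + m).
  rewrite mpolyXE_id (bigD1 i) //=; apply: (idealMr _ iY).
  rewrite -(subnK le) exprD exprM; apply: (idealMl _ iY); exact: idealX_mem.
have gI : graded (idealX setT I m).
  by apply: graded_idealX; apply: graded_lin => i; exists d.
have rnu : (r <= nu)%N.
  have em0 : (0 < em)%N.
    by rewrite /em (bigD1 ord0).
  by apply: leq_trans (ltnW lt); apply: leq_trans (leq_addr m r) _; rewrite leq_pmull // muln_gt0 em0.
exists (pihomog mdeg (nu - r) a), (pihomog mdeg nu b); split.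
- rewrite -{1}(pihomog_dE hu) eu raddfD /=; congr (_ + _).
  by rewrite (@pihomogM_homog _ _ r) // -[X in X.-homog]mul1n; exact: dhomogMn.
- exact: pihomogP.
- exact: pihomogP.
- exact: gI.
Qed.

End BaseLocus.

Lemma gen_ideal_comb (L : fieldType) (O : set L) (g : seq L) z :
  is_subring O -> gen_ideal O [set` g] z ->
  exists a : 'I_(size g) -> L, (forall i, O (a i)) /\ z = \sum_i a i * g`_i.
Proof.
move=> [O1 OB OM]; pose E : set L := [set z | exists a : 'I_(size g) -> L,
  (forall i, O (a i)) /\ z = \sum_i a i * g`_i].
have O0 : O 0 by rewrite -(subrr 1); apply: OB.
have OD u v : O u -> O v -> O (u + v).
  by move=> Ou Ov; rewrite -[v]opprK; apply: (OB) => //; rewrite -sub0r; apply: (OB).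
suff : gen_ideal O [set` g] `<=` E by apply.
apply: gen_ideal_min => [|u /= ug].
  split.
  - by exists (fun=> 0); split=> //; rewrite big1 // => i _; rewrite mul0r.
  - move=> _ _ [a [Oa ->]] [b [Ob ->]]; exists (fun i => a i + b i); split=> [i|]; first exact: OD.
    by rewrite -big_split; apply: eq_bigr => i _; rewrite mulrDl.
  - move=> c _ Oc [a [Oa ->]]; exists (fun i => c * a i); split=> [i|]; first exact: OM.
    by rewrite [_ *: _]mulr_sumr; apply: eq_bigr => i _; rewrite mulrA.
have iu : (index u g < size g)%N by rewrite index_mem.
exists (fun i => if i == Ordinal iu then 1 else 0); split=> [i|]; first by case: ifP.
rewrite (bigD1 (Ordinal iu)) //= eqxx mul1r nth_index // big1 ?addr0 // => i /negbTE ->.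
by rewrite mul0r.
Qed.

(** * Regular sequences and matrices of syzygies in a local ring *)

Section RegularSequences.
Variables (k : fieldType) (M : nat) (L : fieldType) (psi : {rmorphism {mpoly k[M]} -> L}).
Hypothesis psi_inj : injective psi.
Local Notation W := {mpoly k[M]}.
Local Notation O := (extO psi setT).
Let Ol := extO_local psi_inj.

Lemma ext_unit s : s@_0 != 0 -> O (psi s)^-1.
Proof. by move=> s0; exists 1, s; rewrite rmorph1 div1r. Qed.

Lemma psi_div_eq u s w t : s@_0 != 0 -> t@_0 != 0 -> psi u / psi s = psi w / psi t -> u * t = w * s.
Proof.
move=> s0 t0 /eqP; rewrite eqr_div ?(psi_coef0 psi_inj) // => /eqP e.
by apply: psi_inj; rewrite !rmorphM.
Qed.

Lemma ext_denominators (T : finType) (r : T -> L) : (forall i, O (r i)) ->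
  exists S (b : T -> W), S@_0 != 0 /\ forall i, r i = psi (b i) / psi S.
Proof.
move=> Or; have h i : exists us : W * W, us.2@_0 != 0 /\ r i = psi us.1 / psi us.2.
  by have [u [s [_ s0 ->]]] := Or i; exists (u, s).
have [us hus] := choice h.
exists (\prod_i (us i).2), (fun i => (us i).1 * \prod_(j | j != i) (us j).2); split.
  by rewrite (rmorph_prod (mcoeff 0)); apply/prodf_neq0 => i _; case: (hus i).
move=> i; have [s0 ->] := hus i.
have -> : \prod_j (us j).2 = (us i).2 * \prod_(j | j != i) (us j).2 by rewrite (bigD1 i).
rewrite !rmorphM.
rewrite -mulf_div divff ?mulr1 // rmorph_prod; apply/prodf_neq0 => j _.
by rewrite (psi_coef0 psi_inj) //; case: (hus j).
Qed.

Lemma ext_inv_coef0 u s : s@_0 != 0 -> psi u / psi s != 0 -> O (psi u / psi s)^-1 -> u@_0 != 0.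
Proof.
move=> s0 nz [a [b [_ b0 e]]]; apply/eqP => u0.
have pu : psi u != 0 by apply: contra_neq nz => ->; rewrite mul0r.
have : psi s * psi b = psi a * psi u.
  by move: e; rewrite invf_div => /eqP; rewrite (eqr_div _ _ pu (psi_coef0 psi_inj b0)) => /eqP ->.
rewrite -!rmorphM => /psi_inj /(congr1 (mcoeff 0)); rewrite !(rmorphM (mcoeff 0)) /= u0 mulr0.
by move/eqP; rewrite mulf_eq0 (negbTE s0) (negbTE b0).
Qed.

Lemma ext_ideal_mul (E : set L) a v : is_ideal O E -> O a -> E v -> E (a * v).
Proof. by case=> _ _ h Oa Ev; apply: h. Qed.

Lemma ext_gen (G : set L) (T : finType) (h : T -> W) : (forall z, G z -> extO psi (lin h) z) ->
  (forall i, gen_ideal O G (psi (h i))) -> gen_ideal O G = extO psi (lin h).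
Proof.
move=> h1 h2; apply/seteqP; split; first exact: gen_ideal_min (extO_ideal psi_inj (lin_ideal h)) h1.
have iG := gen_ideal_ideal O G.
move=> _ [_ [s [[c ->] s0 ->]]]; rewrite mulrC; apply: (ext_ideal_mul iG (ext_unit s0)).
rewrite rmorph_sum; apply: (submod_sum iG) => i _ /=; rewrite rmorphM.
by apply: (ext_ideal_mul iG); [exact: extO_mem|exact: h2].
Qed.

(** The power of [z ord0] dividing every term is cancelled by regularity; modulo [z ord0] there
    remains a nonzero polynomial in fewer variables. Together with [alg_dep] this bounds the length
    of regular sequences without dimension theory. *)
Lemma regular_independent m (z : 'I_m -> L) (E : nat -> set L) :
  (forall i, is_ideal O (E i)) ->
  (forall i : 'I_m, [/\ E i `<=` E i.+1, E i.+1 (z i), O (z i)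
     & forall a, O a -> E i (z i * a) -> E i a]) ->
  ~ E m 1 -> forall F, F != 0 -> ~ E 0%N (mmap (psi \o @mpolyC M k) z F).
Proof.
elim: m z E => [|m IH] z E iE hz nE F F0.
  have eF : F = (F@_0)%:MP.
    by apply/mpolyP => mm; have -> : mm = 0%MM by [apply/mnmP => -[]]; rewrite mcoeffC eqxx mulr1.
  have c0 : F@_0 != 0 by apply: contra_neq F0 => c0; rewrite eF c0 mpolyC0.
  rewrite eF mmapC /= => h; apply: nE.
  have : O (psi (F@_0)^-1%:MP) by apply: extO_mem.
  by move=> /(ext_ideal_mul (iE _))/(_ h); rewrite -rmorphM -mpolyCM mulVf // rmorph1.
have exa : exists a, has (fun mm : 'X_{1..m.+1} => mm ord0 == a) (msupp F).
  by exists (mlead F ord0); apply/hasP; exists (mlead F) => //; apply: mlead_supp.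
case: (ex_minnP exa) => a /hasP [m0 m0F /eqP m0a] amin.
pose G : {mpoly k[m]} := \sum_(mm <- msupp F | mm ord0 == a) F@_mm *: 'X_[mtail mm].
have G0 : G != 0.
  apply/eqP => /(congr1 (mcoeff (mtail m0))); rewrite (raddf_sum (mcoeff _)) mcoeff0 big_mkcond.
  rewrite (bigD1_seq m0) ?msupp_uniq //= m0a eqxx mcoeffZ mcoeffX eqxx mulr1.
  rewrite big1 ?addr0 => [|mm m0n]; first by move/eqP; rewrite mcoeff_eq0 m0F.
  case: eqP => // ma; rewrite mcoeffZ mcoeffX; case: eqP => [et|_]; last by rewrite mulr0.
  by case/eqP: m0n; rewrite -(mconsK mm) -(mconsK m0) ma m0a et.
pose z' j := z (lift ord0 j).
pose y := \sum_(mm <- msupp F | mm ord0 != a)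
  psi (F@_mm)%:MP * z ord0 ^+ (mm ord0 - a).-1 * mmap1 z' (mtail mm).
have Oz i : O (z i) by case: (hz i).
have OM u v : O u -> O v -> O (u * v) := @subringM _ _ _ Ol u v.
have OX u e : O u -> O (u ^+ e).
  by move=> Ou; elim: e => [|e IHe]; [exact: (subring1 Ol)|rewrite exprS; apply: OM].
have Ommap1 mm : O (mmap1 z' mm).
  by apply: (big_ind O) => [|//|i _]; [exact: (subring1 Ol)|apply: OX; apply: Oz].
have Oy : O y.
  apply: (big_ind O) => [|u v|mm _]; [exact: (subring0 Ol)|exact: (subringD Ol)|].
  by apply: (OM) => //; apply: (OM); [exact: extO_mem|exact: OX].
have eF : mmap (psi \o @mpolyC M k) z F =
    z ord0 ^+ a * (mmap (psi \o @mpolyC M k) z' G + z ord0 * y).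
  have e1 mm : mmap1 z mm = z ord0 ^+ mm ord0 * mmap1 z' (mtail mm).
    rewrite /mmap1 big_ord_recl; congr (_ * _); apply: eq_bigr => j _; by rewrite mnmE.
  rewrite {1}/mmap (bigID (fun mm : 'X_{1..m.+1} => mm ord0 == a)) /= mulrDr; congr (_ + _).
    rewrite raddf_sum mulr_sumr; apply: eq_bigr => mm /eqP ma /=.
    by rewrite e1 ma mmapZ mmapX /= mulrCA.
  rewrite /y !mulr_sumr big_seq_cond [RHS]big_seq_cond; apply: eq_bigr => mm /andP [mF ma].
  have lt : (a < mm ord0)%N.
    by rewrite ltn_neqAle eq_sym ma /= amin //; apply/hasP; exists mm.
  have em : mm ord0 = (a + (mm ord0 - a).-1.+1)%N by rewrite prednK ?subn_gt0 // subnKC // ltnW.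
  by rewrite e1 {1}em exprD exprS /=; ring.
have [E01 E1z Oz0 reg0] := hz ord0.
have cancel e v : O v -> E 0%N (z ord0 ^+ e * v) -> E 0%N v.
  elim: e => [|e IHe] Ov; first by rewrite mul1r.
  by rewrite exprS -mulrA => /reg0 h; apply: IHe => //; apply: h; apply: OM => //; apply: OX.
have OG : O (mmap (psi \o @mpolyC M k) z' G).
  apply: (big_ind O) => [|u v|mm _]; [exact: (subring0 Ol)|exact: (subringD Ol)|].
  by apply: OM => //; exact: extO_mem.
rewrite eF => /cancel h.
have {}h : E 1%N (mmap (psi \o @mpolyC M k) z' G + z ord0 * y).
  by apply: E01; apply: h; apply: (subringD Ol) => //; apply: OM.
have /(submodN Ol (iE 1%N)) hzy : E 1%N (z ord0 * y) by rewrite mulrC; apply: (ext_ideal_mul (iE _)).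
apply: (IH z' (fun i => E i.+1) _ _ nE G G0) => [i|i|] //; last by have := submodD (iE 1%N) h hzy; rewrite addrK.
by have := hz (lift ord0 i); rewrite /= /bump /= add1n.
Qed.

(** The [phi i] are combinations of [g], and conversely. Expressing each [phi j] through [g] and
    back gives a syzygy; at the point the matrix of these is a nonzero scalar minus a product
    through [size g] columns, so its rank is large when [g] is short. *)
Lemma syzygy_matrix (r : nat) (phi : 'I_r -> W) (g : seq L) :
  extO psi (lin phi) = gen_ideal O [set` g] ->
  exists (U : 'M[W]_r) (c : k) (P1 : 'M[k]_(r, size g)) (P2 : 'M[k]_(size g, r)),
  [/\ forall j, \sum_i U j i * phi i = 0, c != 0 & map_mx (mcoeff 0) U = c%:M - P1 *m P2].
Proof.
move=> eO.
have gE l : l \in g -> extO psi (lin phi) l by move=> gl; rewrite eO; apply: gen_ideal_sub.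
have sO : is_subring O by case: Ol.
have h1 i : exists a : 'I_(size g) -> L, (forall l, O (a l)) /\
    psi (phi i) = \sum_l a l * g`_l.
  by apply: gen_ideal_comb => //; rewrite -eO; apply: extO_mem; apply: lin_gen.
have [al hal] := choice h1.
have h2 (l : 'I_(size g)) : exists us : ('I_r -> W) * W, us.2@_0 != 0 /\
    g`_l = (\sum_i psi (us.1 i) * psi (phi i)) / psi us.2.
  have [_ [s [[c0 ->] s0 ->]]] := gE _ (mem_nth 0 (ltn_ord l)).
  by exists (c0, s); split=> //=; rewrite rmorph_sum; under [in RHS]eq_bigr do rewrite -rmorphM.
have [be hbe] := choice h2.
have [S [a [S0 ha]]] := ext_denominators (r := fun il : 'I_r * 'I_(size g) => al il.1 il.2)
  (fun il => (hal il.1).1 il.2).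
have Obs (l : 'I_(size g)) : O (psi 1 / psi (be l).2).
  by exists 1, (be l).2; case: (hbe l).
have [S' [s' [S'0 hs']]] := ext_denominators Obs.
pose b l i := s' l * (be l).1 i.
have hb (l : 'I_(size g)) : g`_l = (\sum_i psi (b l i) * psi (phi i)) / psi S'.
  have [s0 e] := hbe l; have hinv : (psi (be l).2)^-1 = psi (s' l) / psi S'.
    by have := hs' l; rewrite rmorph1 mul1r.
  rewrite e hinv mulrA; congr (_ / _); rewrite mulr_suml; apply: eq_bigr => i _.
  by rewrite /b rmorphM /= mulrC mulrA.
pose U : 'M[W]_r := \matrix_(j, i) ((S * S') *+ (j == i) - \sum_l a (j, l) * b l i).
have hU j : \sum_i U j i * phi i = 0.
  apply: psi_inj; rewrite rmorph0 rmorph_sum /=.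
  transitivity (psi (S * S') * psi (phi j) - \sum_l psi (a (j, l)) * \sum_i psi (b l i) * psi (phi i)).
    under eq_bigr do rewrite mxE mulrBl rmorphB rmorphM /=.
    rewrite sumrB; congr (_ - _).
      rewrite (bigD1 j) //= eqxx mulr1n big1 ?addr0 // => i /negbTE ij.
      by rewrite eq_sym ij mulr0n rmorph0 mul0r.
    under [RHS]eq_bigr do rewrite mulr_sumr; rewrite exchange_big; apply: eq_bigr => i _ /=.
    rewrite rmorphM rmorph_sum /= mulr_suml; apply: eq_bigr => l _.
    by rewrite rmorphM mulrA.
  apply/eqP; rewrite subr_eq0; apply/eqP; have [_ ->] := hal j.
  have c1 : psi S != 0 := psi_coef0 psi_inj S0; have c2 : psi S' != 0 := psi_coef0 psi_inj S'0.
  have -> : psi (S * S') = psi S * psi S' by apply: rmorphM.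
  rewrite mulr_sumr; apply: eq_bigr => l _.
  have -> : al j l = psi (a (j, l)) / psi S := ha (j, l).
  by rewrite hb mulf_div mulrC divfK // mulf_neq0.
exists U, (S * S')@_0, (\matrix_(j, l) (a (j, l))@_0), (\matrix_(l, i) (b l i)@_0); split=> //.
  by rewrite (rmorphM (mcoeff 0)) mulf_neq0.
apply/matrixP => j i; rewrite !mxE mcoeffB mcoeffMn (raddf_sum (mcoeff 0)); congr (_ - _).
by apply: eq_bigr => l _; rewrite !mxE /= (rmorphM (mcoeff 0)).
Qed.

End RegularSequences.

Lemma rank_minor (k : fieldType) m n (U : 'M[k]_(m, n)) : (1 < \rank U)%N ->
  exists i i' j j', U i j * U i' j' - U i j' * U i' j != 0.
Proof.
move=> rU; apply: contrapT => h.
have h' i i' j j' : U i j * U i' j' = U i j' * U i' j.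
  apply/eqP; rewrite -subr_eq0; apply: contra_notT h => nz; by exists i, i', j, j'.
have [U0|U0] := eqVneq U 0; first by move: rU; rewrite U0 mxrank0.
have [i0 [j0 uij]] : exists i j, U i j != 0.
  apply: contrapT => h0; case/eqP: U0; apply/matrixP => i j; rewrite mxE; apply/eqP.
  by apply: contra_notT h0 => nz; exists i, j.
have eU : U = (\col_i (U i j0 / U i0 j0)) *m (\row_j U i0 j).
  apply/matrixP => i j; rewrite mxE big_ord1 !mxE mulrAC -(h' i i0 j j0) mulfK //.
by move: rU; rewrite eU ltnNge (leq_trans (mxrankM_maxl _ _)) // rank_leq_col.
Qed.

Fact relation_comb (R : comNzRingType) (T : finType) (b b' p c : T -> R) (s t : R) :
  \sum_l b l * p l = 0 -> \sum_l b' l * p l = 0 -> (forall l, c l = b l * s + b' l * t) ->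
  \sum_l c l * p l = 0.
Proof.
move=> hb hb' hc; transitivity (s * \sum_l b l * p l + t * \sum_l b' l * p l).
  by rewrite !mulr_sumr -big_split; apply: eq_bigr => l _ /=; rewrite hc; ring.
by rewrite hb hb' !mulr0 addr0.
Qed.

Fact relation_clear (L : fieldType) (T : finType) (r bp f : T -> L) (S y l : L) : l != 0 -> S != 0 ->
  (forall i, r i = bp i / S) -> \sum_i r i * (f i / l) = 0 -> \sum_i bp i * (f i * y) = 0.
Proof.
move=> l0 S0 hb hr; transitivity (S * l * y * \sum_i r i * (f i / l)); last by rewrite hr mulr0.
rewrite mulr_sumr; apply: eq_bigr => i _.
by rewrite hb; field; rewrite l0 S0.
Qed.

(** * Relations at a base point and local complete intersections *)

Section Relations.
Variables (k : fieldType) (N d : nat) (f : N.+3.-tuple {mpoly k[N.+2]}) (x : ppoint k N.+2).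
Variable i0 : 'I_N.+2.
Hypothesis v0 : pcoord x 0 i0 = 1.
Hypothesis fd : forall i, tnth f i \is d.-homog.
Hypothesis Xx : base_points f x.
Local Notation A := {mpoly k[N.+2]}.
Local Notation W := {mpoly k[N.+1]}.
Local Notation B := {mpoly k[N.+3]}.
Local Notation ch := (chart x i0).
Local Notation phi := (local_gens f x i0).
Local Notation psi := (unchart x i0).
Variable c : nat.
Hypothesis mphi : mpow c `<=` loc (lin phi).
Let uinj := unchart_inj v0.
Local Notation O := (extO psi setT).

Lemma local_gens_m i : mpow 1 (phi i).
Proof. by apply/mpow1P; rewrite /local_gens chart0; apply: Xx. Qed.

(* The values at the point of the relations between the generators. *)
Definition spec_rel (v : 'I_N.+3 -> k) : Prop :=
  exists2 b : 'I_N.+3 -> W, \sum_i b i * phi i = 0 & forall i, (b i)@_0 = v i.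

Lemma spec_rel_syzygy a : is_syzygy f a -> spec_rel (fun i => mev (a i) (pcoord x)).
Proof.
move=> ha; exists (fun i => ch (a i)) => [|i]; last exact: chart0.
transitivity (ch (\sum_i a i * tnth f i)); last by rewrite ha rmorph0.
by rewrite rmorph_sum; apply: eq_bigr => i _; rewrite rmorphM.
Qed.

Lemma homog_syzygy (T : finType) (b : T -> 'I_N.+3 -> W) :
  (forall t, \sum_i b t i * phi i = 0) -> exists e (a : T -> 'I_N.+3 -> A),
  forall t, [/\ forall i, a t i \is e.-homog, is_syzygy f (a t) & forall i, ch (a t i) = b t i].
Proof.
move=> hb; have [e [p hp]] := homog_lifts v0 (fun ti : T * 'I_N.+3 => b ti.1 ti.2).
exists e, (fun t i => p (t, i)) => t; split=> [i||i]; try by case: (hp (t, i)).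
apply: (@chart_inj _ _ _ _ v0 (e + d)).
  by apply: rpred_sum => i _; apply: dhomogM => //; case: (hp (t, i)).
rewrite rmorph_sum -[RHS](hb t); apply: eq_bigr => i _; rewrite rmorphM /=.
by have [_ ->] := hp (t, i).
Qed.

Lemma spec_rel_homog v : spec_rel v -> exists e a,
  [/\ forall i, a i \is e.-homog, is_syzygy f a & forall i, mev (a i) (pcoord x) = v i].
Proof.
case=> b hb hv; have [e [a ha]] := homog_syzygy (fun _ : unit => hb).
have [h1 h2 h3] := ha tt; exists e, (a tt); split=> // i.
by rewrite -(chart0 x i0) h3.
Qed.

Lemma value_atE u s : s@_0 != 0 -> value_at x (psi u / psi s) = u@_0 / s@_0.
Proof.
move=> s0; rewrite /value_at; set S := [set c | _].
have Sv : S (u@_0 / s@_0).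
  have [e [p hp]] := homog_lifts v0 (fun b : bool => if b then u else s).
  have [h1 e1] := hp true; have [h2 e2] := hp false.
  have q0 : mev (p false) (pcoord x) != 0 by rewrite -(chart0 x i0) e2.
  exists e, (p true), (p false); split=> //.
    by rewrite (chart_frac v0 h1 h2 (mev_neq0 q0)) e1 e2.
  by rewrite -!(chart0 x i0) e1 e2.
have [e [p [q [hp hq q0 ez ->]]]] : S (xget 0 S) by apply: xgetI Sv.
have cq : (ch q)@_0 != 0 by rewrite chart0.
move: ez; rewrite (chart_frac v0 hp hq (mev_neq0 q0)) => /(psi_div_eq uinj s0 cq).
move/(congr1 (mcoeff 0)); rewrite !(rmorphM (mcoeff 0)) /= !chart0 => e1.
by apply/eqP; rewrite eqr_div // -e1.
Qed.

Lemma relation_form_spec L : is_relation_form f x d L -> exists t v,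
  [/\ t != 0, spec_rel v, exists i, v i != 0 & \sum_i v i *: 'X_i = t *: L].
Proof.
case=> l [r [hl lx Or hr [[i1 [r0 Oi1]] ->]]].
have Or' i : O (r i) by have := Or i; rewrite (stalkE v0).
have [S [b [S0 hb]]] := ext_denominators uinj Or'.
have hv i : (b i)@_0 = S@_0 * value_at x (r i) by rewrite hb value_atE // mulrCA mulfV ?mulr1.
exists S@_0, (fun i => (b i)@_0); split=> //.
- exists b => //; apply: uinj; rewrite rmorph0 rmorph_sum /=.
  have l0 : tofrac (l ^+ d) != 0 :> {fraction A}.
    by rewrite tofrac_eq0 expf_neq0 // (mev_neq0 lx).
  have := relation_clear (tofrac ('X_i0 ^+ d))^-1 l0 (psi_coef0 uinj S0) hb hr.
  move=> e; rewrite -[RHS]e; apply: eq_bigr => i _.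
  by rewrite rmorphM /= /local_gens (unchart_homog v0 (fd i)).
- exists i1; apply: (ext_inv_coef0 uinj S0); rewrite -hb //.
  by move: Oi1; rewrite (stalkE v0).
by rewrite scaler_sumr; apply: eq_bigr => i _; rewrite hv scalerA.
Qed.

(** By Cramer's rule, two relations with an invertible minor express [phi i] and [phi j] by the
    other generators. *)
Lemma two_relations v w i j : spec_rel v -> spec_rel w -> v i * w j - v j * w i != 0 ->
  exists h : 'I_N.+1 -> W, loc (lin h) = loc (lin phi).
Proof.
move=> [b hb ev] [b' hb' ew] nz.
have ij : i != j by apply: contra_neq nz => ->; rewrite subrr.
have [j' ej] : exists j', j = lift i j' by have [j' ->] := unlift_some ij; exists j'.
pose h l := phi (lift i (lift j' l)); exists h.
have hl l : l != i -> l != j -> lin h (phi l).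
  case: (unliftP i l) => [l1 ->|->]; last by rewrite eqxx.
  case: (unliftP j' l1) => [l2 ->|-> _]; last by rewrite -ej eqxx.
  by move=> _ _; apply: (lin_gen h).
have iL : is_ideal setT (loc (lin h)) by apply/loc_ideal/lin_ideal.
pose u := b i * b' j - b j * b' i.
have u0 : u@_0 != 0.
  by rewrite /u mcoeffB !(rmorphM (mcoeff 0)) /= !ev !ew.
have hi : loc (lin h) (phi i).
  exists u => //; have : \sum_l (b l * b' j - b j * b' l) * phi l = 0.
    by apply: (relation_comb hb hb' (s := b' j) (t := - b j)) => l; rewrite mulrN [b j * _]mulrC.
  rewrite (bigD1 i) //= => /eqP; rewrite addr_eq0 => /eqP ->.
  apply: (idealN (lin_ideal h)); apply: (ideal_sum _ (lin_ideal h)) => l li.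
  have [->|lj] := eqVneq l j; first by rewrite [b j * _]mulrC subrr mul0r; apply: (ideal0 (lin_ideal h)).
  by apply: (idealMl _ (lin_ideal h)); apply: hl.
have hj : loc (lin h) (phi j).
  exists u => //; have : \sum_l (b i * b' l - b l * b' i) * phi l = 0.
    by apply: (relation_comb hb hb' (s := - b' i) (t := b i)) => l; rewrite addrC mulrN [b i * _]mulrC.
  rewrite (bigD1 j) //= => /eqP; rewrite addr_eq0 => /eqP ->.
  apply: (idealN (lin_ideal h)); apply: (ideal_sum _ (lin_ideal h)) => l lj.
  have [->|li] := eqVneq l i; first by rewrite subrr mul0r; apply: (ideal0 (lin_ideal h)).
  by apply: (idealMl _ (lin_ideal h)); apply: hl.
apply/seteqP; split; apply: loc_min; try exact: lin_ideal.
  apply: (lin_min (loc_ideal (lin_ideal phi))) => l; apply: loc_sub; exact: (lin_gen phi).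
apply: (lin_min iL) => l; have [->//|li] := eqVneq l i.
by have [->//|lj] := eqVneq l j; apply: loc_sub; apply: hl.
Qed.

(** There are as many generators as variables, so [quasiregular_generators] perturbs them into a
    regular sequence with the same local ideal. *)
Lemma lci_of_generators (h0 : 'I_N.+1 -> W) : loc (lin h0) = loc (lin phi) ->
  locally_complete_intersection f x.
Proof.
move=> e0; have m0 : mpow c `<=` loc (lin h0) by rewrite e0.
have [h [e1 _ reg]] := quasiregular_generators m0.
pose g := [seq psi (h i) | i <- enum 'I_N.+1]; exists g.
have sg : size g = N.+1 by rewrite size_map size_enum_ord.
have nthg (i : 'I_N.+1) : g`_i = psi (h i).
  by rewrite (nth_map i) ?size_enum_ord // nth_ord_enum.
have genE i : gen_ideal (stalk x) [set` take i g] = extO psi (lin (trunc h i)).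
  rewrite (stalkE v0); apply: (ext_gen uinj) => [z /= zg|j].
    have /(nthP 0) [l] := zg; rewrite size_take sg => ls ez.
    have [li lN] : (l < i)%N /\ (l < N.+1)%N by move: ls; case: ifP; lia.
    rewrite -ez nth_take // (nthg (Ordinal lN)); apply: extO_mem.
    have -> : h (Ordinal lN) = trunc h i (Ordinal lN) by rewrite /trunc li.
    exact: lin_gen.
  rewrite /trunc; case: ifP => ji; last first.
    by rewrite rmorph0; apply: (submod0 (gen_ideal_ideal _ _)).
  apply: gen_ideal_sub => /=; rewrite -nthg -(nth_take 0 ji); apply: mem_nth.
  by rewrite size_take sg; case: ifP => _ //; apply: ltn_ord.
have genT : gen_ideal (stalk x) [set` g] = extO psi (lin h).
  have := genE N.+1; rewrite take_oversize ?sg // => ->.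
  congr (extO psi (lin _)); apply/funext => j; by rewrite /trunc ltn_ord.
split; last by rewrite (base_stalkE v0 fd) genT -(extO_loc uinj) -e0 -e1 (extO_loc uinj).
split=> [i|].
  rewrite sg => iN a Oa; rewrite genE (nthg (Ordinal iN)).
  move: Oa; rewrite (stalkE v0) => -[u [s [_ s0 ->]]] [w [t [hw t0 e]]].
  have ht : lin (trunc h i) ((t * u) * h (Ordinal iN)).
    suff -> : t * u * h (Ordinal iN) = w * s by apply: (idealMr _ (lin_ideal _)).
    move: e; rewrite mulrA -rmorphM => /(psi_div_eq uinj s0 t0) <-.
    by rewrite mulrC mulrA mulrAC.
  have hu := reg (Ordinal iN) _ ht.
  exists (t * u), (t * s); split=> //; first exact: unitM.
  by rewrite !rmorphM -mulf_div divff ?mul1r // (psi_coef0 uinj).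
rewrite genT => -[u [s [hu s0 e]]].
have es : s = u.
  have o0 : (1 : W)@_0 != 0 by rewrite mcoeff1 eqxx oner_neq0.
  by have := psi_div_eq uinj o0 s0 (u := 1) (w := u); rewrite mul1r mulr1 rmorph1 divr1; apply.
have : mpow 1 s.
  have : loc (lin phi) s by rewrite -e0 -e1 es; apply: loc_sub.
  case=> t t0 hts; apply/mpow1P/eqP.
  have : (t * s)@_0 == 0.
    apply/eqP/mpow1P; have : lin phi `<=` mpow 1; last by apply.
    by apply: lin_min; [exact: mpow_ideal|exact: local_gens_m].
  by rewrite (rmorphM (mcoeff 0)) mulf_eq0 (negbTE t0).
by move/mpow1P/eqP; rewrite (negbTE s0).
Qed.

(** [N.+2] elements in [N.+1] variables are algebraically dependent over [k], which
    [regular_independent] forbids for a regular sequence. *)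
Lemma lci_length (g : seq {fraction A}) : is_regular_seq (stalk x) g ->
  [set` g] `<=` stalk x -> (size g <= N.+1)%N.
Proof.
move=> [reg g1] gO; rewrite leqNgt; apply/negP => gN.
have Og (l : 'I_N.+2) : O g`_l.
  by rewrite -(stalkE v0); apply: gO; apply: mem_nth; apply: leq_trans (ltn_ord l) gN.
have [S [u [S0 hu]]] := ext_denominators uinj Og.
have [F F0 hF] := alg_dep u.
pose E i := gen_ideal O [set` take i g].
have iE i : is_ideal O (E i) by apply: gen_ideal_ideal.
have eu l : psi (u l) = psi S * g`_l.
  by rewrite hu mulrCA mulfV ?mulr1 // (psi_coef0 uinj).
apply: (@regular_independent _ _ _ psi uinj N.+2 (fun l => psi (u l)) E iE _ _ F F0).
- move=> i; have ig : (i < size g)%N by apply: leq_trans (ltn_ord i) gN.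
  split.
  + apply: gen_ideal_mono => z /= zi; rewrite (take_nth 0) // mem_rcons inE zi orbT; by [].
  + rewrite eu; apply: (ext_ideal_mul (iE _)); first exact: extO_mem.
    by apply: gen_ideal_sub; rewrite /= (take_nth 0) // mem_rcons mem_head.
  + exact: extO_mem.
  + move=> a Oa; rewrite eu -mulrA => /(ext_ideal_mul (iE i) (ext_unit psi S0)).
    rewrite mulrA mulVf ?(psi_coef0 uinj) // mul1r.
    by rewrite -(stalkE v0) /E in Oa *; rewrite -(stalkE v0); apply: reg.
- move=> h; apply: g1; rewrite (stalkE v0).
  have : E N.+2 `<=` gen_ideal O [set` g]; last by apply.
  by apply: gen_ideal_mono => z /= /mem_take.
suff -> : mmap (psi \o @mpolyC N.+1 k) (fun l => psi (u l)) F = 0 by apply: (submod0 (iE 0%N)).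
transitivity (psi (mmap (@mpolyC N.+1 k) u F)); last by rewrite hF rmorph0.
rewrite /mmap rmorph_sum; apply: eq_bigr => m _; rewrite rmorphM /=; congr (_ * _).
by rewrite /mmap1 rmorph_prod; apply: eq_bigr => l _; rewrite rmorphXn.
Qed.

(** A regular sequence has at most [N.+1] terms, so at the point the matrix of [syzygy_matrix], of
    size [N.+3], has rank at least 2. *)
Lemma lci_two_relations : locally_complete_intersection f x ->
  exists v w i j, [/\ spec_rel v, spec_rel w & v i * w j - v j * w i != 0].
Proof.
case=> g [reg eg].
have eO : extO psi (lin phi) = gen_ideal O [set` g] by rewrite -(base_stalkE v0 fd) eg (stalkE v0).
have gO : [set` g] `<=` stalk x.
  move=> z zg; rewrite (stalkE v0).
  have : extO psi (lin phi) z by rewrite eO; apply: gen_ideal_sub.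
  exact: extO_mono.
have sg := lci_length reg gO.
have [U [c0 [P1 [P2 [hU c00 eU0]]]]] := syzygy_matrix uinj eO.
pose U0 := map_mx (mcoeff 0) U.
have rU0 : (1 < \rank U0)%N.
  pose P := P1 *m P2.
  have rP : (\rank P <= N.+1)%N by apply: leq_trans (mxrankM_maxl _ _) (leq_trans (rank_leq_col _) sg).
  have : (N.+3 <= \rank U0 + \rank P)%N.
    rewrite -{1}(mxrank1 k N.+3) -(mxrank_scale_nz _ c00).
    have e : c0 *: 1%:M = U0 + P by rewrite scalemx1 /U0 eU0 subrK.
    by rewrite e; exact: mxrank_add.
  by move: rP; lia.
have [i [i' [j [j' h]]]] := rank_minor rU0.
exists (fun l => U0 i l), (fun l => U0 i' l), j, j'; split=> //.
- by exists (fun l => U i l) => [|l]; [exact: hU|rewrite mxE].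
- by exists (fun l => U i' l) => [|l]; [exact: hU|rewrite mxE].
Qed.

Lemma non_lci_minors v w : ~ locally_complete_intersection f x -> spec_rel v -> spec_rel w ->
  forall i j, v i * w j = v j * w i.
Proof.
move=> nl hv hw i j; apply/eqP; rewrite -subr_eq0; apply: contra_notT nl => nz.
by have [h eh] := two_relations hv hw nz; apply: lci_of_generators eh.
Qed.

End Relations.

(** * The symmetric algebra *)

Section Coefficients.
Variables (k : fieldType) (n N : nat).
Local Notation T := {mpoly k[n]}.
Local Notation W := {mpoly k[N]}.
Local Notation WT := {mpoly T[N]}.
Local Notation up := (@poly_ext k n N).
#[local] Opaque frac_ext tf poly_ext cf.

Lemma up_decomp (w : WT) : exists s : seq 'X_{1..n}, w = \sum_(al <- s) 'X_[al] *: up (cf al w).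
Proof.
have [s hs] := tf_decomp w; exists (undup s); apply: (@tf_inj k n N).
rewrite (hs (undup s)) ?undup_uniq // => [|al]; last by rewrite mem_undup.
by rewrite raddf_sum; apply: eq_bigr => al _; rewrite /= tfZ tf_up.
Qed.

Lemma coefs_in_mul (E E' : set W) (u v : WT) : coefs_in E u -> coefs_in E' v -> coefs_in (idealM setT E E') (u * v).
Proof.
move=> hu hv; have iC := coefs_in_ideal n (@idealM_ideal _ E E').
have [s ->] := up_decomp u; have [s' ->] := up_decomp v.
rewrite mulr_suml; apply: (ideal_sum _ iC) => al _; rewrite mulr_sumr.
apply: (ideal_sum _ iC) => al' _; rewrite -scalerAl -scalerAr -rmorphM -!mul_mpolyC.
apply: (idealMl _ iC); apply: (idealMl _ iC); apply: coefs_in_up; first exact: idealM_ideal.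
exact: idealM_mem.
Qed.

Lemma coefs_in_min (E : set W) (AA : set WT) : is_ideal setT AA -> (forall a, E a -> AA (up a)) ->
  coefs_in E `<=` AA.
Proof.
move=> iA h u hu; have [s ->] := up_decomp u; apply: (ideal_sum _ iA) => al _.
apply: (idealZ _ iA); exact: h.
Qed.

Lemma coefs_in_exp (E : set W) (u : WT) r : coefs_in E u -> coefs_in (idealX setT E r) (u ^+ r).
Proof.
move=> hu; elim: r => [//|r IH]; rewrite exprS idealXS; exact: coefs_in_mul.
Qed.

Lemma coefs_in_mono (E E' : set W) : E `<=` E' -> @coefs_in k n N E `<=` coefs_in E'.
Proof. by move=> EE u hu al; apply: EE. Qed.

Lemma cf_homog al (u : WT) e : u \is e.-homog -> cf al u \is e.-homog.
Proof.
move/dhomogP => hu; apply/dhomogP => m; rewrite mcoeff_msupp mcoeff_cf => h; apply: hu.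
by rewrite mcoeff_msupp; apply: contra_neq h => ->; rewrite mcoeff0.
Qed.

Lemma up_homog (a : W) e : a \is e.-homog -> up a \is e.-homog.
Proof.
move/dhomogP => ha; apply/dhomogP => m; rewrite mcoeff_msupp mcoeff_up => h; apply: ha.
by rewrite mcoeff_msupp; apply: contra_neq h => ->; rewrite mpolyC0.
Qed.

Lemma mcoeff_pihomog (R : comNzRingType) (p : {mpoly R[N]}) D m :
  (pihomog mdeg D p)@_m = if mdeg m == D then p@_m else 0.
Proof.
rewrite pihomogE (raddf_sum (mcoeff m)) /=; under eq_bigr do rewrite mcoeffZ mcoeffX.
have [mp|mp] := boolP (m \in msupp p); last first.
  rewrite big1_seq => [|m' /andP [_ m'p]]; first by rewrite memN_msupp_eq0 //; case: ifP.
  by case: eqP => [em|_]; [case/negP: mp; rewrite -em|rewrite mulr0].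
rewrite big_mkcond (bigD1_seq m) ?msupp_uniq //= eqxx mulr1 big1 ?addr0 // => m' /negbTE ->.
by rewrite mulr0; case: ifP.
Qed.

Lemma cf_pihomog al (u : WT) D : cf al (pihomog mdeg D u) = pihomog mdeg D (cf al u).
Proof.
apply/mpolyP => m; rewrite mcoeff_cf !mcoeff_pihomog mcoeff_cf; case: ifP => // _.
by rewrite mcoeff0.
Qed.

Lemma graded_coefs_in (E : set W) : graded E -> graded (@coefs_in k n N E).
Proof. by move=> gE u D hu al; rewrite /= cf_pihomog; apply: gE; apply: hu. Qed.

Lemma upZ c a : up (c *: a) = c%:MP *: up a.
Proof. by apply/mpolyP => m; rewrite mcoeff_up !mcoeffZ mcoeff_up mpolyCM. Qed.

Lemma up_select (X : T) (a b : W) (p q : bool) :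
  X *: up (a *+ p - b *+ q) = X *: up a *+ p - X *: up b *+ q.
Proof.
have hB x y : X *: up (x - y) = X *: up x - X *: up y by rewrite (raddfB up) scalerBr.
have h0 : X *: up 0 = 0 by rewrite (raddf0 up) scaler0.
have hM c (r : bool) : X *: up (c *+ r) = X *: up c *+ r.
  by case: r => /=; [rewrite mulr1n mulr1n|rewrite mulr0n mulr0n].
by apply: etrans (hB (a *+ p) (b *+ q)) _; congr (_ - _); apply: hM.
Qed.

(* Evaluation of the variables of [W] only. *)
Definition spec (c : 'I_N -> k) (u : WT) : T := u.@[fun i => (c i)%:MP].
HB.instance Definition _ c := GRing.RMorphism.copy (spec c) (meval (fun i => (c i)%:MP : T)).

Lemma spec_up c a : spec c (up a) = (a.@[c])%:MP.
Proof.
rewrite /spec !meval_msupp (raddf_sum (@mpolyC n k)).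
rewrite -(big_msupp_sub (G := fun b m => (b : T) * mmap1 (fun i => (c i)%:MP) m) (msupp_uniq a)).
- apply: eq_bigr => m _ /=; rewrite mcoeff_up mpolyCM; congr (_ * _).
  by rewrite /mmap1 rmorph_prod; apply: eq_bigr => i _; rewrite rmorphXn.
- move=> m; rewrite !mcoeff_msupp mcoeff_up; apply: contra_neq => ->; exact: mpolyC0.
- by move=> m; rewrite mul0r.
Qed.

Lemma specZ c b u : spec c (b *: u) = b * spec c u.
Proof. by rewrite /spec mevalZ. Qed.

Lemma mcoeff_spec c u al : (spec c u)@_al = (cf al u).@[c].
Proof.
have h m : (mmap1 (fun i => (c i)%:MP : T) m) = (mmap1 c m)%:MP.
  by rewrite /mmap1 rmorph_prod; apply: eq_bigr => i _; rewrite rmorphXn.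
rewrite /spec !meval_msupp (raddf_sum (mcoeff al)) /=.
rewrite -(big_msupp_sub (G := fun b m => (b : k) * mmap1 c m) (msupp_uniq u)).
- by apply: eq_bigr => m _; rewrite h mulrC mul_mpolyC mcoeffZ mcoeff_cf mulrC.
- move=> m; rewrite !mcoeff_msupp mcoeff_cf; apply: contra_neq => ->; exact: mcoeff0.
- by move=> m; rewrite mul0r.
Qed.

End Coefficients.

Fact koszul_factor (R : comNzRingType) (a b c e x y : R) :
  a * b * (x * c) - y * (a * (e * c)) = a * c * (x * b - y * e).
Proof. ring. Qed.

Section SymmetricAlgebra.
Variables (k : closedFieldType) (N d : nat) (f : N.+3.-tuple {mpoly k[N.+2]}).
Hypothesis fd : forall i, tnth f i \is d.-homog.
Local Notation A := {mpoly k[N.+2]}.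
Local Notation B := {mpoly k[N.+3]}.
Local Notation AB := {mpoly B[N.+2]}.
Local Notation I := (lin (tnth f)).
Local Notation J := (sym_ideal f).
Local Notation up := (@poly_ext k N.+3 N.+2).
#[local] Opaque frac_ext tf poly_ext cf.

Lemma sym_ideal_ideal : is_ideal setT J. Proof. exact: gen_ideal_ideal. Qed.
Let iJ := sym_ideal_ideal.

Lemma syzygy_formE (a : 'I_N.+3 -> A) : syzygy_form a = \sum_i 'X_i *: up (a i).
Proof. by []. Qed.

Lemma sym_syzygy a : is_syzygy f a -> J (syzygy_form a).
Proof. by move=> ha; apply: gen_ideal_sub; exists a. Qed.

Lemma sym_graded : graded J.
Proof.
apply: graded_gen => _ D [a ha <-]; apply: gen_ideal_sub.
exists (fun i => pihomog mdeg D (a i)).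
  rewrite /= /is_syzygy; transitivity (pihomog mdeg (d + D) (\sum_i tnth f i * a i)).
    rewrite raddf_sum; apply: eq_bigr => i _ /=.
    by rewrite (pihomogM_homog _ (leq_addr _ _) (fd i)) addKn mulrC.
  by under eq_bigr do rewrite mulrC; rewrite ha raddf0.
rewrite !syzygy_formE raddf_sum; apply: eq_bigr => i _ /=; rewrite linearZ /=; congr (_ *: _).
by apply/mpolyP => m; rewrite mcoeff_up !mcoeff_pihomog mcoeff_up; case: ifP => // _; rewrite mpolyC0.
Qed.

Lemma koszul i j : J ('X_j *: up (tnth f i) - 'X_i *: up (tnth f j)).
Proof.
pose a l := tnth f i *+ (l == j) - tnth f j *+ (l == i).
have pick (V : zmodType) (g : 'I_N.+3 -> V) j' : \sum_l g l *+ (l == j') = g j'.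
  by rewrite (bigD1 j') //= eqxx mulr1n big1 ?addr0 // => l /negbTE ->.
have ha : is_syzygy f a.
  rewrite /is_syzygy; transitivity (\sum_l (tnth f i * tnth f l) *+ (l == j)
    - \sum_l (tnth f j * tnth f l) *+ (l == i)); last by rewrite !pick [tnth f j * _]mulrC subrr.
  by rewrite -sumrB; apply: eq_bigr => l _; rewrite /a mulrBl !mulrnAl.
suff -> : 'X_j *: up (tnth f i) - 'X_i *: up (tnth f j) = syzygy_form a by apply: sym_syzygy.
rewrite syzygy_formE -(pick _ (fun l => 'X_l *: up (tnth f i)) j).
rewrite -(pick _ (fun l => 'X_l *: up (tnth f j)) i) -sumrB; apply: eq_bigr => l _.
exact: esym (up_select _ _ _ _ _).
Qed.

Lemma sym_congM u u' v v' : J (u - u') -> J (v - v') -> J (u * v - u' * v').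
Proof.
move=> h h'; have -> : u * v - u' * v' = (u - u') * v + u' * (v - v') by ring.
by apply: (idealD iJ); [exact: (idealMr _ iJ)|exact: (idealMl _ iJ)].
Qed.

(** Each use of the relation [T_i f_j = T_j f_i] trades one variable [T_i] of [b] for [f_i]. *)
Lemma koszul_pow j D (b : B) : b \is D.-homog ->
  J (b *: up (tnth f j ^+ D) - 'X_j ^+ D *: up (b \mPo f)).
Proof.
move=> hb; rewrite [b]mpolyE big_seq.
apply: (big_ind (fun c : B => J (c *: up (tnth f j ^+ D) - 'X_j ^+ D *: up (c \mPo f)))).
- by rewrite raddf0 !(raddf0 up) scaler0 scale0r subrr; exact: ideal0.
- move=> c c' h h'; rewrite raddfD /= (raddfD up) /= scalerDl scalerDr opprD addrACA.
  exact: (idealD iJ h h').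
move=> m mb; have dm : mdeg m = D by apply: (dhomogP _ _ _ hb).
rewrite comp_mpolyZ.
have -> : up (b@_m *: ('X_[m] \mPo f)) = (b@_m)%:MP *: up ('X_[m] \mPo f).
  exact: upZ.
have -> : b@_m *: 'X_[m] = (b@_m)%:MP * 'X_[m] :> B by rewrite mul_mpolyC.
rewrite !scalerA ['X_j ^+ D * _]mulrC -!scalerA -scalerBr -mul_mpolyC.
apply: (idealMl _ iJ) => {b hb mb}.
elim: D m dm => [|D IH] m dm.
  by move/eqP: dm; rewrite mdeg_eq0 => /eqP ->; rewrite mpolyX0 (rmorph1 (comp_mpoly f)) !expr0 (rmorph1 up) subrr; apply: ideal0.
have [i im dmi] := mdegS_split dm.
rewrite -(submK im) mpolyXD rmorphM /= comp_mpolyXU -tnth_nth.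
have -> : 'X_[m - U_(i)] * 'X_i *: up (tnth f j ^+ D.+1) =
    ('X_[m - U_(i)] *: up (tnth f j ^+ D)) * ('X_i *: up (tnth f j)).
  by rewrite -scalerAl -scalerAr scalerA exprSr rmorphM.
have -> : 'X_j ^+ D.+1 *: up (('X_[m - U_(i)] \mPo f) * tnth f i) =
    ('X_j ^+ D *: up ('X_[m - U_(i)] \mPo f)) * ('X_j *: up (tnth f i)).
  by rewrite -scalerAl -scalerAr scalerA exprSr rmorphM.
by apply: sym_congM; [exact: IH|exact: koszul].
Qed.

Definition evT : AB -> A := mmap (fun b : B => b \mPo f) (fun i => 'X_i).
HB.instance Definition _ := GRing.RMorphism.copy evT (mmap (comp_mpoly f) (fun i => 'X_i)).

Lemma evTC b : evT b%:MP = b \mPo f. Proof. exact: mmapC. Qed.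
Lemma evTZ b u : evT (b *: u) = (b \mPo f) * evT u.
Proof. by rewrite -mul_mpolyC rmorphM /= evTC. Qed.

Lemma evT_up a : evT (up a) = a.
Proof.
have e := @mpoly_rmorph_ext _ _ _ (evT \o up) idfun; apply: e => [c|i] /=.
  have -> : up c%:MP = (c%:MP)%:MP.
    by apply/mpolyP => m; rewrite mcoeff_up !mcoeffC; case: eqP; rewrite ?mulr1 ?mulr0.
  by rewrite evTC comp_mpolyC.
by rewrite upX /evT mmapX mmap1U.
Qed.

Lemma sym_evT u : J u -> evT u = 0.
Proof.
move=> Ju; suff : J `<=` [set v | evT v = 0] by apply.
apply: gen_ideal_min => [|_ [a ha <-]].
  apply/idealP; split=> [|v w /= hv hw|v w /= hw]; first exact: rmorph0.
    by rewrite rmorphD /= hv hw addr0.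
  by rewrite rmorphM /= hw mulr0.
rewrite /= syzygy_formE -[RHS]ha rmorph_sum; apply: eq_bigr => i _ /=.
by rewrite evTZ evT_up comp_mpolyXU -tnth_nth mulrC.
Qed.

Definition eq_ideal : set B := [set b | b \mPo f = 0].

Lemma eq_idealP : is_prime_ideal eq_ideal.
Proof.
split.
- apply/idealP; rewrite /eq_ideal; split=> [|u v /= hu hv|u v /= hv]; first exact: rmorph0.
    by rewrite rmorphD /= hu hv addr0.
  by rewrite rmorphM /= hv mulr0.
- by rewrite /eq_ideal /= rmorph1 => /eqP; rewrite oner_eq0.
- by move=> a b; rewrite /eq_ideal /= => /eqP; rewrite rmorphM mulf_eq0 => /orP [] /eqP; [left|right].
Qed.

Lemma comp_homog D (b : B) : b \is D.-homog -> b \mPo f \is (D * d).-homog.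
Proof.
move=> hb; rewrite comp_mpolyEX big_seq; apply: rpred_sum => m mb; apply: rpredZ.
have <- : mdeg m = D by apply: (dhomogP _ _ _ hb).
rewrite comp_mpolyX mdegE big_distrl /=.
apply: (big_ind2 (fun (p : A) e => p \is e.-homog)) => [|p e p' e' h h'|i _].
- exact: dhomog1.
- exact: dhomogM.
- by rewrite mulnC; apply: dhomogMn.
Qed.

Lemma pihomog_comp D (b : B) : (0 < d)%N ->
  pihomog mdeg (D * d) (b \mPo f) = (pihomog mdeg D b) \mPo f.
Proof.
move=> d0; have [K eb] := pihomog_expand b; rewrite {1 2}eb.
rewrite (raddf_sum (comp_mpoly f)) !(raddf_sum (pihomog mdeg _)) (raddf_sum (comp_mpoly f)).
apply: eq_bigr => e _ /=.
have h := comp_homog (pihomogP mdeg e b).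
have [->|eD] := eqVneq (e : nat) D.
  by rewrite (pihomog_dE (pihomogP _ _ _)) pihomog_dE //; apply/comp_homog/pihomogP.
rewrite (pihomog_ne0 eD (pihomogP _ _ _)) raddf0 /= (pihomog_ne0 _ h) //.
by rewrite eqn_pmul2r.
Qed.

Lemma eq_ideal_graded : (0 < d)%N -> graded eq_ideal.
Proof. by move=> d0 b D hb; rewrite /eq_ideal /= -pihomog_comp // hb raddf0. Qed.

(** For a form [b] of degree [D] in the prime, [koszul_pow] says that [b] times [f_j ^ D] is zero in
    the symmetric algebra. Finitely many generators bound [D] by [E], and a product of more than
    [N.+3 * E] of the [f_j] contains one of them to the power [E]. *)
Lemma eq_ideal_kill : (0 < d)%N -> exists m0, forall m, (m0 <= m)%N ->
  forall b u, eq_ideal b -> coefs_in (idealX setT I m) u -> J (b *: u).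
Proof.
move=> d0; have [s [sP Ps]] := hilbert_basis (let: And3 h _ _ := eq_idealP in h).
pose E := (\sum_(l < size s) msize s`_l)%N.
have h b j : eq_ideal b -> J (b *: up (tnth f j ^+ E)).
  case/Ps => c ->; rewrite scaler_suml; apply: (ideal_sum _ iJ) => l _.
  rewrite -scalerA -mul_mpolyC; apply: (idealMl _ iJ).
  have lE : (msize s`_l <= E)%N by rewrite /E (bigD1 l) //= leq_addr.
  have Pl : eq_ideal s`_l by apply/sP/mem_nth.
  rewrite [s`_l](pihomog_partitionE lE) scaler_suml; apply: (ideal_sum _ iJ) => D _.
  have := koszul_pow j (pihomogP mdeg D s`_l).
  rewrite (eq_ideal_graded d0 D Pl) (raddf0 up) scaler0 subr0 => hD.
  have -> : tnth f j ^+ E = tnth f j ^+ (E - D) * tnth f j ^+ D by rewrite -exprD subnK // ltnW.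
  by rewrite rmorphM /= scalerAr; exact: (idealMl _ iJ).
exists (N.+3 * E).+1 => m hm b u Pb hu; move: u hu.
suff : @coefs_in k N.+3 N.+2 (idealX setT I m) `<=` [set u | J (b *: u)] by apply.
apply: coefs_in_min => [|a ha /=].
  apply/idealP; split=> [|u v /= hu hv|u v /= hv]; first by rewrite /= scaler0; exact: ideal0.
    by rewrite scalerDr; apply: (idealD iJ).
  by rewrite scalerAr; apply: (idealMl _ iJ).
have {ha}/idealX_linP [F hF ->] := idealX_sub hm ha.
rewrite meval_msupp big_seq (raddf_sum up) scaler_sumr; apply: (ideal_sum _ iJ) => al alF /=.
have dal : mdeg al = (N.+3 * E).+1 by apply: (dhomogP _ _ _ hF).
have [i hi] : exists i, (E <= al i)%N.
  apply/existsP; apply: contraTT (eq_leq (esym dal)) => /existsPn h'; rewrite -ltnNge ltnS mdegE.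
  have -> : (N.+3 * E = \sum_(i < N.+3) E)%N by rewrite sum_nat_const card_ord.
  by apply: leq_sum => i _; apply: ltnW; rewrite ltnNge h'.
have red r : J (b *: up (r * tnth f i ^+ E)).
  by rewrite rmorphM /= scalerAr; exact: (idealMl _ iJ (h _ _ Pb)).
by rewrite /mmap1 (bigD1 i) //= -(subnK hi) exprD mulrA mulrAC mulrA; exact: red.
Qed.

(** Multiplied by a power of [f_j], [v] becomes a combination of powers of [T_j] whose coefficients
    are, up to powers of [f_j], the components of [evT f v] in the degrees [D * d + nu]. These
    degrees are distinct since [d] is positive, so every component vanishes. *)
Lemma evT_kernel j nu v : (0 < d)%N -> v \is nu.-homog -> evT v = 0 ->
  exists D, J (up (tnth f j ^+ D) * v).
Proof.
move=> d0 hv ev0; have [s es] := up_decomp v.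
pose Dm := (\sum_(al <- s) mdeg al)%N; exists Dm.
pose g (al : 'X_{1..N.+3}) := ('X_[al] \mPo f) * cf al v.
have hg al : g al \is (mdeg al * d + nu).-homog.
  by apply: dhomogM; [apply: comp_homog; rewrite dhomogX|exact: cf_homog].
have eg : \sum_(al <- s) g al = 0.
  rewrite -[RHS]ev0 es raddf_sum; apply: eq_bigr => al _ /=.
  by rewrite evTZ evT_up /g; congr (_ * cf al _); rewrite -es.
pose Phi (p : A) := \sum_(D < Dm.+1) ('X_j : B) ^+ D *: up (tnth f j ^+ (Dm - D) * pihomog mdeg (D * d + nu) p).
have PhiD p q : Phi (p + q) = Phi p + Phi q.
  rewrite -big_split; apply: eq_bigr => D _ /=.
  by rewrite raddfD /= mulrDr (raddfD up) /= scalerDr.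
have Phi0 : Phi 0 = 0.
  by rewrite /Phi big1 // => D _; rewrite raddf0 mulr0 (raddf0 up) scaler0.
have Phig al : (mdeg al <= Dm)%N -> Phi (g al) = 'X_j ^+ mdeg al *: up (tnth f j ^+ (Dm - mdeg al) * g al).
  rewrite -ltnS => lt; rewrite /Phi (bigD1 (Ordinal lt)) //= pihomog_dE // big1 ?addr0 // => D nD.
  rewrite (pihomog_ne0 _ (hg al)) ?mulr0 ?(raddf0 up) ?scaler0 //.
  by rewrite eqn_add2r eqn_pmul2r // eq_sym; apply: contra_neq nD => e; apply: val_inj.
suff : J (up (tnth f j ^+ Dm) * v - Phi (\sum_(al <- s) g al)) by rewrite eg Phi0 subr0.
have -> : Phi (\sum_(al <- s) g al) = \sum_(al <- s) Phi (g al).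
  by apply: (big_morph Phi PhiD Phi0).
rewrite {1}es mulr_sumr -sumrB big_seq; apply: (ideal_sum _ iJ) => al als.
have le : (mdeg al <= Dm)%N by rewrite /Dm (big_rem al) //= leq_addr.
have -> : tnth f j ^+ Dm = tnth f j ^+ (Dm - mdeg al) * tnth f j ^+ mdeg al by rewrite -exprD subnK.
rewrite (Phig al le) /g.
have hX : ('X_[al] : B) \is (mdeg al).-homog by rewrite dhomogX.
have he := koszul_pow j hX.
rewrite !(rmorphM up) /= -!mul_mpolyC koszul_factor.
apply: (idealMl _ iJ); rewrite !mul_mpolyC.
exact: he.
Qed.

End SymmetricAlgebra.

Section PrimeIdeals.
Variables (R : comNzRingType) (q : set R).
Hypothesis pq : is_prime_ideal q.

Lemma prime_ideal : is_ideal setT q. Proof. by case: pq. Qed.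
Lemma primeN1 : ~ q 1. Proof. by case: pq. Qed.
Lemma primeN_mul a b : ~ q a -> ~ q b -> ~ q (a * b).
Proof. by case: pq => _ _ h na nb /h []. Qed.
Lemma primeN_exp a r : ~ q a -> ~ q (a ^+ r).
Proof.
by move=> na; elim: r => [|r IH]; [exact: primeN1|rewrite exprS; apply: primeN_mul].
Qed.
Lemma primeN_prod (T : eqType) (s : seq T) (g : T -> R) : (forall x, x \in s -> ~ q (g x)) ->
  ~ q (\prod_(x <- s) g x).
Proof.
move=> h; rewrite big_seq; apply: (big_ind (fun a => ~ q a)) => //; first exact: primeN1.
exact: primeN_mul.
Qed.

Lemma ideal_prod_sub (T : Type) (s : seq T) (a b : T -> R) (E : set R) : is_ideal setT E ->
  (forall x, E (b x)) -> E (\prod_(x <- s) (a x - b x) - \prod_(x <- s) a x).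
Proof.
move=> iE hb; elim: s => [|x s IH]; first by rewrite !big_nil subrr; apply: ideal0.
rewrite !big_cons.
have -> : (a x - b x) * \prod_(y <- s) (a y - b y) - a x * \prod_(y <- s) a y =
  a x * (\prod_(y <- s) (a y - b y) - \prod_(y <- s) a y) - b x * \prod_(y <- s) (a y - b y) by ring.
by apply: (idealB iE); [exact: (idealMl _ iE)|exact: (idealMr _ iE)].
Qed.

Lemma ideal_sub_exp (E : set R) y z r : is_ideal setT E -> E (y - z) -> E (y ^+ r) -> E (z ^+ r).
Proof.
move=> iE h hy; have -> : z ^+ r = y ^+ r - (y ^+ r - z ^+ r) by rewrite subKr.
by apply: (idealB iE) => //; rewrite subrXX; apply: (idealMr _ iE).
Qed.

End PrimeIdeals.

Definition linform (k : fieldType) n (v : 'I_n -> k) : {mpoly k[n]} := \sum_i v i *: 'X_i.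

(* [q] contains at most one linear form up to a constant; both the zero ideal
   and the primes of height one are such. *)
Definition thin (k : fieldType) n (q : set {mpoly k[n]}) : Prop :=
  is_prime_ideal q /\ forall v w i j, v i * w j - v j * w i != 0 ->
    q (linform v) -> q (linform w) -> False.

Lemma ideal_const (k : fieldType) n (E : set {mpoly k[n]}) c h : is_ideal setT E -> c != 0 ->
  E (c%:MP * h) -> E h.
Proof.
by move=> iE c0 /(idealMl (c^-1)%:MP iE); rewrite mulrA -mpolyCM mulVf // mul1r.
Qed.

(** * From local data at the base points to forms of large degree *)

Section Gluing.
Variables (k : closedFieldType) (N d : nat) (f : N.+3.-tuple {mpoly k[N.+2]}).
Hypothesis fd : forall i, tnth f i \is d.-homog.
Hypothesis finX : finite_set (base_points f).
Hypothesis d0 : (0 < d)%N.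
Local Notation A := {mpoly k[N.+2]}.
Local Notation B := {mpoly k[N.+3]}.
Local Notation AB := {mpoly B[N.+2]}.
Local Notation I := (lin (tnth f)).
Local Notation J := (sym_ideal f).
Local Notation X := (base_points f).
Local Notation up := (@poly_ext k N.+3 N.+2).
Local Notation specx x := (@spec k N.+3 N.+2 (pcoord x 0)).
#[local] Opaque frac_ext tf poly_ext cf.
Let iJ := sym_ideal_ideal f.
Let iIm m := @idealX_ideal _ I m.
Let iC m := coefs_in_ideal N.+3 (iIm m).

Definition symE m : set AB := [set u | exists2 j, J j & coefs_in (idealX setT I m) (u - j)].

Lemma symE_ideal m : is_ideal setT (symE m).
Proof.
apply/idealP; split.
- by exists 0; [exact: ideal0|rewrite subrr; exact: (ideal0 (iC m))].
- move=> u v [j Jj h] [j' Jj' h']; exists (j + j'); first exact: (idealD iJ).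
  by rewrite opprD addrACA; exact: (idealD (iC m)).
- move=> a v [j Jj h]; exists (a * j); first exact: (idealMl _ iJ).
  by rewrite -mulrBr; exact: (idealMl _ (iC m)).
Qed.

Lemma symE_sym m : J `<=` symE m.
Proof. by move=> u Ju; exists u => //; rewrite subrr; apply: (ideal0 (iC m)). Qed.

Lemma symE_coefs m : coefs_in (idealX setT I m) `<=` symE m.
Proof. by move=> u h; exists 0; [exact: ideal0|rewrite subr0]. Qed.

Lemma symE_kill : exists m0, forall m, (m0 <= m)%N ->
  forall b u, eq_ideal f b -> symE m u -> J (b *: u).
Proof.
have [m0 h] := eq_ideal_kill fd d0; exists m0 => m mm b u Pb [j Jj hj].
rewrite -(subrK j u) scalerDr; apply: (idealD iJ); first exact: h hj.
by apply: (idealZ _ iJ).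
Qed.

Variable l : A.
Hypothesis hl : l \is 1.-homog.
Hypothesis lX : forall x, X x -> mev l (pcoord x) != 0.

Lemma homogXn (R : comNzRingType) n (p : {mpoly R[n]}) r : p \is 1.-homog -> p ^+ r \is r.-homog.
Proof. by move=> hp; have := dhomogMn r hp; rewrite mul1n. Qed.

Lemma large_degree_up : exists e, forall r m nu u, (e * (r + m) < nu)%N -> u \is nu.-homog ->
  exists a b : AB, [/\ u = up (l ^+ r) * a + b, a \is (nu - r).-homog & coefs_in (idealX setT I m) b].
Proof.
have [e he] := large_degree fd hl lX; exists e => r m nu u lt hu.
have [s es] := up_decomp u.
have h al : exists ab : A * A, [/\ cf al u = l ^+ r * ab.1 + ab.2, ab.1 \is (nu - r).-homog
    & idealX setT I m ab.2].
  by have [a [b [e1 h1 _ h2]]] := he r m nu _ lt (cf_homog al hu); exists (a, b).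
have [ab hab] := choice h.
exists (\sum_(al <- s) 'X_[al] *: up (ab al).1), (\sum_(al <- s) 'X_[al] *: up (ab al).2); split.
- rewrite {1}es mulr_sumr -big_split; apply: eq_bigr => al _.
  have [-> _ _] := hab al.
  by rewrite (raddfD up) /= rmorphM /= scalerDr scalerAr.
- apply: rpred_sum => al _; have [_ h1 _] := hab al.
  by apply: rpredZ; apply: up_homog.
- apply: (ideal_sum _ (iC m)) => al _; have [_ _ h1] := hab al.
  apply: (idealZ _ (iC m)); exact: coefs_in_up.
Qed.

Lemma spec_zero (u : AB) c : (forall i, (tnth f i).@[c] = 0) ->
  [\/ forall p : A, p \is 1.-homog -> p.@[c] = 0
    | exists x t, [/\ X x, forall e (p : A), p \is e.-homog -> p.@[c] = t ^+ e * mev p (pcoord x)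
       & forall e (w : AB), w \is e.-homog -> spec c w = (t ^+ e)%:MP * specx x w]].
Proof.
move=> hc; case: (pselect (exists i, c i != 0)) => [/ppoint_of [x [t [t0 ec]]]|nc]; [right|left].
  have ev p e' : p \is e'.-homog -> p.@[c] = t ^+ e' * mev p (pcoord x).
    move=> hp; rewrite -(homog_scale t _ hp); apply: meval_eq => i; exact: ec.
  exists x, t; split=> //.
  - move=> i; have := hc i; rewrite (ev _ _ (fd i)).
    by move/eqP; rewrite mulf_eq0 expf_eq0 (negbTE t0) andbF => /eqP.
  - by move=> e p; apply: ev.
  - move=> e w hw; rewrite rmorphXn -(homog_scale _ _ hw); apply: meval_eq => i.
    by rewrite ec mpolyCM.
move=> p hp; have ec : p.@[c] = p.@[fun i => 0 * c i].
  apply: meval_eq => i; rewrite mul0r; apply/eqP; apply: contra_notT nc => ci.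
  by exists i.
by rewrite ec (homog_scale _ _ hp) expr1 mul0r.
Qed.

(* A form [G] of [AA] whose value at every base point lies outside of [q] is
   glued from the [H]; up to a multiple of [G], a product of powers of these
   values and of [l] vanishes on the base locus.                            *)
Lemma glue e m : exists r, forall (AA : set AB) (q : set B), is_ideal setT AA -> is_prime_ideal q ->
  (forall a, idealX setT I m a -> AA (up a)) ->
  (forall x, X x -> exists H, [/\ AA H, H \is e.-homog & ~ q (specx x H)]) ->
  exists2 s, ~ q s & AA (s *: up (l ^+ r)).
Proof.
have [xs [uxs hxs]] := base_seq finX.
have [R hR] := @vanishing_pow k N f m.
have h x : exists Dp : nat * A, [/\ Dp.2 \is Dp.1.-homog, mev Dp.2 (pcoord x) != 0
  & forall z, X z -> z != x -> mev Dp.2 (pcoord z) = 0].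
  by have [D [p hp]] := isolating_form finX x; exists (D, p).
have [p hp] := choice h.
pose Dm := (\sum_(x <- xs) (p x).1)%N; pose e' := (Dm + e)%N.
(* The form [Y] below consists of one [l] and a factor of degree [e'] for each base point; its power
   [R] falls into the power [m] of [I] by [vanishing_pow]. *)
exists ((1 + e' * size xs) * R)%N => AA q iA pq hI hH.
have h' x : exists H : AB, X x -> [/\ AA H, H \is e.-homog & ~ q (specx x H)].
  by case: (pselect (X x)) => [/hH [H ?]|nx]; [exists H|exists 0].
have [H hH'] := choice h'.
pose p' x := l ^+ (Dm - (p x).1) * (p x).2.
have hp' x : x \in xs -> p' x \is Dm.-homog.
  move=> xx; have le : ((p x).1 <= Dm)%N by rewrite /Dm (big_rem x) //= leq_addr.
  rewrite /p' -{2}(subnK le); apply: dhomogM; last by case: (hp x).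
  exact: homogXn.
(* As [p' z] vanishes at the other base points, the value of [G] at [z] is a nonzero constant times
   that of [H z]. *)
pose G := \sum_(z <- xs) up (p' z) * H z.
have AG : AA G.
  rewrite /G big_seq; apply: (ideal_sum _ iA) => z /hxs /hH' [h1 _ _]; exact: (idealMl _ iA).
have hG : G \is e'.-homog.
  rewrite /G big_seq; apply: rpred_sum => z zx; apply: dhomogM; first exact/up_homog/hp'.
  by have [] := hH' _ ((hxs _).2 zx).
pose ga x := specx x G.
have gaq x : x \in xs -> ~ q (ga x).
  move=> xx; have Xx := (hxs x).2 xx; have [_ _ nq] := hH' x Xx.
  rewrite /ga /G raddf_sum (bigD1_seq x xx uxs) /= big1_seq ?addr0 => [|z /andP [zx zz]]; last first.
    rewrite rmorphM /= spec_up.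
    have [_ _ hz] := hp z; rewrite /p' mevalM [(p z).2.@[_]](hz x Xx) ?mulr0 ?mpolyC0 ?mul0r //.
    by rewrite eq_sym.
  rewrite rmorphM /= spec_up => hq; apply: nq.
  apply: ideal_const hq; first exact: prime_ideal.
  have [_ px _] := hp x; rewrite /p' mevalM mulf_neq0 //; rewrite rmorphXn expf_neq0 //.
  exact: (lX Xx).
(* The factor of [x] vanishes on the whole line of [x], its two terms being forms of the same degree
   [e']; the factor [up l] takes care of the origin of the cone. *)
pose Y : AB := up l * \prod_(x <- xs) (ga x *: up (l ^+ e') - (mev l (pcoord x) ^+ e')%:MP *: G).
have VY : coefs_in (vanishing f) Y.
  move=> al c hc; rewrite -mcoeff_spec.
  suff -> : spec c Y = 0 by rewrite mcoeff0.
  rewrite /Y rmorphM /= spec_up; have [h0|[x [t [Xx e1 e2]]]] := spec_zero Y hc.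
    by rewrite h0 // mpolyC0 mul0r.
  rewrite rmorph_prod (bigD1_seq x ((hxs x).1 Xx) uxs) /=.
  have mul0 (R0 : nzRingType) (a b c0 : R0) : b = 0 -> a * (b * c0) = 0.
    by move=> ->; rewrite mul0r mulr0.
  have swap (R0 : comNzRingType) (a b c0 : R0) : c0 * (a * b) - b * (a * c0) = 0 by ring.
  apply: mul0; rewrite rmorphB /= !specZ spec_up (rmorphXn (meval c)) /= (e1 _ _ hl) (e2 _ _ hG).
  by rewrite expr1 exprMn mpolyCM; apply: swap.
pose sg := \prod_(x <- xs) ga x.
exists (sg ^+ R); first by apply: primeN_exp => //; apply: primeN_prod.
have -> : sg ^+ R *: up (l ^+ ((1 + e' * size xs) * R)) = (sg *: up (l ^+ (1 + e' * size xs))) ^+ R.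
  by rewrite exprZn -rmorphXn exprM.
apply: (ideal_sub_exp (y := Y)) => //.
  have -> : sg *: up (l ^+ (1 + e' * size xs)) = up l * \prod_(x <- xs) (ga x *: up (l ^+ e')).
    rewrite scaler_prod -/sg -scalerAr big_const_seq count_predT iter_mulr_1; congr (_ *: _).
    by rewrite -rmorphXn -rmorphM exprD expr1 exprM.
  rewrite /Y -mulrBr; apply: (idealMl _ iA); apply: (ideal_prod_sub _ _ iA) => x.
  by apply: (idealZ _ iA).
have : coefs_in (idealX setT I m) (Y ^+ R).
  apply: (coefs_in_mono hR); exact: coefs_in_exp.
exact: (coefs_in_min iA hI).
Qed.

Lemma glue_any m (AA : set AB) (q : set B) : is_ideal setT AA -> is_prime_ideal q ->
  (forall a, idealX setT I m a -> AA (up a)) ->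
  (forall x, X x -> exists e H, [/\ AA H, H \is e.-homog & ~ q (specx x H)]) ->
  exists r s, ~ q s /\ AA (s *: up (l ^+ r)).
Proof.
move=> iA pq hI hH; have [xs [_ hxs]] := base_seq finX.
have h x : exists e, X x -> exists H, [/\ AA H, H \is e.-homog & ~ q (specx x H)].
  by case: (pselect (X x)) => [/hH [e [H ?]]|nx]; [exists e => _; exists H|exists 0%N].
have [e he] := choice h; pose E := (\sum_(x <- xs) e x)%N.
have [r hr] := glue E m; have [x Xx|s ns hs] := hr AA q iA pq hI; last by exists r, s.
have [H [AH hom nH]] := he x Xx.
have le : (e x <= E)%N by rewrite /E (big_rem x) ?leq_addr //; exact/hxs.
exists (up (l ^+ (E - e x)) * H); split; first exact: (idealMl _ iA).
  by rewrite -{2}(subnK le); apply: dhomogM => //; apply/up_homog/homogXn.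
rewrite rmorphM /= spec_up => hq; apply: nH.
apply: ideal_const hq; first exact: prime_ideal.
by rewrite rmorphXn expf_neq0 //; exact: (lX Xx).
Qed.

Lemma spec_syzygy c (a : 'I_N.+3 -> A) : spec c (syzygy_form a) = linform (fun i => (a i).@[c]).
Proof.
rewrite syzygy_formE raddf_sum; apply: eq_bigr => i _ /=.
by rewrite specZ spec_up mulrC mul_mpolyC.
Qed.

Lemma syzygy_form_homog e (a : 'I_N.+3 -> A) : (forall i, a i \is e.-homog) ->
  syzygy_form a \is e.-homog.
Proof. by move=> ha; apply: rpred_sum => i _; apply/rpredZ/up_homog. Qed.

Variable L : ppoint k N.+2 -> B.
Hypothesis hL : forall x, non_lci_points f x -> is_relation_form f x d (L x).

Definition avoids (q : set B) := forall x, non_lci_points f x -> ~ q (L x).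

Let irr_at x e := forall q, thin q -> (non_lci_points f x -> ~ q (L x)) ->
  exists H, [/\ J H, H \is e.-homog & ~ q (specx x H)].

Lemma irr_at_mono x e e' : X x -> irr_at x e -> irr_at x (e' + e).
Proof.
move=> Xx h q tq nq; have [H [JH hH nH]] := h q tq nq.
exists (up (l ^+ e') * H); split; first exact: (idealMl _ iJ).
  by apply: dhomogM => //; apply/up_homog/homogXn.
rewrite rmorphM /= spec_up => hq; apply: nH.
apply: ideal_const hq; first exact: (prime_ideal (proj1 tq)).
by rewrite rmorphXn expf_neq0 //; exact: (lX Xx).
Qed.

(** At a complete intersection two syzygies take independent values, which a thin prime cannot both
    contain; at another point one syzygy takes the value [L x] up to a constant. Powers of [l] bring
    them to a common degree, chosen before [q]. *)
Lemma irr_data : exists e, forall q, thin q -> forall x, X x ->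
  (non_lci_points f x -> ~ q (L x)) -> exists H, [/\ J H, H \is e.-homog & ~ q (specx x H)].
Proof.
have hx x : X x -> exists e, irr_at x e.
  move=> Xx; have [i0 [v0 _]] := normP x; have [c mphi] := chart_nilpotent fd finX v0 Xx.
  have hv v : spec_rel f x i0 v -> exists e H, [/\ J H, H \is e.-homog & specx x H = linform v].
    case/(spec_rel_homog v0 fd) => e [a [h1 h2 h3]]; exists e, (syzygy_form a); split.
    - exact: sym_syzygy.
    - exact: syzygy_form_homog.
    - by rewrite spec_syzygy; congr linform; apply/funext => i; exact: h3.
  case: (pselect (locally_complete_intersection f x)) => lc.
    have [v [w [i [j [/hv [e1 [H1 [J1 h1 s1]]] /hv [e2 [H2 [J2 h2 s2]]] nz]]]]] :=
      lci_two_relations v0 fd lc.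
    exists (e2 + e1)%N => q tq nq; case: (pselect (q (linform v))) => qv.
      exists (up (l ^+ e1) * H2); split; first exact: (idealMl _ iJ).
        by rewrite addnC; apply: dhomogM => //; apply/up_homog/homogXn.
      rewrite rmorphM /= spec_up s2 => hq.
      apply: (proj2 tq v w i j) => //; apply: ideal_const hq; first exact: (prime_ideal (proj1 tq)).
      by rewrite rmorphXn expf_neq0 //; exact: (lX Xx).
    exists (up (l ^+ e2) * H1); split; first exact: (idealMl _ iJ).
      by apply: dhomogM => //; apply/up_homog/homogXn.
    rewrite rmorphM /= spec_up s1 => hq; apply: qv.
    apply: ideal_const hq; first exact: (prime_ideal (proj1 tq)).
    by rewrite rmorphXn expf_neq0 //; exact: (lX Xx).
  have nl : non_lci_points f x by split.
  have [t [v [t0 /hv [e [H [JH hH sH]]] _ ev]]] := relation_form_spec v0 fd (hL nl).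
  exists e => q tq /(_ nl) nq; exists H; split=> //; rewrite sH /linform ev => hq; apply: nq.
  by apply: (ideal_const (prime_ideal (proj1 tq)) t0); rewrite mul_mpolyC.
have [xs [_ hxs]] := base_seq finX.
have [e he] : exists e, forall x, x \in xs -> irr_at x e.
  have : forall x, x \in xs -> X x by move=> x /hxs.
  elim: xs {hxs} => [|y s IH] hs; first by exists 0%N.
  have [|e he] := IH; first by move=> x xs; apply: hs; rewrite inE xs orbT.
  have Xy : X y by apply: hs; rewrite mem_head.
  have [e' he'] := hx y Xy.
  exists (e + e')%N => x xs; have Xx := hs x xs; move: xs; rewrite inE => /predU1P [->|xs].
    exact: irr_at_mono.
  by rewrite addnC; apply: irr_at_mono => //; apply: he.
by exists e => q tq x Xx aq; apply: (he x) => //; exact/hxs.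
Qed.

(** [glue] puts [s] times [l ^+ r] into [symE f m], and a form of large degree is a multiple of
    [l ^+ r] modulo the power [m] of [I]. Both exponents are fixed before [q], which makes the bound
    on [nu] uniform. *)
Lemma kill_symE m : exists nu0, forall nu, (nu0 <= nu)%N -> forall q, thin q -> avoids q ->
  exists2 s, ~ q s & forall u, u \is nu.-homog -> symE m (s *: u).
Proof.
have [e he] := irr_data; have [r hr] := glue e m; have [e' he'] := large_degree_up.
exists (e' * (r + m)).+1 => nu lt q tq aq.
have [a ha|x Xx|s ns hs] := hr (symE m) q (symE_ideal m) (proj1 tq).
- apply: symE_coefs; exact: (coefs_in_up (iIm m) ha).
- by have [H [JH hH nH]] := he q tq x Xx (aq x); exists H; split=> //; apply: symE_sym.
exists s => [|u hu]; first exact: ns.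
have iE := symE_ideal m.
have [a [b [-> _ hb]]] := he' r m nu u lt hu.
rewrite scalerDr; apply: (idealD iE).
  by rewrite scalerAl; apply: (idealMr _ iE).
by apply: (idealZ _ iE); apply: symE_coefs.
Qed.

Lemma kill_sym : exists nu0, forall nu, (nu0 <= nu)%N -> forall q, thin q -> avoids q ->
  (exists2 b, eq_ideal f b & ~ q b) ->
  exists2 s, ~ q s & forall u, u \is nu.-homog -> J (s *: u).
Proof.
have [m0 hm0] := symE_kill; have [nu0 h] := kill_symE m0.
exists nu0 => nu lt q tq aq [b Pb nb]; have [s ns hs] := h nu lt q tq aq.
exists (b * s) => [|u hu]; first exact: (primeN_mul (proj1 tq)).
by rewrite -scalerA; apply: (hm0 m0) => //; apply: hs.
Qed.

End Gluing.

Section MoreComposition.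
Variables (F : comNzRingType) (V : lmodType F) (R m : set F).
Hypothesis Rm : is_local R m.

Lemma clen_basis (P N : set V) l (v : 'I_l -> V) : ~ m 1 -> is_submodule R P ->
  (forall i r, m r -> P (r *: v i)) ->
  (forall c : 'I_l -> F, (forall i, R (c i)) -> P (\sum_i c i *: v i) -> forall i, m (c i)) ->
  (forall u, N u <-> exists c : 'I_l -> F, (forall i, R (c i)) /\ P (u - \sum_i c i *: v i)) ->
  clen R m P N l.
Proof.
move=> m1 sP; elim: l v N => [|l IH] v N mv iv Nv.
  have -> : N = P.
    apply/seteqP; split=> u; first by case/Nv => c [_]; rewrite big_ord0 subr0.
    by move=> Pu; apply/Nv; exists (fun=> 0); rewrite big_ord0 subr0; split=> // -[].
  exact: clen_nil.
pose M : set V := [set u | exists c : 'I_l -> F,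
  (forall i, R (c i)) /\ P (u - \sum_i c i *: v (lift ord0 i))].
pose ext (a : F) (c : 'I_l -> F) i := if unlift ord0 i is Some j then c j else a.
have Rext a c : R a -> (forall i, R (c i)) -> forall i, R (ext a c i).
  by move=> Ra Rc i; rewrite /ext; case: unlift.
have E a c : \sum_i ext a c i *: v i = a *: v ord0 + \sum_i c i *: v (lift ord0 i).
  by rewrite big_ord_recl /ext unlift_none; under eq_bigr do rewrite liftK.
have R0 := subring0 Rm.
have cM : clen R m P M l.
  apply: (IH (fun i => v (lift ord0 i))) => // [i r mr|c Rc Pc i]; first exact: mv.
  have := iv _ (Rext 0 c R0 Rc).
  by rewrite E scale0r add0r => /(_ Pc (lift ord0 i)); rewrite /ext liftK.
have -> : N = adjoin R M (v ord0).
  apply/seteqP; split=> u.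
    case/Nv => c [Rc]; rewrite big_ord_recl opprD addrA => Pu.
    by exists (c ord0) => //; exists (fun i => c (lift ord0 i)).
  case=> r Rr [c [Rc Pu]]; apply/Nv; exists (ext r c); split; first exact: Rext.
  by rewrite E opprD addrA.
apply: clen_step => // [|r mr]; last first.
  by exists (fun=> 0); split=> //; rewrite big1 ?subr0 => [|i _]; [exact: mv|rewrite scale0r].
case=> c [Rc Pu]; have := iv (ext 1 (fun i => - c i)).
rewrite E scale1r => h; apply: m1.
have := h _ _ ord0; rewrite /ext unlift_none; apply; last first.
  by under eq_bigr do rewrite scaleNr; rewrite sumrN.
by apply: Rext => [|i]; [exact: (subring1 Rm)|exact: (subringN Rm)].
Qed.

(** The ascending chain condition; [r0] is where the length of [N / K r] is smallest. *)
Lemma clen_stable P N l (K : nat -> set V) : clen R m P N l -> (forall r, is_submodule R (K r)) ->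
  (forall r, P `<=` K r /\ K r `<=` N) -> (forall r, K r `<=` K r.+1) ->
  exists r0, forall r, K r `<=` K r0.
Proof.
move=> c sK PKN KS.
have mono r s : (r <= s)%N -> K r `<=` K s.
  elim: s => [|s IH]; first by rewrite leqn0 => /eqP ->.
  rewrite leq_eqVlt => /predU1P [-> //|]; rewrite ltnS => /IH h.
  by apply: subset_trans h (KS s).
have len r : exists b, clen R m (K r) N b.
  by have [PK KN] := PKN r; have [a [b [_ h _]]] := clen_split Rm c (sK r) PK KN; exists b.
have exb : exists b, `[< exists r, clen R m (K r) N b >].
  by have [b h] := len 0%N; exists b; apply/asboolP; exists 0%N.
case: (ex_minnP exb) => b /asboolP [r0 h0] bmin; exists r0 => r.
have [le|lt] := leqP r r0; first exact: mono.
have [a [b' [ca cb e]]] := clen_split Rm h0 (sK r) (mono _ _ (ltnW lt)) (PKN r).2.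
have le : (b <= b')%N by apply: bmin; apply/asboolP; exists r.
have a0 : a = 0%N by lia.
by move: ca; rewrite a0 => /clen0 ->.
Qed.

Lemma clen_killed P (s : seq V) : is_submodule R P -> {in s, forall v r, m r -> P (r *: v)} ->
  exists l, clen R m P (adjoins R P s) l.
Proof.
elim: s P => [|v s IH] P sP h /=; first by exists 0%N; apply: clen_nil.
have sA := adjoin_submod Rm v sP.
have [l1 c1] : exists l, clen R m P (adjoin R P v) l.
  case: (pselect (P v)) => Pv; first by exists 0%N; rewrite (adjoin_id Rm) //; apply: clen_nil.
  exists 1%N; apply: clen_step => //; first exact: clen_nil.
  exact: h (mem_head _ _).
have [w ws r mr|l2 c2] := IH _ sA.
  by apply: (adjoin_sub Rm); apply: h => //; rewrite inE ws orbT.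
by exists (l1 + l2)%N; apply: clen_cat c1 c2.
Qed.

End MoreComposition.

Section Fractions.
Variables (L : fieldType) (V : lmodType L).
Implicit Types (s t b : L) (x y : V).

Fact scaleV_eq s t x y : s != 0 -> t != 0 -> s^-1 *: x = t^-1 *: y -> t *: x = s *: y.
Proof.
move=> s0 t0 e; rewrite -[x](scalerKV s0) e !scalerA [t * s]mulrC -mulrA mulfV // mulr1.
by [].
Qed.

Fact scaleV_cancel s t x : t != 0 -> (s * t)^-1 *: (t *: x) = s^-1 *: x.
Proof. by move=> t0; rewrite scalerA invfM -mulrA mulVf // mulr1. Qed.

Fact scaleV_add s t x y : s != 0 -> t != 0 -> (s * t)^-1 *: (t *: x + s *: y) = s^-1 *: x + t^-1 *: y.
Proof. by move=> s0 t0; rewrite scalerDr scaleV_cancel // mulrC scaleV_cancel. Qed.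

Fact scaleV_mul s t b x : (t * s)^-1 *: (b *: x) = (b / t) *: (s^-1 *: x).
Proof. by rewrite !scalerA invfM mulrC mulrA. Qed.
End Fractions.

(** * Localisation of the graded pieces at a prime of [B] *)

Section PrimeLocalization.
Variables (k : fieldType) (n N : nat).
Local Notation B := {mpoly k[n]}.
Local Notation F := {fraction B}.
Local Notation AB := {mpoly B[N]}.
Local Notation V := {mpoly F[N]}.
Local Notation "x %:F" := (tofrac x).
Variable q : set B.
Hypothesis pq : is_prime_ideal q.
Local Notation Rq := (loc_ring q).
#[local] Opaque frac_ext tf poly_ext cf.

Definition loc_max : set F := [set z | exists a s, [/\ q a, ~ q s & z = a%:F / s%:F]].

Lemma denom_neq0 s : ~ q s -> s%:F != 0 :> F.
Proof.
rewrite tofrac_eq0 => nq; apply: contra_not_neq nq => ->; exact: ideal0 (prime_ideal pq).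
Qed.

Lemma frac_eq (L : fieldType) (a s b t : L) : s != 0 -> t != 0 -> a / s = b / t -> t * a = s * b.
Proof. by move=> s0 t0 /eqP; rewrite eqr_div // => /eqP e; rewrite mulrC e mulrC. Qed.

Lemma frac_add (L : fieldType) (a s b t : L) : s != 0 -> t != 0 ->
  a / s + b / t = (t * a + s * b) / (s * t).
Proof. by move=> s0 t0; rewrite addf_div // [a * t]mulrC [b * s]mulrC. Qed.

Lemma loc_ring_local : is_local Rq loc_max.
Proof.
have iq := prime_ideal pq.
split.
- split; first by exists 1, 1; rewrite divr1 tofrac1; split=> //; exact: primeN1.
  + move=> _ _ [a [s [ns ->]]] [b [t [nt ->]]]; exists (t * a - s * b), (s * t).
    split; first exact: primeN_mul.
    by rewrite -mulNr frac_add ?denom_neq0 // mulrN tofracB !tofracM.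
  + move=> _ _ [a [s [ns ->]]] [b [t [nt ->]]]; exists (a * b), (s * t).
    by split; [exact: primeN_mul|rewrite !tofracM mulf_div].
- by move=> _ [a [s [qa ns ->]]]; exists a, s.
- by exists 0, 1; rewrite tofrac0 mul0r; split=> //; [exact: ideal0|exact: primeN1].
move=> _ [a [s [ns ->]]]; case: (pselect (q a)) => qa; first by left; exists a, s.
right; exists (s%:F / a%:F); first by exists s, a.
exists 0, 1; rewrite tofrac0 mul0r; split; [exact: ideal0|exact: primeN1|].
by rewrite mulf_div [s%:F * _]mulrC divff ?subrr // mulf_neq0 ?denom_neq0.
Qed.

Lemma loc_max1 : ~ loc_max 1.
Proof.
case=> a [s [qa ns e]]; have s0 := denom_neq0 ns; apply: ns; suff -> : s = a by [].
apply/eqP; rewrite -tofrac_eq; apply/eqP.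
by rewrite -[a%:F](divfK s0) -e mul1r.
Qed.

Definition piece (E : set AB) nu : set V :=
  loc_mod q (@tf k n N @` [set u | u \is nu.-homog /\ E u]).

Lemma pieceP E nu v : piece E nu v <->
  exists s u, [/\ ~ q s, u \is nu.-homog, E u & v = (s%:F)^-1 *: tf u].
Proof.
split=> [[s [_ [ns [u [hu Eu] <-] ->]]]|[s [u [ns hu Eu ->]]]]; first by exists s, u.
by exists s, (tf u); split=> //; exists u.
Qed.

Lemma tf_frac (s t : B) (u w : AB) : ~ q s -> ~ q t ->
  (s%:F)^-1 *: tf u = (t%:F)^-1 *: tf w -> t *: u = s *: w.
Proof.
move=> ns nt e; apply: (@tf_inj k n N); rewrite !tfZ.
by apply: scaleV_eq e; exact: denom_neq0.
Qed.

Lemma piece_tf E nu s u : is_ideal setT E -> ~ q s -> u \is nu.-homog ->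
  piece E nu ((s%:F)^-1 *: tf u) <-> exists2 t, ~ q t & E (t *: u).
Proof.
move=> iE ns hu; split=> [/pieceP [t [w [nt hw Ew e]]]|[t nt Et]].
  exists t; first exact: nt.
  by rewrite (tf_frac ns nt e) -mul_mpolyC; exact: (idealMl _ iE).
apply/pieceP; exists (s * t), (t *: u); split; [exact: primeN_mul|exact: rpredZ|exact: Et|].
by rewrite tfZ tofracM scaleV_cancel // denom_neq0.
Qed.

Lemma piece_submod E nu : is_ideal setT E -> is_submodule Rq (piece E nu).
Proof.
move=> iE; split.
- apply/pieceP; exists 1, 0; split=> //; [exact: primeN1|exact: dhomog0|exact: ideal0|].
  by rewrite raddf0 scaler0.
- move=> _ _ /pieceP [s [u [ns hu Eu ->]]] /pieceP [t [w [nt hw Ew ->]]].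
  apply/pieceP; exists (s * t), (t *: u + s *: w); split; first exact: primeN_mul.
  + by apply: rpredD; apply: rpredZ.
  + by apply: (idealD iE); apply: (idealZ _ iE).
  + by rewrite raddfD /= !tfZ tofracM scaleV_add ?denom_neq0.
- move=> _ _ [b [t [nt ->]]] /pieceP [s [u [ns hu Eu ->]]].
  apply/pieceP; exists (t * s), (b *: u); split; [exact: primeN_mul|exact: rpredZ| |].
    by apply: (idealZ _ iE).
  by rewrite tfZ tofracM scaleV_mul.
Qed.

Lemma piece_sub (E E' : set AB) nu : (forall u, u \is nu.-homog -> E u -> exists2 t, ~ q t & E' (t *: u)) ->
  piece E nu `<=` piece E' nu.
Proof.
move=> h _ /pieceP [s [u [ns hu Eu ->]]]; have [t nt Et] := h u hu Eu.
apply/pieceP; exists (s * t), (t *: u); split; [exact: primeN_mul|exact: rpredZ|exact: Et|].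
by rewrite tfZ tofracM scaleV_cancel // denom_neq0.
Qed.

Lemma piece_mono (E E' : set AB) nu : E `<=` E' -> piece E nu `<=` piece E' nu.
Proof.
by move=> EE; apply: piece_sub => u _ /EE Eu; exists 1; [exact: primeN1|rewrite scale1r].
Qed.

Lemma piece_mon nu : exists s : seq AB, (forall u, u \in s -> u \is nu.-homog) /\
  forall P, is_submodule Rq P -> piece setT nu `<=` adjoins Rq P [seq tf u | u <- s].
Proof.
exists [seq 'X_[m] | m <- mons N nu]; split=> [_ /mapP [m mm ->]|P sP].
  by rewrite dhomogX; rewrite mem_mons in mm.
have Rl := loc_ring_local; have sA := adjoins_submod Rl [seq tf u | u <- [seq 'X_[m] | m <- mons N nu]] sP.
move=> _ /pieceP [s [u [ns hu _ ->]]]; apply: (submodZ sA).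
  by exists 1, s; rewrite tofrac1 div1r.
rewrite [u]mpolyE raddf_sum big_seq; apply: (submod_sum sA) => m mu /=.
rewrite tfZ; apply: (submodZ sA).
  by exists u@_m, 1; rewrite tofrac1 divr1; split=> //; exact: primeN1.
apply: (adjoins_mem Rl) => //; apply/map_f/map_f; rewrite mem_mons.
by apply/eqP; apply: (dhomogP _ _ _ hu).
Qed.

Section Transport.
Variables (K : fieldType) (M : nat).
Local Notation W := {mpoly K[M]}.
Variables (om : {rmorphism AB -> W}) (Jx : set W) (c : nat).
Hypothesis iJx : is_ideal setT Jx.
Hypothesis locJx : loc Jx = Jx.
Hypothesis mJx : mpow c `<=` Jx.
Hypothesis omq : forall s, (om s%:MP)@_0 = 0 <-> q s.
Hypothesis res_surj : forall z : K, exists b s, ~ q s /\ (om s%:MP)@_0 * z = (om b%:MP)@_0.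

Lemma clen_transport (D : set AB) nu l : is_ideal setT D ->
  (forall w, exists u s, [/\ ~ q s, u \is nu.-homog, D u & Jx (om s%:MP * w - om u)]) ->
  @clen W W^o setT (@mI K M) Jx setT l ->
  clen Rq loc_max (piece (D `&` [set u | Jx (om u)]) nu) (piece D nu) l.
Proof.
move=> iD surj cl; have Rl := loc_ring_local.
have unit s : ~ q s -> (om s%:MP)@_0 != 0 by move=> ns; apply/eqP => /omq.
pose rel (v : V) (w : W^o) := exists u s, [/\ ~ q s, u \is nu.-homog,
  v = (s%:F)^-1 *: tf u & Jx (om s%:MP * w - om u)].
have omZ s u : om (s *: u) = om s%:MP * om u by rewrite -mul_mpolyC rmorphM.
have cp := @clen_preim F W V W^o Rq loc_max setT (@mI K M) rel (piece D nu) setT Jx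
  Rl (@mI_local K M) (piece_submod nu iD) iJx _ _ _ _ _ _ _ _ cl (@subset_refl _ _).
have e1 : preim rel (piece D nu) Jx = piece (D `&` [set u | Jx (om u)]) nu.
  apply/seteqP; split=> [v [Dv [w Jw [u [s [ns hu ev hJ]]]]]|v /pieceP [s [u [ns hu [Du Ju] ev]]]].
    move: Dv; rewrite ev => /(piece_tf iD ns hu) [t nt Dt].
    apply/pieceP; exists (s * t), (t *: u); split; [exact: primeN_mul|exact: rpredZ| |].
      split; first exact: Dt.
      rewrite /= omZ; apply: (idealMl _ iJx).
      by rewrite -[om u](subKr (om s%:MP * w)); apply: (idealB iJx) => //; apply: (idealMl _ iJx).
    by rewrite tfZ tofracM scaleV_cancel // denom_neq0.
  split; first by apply/pieceP; exists s, u.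
  exists 0; first exact: (ideal0 iJx).
  by exists u, s; rewrite mulr0 sub0r; split=> //; apply: (idealN iJx).
have e2 : preim rel (piece D nu) setT = piece D nu.
  apply/seteqP; split=> [v []//|v Dv]; split=> //.
  have /pieceP [s [u [ns hu Du ev]]] := Dv; have [s' hs'] := inv_mod c (unit s ns).
  exists (s' * om u) => //; exists u, s; split=> //.
  have -> : om s%:MP * (s' * om u) - om u = - ((1 - s' * om s%:MP) * om u) by ring.
  by apply: (idealN iJx); apply: (idealMr _ iJx); apply: mJx.
rewrite e1 e2 in cp; apply: cp.
- move=> w _; have [u [s [ns hu Du hJ]]] := surj w.
  by exists ((s%:F)^-1 *: tf u); [apply/pieceP; exists s, u|exists u, s].
- move=> _ _ w1 w2 [u [s [ns hu -> h1]]] [v [t [nt hv -> h2]]].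
  exists (t *: u + s *: v), (s * t); split; first exact: primeN_mul.
  + by apply: rpredD; apply: rpredZ.
  + by rewrite raddfD /= !tfZ tofracM scaleV_add ?denom_neq0.
  + rewrite mpolyCM rmorphM rmorphD /= !omZ.
    have -> : om s%:MP * om t%:MP * (w1 + w2) - (om t%:MP * om u + om s%:MP * om v) =
      om t%:MP * (om s%:MP * w1 - om u) + om s%:MP * (om t%:MP * w2 - om v) by ring.
    by apply: (idealD iJx); apply: (idealMl _ iJx).
- move=> _ w [u [s [ns hu -> h]]]; exists (- u), s; split=> //; first by rewrite rpredN.
    by rewrite raddfN /= scalerN.
  by rewrite mulrN rmorphN /= -opprD; apply: (idealN iJx).
- move=> w [u [s [ns hu e h]]]; rewrite -locJx; exists (om s%:MP); first exact: unit.
  suff u0 : u = 0 by move: h; rewrite u0 rmorph0 subr0.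
  apply: (@tf_inj k n N); rewrite raddf0; apply: (scalerI (invr_neq0 (denom_neq0 ns))).
  by rewrite -e scaler0.
- move=> _ _ w [b [t [nt ->]]] [u [s [ns hu -> h]]]; have [t' ht'] := inv_mod c (unit t nt).
  exists (t' * om b%:MP); split=> //.
    move=> [b1 [t1 [qb1 nt1 e]]]; apply: (idealMl _ (@mpow_ideal K M 1)); apply/mpow1P/omq.
    have e' : t1 * b = t * b1.
      apply/eqP; rewrite -tofrac_eq !tofracM; apply/eqP; apply: frac_eq e; exact: denom_neq0.
    case: pq => _ _ /(_ t1 b); rewrite e' => -[|//|//]; exact: (idealMl _ (prime_ideal pq)).
  exists (b *: u), (t * s); split; [exact: primeN_mul|exact: rpredZ| |].
    by rewrite tfZ tofracM scaleV_mul.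
  rewrite [_ *: _]/(_ * _) mpolyCM rmorphM /= omZ.
  have -> : om t%:MP * om s%:MP * (t' * om b%:MP * w) - om b%:MP * om u =
     om b%:MP * (om s%:MP * w - om u) - (1 - t' * om t%:MP) * (om b%:MP * om s%:MP * w) by ring.
  apply: (idealB iJx); first exact: (idealMl _ iJx).
  by apply: (idealMr _ iJx); apply: mJx.
- move=> r' _ w _ [u [s [ns hu -> h]]]; have [b [t [nt e]]] := res_surj r'@_0.
  have [t' ht'] := inv_mod c.+1 (unit t nt).
  exists (b%:F / t%:F), (t' * om b%:MP); split=> //; first by exists b, t.
    apply/mpow1P; rewrite mcoeffB (rmorphM (mcoeff 0)) /= -e mulrA.
    have : (1 - t' * om t%:MP)@_0 = 0 by apply: ht'; rewrite mdeg0.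
    by rewrite mcoeffB mcoeff1 eqxx (rmorphM (mcoeff 0)) /= => /eqP; rewrite subr_eq0 => /eqP <-; rewrite mul1r subrr.
  exists (b *: u), (t * s); split; [exact: primeN_mul|exact: rpredZ| |].
    by rewrite tfZ tofracM scaleV_mul.
  rewrite [_ *: _]/(_ * _) mpolyCM rmorphM /= omZ.
  have -> : om t%:MP * om s%:MP * (t' * om b%:MP * w) - om b%:MP * om u =
     om b%:MP * (om s%:MP * w - om u) - (1 - t' * om t%:MP) * (om b%:MP * om s%:MP * w) by ring.
  apply: (idealB iJx); first exact: (idealMl _ iJx).
  by apply: (idealMr _ iJx); apply: mJx; apply: (mpow_sub (leqnSn c)).
Qed.

End Transport.

Section Filtration.
Variables (K : fieldType) (M : nat) (X : eqType).
Local Notation W := {mpoly K[M]}.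
Variables (om : X -> {rmorphism AB -> W}) (Jx : X -> set W) (lx : X -> nat) (nu : nat).

(** The conditions at the points are imposed one after the other. As in the Chinese remainder
    theorem, values at [x] are attained by elements vanishing at the other points, so the lengths
    add up. *)
Lemma clen_filtration (xs : seq X) : uniq xs ->
  (forall x, x \in xs -> [/\ is_ideal setT (Jx x), loc (Jx x) = Jx x, exists c, mpow c `<=` Jx x,
     forall s, (om x s%:MP)@_0 = 0 <-> q s
   & forall z : K, exists b s, ~ q s /\ (om x s%:MP)@_0 * z = (om x b%:MP)@_0]) ->
  (forall x, x \in xs -> @clen W W^o setT (@mI K M) (Jx x) setT (lx x)) ->
  (forall x w, x \in xs -> exists u s, [/\ ~ q s, u \is nu.-homog, Jx x (om x s%:MP * w - om x u)
     & forall z, z \in xs -> z != x -> Jx z (om z u)]) ->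
  clen Rq loc_max (piece [set u | forall x, x \in xs -> Jx x (om x u)] nu) (piece setT nu)
    (\sum_(x <- xs) lx x).
Proof.
have Rl := loc_ring_local.
move=> uxs hJ hl surj; pose D (s : seq X) : set AB := [set u | forall x, x \in s -> Jx x (om x u)].
have iD s : {subset s <= xs} -> is_ideal setT (D s).
  move=> ss; apply/idealP; split=> [x xs'|u v hu hv x xs'|a v hv x xs'];
    have [iJ _ _ _ _] := hJ x (ss x xs').
  + by rewrite rmorph0; exact: ideal0.
  + by rewrite rmorphD; exact: (idealD iJ (hu x xs') (hv x xs')).
  + by rewrite rmorphM; apply: (idealMl _ iJ); exact: hv.
suff : forall s, uniq s -> {subset s <= xs} -> clen Rq loc_max (piece (D s) nu) (piece setT nu) (\sum_(x <- s) lx x).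
  by move=> /(_ xs uxs); apply.
elim=> [_ _|x s IH /= /andP [xns us] ss].
  rewrite big_nil; have -> : D [::] = setT by apply/seteqP; split=> // u _ x.
  by apply: clen_nil; apply: piece_submod.
have ss' : {subset s <= xs} by move=> y ys; apply: ss; rewrite inE ys orbT.
have xx : x \in xs by apply: ss; rewrite mem_head.
have [iJ lJ [c mJ] oq rs] := hJ x xx.
rewrite big_cons addnC; rewrite addnC.
have c1 := IH us ss'.
have e : D (x :: s) = D s `&` [set u | Jx x (om x u)].
  apply/seteqP; split=> [u hu|u [hu hx] y].
    by split=> [y ys|]; apply: hu; rewrite inE ?ys ?orbT ?eqxx.
  by rewrite inE => /predU1P [->//|/hu].
rewrite e; apply: clen_cat c1.
apply: (clen_transport iJ lJ mJ oq rs (iD s ss') _ (hl x xx)) => w.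
have [u [t [nt hu h1 h2]]] := surj x w xx; exists u, t; split=> // z zs.
by apply: h2; [exact: ss'|apply: contraNneq xns => <-].
Qed.

End Filtration.

End PrimeLocalization.

(** * Fibres over the base points *)

Section Congruences.
Variables (R : comNzRingType) (E : set R).
Hypothesis iE : is_ideal setT E.

Lemma congM a b c e : E (a - b) -> E (c - e) -> E (a * c - b * e).
Proof.
move=> h h'; have -> : a * c - b * e = (a - b) * c + b * (c - e) by ring.
by apply: (idealD iE); [exact: (idealMr _ iE)|exact: (idealMl _ iE)].
Qed.

Lemma congX a b r : E (a - b) -> E (a ^+ r - b ^+ r).
Proof.
by move=> h; elim: r => [|r IH]; [rewrite subrr; apply: ideal0|rewrite !exprS; apply: congM].
Qed.

Lemma cong_prod (T : finType) (a b : T -> R) : (forall i, E (a i - b i)) ->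
  E (\prod_i a i - \prod_i b i).
Proof.
move=> h; apply: (big_ind2 (fun x y => E (x - y))) => [|x1 x2 y1 y2|//].
  by rewrite subrr; apply: ideal0.
exact: congM.
Qed.

Lemma hom_congr (K : comNzRingType) n (u v : {rmorphism {mpoly K[n]} -> R}) :
  (forall c, E (u c%:MP - v c%:MP)) -> (forall i, E (u 'X_i - v 'X_i)) ->
  forall p, E (u p - v p).
Proof.
move=> hc hX p; rewrite (mpoly_rmorph u) (mpoly_rmorph v) -sumrB; apply: (ideal_sum _ iE) => m _.
by apply: congM => //; apply: cong_prod => i; apply: congX.
Qed.

End Congruences.

Section LinearPrime.
Variables (k : fieldType) (n : nat) (v : 'I_n.+1 -> k) (j : 'I_n.+1).
Hypothesis vj : v j != 0.
Local Notation B := {mpoly k[n.+1]}.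
Local Notation B' := {mpoly k[n]}.

(** The variable of index [j] is solved from the equation [linform v = 0]; this identifies the
    quotient by that form with a polynomial ring, so the form is prime. *)
Definition elim_gen i : B' :=
  if unlift j i is Some l then 'X_l else - \sum_l (v (lift j l) / v j) *: 'X_l.
Definition elim : B -> B' := mmap (@mpolyC n k) elim_gen.
HB.instance Definition _ := GRing.RMorphism.on elim.
Definition unelim : B' -> B := mmap (@mpolyC n.+1 k) (fun l => 'X_(lift j l)).
HB.instance Definition _ := GRing.RMorphism.on unelim.

Lemma elimC c : elim c%:MP = c%:MP. Proof. exact: mmapC. Qed.
Lemma elimX i : elim 'X_i = elim_gen i. Proof. by rewrite /elim mmapX mmap1U. Qed.
Lemma unelimC c : unelim c%:MP = c%:MP. Proof. exact: mmapC. Qed.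
Lemma unelimX l : unelim 'X_l = 'X_(lift j l). Proof. by rewrite /unelim mmapX mmap1U. Qed.
Lemma elim_lift l : elim_gen (lift j l) = 'X_l. Proof. by rewrite /elim_gen liftK. Qed.
Lemma elim_pivot : elim_gen j = - \sum_l (v (lift j l) / v j) *: 'X_l.
Proof. by rewrite /elim_gen unlift_none. Qed.

Lemma unelimK : cancel unelim elim.
Proof.
have h := @mpoly_rmorph_ext _ _ _ (elim \o unelim) idfun; apply: h => [c|l] /=.
  by rewrite unelimC elimC.
by rewrite unelimX elimX elim_lift.
Qed.

Lemma linform_split : linform v = v j *: 'X_j + \sum_l v (lift j l) *: 'X_(lift j l).
Proof. by rewrite /linform (bigD1_ord j). Qed.

Lemma elim_linform : elim (linform v) = 0.
Proof.
have eZ c p : elim (c *: p) = c *: elim p by rewrite /elim mmapZ mul_mpolyC.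
rewrite linform_split rmorphD /= eZ elimX elim_pivot rmorph_sum scalerN scaler_sumr -sumrN -big_split.
rewrite big1 // => l _ /=; rewrite eZ elimX elim_lift scalerA mulrC divfK //.
by rewrite addNr.
Qed.

Lemma elim_ker s : elim s = 0 <-> exists b, s = b * linform v.
Proof.
split=> [es|[b ->]]; last by rewrite rmorphM /= elim_linform mulr0.
pose E : set B := [set u | exists b, u = b * linform v].
have iE : is_ideal setT E.
  apply/idealP; split; first by exists 0; rewrite mul0r.
    by move=> _ _ [a ->] [b ->]; exists (a + b); rewrite mulrDl.
  by move=> a _ [b ->]; exists (a * b); rewrite mulrA.
have h := @hom_congr _ E iE _ _ idfun (unelim \o elim).
have : E (s - unelim (elim s)).
  apply: h => [c|i] /=; first by rewrite elimC unelimC subrr; apply: (ideal0 iE).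
  rewrite elimX; case: (unliftP j i) => [l ->|->].
    by rewrite elim_lift unelimX subrr; apply: (ideal0 iE).
  exists ((v j)^-1)%:MP; rewrite elim_pivot linform_split mul_mpolyC scalerDr scalerA mulVf // scale1r.
  congr (_ + _); rewrite rmorphN opprK rmorph_sum scaler_sumr; apply: eq_bigr => l _ /=.
  by rewrite /unelim mmapZ mmapX mmap1U mul_mpolyC scalerA mulrC.
by rewrite es rmorph0 subr0.
Qed.

Lemma linform_prime : is_prime_ideal [set s : B | exists b, s = b * linform v].
Proof.
split.
- apply/idealP; split=> [|u w|u w] /=; first by exists 0; rewrite mul0r.
    by move=> [a ->] [b ->]; exists (a + b); rewrite mulrDl.
  by move=> [b ->]; exists (u * b); rewrite mulrA.
- by move/elim_ker; rewrite rmorph1 => /eqP; rewrite oner_eq0.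
- move=> a b /= /elim_ker; rewrite rmorphM => /eqP; rewrite mulf_eq0.
  by case/orP => /eqP /elim_ker; [left|right].
Qed.

End LinearPrime.

Fact sum_split (V : nmodType) (T : finType) (g g1 g2 : T -> V) : (forall i, g i = g1 i + g2 i) ->
  \sum_i g i = \sum_i g1 i + \sum_i g2 i.
Proof. by move=> h; rewrite -big_split; apply: eq_bigr. Qed.

Fact pencil_diff (R : comNzRingType) (p q z w t Q w0 y : R) :
  p = 1 -> q = 1 -> z = Q * w0 -> w = w0 - y -> t = Q -> p * z - q * (w * t) = y * Q.
Proof. by move=> -> -> -> -> ->; ring. Qed.

Fact pencil_split (R : comNzRingType) (y1 y2 a b c x t u : R) :
  y1 * (y2 * (a * (x * (t * u)) - b) - c) = a * (y1 * y2 * x * t) * u - (y1 * y2 * b + y1 * c).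
Proof. ring. Qed.

Section Coefficients2.
Variables (k : fieldType) (n N : nat).
Local Notation T := {mpoly k[n]}.
Local Notation W := {mpoly k[N]}.
Local Notation WT := {mpoly T[N]}.
Local Notation up := (@poly_ext k n N).

Lemma upC c : up c%:MP = (c%:MP)%:MP.
Proof. by apply/mpolyP => m; rewrite mcoeff_up !mcoeffC; case: eqP; rewrite ?mulr1 ?mulr0. Qed.

Lemma cf_scale_up al (c : T) p : cf al (c *: up p) = c@_al *: p.
Proof.
by apply/mpolyP => m; rewrite mcoeff_cf !mcoeffZ mcoeff_up mulrC mul_mpolyC mcoeffZ mulrC.
Qed.

Lemma mpolyE_up (u : WT) : u = \sum_(m <- msupp u) u@_m *: up 'X_[m].
Proof. by rewrite [LHS]mpolyE; apply: eq_bigr => m _; rewrite upX. Qed.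

Lemma mpow_cb M p : mpow M p -> mpow M (@frac_ext k n N p).
Proof. by move=> h m mM; rewrite mcoeff_cb h // rmorph0. Qed.

Lemma map_mpoly_up n' (g : {rmorphism T -> {mpoly k[n']}}) p : (forall c, g c%:MP = c%:MP) ->
  map_mpoly g (up p) = @poly_ext k n' N p.
Proof.
move=> gC; apply/mpolyP => m; transitivity (g (up p)@_m).
  exact: (@mcoeff_map_mpoly N T {mpoly k[n']} g m (up p)).
by rewrite mcoeff_up gC; symmetry; exact: mcoeff_up.
Qed.

Lemma tf_pivot (X : T) p q r : - tf (X *: up p * up q) + tf (X%:MP * up r) =
  tofrac X *: @frac_ext k n N (r - q * p).
Proof.
have e1 : X *: up p * up q = X *: up (q * p) by rewrite -scalerAl -rmorphM mulrC.
have e2 w : tf (X *: up w) = tofrac X *: @frac_ext k n N w.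
  by rewrite tfZ tf_up.
have h : - (X *: up p * up q) + X%:MP * up r = X *: up (r - q * p).
  by rewrite e1 mul_mpolyC (raddfB up) scalerBr addrC.
transitivity (tf (- (X *: up p * up q) + X%:MP * up r)); last by rewrite h; exact: e2.
symmetry; apply: etrans (raddfD (@tf k n N) _ _) _; congr (_ + _); exact: (raddfN (@tf k n N)).
Qed.

Lemma cb_scale_split (th : {fraction T}) p z e y : p * z = e + y ->
  @frac_ext k n N p * (th *: @frac_ext k n N z) = th *: @frac_ext k n N e + th *: @frac_ext k n N y.
Proof.
move=> h; rewrite -scalerAr -scalerDr; congr (_ *: _).
apply: etrans (esym (rmorphM (@frac_ext k n N) p z)) _; rewrite h; exact: (rmorphD (@frac_ext k n N)).
Qed.

Lemma msize_le (R : nzRingType) (p : {mpoly R[N]}) e :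
  (forall m, p@_m != 0 -> (mdeg m <= e)%N) -> (msize p <= e.+1)%N.
Proof.
move=> h; rewrite mmeasureE big_seq; apply: (big_ind (fun s => (s <= e.+1)%N)) => //.
  by move=> a b ha hb; rewrite geq_max ha.
by move=> m; rewrite mcoeff_msupp => /h.
Qed.

Lemma msize_cf al (w : WT) e : (msize w <= e.+1)%N -> (msize (cf al w) <= e.+1)%N.
Proof.
move=> we; apply: msize_le => m; rewrite mcoeff_cf => h; rewrite -ltnS; apply: leq_trans we.
apply: msize_mdeg_lt; rewrite mcoeff_msupp; apply: contra_neq h => ->; exact: mcoeff0.
Qed.

End Coefficients2.

(** * The fibre map at a base point *)

Section PointMap.
Variables (k : closedFieldType) (N d : nat) (f : N.+3.-tuple {mpoly k[N.+2]}) (x : ppoint k N.+2).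
Variable i0 : 'I_N.+2.
Hypothesis v0 : pcoord x 0 i0 = 1.
Hypothesis fd : forall i, tnth f i \is d.-homog.
Hypothesis Xx : base_points f x.
Local Notation A := {mpoly k[N.+2]}.
Local Notation B := {mpoly k[N.+3]}.
Local Notation B' := {mpoly k[N.+2]}.
Local Notation K := {fraction B'}.
Local Notation AB := {mpoly B[N.+2]}.
Local Notation W := {mpoly k[N.+1]}.
Local Notation WB := {mpoly B[N.+1]}.
Local Notation WB' := {mpoly B'[N.+1]}.
Local Notation WK := {mpoly K[N.+1]}.
Local Notation "y %:F" := (tofrac y).
Local Notation ch := (chart x i0).
Local Notation phi := (local_gens f x i0).
Local Notation I := (lin (tnth f)).
Local Notation up := (@poly_ext k N.+3 N.+2).
Local Notation upW := (@poly_ext k N.+3 N.+1).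
Local Notation upW' := (@poly_ext k N.+2 N.+1).
Local Notation tf' := (@tf k N.+2 N.+1).
Local Notation cb' := (@frac_ext k N.+2 N.+1).
Local Notation specx := (@spec k N.+3 N.+2 (pcoord x 0)).

Variables (v : 'I_N.+3 -> k) (j : 'I_N.+3) (b : 'I_N.+3 -> W) (M : nat).
Hypothesis vj : v j != 0.
Hypothesis hb : \sum_i b i * phi i = 0.
Hypothesis M0 : (0 < M)%N.
Hypothesis hb1 : mpow M (1 - b j).
Hypothesis hbv : forall i, (b i)@_0 = v i / v j.

(** The variable [T_j] is solved from the relation [b] as if [b j] were 1. It is 1 only modulo
    [mpow M], since inverting a local unit by a polynomial is possible only modulo such powers; the
    error is absorbed by ideals containing [mpow M]. *)
Definition sub_gen i : WB' :=
  if unlift j i is Some l then ('X_l)%:MP else - \sum_l 'X_l *: upW' (b (lift j l)).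
Definition subB : B -> WB' := mmap (@mpolyC N.+1 B' \o @mpolyC N.+2 k) sub_gen.
HB.instance Definition _ := GRing.RMorphism.on subB.
Definition subAB : AB -> WB' := mmap subB (fun i => upW' (chart_gen x i0 i)).
HB.instance Definition _ := GRing.RMorphism.on subAB.
(* The fibre of [Proj Sym] over the point, [T_j] being eliminated by means of
   the relation [b].                                                         *)
Definition om : AB -> WK := tf' \o subAB.
HB.instance Definition _ := GRing.RMorphism.on om.

Lemma subB_C c : subB c%:MP = (c%:MP)%:MP. Proof. exact: mmapC. Qed.
Lemma subB_X i : subB 'X_i = sub_gen i. Proof. by rewrite /subB mmapX mmap1U. Qed.
Lemma subAB_C c : subAB c%:MP = subB c. Proof. exact: mmapC. Qed.
Lemma subAB_X i : subAB 'X_i = upW' (chart_gen x i0 i). Proof. by rewrite /subAB mmapX mmap1U. Qed.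
Lemma subAB_Z c u : subAB (c *: u) = subB c * subAB u.
Proof. by rewrite -mul_mpolyC rmorphM /= subAB_C. Qed.

Lemma subAB_up a : subAB (up a) = upW' (ch a).
Proof.
have h := @mpoly_rmorph_ext _ _ _ (subAB \o up) (upW' \o ch); apply: h => [c|i] /=.
  by rewrite upC subAB_C subB_C /chart mmapC upC.
by rewrite upX subAB_X chartX.
Qed.

Lemma subB_unelim s : subB (unelim j s) = s%:MP.
Proof.
have h := @mpoly_rmorph_ext _ _ _ (subB \o unelim j) (@mpolyC N.+1 B'); apply: h => [c|l] /=.
  by rewrite unelimC subB_C.
by rewrite unelimX subB_X /sub_gen liftK.
Qed.

Lemma sub_gen0 i : (sub_gen i)@_0 = elim_gen v j i.
Proof.
rewrite /sub_gen /elim_gen; case: unlift => [l|]; first by rewrite mcoeffC eqxx mulr1.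
rewrite mcoeffN (raddf_sum (mcoeff 0)); congr (- _); apply: eq_bigr => l _ /=.
by rewrite mcoeffZ mcoeff_up hbv mulrC mul_mpolyC.
Qed.

Lemma subB0 s : (subB s)@_0 = elim v j s.
Proof.
have h := @mpoly_rmorph_ext _ _ _ (mcoeff 0 \o subB) (elim v j); apply: h => [c|i] /=.
  by rewrite subB_C elimC mcoeffC eqxx mulr1.
by rewrite subB_X elimX sub_gen0.
Qed.

Lemma om_coef0 u : (om u)@_0 = (elim v j (specx u))%:F.
Proof.
rewrite /om /= mcoeff_tf; congr _%:F.
have h := @mpoly_rmorph_ext _ _ _ (mcoeff 0 \o subAB) (elim v j \o specx); apply: h => [c|i] /=.
  by rewrite subAB_C subB0 /spec mevalC.
have -> : ('X_i : AB) = up 'X_i by rewrite upX.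
by rewrite spec_up elimC subAB_up mcoeff_up chart0.
Qed.

Lemma omC0 s : (om s%:MP)@_0 = (elim v j s)%:F.
Proof. by rewrite om_coef0 /spec mevalC. Qed.

Lemma om_up a : om (up a) = cb' (ch a).
Proof. by rewrite /om /= subAB_up tf_up. Qed.

Lemma om_unelim s : om (unelim j s)%:MP = (s%:F)%:MP.
Proof.
rewrite /om /= subAB_C subB_unelim; apply/mpolyP => m.
by rewrite mcoeff_tf !mcoeffC; case: eqP; rewrite ?mulr1 ?mulr0 ?rmorph0.
Qed.

Lemma omD u w : om (u + w) = om u + om w. Proof. exact: (rmorphD om). Qed.
Lemma omM u w : om (u * w) = om u * om w. Proof. exact: (rmorphM om). Qed.
Lemma om0 : om 0 = 0. Proof. exact: (rmorph0 om). Qed.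

Lemma om_Zunelim t u y (t' : B') : om u = t%:F *: y -> om (unelim j t' *: u) = (t' * t)%:F *: y.
Proof.
by move=> e; rewrite -mul_mpolyC omM om_unelim e mul_mpolyC scalerA tofracM.
Qed.

Lemma om_syzygy a : om (syzygy_form a) =
  \sum_l theta k l *: cb' (ch (a (lift j l)) - ch (a j) * b (lift j l)).
Proof.
rewrite syzygy_formE (bigD1_ord j) //= rmorphD rmorph_sum /=.
have e i : om ('X_i *: up (a i)) = tf' (sub_gen i * upW' (ch (a i))).
  by rewrite /om /= subAB_Z subB_X subAB_up.
have -> : \sum_(l < N.+2) om ('X_(lift j l) *: up (a (lift j l))) =
  \sum_(l < N.+2) tf' (sub_gen (lift j l) * upW' (ch (a (lift j l)))).
  by apply: eq_bigr => l _; exact: e.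
rewrite e; have -> : sub_gen j = - \sum_l 'X_l *: upW' (b (lift j l)) by rewrite /sub_gen unlift_none.
rewrite mulNr mulr_suml (raddfN tf') /= (raddf_sum tf') -sumrN -big_split; apply: eq_bigr => l _ /=.
by rewrite /sub_gen liftK; exact: tf_pivot.
Qed.

Definition local_gens' l := phi (lift j l).
Local Notation phi' := local_gens'.
Definition Jx : set WK := loc (Jstar phi').
Let iJx : is_ideal setT Jx. Proof. exact/loc_ideal/Jstar_ideal. Qed.

Lemma sum_pivot (R : comNzRingType) (g : 'I_N.+3 -> R) : \sum_i g i = g j + \sum_l g (lift j l).
Proof. by rewrite (bigD1_ord j). Qed.

(** Eliminating [phi j] between a syzygy [a] and the relation [b] gives a syzygy [e] of the other
    generators. Up to the local unit [b j], the image of the syzygy form is the value of [e] plus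
    multiples of [1 - b j], which lie in [mpow M]. *)
Lemma om_sym u : mpow M `<=` Jx -> sym_ideal f u -> Jx (om u).
Proof.
move=> mJ; suff : sym_ideal f `<=` [set w | Jx (om w)] by apply.
apply: gen_ideal_min => [|_ [a ha <-]].
  apply/idealP; split=> [|w z /= hw hz|w z /= hz]; first by rewrite /= om0; exact: (ideal0 iJx).
    by rewrite omD; exact: (idealD iJx hw hz).
  by rewrite omM; exact: (idealMl _ iJx hz).
rewrite /= om_syzygy; apply: (@loc_unit _ _ _ (cb' (b j))).
  rewrite mcoeff_cb hbv divff // rmorph1 oner_neq0; by [].
have fa : \sum_i ch (a i) * phi i = 0.
  rewrite -[RHS](rmorph0 ch) -ha rmorph_sum; apply: eq_bigr => i _; by rewrite rmorphM.
pose e l := b j * ch (a (lift j l)) - ch (a j) * b (lift j l).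
have he : \sum_l e l * phi' l = 0.
  transitivity (b j * (\sum_i ch (a i) * phi i) - ch (a j) * (\sum_i b i * phi i)); last first.
    by rewrite fa hb !mulr0 subrr.
  rewrite !sum_pivot !mulrDr opprD addrACA [X in _ = X + _](_ : _ = 0) ?add0r.
    by rewrite !mulr_sumr -sumrB; apply: eq_bigr => l _; rewrite /e mulrBl !mulrA.
  by ring.
rewrite mulr_sumr.
have -> : \sum_l cb' (b j) * (theta k l *: cb' (ch (a (lift j l)) - ch (a j) * b (lift j l))) =
   \sum_l theta k l *: cb' (e l) + \sum_l theta k l *: cb' (ch (a j) * b (lift j l) * (1 - b j)).
  have hl l : b j * (ch (a (lift j l)) - ch (a j) * b (lift j l)) = e l + ch (a j) * b (lift j l) * (1 - b j).
    rewrite /e; move: (ch _) (ch _) (b _) (b _) => y1 y2 y3 y4; ring.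
  have hl' l : cb' (b j) * (theta k l *: cb' (ch (a (lift j l)) - ch (a j) * b (lift j l))) =
    theta k l *: cb' (e l) + theta k l *: cb' (ch (a j) * b (lift j l) * (1 - b j)).
    exact: (cb_scale_split (theta k l) (hl l)).
  exact: sum_split hl'.
apply: (idealD (loc_ideal (@Jstar_ideal _ _ _))).
  by apply: loc_sub; apply: gen_ideal_sub; exists e.
apply: (ideal_sum _ iJx) => l _; apply: mJ.
apply: (idealZ _ (@mpow_ideal K _ M)).
by apply: mpow_cb; apply: (idealMl _ (@mpow_ideal k _ M)).
Qed.

Lemma om_coefs m u : coefs_in (idealX setT I m) u -> mpow m (om u).
Proof.
have im := @mpow_ideal K N.+1 m.
suff : @coefs_in k N.+3 N.+2 (idealX setT I m) `<=` [set w | mpow m (om w)] by apply.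
apply: coefs_in_min => [|a ha] /=.
  apply/idealP; split=> [|w z /= hw hz|w z /= hz]; first by rewrite /= om0; exact: (ideal0 im).
    by rewrite omD; exact: (idealD im hw hz).
  by rewrite omM; exact: (idealMl _ im hz).
rewrite om_up; apply: mpow_cb.
have {ha}/idealX_linP [F hF ->] := ha; have im' := @mpow_ideal k N.+1 m.
rewrite meval_msupp rmorph_sum big_seq; apply: (ideal_sum _ im') => al alF /=.
rewrite rmorphM; apply: (idealMl _ im').
have <- : mdeg al = m by apply: (dhomogP _ _ _ hF).
rewrite rmorph_prod mdegE.
apply: (big_ind2 (fun (p : W) e => mpow e p)) => [//|p e p' e' h h'|i _]; first exact: mpowM.
rewrite rmorphXn; apply: mpowX; exact: (local_gens_m i0 Xx i).
Qed.

Lemma om_symE m u : mpow m `<=` Jx -> mpow M `<=` Jx -> symE f m u -> Jx (om u).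
Proof.
move=> mJ MJ [w Jw hu]; rewrite -(subrK w u) omD.
exact: (idealD iJx (mJ _ (om_coefs hu)) (om_sym MJ Jw)).
Qed.

Lemma sub_lift e (w : WB') : (msize w <= e.+1)%N -> exists2 U : AB, U \is e.-homog & subAB U = w.
Proof.
move=> we; have [s es] := up_decomp w.
have h al : exists p : A, p \is e.-homog /\ ch p = cf al w.
  by have [p hp ep] := homog_lift v0 (msize_cf al we); exists p.
have [p hp] := choice h.
exists (\sum_(al <- s) unelim j 'X_[al] *: up (p al)).
  by apply: rpred_sum => al _; apply/rpredZ/up_homog; case: (hp al).
rewrite rmorph_sum [RHS]es; apply: eq_bigr => al _ /=.
by rewrite subAB_Z subB_unelim subAB_up mul_mpolyC; have [_ ->] := hp al.
Qed.

Lemma om_lift e (w : WK) : (msize w <= e.+1)%N ->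
  exists t U, [/\ t != 0, U \is e.-homog & om U = t%:F *: w].
Proof.
move=> we; have [t [w0 [t0 ew]]] := clear_denom w.
have : (msize w0 <= e.+1)%N.
  apply: msize_le => m m0; rewrite -ltnS; apply: leq_trans we; apply: msize_mdeg_lt.
  have := mcoeff_tf w0 m; rewrite ew mcoeffZ => e1.
  by rewrite mcoeff_msupp; apply: contra_neq m0 => w0'; apply/eqP; rewrite -tofrac_eq0 -e1 w0' mulr0.
case/sub_lift => U hU eU; exists t, U; split; [exact: t0|exact: hU|].
exact: etrans (congr1 tf' eU) ew.
Qed.

Lemma om_X0 r : om (up ('X_i0 ^+ r)) = 1.
Proof. by rewrite om_up rmorphXn /= (chart1 v0) expr1n rmorph1. Qed.

Lemma homog_up_X0 r : up ('X_i0 ^+ r) \is r.-homog.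
Proof. exact/up_homog/homogX. Qed.

(** A syzygy of the generators other than [phi j] is extended by zero at [j] and lifted to a
    homogeneous syzygy of [f]. *)
Lemma om_Jstar y : Jstar phi' y ->
  exists t U e, [/\ t != 0, U \is e.-homog, sym_ideal f U & om U = t%:F *: y].
Proof.
have iJ := sym_ideal_ideal f.
set S := [set y | exists t U e, [/\ t != 0, U \is e.-homog, sym_ideal f U & om U = t%:F *: y]].
suff : Jstar phi' `<=` S by apply.
apply: gen_ideal_min => [|_ [a ha ->]].
  apply/idealP; split.
  - exists 1, 0, 0%N; split; [exact: oner_neq0|exact: dhomog0|exact: ideal0|].
    by rewrite scaler0 om0.
  - move=> y1 y2 [t [U [e [t0 hU JU eU]]]] [t' [U' [e' [t0' hU' JU' eU']]]].
    exists (t * t'), (unelim j t' *: (up ('X_i0 ^+ e') * U) + unelim j t *: (up ('X_i0 ^+ e) * U')), (e' + e)%N.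
    split; first by rewrite mulf_neq0.
    + apply: rpredD; apply: rpredZ; first exact: (dhomogM (homog_up_X0 e') hU).
      by rewrite addnC; exact: (dhomogM (homog_up_X0 e) hU').
    + apply: (idealD iJ); apply: (idealZ _ iJ); exact: (idealMl _ iJ).
    + have h1 : om (up ('X_i0 ^+ e') * U) = t%:F *: y1 by rewrite omM om_X0 mul1r.
      have h2 : om (up ('X_i0 ^+ e) * U') = t'%:F *: y2 by rewrite omM om_X0 mul1r.
      by rewrite omD (om_Zunelim t' h1) (om_Zunelim t h2) scalerDr [t' * t]mulrC.
  - move=> a y1 [t [U [e [t0 hU JU eU]]]].
    have [t' [U' [t0' hU' eU']]] := om_lift (leqnSn (msize a)).
    exists (t' * t), (U' * U), (msize a + e)%N; split; first by rewrite mulf_neq0.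
    + exact: dhomogM.
    + exact: (idealMl _ iJ).
    + by rewrite omM eU eU' tofracM -scalerAl -scalerAr scalerA.
pose a' i := if unlift j i is Some l then a l else 0.
have ha' (_ : unit) : \sum_i a' i * phi i = 0.
  rewrite sum_pivot /a' unlift_none mul0r add0r -[RHS]ha; apply: eq_bigr => l _.
  by rewrite liftK.
have [e [al hal]] := homog_syzygy v0 fd ha'; have [h1 h2 h3] := hal tt.
exists 1, (syzygy_form (al tt)), e; split; [exact: oner_neq0|exact: syzygy_form_homog| |].
  exact: sym_syzygy.
rewrite tofrac1 scale1r om_syzygy; apply: eq_bigr => l _.
by rewrite !h3 /a' unlift_none liftK mul0r subr0.
Qed.

Definition chT : AB -> WB := mmap (@mpolyC N.+1 B) (fun i => upW (chart_gen x i0 i)).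
HB.instance Definition _ := GRing.RMorphism.on chT.

Lemma chTC c : chT c%:MP = c%:MP. Proof. exact: mmapC. Qed.
Lemma chTX i : chT 'X_i = upW (chart_gen x i0 i). Proof. by rewrite /chT mmapX mmap1U. Qed.
Lemma chTZ c u : chT (c *: u) = c *: chT u.
Proof. by rewrite -mul_mpolyC rmorphM /= chTC mul_mpolyC. Qed.
Lemma chT_up a : chT (up a) = upW (ch a).
Proof.
have h := @mpoly_rmorph_ext _ _ _ (chT \o up) (upW \o ch); apply: h => [c|i] /=.
  by rewrite upC chTC /chart mmapC upC.
by rewrite upX chTX chartX.
Qed.

Lemma cf_chT al u : cf al (chT u) = ch (cf al u).
Proof.
rewrite [u]mpolyE_up (raddf_sum chT) !(raddf_sum (cf al)) (raddf_sum ch); apply: eq_bigr => m _ /=.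
by rewrite chTZ chT_up !cf_scale_up chartZ.
Qed.

Let w0 : WB := ('X_j)%:MP + \sum_l 'X_(lift j l) *: upW (b (lift j l)).

Lemma chT_kernel u : subAB u = 0 -> exists Q, chT u = Q * w0.
Proof.
move=> eu; pose E : set WB := [set y | exists Q, y = Q * w0].
have iE : is_ideal setT E.
  apply/idealP; split; first by exists 0; rewrite mul0r.
    by move=> _ _ [a ->] [c ->]; exists (a + c); rewrite mulrDl.
  by move=> a _ [c ->]; exists (a * c); rewrite mulrA.
have emap (p : W) : map_mpoly (unelim j) (upW' p) = upW p.
  exact: (map_mpoly_up _ (unelimC j)).
have eC (c : B') : map_mpoly (unelim j) (c%:MP : WB') = (unelim j c)%:MP.
  by rewrite map_mpolyC.
have h := @hom_congr _ E iE _ _ chT (map_mpoly (unelim j) \o subAB).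
have : E (chT u - map_mpoly (unelim j) (subAB u)).
  apply: h => [c|i] /=; last first.
    by rewrite chTX subAB_X emap subrr; apply: (ideal0 iE).
  rewrite chTC subAB_C.
  have h' := @hom_congr _ E iE _ _ (@mpolyC N.+1 B) (map_mpoly (unelim j) \o subB).
  apply: h' => [c'|i] /=.
    by rewrite subB_C eC unelimC subrr; apply: (ideal0 iE).
  rewrite subB_X /sub_gen; case: unliftP => [l ->|->].
    by rewrite eC unelimX subrr; apply: (ideal0 iE).
  exists 1; rewrite mul1r /w0 rmorphN opprK; congr (_ + _).
  rewrite raddf_sum; apply: eq_bigr => l _ /=.
  by rewrite -mul_mpolyC rmorphM /= eC unelimX emap mul_mpolyC.
by rewrite eu (rmorph0 (map_mpoly _)) subr0.
Qed.

Lemma chart_descend m e z : z \is e.-homog -> loc (idealX setT (lin phi) m) (ch z) ->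
  exists e' h, [/\ h \is e'.-homog, mev h (pcoord x) != 0 & idealX setT I m (h * z)].
Proof.
move=> hz [t t0 /idealX_linP [F hF etz]].
pose s := msupp F.
have [e1 [p hp]] := homog_lifts v0 (fun o : option 'I_(size s) => if o is Some l then F@_(tnth (in_tuple s) l) else t).
have [hT eT] := hp None.
pose al (l : 'I_(size s)) := tnth (in_tuple s) l.
pose G := \sum_l p (Some l) * mmap1 (tnth f) (al l).
have dal l : mdeg (al l) = m by apply: (dhomogP _ _ _ hF); exact: mem_tnth.
have hf be : mmap1 (tnth f) be \is (mdeg be * d).-homog.
  rewrite /mmap1 mdegE big_distrl /=.
  apply: (big_ind2 (fun (p : A) e => p \is e.-homog)) => [|q e2 q' e2' h h'|i _].
  - exact: dhomog1.
  - exact: dhomogM.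
  - by rewrite mulnC; apply: dhomogMn.
have hG : G \is (e1 + m * d).-homog.
  by apply: rpred_sum => l _; apply: dhomogM; [case: (hp (Some l))|rewrite -(dal l)].
have IG : idealX setT I m G.
  have iI := @idealX_ideal _ I m.
  apply: (ideal_sum _ iI) => l _; apply: (idealMl _ iI).
  apply/idealX_linP; exists 'X_[al l]; last by rewrite /meval mmapX.
  by rewrite dhomogX /= dal.
have chG : ch G = F.@[phi].
  rewrite rmorph_sum meval_msupp [RHS]big_tnth.
  apply: eq_bigr => l _; rewrite rmorphM /=; have [_ ->] := hp (Some l); congr (_ * _).
  by rewrite /mmap1 rmorph_prod; apply: eq_bigr => i _; rewrite rmorphXn.
exists (m * d + e1)%N, ('X_i0 ^+ (m * d) * p None); split.
- by apply: dhomogM => //; apply: homogX.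
- by rewrite -(chart0 x i0) rmorphM rmorphXn /= (chart1 v0) expr1n mul1r eT.
have e2 : 'X_i0 ^+ (m * d) * p None * z = 'X_i0 ^+ e * G.
  apply/eqP; rewrite -subr_eq0; apply/eqP; apply: (@chart_inj _ _ _ _ v0 (m * d + e1 + e)).
    apply: rpredB; first by apply: dhomogM => //; apply: dhomogM => //; apply: homogX.
    have -> : (m * d + e1 + e = e + (e1 + m * d))%N by rewrite [(m * d + e1)%N]addnC addnC.
    by apply: dhomogM => //; apply: homogX.
  by rewrite rmorphB !rmorphM !rmorphXn /= (chart1 v0) !expr1n !mul1r eT chG etz subrr.
by rewrite e2; apply: (idealMl _ (@idealX_ideal _ I m)).
Qed.

Lemma om_lift_neq0 t U (w : WK) : t != 0 -> om U = t%:F *: w -> w@_0 != 0 -> elim v j (specx U) != 0.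
Proof.
move=> t0 e w0'; apply/eqP => h; have := om_coef0 U; rewrite h tofrac0 e mcoeffZ => /eqP.
by rewrite mulf_eq0 tofrac_eq0 (negbTE t0) (negbTE w0').
Qed.

Lemma spec_elimM u1 u2 : elim v j (specx (u1 * u2)) = elim v j (specx u1) * elim v j (specx u2).
Proof. exact: (rmorphM (elim v j \o specx)). Qed.

(** After clearing denominators, a multiple of [u] differs from an element of [J] by some [Z] killed
    by the elimination of [T_j]. In the chart [Z] is a multiple of [w0], the equation that was
    solved. Subtracting the same multiple of the syzygy form of [b] leaves a multiple of [1 - b j],
    which lies locally in the power [m] of [I]; [chart_descend] brings this back to forms. *)
Lemma om_kernel m nu u : mpow M `<=` loc (idealX setT (lin phi) m) -> u \is nu.-homog -> Jx (om u) ->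
  exists e H, [/\ H \is e.-homog, elim v j (specx H) != 0 & symE f m (H * u)].
Proof.
move=> mM hu [t00 tt0 /om_Jstar [t1 [U [e1 [t10 hU JU eU]]]]].
have [t2 [T0 [t20 hT0 eT0]]] := om_lift (leqnSn (msize t00)); set e2 := msize t00 in hT0.
pose Z := unelim j t1 *: (up ('X_i0 ^+ e1) * (T0 * u)) - unelim j t2 *: (up ('X_i0 ^+ (e2 + nu)) * U).
have hZ : Z \is (e1 + (e2 + nu)).-homog.
  apply: rpredB; apply: rpredZ; first exact: (dhomogM (homog_up_X0 e1) (dhomogM hT0 hu)).
  by rewrite (addnC e1); exact: (dhomogM (homog_up_X0 (e2 + nu)) hU).
have sZ : subAB Z = 0.
  apply: (@tf_inj k N.+2 N.+1); apply: etrans (esym (raddf0 tf')); apply: (etrans (y := om Z)); first by [].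
  have h1 : om (up ('X_i0 ^+ e1) * (T0 * u)) = t2%:F *: (t00 * om u) by rewrite !omM om_X0 mul1r eT0 scalerAl.
  have h2 : om (up ('X_i0 ^+ (e2 + nu)) * U) = t1%:F *: (t00 * om u) by rewrite omM om_X0 mul1r.
  have h3 := om_Zunelim t1 h1; have h4 := om_Zunelim t2 h2.
  apply: etrans (rmorphB om _ _) _; apply: etrans (congr2 (fun y z => y - z) h3 h4) _.
  by rewrite mulrC; exact: subrr.
have [Q eQ] := chT_kernel sZ.
have [s es] := up_decomp Q.
pose e3 := (\sum_(al <- s) msize (cf al Q))%N.
have h3 al : exists p : A, al \in s -> p \is e3.-homog /\ ch p = cf al Q.
  case: (boolP (al \in s)) => als; last by exists 0.
  have [|p hp ep] := @homog_lift _ _ _ _ v0 (cf al Q) e3; last by exists p.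
  by rewrite /e3 (big_rem al) //=; apply: leq_trans (leq_addr _ _) (leqnSn _).
have [p hp] := choice h3.
pose Q' : AB := \sum_(al <- s) 'X_[al] *: up (p al).
have hQ' : Q' \is e3.-homog.
  by rewrite /Q' big_seq; apply: rpred_sum => al /hp [h _]; apply/rpredZ/up_homog.
have eQ' : chT Q' = Q.
  rewrite [RHS]es (raddf_sum chT) big_seq [RHS]big_seq; apply: eq_bigr => al /hp [_ e] /=.
  by rewrite chTZ chT_up e.
have hb' (_ : unit) : \sum_i b i * phi i = 0 by [].
have [e4 [a ha]] := homog_syzygy v0 fd hb'; have [ha1 ha2 ha3] := ha tt.
pose w := syzygy_form (a tt).
have hw : w \is e4.-homog by apply: syzygy_form_homog.
have ew : chT w = w0 - ('X_j) *: upW (1 - b j).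
  rewrite /w syzygy_formE (raddf_sum chT) sum_pivot /= /w0.
  have e i : chT ('X_i *: up (a tt i)) = 'X_i *: upW (b i) by rewrite chTZ chT_up ha3.
  have -> : \sum_(l < N.+2) chT ('X_(lift j l) *: up (a tt (lift j l))) =
    \sum_(l < N.+2) 'X_(lift j l) *: upW (b (lift j l)) by apply: eq_bigr => l _; exact: e.
  have eu : upW (1 - b j) = 1 - upW (b j) by rewrite -(rmorph1 upW); exact: (raddfB upW).
  have ex : ('X_j)%:MP = 'X_j *: 1 :> WB by rewrite -mul_mpolyC mulr1.
  rewrite e ex eu scalerBr; move: ('X_j *: 1) ('X_j *: _) (\sum_l _) => y1 y2 y3.
  by rewrite opprB [y1 + y3]addrC -addrA [y1 + _]addrC subrK addrC.
pose E := (e1 + (e2 + nu))%N.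
pose Z1 := up ('X_i0 ^+ (e4 + e3)) * Z - up ('X_i0 ^+ E) * (w * Q').
have hZ1 : Z1 \is (e4 + e3 + E).-homog.
  apply: rpredB; first exact: (dhomogM (homog_up_X0 (e4 + e3)) hZ).
  by rewrite (addnC (e4 + e3)%N); exact: (dhomogM (homog_up_X0 E) (dhomogM hw hQ')).
have chX r : chT (up ('X_i0 ^+ r)) = 1 by rewrite chT_up rmorphXn /= (chart1 v0) expr1n rmorph1.
have eZ1 : chT Z1 = upW (1 - b j) * ('X_j *: Q).
  have -> : chT Z1 = chT (up ('X_i0 ^+ (e4 + e3))) * chT Z - chT (up ('X_i0 ^+ E)) * (chT w * chT Q').
    by rewrite /Z1 (rmorphB chT) !(rmorphM chT).
  rewrite -scalerAr scalerAl.
  exact: (pencil_diff (chX _) (chX _) eQ ew eQ').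
have hz al : exists eh : nat * A, [/\ eh.2 \is eh.1.-homog, mev eh.2 (pcoord x) != 0
    & idealX setT I m (eh.2 * cf al Z1)].
  have [|e' [h [h1 h2 h4]]] := @chart_descend m _ _ (cf_homog al hZ1); last by exists (e', h).
  apply: mM; rewrite -cf_chT eZ1 cf_up; exact: (idealMr _ (@mpow_ideal k _ M)).
have [eh Heh] := choice hz.
have [s1 es1] := up_decomp Z1.
pose h : A := \prod_(al <- s1) (eh al).2.
have [eH hH] : exists e, h \is e.-homog.
  exists (\sum_(al <- s1) (eh al).1)%N; apply: (big_ind2 (fun (p : A) e => p \is e.-homog)).
  - exact: dhomog1.
  - by move=> *; apply: dhomogM.
  - by move=> al _; case: (Heh al).
have hx : mev h (pcoord x) != 0.
  rewrite /h /mev rmorph_prod prodf_seq_neq0; apply/allP => al _ /=.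
  by case: (Heh al).
have iI := @idealX_ideal _ I m; have iC := coefs_in_ideal N.+3 iI.
have hI : coefs_in (idealX setT I m) (up h * Z1).
  rewrite [Z1]es1 mulr_sumr big_seq; apply: (ideal_sum _ iC) => al als.
  rewrite -scalerAr -(rmorphM up) -mul_mpolyC; apply: (idealMl _ iC); apply: (coefs_in_up iI).
  rewrite /h (big_rem al) //= -mulrA mulrCA; apply: (idealMl _ iI).
  by case: (Heh al).
exists (eH + (e4 + e3) + e1 + e2)%N, (unelim j t1 *: (up h * up ('X_i0 ^+ (e4 + e3)) * up ('X_i0 ^+ e1) * T0)).
split.
- apply: rpredZ.
  exact: (dhomogM (dhomogM (dhomogM (up_homog N.+3 hH) (homog_up_X0 (e4 + e3))) (homog_up_X0 e1)) hT0).
- pose nz u := elim v j (specx u) != 0.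
  have nzM u1 u2 : nz u1 -> nz u2 -> nz (u1 * u2).
    by move=> n1 n2; have := mulf_neq0 n1 n2; rewrite -(spec_elimM u1 u2).
  have nzup y : y.@[pcoord x 0] != 0 -> nz (up y).
    by move=> p0; rewrite /nz spec_up elimC mpolyC_eq0.
  have nzX r : nz (up ('X_i0 ^+ r)).
    by apply: nzup; rewrite rmorphXn /= mevalXU v0 expr1n oner_neq0.
  suff : nz (unelim j t1 *: (up h * up ('X_i0 ^+ (e4 + e3)) * up ('X_i0 ^+ e1) * T0)) by [].
  rewrite -mul_mpolyC; apply: (nzM); first by rewrite /nz /spec mevalC unelimK.
  apply: (nzM); first by apply: (nzM); [apply: (nzM); [exact: nzup|exact: nzX]|exact: nzX].
  exact: (om_lift_neq0 t20 eT0 tt0).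
- exists (up h * up ('X_i0 ^+ (e4 + e3)) * (unelim j t2 *: (up ('X_i0 ^+ (e2 + nu)) * U))
     + up h * (up ('X_i0 ^+ E) * (w * Q'))).
    have iJ := sym_ideal_ideal f.
    apply: (idealD iJ).
      by apply: (idealMl _ iJ); apply: (idealZ _ iJ); apply: (idealMl _ iJ).
    by do 2 apply: (idealMl _ iJ); apply: (idealMr _ iJ); exact: sym_syzygy.
  move: hI; congr (coefs_in _ _); rewrite /Z1 /Z; move: (up h) (up ('X_i0 ^+ (e4 + e3))) => y1 y2.
  rewrite -[unelim j t1 *: (up ('X_i0 ^+ e1) * _)]mul_mpolyC -[unelim j t1 *: (y1 * _ * _ * _)]mul_mpolyC.
  exact: pencil_split.
Qed.

End PointMap.

(** A power of the ideal of [phi] lies locally in the ideal of the minors, which is contained in its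
    colon ideal. *)
Lemma Jstar_nilpotent (k : fieldType) N c (phi : 'I_N.+2 -> {mpoly k[N.+1]}) :
  (forall i, mpow 1 (phi i)) -> mpow c `<=` loc (lin phi) -> exists c', mpow c' `<=` loc (Jstar phi).
Proof.
move=> phi_m mphi; have [r0 hr] := minors_reduction phi_m.
exists (c * (r0 + 1))%N.
apply: (subset_trans (mpow_locX (mphiK mphi))).
have h := hr 1%N; rewrite idealX1 in h; last exact: lin_ideal.
apply: loc_min; first exact: Jstar_ideal.
apply: (subset_trans h) => u hu; rewrite JstarE.
apply/(loc_syz_valuesP _ (theta_neq0 k ord_max)).
exact: (idealMl _ (minors_ideal _ _) hu).
Qed.

Fact frac_residue (L : fieldType) (p q a t : L) : t != 0 -> p = t -> q = a -> p * (a / t) = q.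
Proof. by move=> t0 -> ->; rewrite mulrC divfK. Qed.

Lemma loc_idealX_eq (F : fieldType) N (E E' : set {mpoly F[N]}) t : loc E = loc E' ->
  loc (idealX setT E t) = loc (idealX setT E' t).
Proof.
have h (D D' : set {mpoly F[N]}) : loc D = loc D' -> loc (idealX setT D t) `<=` loc (idealX setT D' t).
  move=> e; apply: loc_min; first exact: idealX_ideal.
  apply: subset_trans (@locX _ _ D' t); apply: idealX_mono; rewrite -e; exact: loc_sub.
by move=> e; apply/seteqP; split; apply: h.
Qed.

Section PointData.
Variables (k : closedFieldType) (N d : nat) (f : N.+3.-tuple {mpoly k[N.+2]}) (x : ppoint k N.+2).
Hypothesis fd : forall i, tnth f i \is d.-homog.
Hypothesis finX : finite_set (base_points f).
Hypothesis Xx : base_points f x.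
Local Notation A := {mpoly k[N.+2]}.
Local Notation B := {mpoly k[N.+3]}.
Local Notation B' := {mpoly k[N.+2]}.
Local Notation K := {fraction B'}.
Local Notation AB := {mpoly B[N.+2]}.
Local Notation W := {mpoly k[N.+1]}.
Local Notation WK := {mpoly K[N.+1]}.
Local Notation up := (@poly_ext k N.+3 N.+2).
Local Notation specx := (@spec k N.+3 N.+2 (pcoord x 0)).

(* [q] is the prime ideal generated by a linear form, and [Jx] the fibre of
   [Sym] at [x] over [q]. *)
Definition point_map (q : set B) (Jx : set WK) (m : nat) (om : {rmorphism AB -> WK}) : Prop :=
  [/\ (forall s, (om s%:MP)@_0 = 0 <-> q s) /\
      (forall z : K, exists b s, ~ q s /\ (om s%:MP)@_0 * z = (om b%:MP)@_0),
      forall u, symE f m u -> Jx (om u),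
      forall nu u, u \is nu.-homog -> Jx (om u) ->
        exists e H, [/\ H \is e.-homog, ~ q (specx H) & symE f m (H * u)],
      forall e w, (msize w <= e.+1)%N ->
        exists t U, [/\ ~ q t, U \is e.-homog & om U = om t%:MP * w]
    & forall a, (om (up a))@_0 = 0 <-> mev a (pcoord x) = 0].

Definition point_data (q : set B) (Jx : set WK) (c : nat) : Prop :=
  [/\ is_ideal setT Jx, loc Jx = Jx, mpow c `<=` Jx,
     @clen WK WK^o setT (@mI K N.+1) Jx setT (local_multiplicity f x - local_degree f x)%N
   & forall m, (c <= m)%N -> exists om, point_map q Jx m om].

(** As [vx j] is nonzero, the generator of index [j] is redundant near [x]. The other [N.+2] are
    submitted to [local_theorem], and the variables left after eliminating [T_j] are the coordinates
    of its generic point. *)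
Lemma point_dataP i0 (v0 : pcoord x 0 i0 = 1) (v vx : 'I_N.+3 -> k) j : v j != 0 -> vx j != 0 ->
  (forall i, vx i * v j = vx j * v i) -> spec_rel f x i0 vx ->
  (local_degree f x <= local_multiplicity f x)%N /\
  exists Jx c, point_data [set s | exists b, s = b * linform v] Jx c.
Proof.
move=> vj vxj vv [b0 hb0 b0x]; have [c0 mphi] := chart_nilpotent fd finX v0 Xx.
have iphi := lin_ideal (local_gens f x i0).
pose phi' := local_gens' f x i0 j.
have eloc : loc (lin phi') = loc (lin (local_gens f x i0)).
  apply/seteqP; split; apply: loc_min; try exact: lin_ideal.
    by apply: (lin_min (loc_ideal iphi)) => l; apply: loc_sub; apply: (lin_gen (local_gens f x i0)).
  apply: (lin_min (loc_ideal (lin_ideal phi'))) => i; case: (unliftP j i) => [l ->|->].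
    by apply: loc_sub; apply: (lin_gen phi').
  exists (b0 j); first by rewrite b0x.
  move: hb0; rewrite (bigD1_ord j) //= => /eqP; rewrite addr_eq0 => /eqP ->.
  apply: (idealN (lin_ideal phi')); apply: (ideal_sum _ (lin_ideal phi')) => l _.
  by apply: (idealMl _ (lin_ideal phi')); apply: (lin_gen phi').
have mphi' : mpow c0 `<=` loc (lin phi') by rewrite eloc.
have phi'm l : mpow 1 (phi' l) := local_gens_m i0 Xx _.
have [d0 [D [h [cd dD cJ ch [p [t0 [hp sp lp]]]]]]] := local_theorem phi'm mphi'.
have ed : local_degree f x = d0 by apply: (local_degreeE v0 fd mphi); rewrite -eloc.
have eD : local_multiplicity f x = D.
  apply: (local_multiplicityE v0 fd mphi _ hp sp lp) => t.
  by rewrite -!(loc_idealX_eq _ eloc).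
rewrite /point_data ed eD; split=> //.
have [c1 mJ] := Jstar_nilpotent phi'm mphi'.
have iJ : is_ideal setT (Jx f x i0 j) := loc_ideal (@Jstar_ideal _ _ _).
exists (Jx f x i0 j), c1; split=> //; first exact: loc_loc.
  exact: (dim_clenW iJ mJ (@idealT _) (@subsetT _ _) cJ).
(* Large enough for [mpow M] to lie in [Jx] and, locally, in the power [m] of [I]; the relation is
   then scaled so that its coefficient of index [j] is 1 modulo [mpow M]. *)
move=> m cm; pose M := (c0 * m + c1).+1.
have b0j : (b0 j)@_0 != 0 by rewrite b0x.
have [s hs] := inv_mod M b0j.
pose b i := s * b0 i.
have hb : \sum_i b i * local_gens f x i0 i = 0.
  by under eq_bigr do rewrite -mulrA; rewrite -mulr_sumr hb0 mulr0.
have hb1 : mpow M (1 - b j) by [].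
have hbv i : (b i)@_0 = v i / v j.
  have : (1 - b j)@_0 = 0 by apply: hb1; rewrite mdeg0.
  rewrite mcoeffB mcoeff1 eqxx !(rmorphM (mcoeff 0)) /= !b0x => /eqP; rewrite subr_eq0 => /eqP e.
  have vxi : vx i = vx j * v i / v j by rewrite -vv mulfK.
  by rewrite vxi !mulrA -e mul1r.
have omq s' : (om x i0 j b s'%:MP)@_0 = 0 <-> exists b', s' = b' * linform v.
  rewrite (omC0 x i0 hbv); split=> [/eqP|/(elim_ker vj) ->]; last exact: tofrac0.
  by rewrite tofrac_eq0 => /eqP /(elim_ker vj).
have unelimq t : t != 0 -> ~ (exists b', unelim j t = b' * linform v).
  by move=> t1 /(elim_ker vj); rewrite unelimK => /eqP; rewrite (negbTE t1).
exists (om x i0 j b); split.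
- split=> // z; have [a [t [t1 ->]]] := fracP z.
  exists (unelim j a), (unelim j t); split; first exact: unelimq.
  have e1 y : (om x i0 j b (unelim j y)%:MP)@_0 = tofrac y by rewrite (omC0 x i0 hbv) unelimK.
  by apply: frac_residue (e1 t) (e1 a); rewrite tofrac_eq0.
- move=> u; apply: (om_symE Xx vj hb hb1 hbv).
    exact: subset_trans (mpow_sub cm) mJ.
  apply: subset_trans mJ; apply: mpow_sub; rewrite /M; lia.
- move=> nu u hu Ju.
  have mM : mpow M `<=` loc (idealX setT (lin (local_gens f x i0)) m).
    apply: subset_trans (mpow_locX mphi); apply: mpow_sub; rewrite /M; lia.
  have [e [H [hH nz sH]]] := om_kernel v0 fd hb hb1 hbv mM hu Ju.
  exists e, H; split=> //; move=> /(elim_ker vj) e0; by rewrite e0 eqxx in nz.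
- move=> e w we; have [t [U [t1 hU eU]]] := om_lift v0 j b we.
  exists (unelim j t), U; split=> //; first exact: unelimq.
  apply: (etrans eU); apply: (etrans (esym (mul_mpolyC _ _))); exact: (congr1 (fun y => y * w) (esym (om_unelim x i0 j b t))).
- move=> a; have e : (om x i0 j b (up a))@_0 = cst _ (mev a (pcoord x)).
    by rewrite om_up mcoeff_cb chart0.
  apply: (iff_trans (B := cst N.+2 (mev a (pcoord x)) = 0)); first by split=> h1; [rewrite -e|apply: (etrans e)].
  by split=> [/eqP|->]; [rewrite cst_eq0 => /eqP|exact: rmorph0].
Qed.

End PointData.

Lemma mpow_trunc (F : fieldType) N (w : {mpoly F[N]}) C :
  exists w1, (msize w1 <= C.+1)%N /\ mpow C (w - w1).
Proof.
exists (\sum_(e < C) pihomog mdeg e w); split.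
  apply: msize_le => m; apply: contraNT; rewrite -ltnNge => Cm.
  rewrite (raddf_sum (mcoeff m)) /= big1 // => e _; rewrite mcoeff_pihomog.
  by case: eqP => // em; move: (ltn_ord e); rewrite -em; lia.
move=> m mC; rewrite mcoeffB (raddf_sum (mcoeff m)) (bigD1 (Ordinal mC)) //= mcoeff_pihomog eqxx.
rewrite big1 ?addr0 ?subrr // => e ne; rewrite mcoeff_pihomog; case: eqP => // em.
by case/eqP: ne; apply: val_inj.
Qed.

Lemma homog0_const (R : comNzRingType) n (p : {mpoly R[n]}) : p \is 0.-homog -> p = (p@_0)%:MP.
Proof.
move=> hp; apply/mpolyP => m; rewrite mcoeffC; case: eqP => [->|/eqP m0]; first by rewrite mulr1.
rewrite mulr0; apply/eqP; apply: contraNT m0 => nz; rewrite -mdeg_eq0; apply/eqP.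
by apply: (dhomogP _ _ _ hp); rewrite mcoeff_msupp.
Qed.

Section LinearForms.
Variables (k : fieldType) (n : nat).
Local Notation B := {mpoly k[n.+1]}.
Implicit Types (v w : 'I_n.+1 -> k) (q : set B).

Lemma linform_coef v i : (linform v)@_U_(i) = v i.
Proof.
rewrite (raddf_sum (mcoeff _)) (bigD1 i) //= mcoeffZ mcoeffX eqxx mulr1 big1 ?addr0 // => l li.
by rewrite mcoeffZ mcoeffX eq_mnm1 (negbTE li) mulr0.
Qed.

Lemma linform_homog v : linform v \is 1.-homog.
Proof. by apply: rpred_sum => i _; rewrite rpredZ // dhomogX /= mdeg1. Qed.

Lemma linform_mem v w j : v j != 0 -> (exists b, linform w = b * linform v) ->
  forall l, w l * v j = w j * v l.
Proof.
move=> vj [b eb] l.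
have h : linform w = (w j / v j) *: linform v.
  have hb : linform w = (pihomog mdeg 0 b) * linform v.
    rewrite -{1}(pihomog_dE (linform_homog w)) eb mulrC (pihomogM_homog _ _ (linform_homog v)) //.
    by rewrite mulrC.
  rewrite (homog0_const (pihomogP mdeg 0 b)) mul_mpolyC in hb; rewrite hb; congr (_ *: _).
  by rewrite -(linform_coef w j) hb mcoeffZ linform_coef mulfK.
by rewrite -(linform_coef w l) h mcoeffZ linform_coef mulrAC divfK.
Qed.

Lemma height_one_linform q v j : height_one q -> v j != 0 -> q (linform v) ->
  q = [set s | exists b, s = b * linform v].
Proof.
move=> [pq q0 qmin] vj qv; have pv := linform_prime vj.
set p := [set s | _]; have sub : p `<=` q.
  move=> _ [b ->]; exact: idealMl _ (prime_ideal pq) qv.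
case: (pselect (q `<=` p)) => qp; first by apply/seteqP.
have p0 : p = [set 0] by apply: qmin => //; split.
have : p (linform v) by exists 1; rewrite mul1r.
rewrite p0 => /= e; case/eqP: vj; by rewrite -(linform_coef v j) e mcoeff0.
Qed.

Lemma height_one_thin q : height_one q -> thin q.
Proof.
move=> hq; split; first by case: hq.
move=> v w i j nz qv qw.
have [j0 vj0] : exists j0, v j0 != 0.
  case: (eqVneq (v i) 0) => [vi|vi]; last by exists i.
  exists j; apply: contra_neq nz => vj; by rewrite vi vj !mul0r subrr.
have := qw; rewrite (height_one_linform hq vj0 qv) => /(linform_mem vj0) h.
case/eqP: nz; apply: (mulIf vj0); rewrite mul0r mulrBl -!mulrA (h j) (h i); ring.
Qed.

Lemma zero_thin : thin [set 0 : B].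
Proof.
split.
  split; first by apply/idealP; split=> [|u v -> ->|u v ->] //=; rewrite ?addr0 ?mulr0.
    by move=> /eqP; rewrite oner_eq0.
  by move=> a b /eqP; rewrite mulf_eq0 => /orP [] /eqP; [left|right].
move=> v w i j nz e _; case/eqP: nz.
have v0 l : v l = 0 by rewrite -(linform_coef v l) e mcoeff0.
by rewrite !v0 !mul0r subrr.
Qed.

Lemma linform_val v j (s : B) : v j != 0 -> s != 0 ->
  exists e s', s = linform v ^+ e * s' /\ ~ exists b, s' = b * linform v.
Proof.
move=> vj; have [r] := ubnP (msize s); elim: r s => // r IH s; rewrite ltnS => sr s0.
case: (pselect (exists b, s = b * linform v)) => [[b eb]|nb]; last first.
  by exists 0%N, s; rewrite mul1r.
have b0 : b != 0 by apply: contra_neq s0 => b0; rewrite eb b0 mul0r.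
have lt1 : (1 < msize (linform v))%N.
  have : U_(j)%MM \in msupp (linform v) by rewrite mcoeff_msupp linform_coef.
  by move/msize_mdeg_lt; rewrite mdeg1.
have sz : (msize b < msize s)%N.
  have l0 : linform v != 0 by rewrite -msize_poly_eq0 -lt0n ltnW.
  rewrite eb msizeM //; move: lt1; set a := mmeasure _ _; set c := mmeasure _ b; lia.
have [e [s' [es ns]]] := IH b (leq_trans sz sr) b0.
by exists e.+1, s'; rewrite eb es exprS; split=> //; rewrite mulrC mulrA.
Qed.

End LinearForms.

Section RelevantPrimes.
Variables (k : closedFieldType) (N d : nat) (f : N.+3.-tuple {mpoly k[N.+2]}).
Hypothesis fd : forall i, tnth f i \is d.-homog.
Hypothesis finX : finite_set (base_points f).
Hypothesis d0 : (0 < d)%N.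
Local Notation A := {mpoly k[N.+2]}.
Local Notation B := {mpoly k[N.+3]}.
Local Notation K := {fraction {mpoly k[N.+2]}}.
Local Notation AB := {mpoly B[N.+2]}.
Local Notation WK := {mpoly K[N.+1]}.
Local Notation I := (lin (tnth f)).
Local Notation X := (base_points f).
Local Notation up := (@poly_ext k N.+3 N.+2).
Local Notation specx x := (@spec k N.+3 N.+2 (pcoord x 0)).
Variable l : A.
Hypothesis hl : l \is 1.-homog.
Hypothesis lX : forall x, X x -> mev l (pcoord x) != 0.
Variable L : ppoint k N.+2 -> B.
Hypothesis hL : forall x, non_lci_points f x -> is_relation_form f x d (L x).

Lemma large_degree_iter m : exists nu0, forall nu1 nu u, (nu0 <= nu1)%N -> (nu1 <= nu)%N ->
  u \is nu.-homog -> exists a b : AB, [/\ u = up (l ^+ (nu - nu1)) * a + b, a \is nu1.-homog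
    & coefs_in (idealX setT I m) b].
Proof.
have [e he] := large_degree_up fd hl lX; have iI := @idealX_ideal _ I m.
have iC := coefs_in_ideal N.+3 iI.
exists (e * (1 + m)).+1 => nu1 nu u lt1; elim: nu u => [|nu IH] u lt2 hu; first by lia.
move: lt2; rewrite leq_eqVlt => /predU1P [e1|].
  exists u, 0; rewrite -e1 subnn expr0 rmorph1 mul1r addr0; split=> //; first by rewrite e1.
  exact: ideal0.
rewrite ltnS => lt2.
have [a [b [eu ha hb]]] : exists a b : AB, [/\ u = up (l ^+ 1) * a + b, a \is (nu.+1 - 1).-homog
    & coefs_in (idealX setT I m) b] by apply: he hu; lia.
rewrite subn1 /= in ha; have [a' [b' [ea ha' hb']]] := IH a lt2 ha.
exists a', (up l * b' + b); split=> //; last by apply: (idealD iC) => //; exact: (idealMl _ iC).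
by rewrite eu ea subSn // expr1 exprS rmorphM /= mulrDr mulrA addrA.
Qed.

Section Prime.
Variables (v : 'I_N.+3 -> k) (j : 'I_N.+3).
Hypothesis vj : v j != 0.
Let q : set B := [set s | exists b, s = b * linform v].
Let pq : is_prime_ideal q := linform_prime vj.
Local Notation Rq := (loc_ring q).
Local Notation mq := (loc_max q).
Local Notation "y %:F" := (tofrac y).
Let Rl := loc_ring_local pq.

Lemma linform_neq0 : linform v != 0.
Proof. by apply/eqP => e; case/eqP: vj; rewrite -(linform_coef v j) e mcoeff0. Qed.

(** [s] is a power of the linear form times an element outside of [q]. At [q] that power kills the
    quotient, and the linear form generates the maximal ideal. *)
Lemma finite_length (E : set AB) nu s : is_ideal setT E -> s != 0 ->
  (forall u, u \is nu.-homog -> E (s *: u)) -> exists c, clen Rq mq (piece q E nu) (piece q setT nu) c.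
Proof.
move=> iE s0 hs; have [e [s' [es ns']]] := linform_val vj s0.
have [t [ht tA]] := @piece_mon k _ N.+2 _ pq nu.
have sP := piece_submod pq nu iE.
have Rp b : Rq b%:F by exists b, 1; rewrite tofrac1 divr1; split=> //; exact: primeN1.
have [|||c cc] := @clen_adjoins_nilp _ _ Rq mq Rl (piece q E nu) [seq tf u | u <- t] (linform v)%:F e sP.
- exact: Rp.
- move=> _ [a [s1 [[b ->] ns1 ->]]]; exists (b%:F / s1%:F); first by exists b, s1.
  by rewrite mulrA tofracM [_ * b%:F]mulrC.
- move=> _ /mapP [u ut ->]; rewrite -tofracXn -tfZ -[tf _]scale1r -invr1 -tofrac1.
  apply/(piece_tf pq iE (primeN1 pq)); first by apply: rpredZ; exact: ht.
  by exists s'; [exact: ns'|rewrite scalerA mulrC -es; apply: hs; exact: ht].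
exists c; move: cc; congr (clen _ _ _ _ _); apply/seteqP; split; last exact: tA.
have sT := piece_submod pq nu (@idealT _).
apply: (adjoins_min (sT N.+2)).
  exact: (piece_mono pq).
move=> _ /mapP [u ut ->]; apply/pieceP; exists 1, u; split=> //; [exact: primeN1|exact: ht|].
by rewrite tofrac1 invr1 scale1r.
Qed.

(** A power of the form isolating [x] vanishes to order [m] at the other points, where [mpow m] lies
    in [Jx], and is a unit at [x]. Dividing [w] by it and truncating at degree [m] leaves a
    polynomial that lifts to a form; a power of [l] adjusts the degree to [nu]. *)
Lemma surjective_point m (xs : seq (ppoint k N.+2)) (om : ppoint k N.+2 -> {rmorphism AB -> WK})
    (Jx : ppoint k N.+2 -> set WK) : 
  (forall x, x \in xs -> X x) ->
  (forall x, x \in xs -> is_ideal setT (Jx x) /\ mpow m `<=` Jx x) ->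
  (forall x, x \in xs -> (forall e w, (msize w <= e.+1)%N ->
           exists t U, [/\ ~ q t, U \is e.-homog & om x U = om x t%:MP * w]) /\
       (forall a, (om x (up a))@_0 = 0 <-> mev a (pcoord x) = 0)) ->
  exists nu0, forall nu x w, (nu0 <= nu)%N -> x \in xs ->
    exists u s, [/\ ~ q s, u \is nu.-homog, Jx x (om x s%:MP * w - om x u)
     & forall z, z \in xs -> z != x -> Jx z (om z u)].
Proof.
move=> xX hJ hom.
have h x : exists Dp : nat * A, [/\ Dp.2 \is Dp.1.-homog, mev Dp.2 (pcoord x) != 0
  & forall z, X z -> z != x -> mev Dp.2 (pcoord z) = 0].
  by have [D [p hp]] := isolating_form finX x; exists (D, p).
have [p hp] := choice h; pose Dm := (\sum_(x <- xs) (p x).1)%N.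
exists (Dm * m + m)%N => nu x w le xx; have [iJ mJ] := hJ x xx; have [hlift h0] := hom x xx.
have leD : ((p x).1 <= Dm)%N by rewrite /Dm (big_rem x) //= leq_addr.
have [hpx px pz] := hp x.
pose r := (nu - ((p x).1 * m + m))%N.
have le' : ((p x).1 * m + m <= nu)%N by apply: leq_trans le; rewrite leq_add2r leq_mul2r leD orbT.
pose a := (p x).2 ^+ m * l ^+ r.
have ha : a \is ((p x).1 * m + r).-homog.
  by apply: dhomogM; [exact: dhomogMn|exact: homogXn].
have a0 : (om x (up a))@_0 != 0.
  apply/eqP => /h0; rewrite /mev rmorphM !rmorphXn /= => /eqP.
  rewrite mulf_eq0 !expf_eq0 => /orP [] /andP [_ /eqP e0]; first by case/eqP: px.
  by case/eqP: (lX (xX x xx)).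
have [y hy] := inv_mod m a0.
have [w1 [sw1 hw1]] := mpow_trunc (y * w) m.
have [t [U [nt hU eU]]] := hlift m w1 sw1.
exists (up a * U), t; split=> //.
- have -> : nu = ((p x).1 * m + r + m)%N by rewrite /r; lia.
  by apply: dhomogM => //; apply: up_homog.
- apply: mJ; rewrite (rmorphM (om x)) eU.
  have im := @mpow_ideal K N.+1 m.
  have -> : om x t%:MP * w - om x (up a) * (om x t%:MP * w1) =
    om x t%:MP * ((1 - y * om x (up a)) * w + om x (up a) * (y * w - w1)) by ring.
  by apply: (idealMl _ im); apply: (idealD im); [exact: (idealMr _ im)|exact: (idealMl _ im)].
- move=> z zs zx; have [iJz mJz] := hJ z zs; have [_ hz0] := hom z zs.
  rewrite (rmorphM (om z)); apply: (idealMr _ iJz); apply: mJz.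
  rewrite /a rmorphM rmorphM; apply: (idealMr _ (@mpow_ideal K N.+1 m)).
  rewrite !rmorphXn; apply: mpowX; apply/mpow1P/hz0; apply: pz => //; exact: xX.
Qed.

End Prime.

(** The sum is the length modulo the ideal [D] of the elements vanishing in all fibres, which
    contains [symE f m]. For the converse, an element of large degree is reduced to a power of [l]
    times some [a] of fixed degree [nu0]. By [glue_any] a power of [l] brings [a] into [symE f m],
    up to an element outside of [q]; finite length in degree [nu0] bounds that power independently
    of [nu]. *)
Lemma symE_length (q : set B) (xs : seq (ppoint k N.+2)) : height_one q -> uniq xs ->
  (forall x, x \in xs <-> non_lci_points f x /\ q (L x)) ->
  exists m1, forall m, (m1 <= m)%N -> exists nu1, forall nu, (nu1 <= nu)%N ->
  clen (loc_ring q) (loc_max q) (piece q (symE f m) nu) (piece q setT nu)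
    (\sum_(x <- xs) (local_multiplicity f x - local_degree f x)).
Proof.
move=> hq uxs hxs; have pq : is_prime_ideal q by case: hq.
have tq := height_one_thin hq.
case: xs uxs hxs => [|x0 xs0] uxs hxs.
  exists 0%N => m _; have [nu0 hnu] := kill_symE fd finX hl lX hL m.
  exists nu0 => nu le; rewrite big_nil.
  have [|s ns hs] := hnu nu le q tq.
    by move=> x nx qx; have := (hxs x).2 (conj nx qx).
  have -> : piece q setT nu = piece q (symE f m) nu.
    apply/seteqP; split; last exact: (piece_mono pq).
    by apply: (piece_sub pq) => u hu _; exists s => //; apply: hs.
  by apply: clen_nil; apply: piece_submod => //; apply: symE_ideal.
set xs := x0 :: xs0 in uxs hxs *.
have [nx0 qx0] := (hxs x0).1 (mem_head _ _).
have rel x : non_lci_points f x -> exists i0, pcoord x 0 i0 = 1 /\ exists t v,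
   [/\ t != 0, spec_rel f x i0 v, exists i, v i != 0 & linform v = t *: L x].
  move=> nx; have [i0 [v0 _]] := normP x; exists i0; split=> //.
  have [c mphi] := chart_nilpotent fd finX v0 nx.1.
  exact: (relation_form_spec v0 fd (hL nx)).
have qlin x t v : x \in xs -> t != 0 -> linform v = t *: L x -> q (linform v).
  move=> xx t0 ->; apply: (idealZ _ (prime_ideal pq)).
  by have [] := (hxs x).1 xx.
have [i00 [v00 [t0 [v [t00 sv [j vj] ev]]]]] := rel x0 nx0.
have qv : q (linform v) := qlin x0 t0 v (mem_head _ _) t00 ev.
have eq := height_one_linform hq vj qv.
have hdata x : exists Jc : set WK * nat, x \in xs -> point_data f x q Jc.1 Jc.2.
  case: (boolP (x \in xs)) => xx; last by exists (setT, 0%N).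
  have [nx _] := (hxs x).1 xx; have [i0 [v0 [t [vx [tn0 svx [i vxi] evx]]]]] := rel x nx.
  have vv l1 : vx l1 * v j = vx j * v l1.
    apply: (linform_mem vj); have := qlin x t vx xx tn0 evx; by rewrite eq.
  have vxj : vx j != 0.
    apply/eqP => e; case/eqP: vxi; apply: (mulIf vj); by rewrite vv e !mul0r.
  have [_ [Jx [c pd]]] := point_dataP fd finX nx.1 v0 vj vxj vv svx.
  by exists (Jx, c) => _; rewrite eq.
have [Jc hJc] := choice hdata; pose Jx x := (Jc x).1.
exists (\sum_(x <- xs) (Jc x).2)%N => m hm.
have cm x : x \in xs -> ((Jc x).2 <= m)%N.
  by move=> xx; apply: leq_trans hm; rewrite (big_rem x) //= leq_addr.
have [_ _ _ _ /(_ m (cm x0 (mem_head _ _))) [om0 _]] := hJc x0 (mem_head _ _).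
have hom x : exists om : {rmorphism AB -> WK}, x \in xs ->
    point_map f x q (Jx x) m om.
  case: (boolP (x \in xs)) => xx; last by exists om0.
  by have [_ _ _ _ /(_ m (cm x xx)) [om hm']] := hJc x xx; exists om.
have [om Hom] := choice hom.
have xX x : x \in xs -> X x by move=> /hxs [[]].
have hJm x : x \in xs -> is_ideal setT (Jx x) /\ mpow m `<=` Jx x.
  move=> xx; have [i1 _ i2 _ _] := hJc x xx; split=> //.
  by apply: subset_trans i2; apply: mpow_sub; apply: cm.
have [nuS hS] : exists nu0, forall nu x w, (nu0 <= nu)%N -> x \in xs ->
    exists u s, [/\ ~ q s, u \is nu.-homog, Jx x (om x s%:MP * w - om x u)
     & forall z, z \in xs -> z != x -> Jx z (om z u)].
  rewrite eq; apply: (surjective_point j xX hJm) => x xx.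
  by have [_ _ _ h1 h2] := Hom x xx; split=> //; rewrite eq in h1.
pose D : set AB := [set u | forall x, x \in xs -> Jx x (om x u)].
have cD nu : (nuS <= nu)%N -> clen (loc_ring q) (loc_max q) (piece q D nu) (piece q setT nu)
    (\sum_(x <- xs) (local_multiplicity f x - local_degree f x)).
  move=> le; apply: (@clen_filtration _ _ _ q pq K N.+1 _ om Jx _ nu xs uxs) => [x xx|x xx|x w xx].
  - have [h1 h2 h3 _ _] := hJc x xx; have [[h4 h5] _ _ _ _] := Hom x xx.
    by split=> //; exists (Jc x).2.
  - by have [_ _ _ h1 _] := hJc x xx.
  - exact: hS.
have iE := symE_ideal f m.
have ED : symE f m `<=` D by move=> u hu x xx; have [_ h _ _ _] := Hom x xx; apply: h.
have lD r a b : symE f m b -> D (up (l ^+ r) * a + b) -> D a.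
  move=> hb hD x xx; have [iJ mJ] := hJm x xx; have [_ eJ _ _ _] := hJc x xx.
  have [_ _ _ _ h0] := Hom x xx; rewrite -/(Jx x) in eJ; rewrite -eJ.
  exists (om x (up (l ^+ r))).
    apply/eqP => /h0; rewrite /mev rmorphXn /= => /eqP; rewrite expf_eq0 => /andP [_ /eqP e0].
    by case/eqP: (lX (xX x xx)).
  have := idealB iJ (hD x xx) (ED b hb x xx).
  by rewrite (rmorphD (om x)) (rmorphM (om x)) addrK.
have [nuK hK] := kill_symE fd finX hl lX hL m.
have [nuL hLd] := large_degree_iter m.
pose nu0 := maxn nuK nuL.
have av0 : avoids f L [set 0].
  move=> x nx; have [i0 [v0 [t [vx [tn0 svx [i vxi] evx]]]]] := rel x nx.
  move=> /= e; case/eqP: vxi; by rewrite -(linform_coef vx i) evx e scaler0 mcoeff0.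
(* The zero ideal is thin and contains no [L x]: it provides a nonzero [s] killing the quotient in
   degree [nu0]. *)
have [c cE] : exists c, clen (loc_ring q) (loc_max q) (piece q (symE f m) nu0) (piece q setT nu0) c.
  have [s /eqP s0 hs] := hK nu0 (leq_maxl _ _) _ (zero_thin k N.+2) av0.
  rewrite eq; exact: (finite_length vj iE s0 hs).
pose Er r : set AB := [set u | symE f m (up (l ^+ r) * u)].
have iEr r : is_ideal setT (Er r) by exact: (colon_ideal _ iE).
have [|r|r|r0 hr0] := @clen_stable _ _ _ _ (loc_ring_local pq) _ _ _ (fun r => piece q (Er r) nu0) cE.
- by move=> r; apply: (piece_submod pq).
- by split; apply: (piece_mono pq) => // u hu; apply: (idealMl _ iE).
- by apply: (piece_mono pq) => u; rewrite /Er /= exprS rmorphM -mulrA => hu; apply: (idealMl _ iE).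
exists (maxn nuS (nu0 + r0)) => nu; rewrite geq_max => /andP [le1 le2].
suff e : piece q D nu = piece q (symE f m) nu by rewrite -e; apply: cD.
apply/seteqP; split; last exact: (piece_mono pq).
apply: (piece_sub pq) => u hu Du.
have le3 : (nu0 <= nu)%N by apply: leq_trans le2; apply: leq_addr.
have [a [b [eu ha hb]]] := hLd nu0 nu u (leq_maxr _ _) le3 hu.
have Da : D a by move: Du; rewrite eu; apply: lD; apply: symE_coefs.
have [r [s [ns hs]]] : exists r s, ~ q s /\ symE f m (s *: up (l ^+ r) * a).
  pose AA : set AB := [set y | symE f m (a * y)].
  have iAA : is_ideal setT AA by exact: (colon_ideal _ iE).
  have [||r [s [ns hs]]] := glue_any fd finX hl lX (m := m) iAA pq.
  - move=> y hy; apply: (idealMl _ iE); apply: symE_coefs.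
    exact: (coefs_in_up (@idealX_ideal _ I m) hy).
  - move=> x Xx; case: (boolP (x \in xs)) => xx.
      have [_ _ h _ _] := Hom x xx; have [e [H [h1 h2 h3]]] := h nu0 a ha (Da x xx).
      by exists e, H; split; [rewrite /AA /= mulrC; exact: h3|exact: h1|exact: h2].
    have [e he] := irr_data fd finX hl lX hL.
    have [|H [JH hH nH]] := he q tq x Xx.
      by move=> nx qx; case/negP: xx; apply/hxs.
    by exists e, H; split; [apply: (idealMl _ iE); apply: symE_sym|exact: hH|exact: nH].
  by exists r, s; split; [exact: ns|rewrite mulrC].
have : piece q (Er r0) nu0 (tf a).
  apply: (hr0 r); rewrite -[tf a]scale1r -invr1 -(tofrac1 B).
  apply/(piece_tf pq (iEr r) (primeN1 pq) ha); exists s; first exact: ns.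
  by rewrite /Er /= -scalerAr scalerAl.
rewrite -[tf a]scale1r -invr1 -(tofrac1 B) => /(piece_tf pq (iEr r0) (primeN1 pq) ha) [t nt ht].
exists t; first exact: nt.
rewrite eu scalerDr; apply: (idealD iE); last first.
  by apply: (idealZ _ iE); apply: symE_coefs.
have er : (nu - nu0 = (nu - nu0 - r0) + r0)%N by rewrite subnK // leq_subRL // .
rewrite er exprD rmorphM -mulrA /= scalerAr; apply: (idealMl _ iE).
by move: ht; rewrite /Er /= -scalerAr.
Qed.

End RelevantPrimes.

(** * The image hypersurface *)

Lemma homog1_linform (k : fieldType) n (p : {mpoly k[n]}) : p \is 1.-homog ->
  exists w, p = linform w.
Proof.
move=> /homogS_split [b [hb ->]]; exists (fun i => (b i)@_0); apply: eq_bigr => i _.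
by rewrite {1}(homog0_const (hb i)) mul_mpolyC.
Qed.

Lemma vanishing_poly (k : closedFieldType) n (p : {mpoly k[n]}) : (forall c, p.@[c] = 0) -> p = 0.
Proof.
move=> h; have [r [c]] : exists r, lin (fun i : 'I_0 => 0 : {mpoly k[n]}) (p ^+ r).
  by apply: nullstellensatz => c _.
by rewrite big_ord0 => /eqP; rewrite expf_eq0 => /andP [_ /eqP].
Qed.

Lemma homog_eval0 (R : comNzRingType) n e (p : {mpoly R[n]}) c : (0 < e)%N -> p \is e.-homog ->
  (forall i, c i = 0) -> p.@[c] = 0.
Proof.
move=> e0 hp c0; have := homog_scale (0 : R) c hp; rewrite expr0n eqn0Ngt e0 mul0r => <-.
by apply: meval_eq => i; rewrite c0 mul0r.
Qed.

Lemma unelim_support (k : fieldType) n (j : 'I_n.+1) (F : {mpoly k[n]}) m :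
  (unelim j F)@_m != 0 -> m j = 0%N.
Proof.
rewrite (mpoly_rmorph (unelim j)) (raddf_sum (mcoeff m)) => nz.
suff [m' _] : exists2 m', m' \in msupp F & (unelim j (F@_m')%:MP * \prod_i unelim j 'X_i ^+ m' i)@_m != 0.
  rewrite unelimC mul_mpolyC mcoeffZ.
  have -> : \prod_i unelim j 'X_i ^+ m' i = 'X_[\sum_i U_(lift j i) *+ m' i] :> {mpoly k[n.+1]}.
    rewrite (big_morph _ (@mpolyXD _ k) (@mpolyX0 _ k)); apply: eq_bigr => i _.
    by rewrite unelimX mpolyXn.
  rewrite mcoeffX; case: (_ =P m) => [em _|_]; last by rewrite mulr0 eqxx.
  rewrite -em mnm_sumE big1 // => i _; rewrite mulmnE mnm1E eq_sym.
  by rewrite (negbTE (neq_lift j i)).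
apply/hasP; move: nz; apply: contraNT => /hasPn h.
by rewrite big_seq big1 // => m' /h; rewrite negbK => /eqP.
Qed.

Section ImageEquation.
Variables (k : closedFieldType) (N d : nat) (f : N.+3.-tuple {mpoly k[N.+2]}).
Hypothesis fd : forall i, tnth f i \is d.-homog.
Hypothesis d0 : (0 < d)%N.
Local Notation A := {mpoly k[N.+2]}.
Local Notation B := {mpoly k[N.+3]}.
Local Notation P := (eq_ideal f).
Variable H : B.
Hypothesis hH : is_image_equation f H.

Let iP : is_ideal setT P. Proof. by case: (eq_idealP f). Qed.

Lemma image_eq_homog : exists2 D, (0 < D)%N & H \is D.-homog.
Proof.
have [[H0 nu _] [D hD] _] := hH; exists D => //; rewrite lt0n; apply/eqP => e.
move: hD; rewrite e => /homog0_const e'; case/negP: nu; rewrite e'.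
apply: rmorph_unit; rewrite unitfE; apply: contraNneq H0 => z; by rewrite e' z.
Qed.

Lemma image_value (c : 'I_N.+2 -> k) : (exists i, (tnth f i).@[c] != 0) ->
  exists y t, [/\ lambda_image f y, t != 0 & forall i, (tnth f i).@[c] = t * pcoord y 0 i].
Proof.
move=> [i fi].
have [x [t [t0 ex]]] : exists x (t : k), t != 0 /\ forall i, c i = t * pcoord x 0 i.
  apply: ppoint_of; apply: contrapT => h; case/eqP: fi; apply: (homog_eval0 d0 (fd i)) => l.
  by apply: contrapT => /eqP cl; apply: h; exists l.
have [y [t' [t'0 ey]]] := @ppoint_of k N.+3 (fun i => (tnth f i).@[c]) (ex_intro _ i fi).
exists y, t'; split=> //; exists x; exists (t' / t ^+ d); split.
  by rewrite mulf_neq0 // invr_eq0 expf_neq0.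
apply/rowP => l; rewrite !mxE /mev.
have el : (tnth f l).@[c] = t ^+ d * (tnth f l).@[pcoord x 0].
  by rewrite -(homog_scale _ _ (fd l)); apply: meval_eq.
by apply: (mulfI (expf_neq0 d t0)); rewrite -el ey mulrA mulrCA divff ?mulr1 // expf_neq0.
Qed.

Lemma image_eq_mem : P H.
Proof.
have [D D0 hD] := image_eq_homog; have [_ _ eV] := hH.
apply: vanishing_poly => c; rewrite comp_mpoly_meval.
case: (pselect (exists i, (tnth f i).@[c] != 0)) => [/image_value [y [t [hy t0 ey]]]|nz].
  have -> : H.@[fun i => (tnth f i).@[c]] = t ^+ D * H.@[pcoord y 0].
    by rewrite -(homog_scale _ _ hD); apply: meval_eq.
  suff : [set y | mev H (pcoord y) = 0] y by move=> /= e; rewrite /mev in e; rewrite e mulr0.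
  by rewrite -eV => E Q _ h; apply: h.
apply: (homog_eval0 D0 hD) => i.
by apply: contrapT => /eqP h; apply: nz; exists i.
Qed.

(** The zeros of [H] form the closed image, on which a form of the prime vanishes; the
    Nullstellensatz applies. *)
Lemma image_eq_rad e p : p \is e.-homog -> P p -> exists r b, p ^+ r = b * H.
Proof.
move=> hp Pp; have [D D0 hD] := image_eq_homog; have [_ _ eV] := hH.
have [r [c ec]] : exists r, lin (fun i : 'I_1 => H) (p ^+ r); last first.
  by exists r, (c ord0); rewrite ec big_ord1.
case: (posnP e) => [e0|e0].
  exists 1%N; move: hp; rewrite e0 => /homog0_const ep; move: Pp; rewrite /eq_ideal /= ep.
  rewrite comp_mpolyC => /eqP; rewrite mpolyC_eq0 => /eqP ->.
  rewrite expr1 mpolyC0; apply: ideal0; exact: lin_ideal.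
apply: nullstellensatz => c /(_ ord0) Hc.
case: (pselect (exists i, c i != 0)) => [/ppoint_of [y [t [t0 ey]]]|nz]; last first.
  by apply: (homog_eval0 e0 hp) => i; apply: contrapT => /eqP h; apply: nz; exists i.
have sc e' (Q : B) : Q \is e'.-homog -> Q.@[c] = t ^+ e' * Q.@[pcoord y 0].
  by move=> hQ; rewrite -(homog_scale _ _ hQ); apply: meval_eq.
suff : mev p (pcoord y) = 0 by rewrite /mev (sc _ _ hp) => ->; rewrite mulr0.
have : [set y | mev H (pcoord y) = 0] y.
  rewrite /= /mev; apply/eqP; move: Hc; rewrite (sc _ _ hD) => /eqP.
  by rewrite mulf_eq0 expf_eq0 (negbTE t0) andbF.
rewrite -eV; apply; first exact: hp.
move=> z [x [s [s0 es]]].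
have := congr1 (meval (pcoord x 0)) Pp; rewrite comp_mpoly_meval meval0.
have -> : p.@[fun i => (tnth f i).@[pcoord x 0]] = s ^+ e * p.@[pcoord z 0].
  rewrite -(homog_scale _ _ hp); apply: meval_eq => i.
  by have /rowP /(_ i) := es; rewrite !mxE.
by move/eqP; rewrite mulf_eq0 expf_eq0 (negbTE s0) andbF => /eqP.
Qed.

Lemma eq_ideal_comp u : (forall e, P (pihomog mdeg e u)) -> P u.
Proof.
by move=> h; have [K ->] := pihomog_expand u; apply: (ideal_sum _ iP) => e _.
Qed.

(** The omitted variable [T_j] occurs in the leading monomial of [H]. A relation between the others
    would give a form of the prime without [T_j], a power of which is a multiple of [H]; leading
    monomials contradict this. *)
Lemma independent_generators : exists j, forall F : {mpoly k[N.+2]}, P (unelim j F) -> F = 0.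
Proof.
have [D D0 hD] := image_eq_homog; have [[H0 _ _] _ _] := hH.
have [j mj] : exists j, (0 < mlead H j)%N.
  apply/existsP; apply: contraTT D0 => /existsPn h; rewrite -(homog_lead H0 hD) mdegE.
  by rewrite big1 // => i _; apply/eqP; rewrite -leqn0 leqNgt h.
exists j => F PF; apply: contrapT => /eqP F0.
have u0 : unelim j F != 0.
  have nz : (1 : k) != 0 := oner_neq0 _.
  by apply: contraNneq F0 => e; rewrite -(@unelimK k N.+2 (fun=> 1) j F) e rmorph0.
have [e [p [hp p0 ep]]] : exists e p, [/\ p \is e.-homog, p != 0 & p = pihomog mdeg e (unelim j F)].
  apply: contrapT => h; case/eqP: u0; have [K ->] := pihomog_expand (unelim j F).
  rewrite big1 // => e _; apply: contrapT => /eqP nz; apply: h; exists e; eexists; split; last by [].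
    exact: pihomogP.
  exact: nz.
have Pp : P p by rewrite ep; apply: (eq_ideal_graded fd).
have [r [b eb]] := image_eq_rad hp Pp.
have b0 : b != 0 by apply: contraTneq (expf_neq0 r p0) => z; rewrite eb z mul0r eqxx.
have := congr1 (fun q => mlead q j) eb; rewrite /= mleadX // mleadM // mulmnE mnmDE.
have -> : mlead p j = 0%N.
  apply: (@unelim_support _ _ _ F); have := p0; rewrite -mleadc_eq0.
  by rewrite {2}ep mcoeff_pihomog; case: ifP => // _; rewrite eqxx.
by rewrite mul0n; move: mj; case: (mlead H j) => // a _; rewrite addnS.
Qed.

(* [n] of the [f_i] are independent but their restrictions to [l = 0], which
   are polynomials in [n - 1] variables, are not. *)
Lemma divisible_value (l : A) : l \is 1.-homog -> l != 0 ->
  exists D u p, [/\ u \is D.-homog, ~ P u & u \mPo f = p * l].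
Proof.
move=> /homog1_linform [w ->] l0.
have [i0 wi0] : exists i, w i != 0.
  apply: contrapT => h; case/eqP: l0; rewrite /linform big1 // => i _.
  by case: (eqVneq (w i) 0) => [->|wi]; [rewrite scale0r|case: h; exists i].
have [j hj] := independent_generators.
have [F F0 eF] := alg_dep (fun i => elim w i0 (tnth f (lift j i))).
pose u := unelim j F.
have eu : elim w i0 (u \mPo f) = 0.
  have h := @mpoly_rmorph_ext _ _ _ (elim w i0 \o (comp_mpoly f \o unelim j))
    (mmap (@mpolyC N.+1 k) (fun i => elim w i0 (tnth f (lift j i)))).
  rewrite -[RHS]eF; apply: h => [c|i] /=.
    by rewrite unelimC comp_mpolyC elimC mmapC.
  by rewrite unelimX comp_mpolyXU -tnth_nth mmapX mmap1U.
have [b eb] := (elim_ker wi0 _).1 eu.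
have [e ne] : exists e, ~ P (pihomog mdeg e u).
  apply: contrapT => h; case/eqP: F0; apply: hj; apply: eq_ideal_comp => e.
  by apply: contrapT => ne; apply: h; exists e.
have gl : graded (lin (fun i : 'I_1 => linform w)).
  by apply: graded_lin => _; exists 1%N; exact: linform_homog.
have [|c ec] := gl (u \mPo f) (e * d)%N.
  by exists (fun=> b); rewrite big_ord1.
exists e, (pihomog mdeg e u), (c ord0); split=> //; first exact: pihomogP.
by rewrite -(pihomog_comp fd) // ec big_ord1.
Qed.

End ImageEquation.

Lemma chart_msize (k : fieldType) M (x : ppoint k M.+1) (i0 : 'I_M.+1) e p : p \is e.-homog ->
  (msize (chart x i0 p) <= e.+1)%N.
Proof.
move=> hp; rewrite /chart /mmap big_seq.
apply: (big_ind (fun w => (msize w <= e.+1)%N)) => [|w1 w2 h1 h2|m mp].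
- by rewrite msize0.
- by apply: leq_trans (msizeD_le _ _) _; rewrite geq_max h1.
rewrite mul_mpolyC; apply: leq_trans (msizeZ_le _ _) _.
have -> : e = (mdeg m * 1)%N by rewrite muln1; apply/esym; apply: (dhomogP _ _ _ hp).
apply: msize_mmap1 => i; rewrite /chart_gen; apply: leq_trans (msizeD_le _ _) _.
rewrite geq_max; apply/andP; split; first by rewrite msizeC; case: eqP.
by case: unlift => [l|]; rewrite ?msize0 // msizeX mdeg1.
Qed.

Lemma unelimZ (k : fieldType) n (j : 'I_n.+1) c (p : {mpoly k[n]}) :
  unelim j (c *: p) = c *: unelim j p.
Proof. by rewrite -mul_mpolyC rmorphM /= unelimC mul_mpolyC. Qed.

Section HomogeneousFractions.
Variables (k : fieldType) (n : nat).
Local Notation A := {mpoly k[n]}.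

Lemma homog_prod (T : finType) (Q : pred T) (q : T -> A) (e : T -> nat) :
  (forall i, q i \is (e i).-homog) -> \prod_(i | Q i) q i \is (\sum_(i | Q i) e i)%N.-homog.
Proof.
move=> h; apply: (big_ind2 (fun (p : A) d => p \is d.-homog)) => [|p1 d1 p2 d2 h1 h2|//].
  exact: dhomog1.
exact: dhomogM.
Qed.

Lemma homog_denominators (T : finType) (a b : T -> A) :
  (forall i, exists e, a i \is e.-homog /\ b i \is e.-homog) ->
  exists D p, [/\ \prod_i b i \is D.-homog, forall i, p i \is D.-homog
    & forall i, a i * \prod_i b i = p i * b i].
Proof.
move=> h; have [e he] := choice h.
exists (\sum_i e i)%N, (fun i => a i * \prod_(l | l != i) b l).
split=> [|i|i]; first by apply: homog_prod => i; case: (he i).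
  rewrite (bigD1 (F := e) i) //=; apply: dhomogM; first by case: (he i).
  by apply: homog_prod => l; case: (he l).
by rewrite (bigD1 i) //= [b i * _]mulrC mulrA.
Qed.

End HomogeneousFractions.

Section FractionFacts.
Variables (R : idomainType).
Local Notation "x %:F" := (tofrac x).

Lemma tofrac_div_eq (a b c e : R) : b != 0 -> e != 0 ->
  a%:F / b%:F = c%:F / e%:F <-> a * e = c * b.
Proof.
move=> b0 e0; split=> h.
  apply/eqP; rewrite -tofrac_eq !tofracM; apply/eqP/eqP; rewrite -eqr_div ?tofrac_eq0 //.
  exact/eqP.
by apply/eqP; rewrite eqr_div ?tofrac_eq0 // -!tofracM h.
Qed.

Lemma tofrac_comb (T : finType) (g p : T -> R) h u : h != 0 -> u != 0 ->
  \sum_i (g i)%:F / h%:F * ((p i)%:F / u%:F) = (\sum_i g i * p i)%:F / (h * u)%:F.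
Proof.
move=> h0 u0; rewrite rmorph_sum mulr_suml; apply: eq_bigr => i _.
by rewrite mulf_div -!tofracM.
Qed.

Lemma tofrac_div_eq0 (a b : R) : b != 0 -> (a%:F / b%:F = 0) <-> a = 0.
Proof.
move=> b0; split=> [/eqP|->]; last by rewrite tofrac0 mul0r.
by rewrite mulf_eq0 invr_eq0 !tofrac_eq0 (negbTE b0) orbF => /eqP.
Qed.

Lemma tofrac_quot (a b c e : R) : b != 0 -> c != 0 -> e != 0 ->
  - (a%:F / b%:F) / (c%:F / e%:F) = (- (a * e))%:F / (b * c)%:F.
Proof. by move=> b0 c0 e0; rewrite invf_div mulNr mulf_div tofracN !tofracM mulNr. Qed.

End FractionFacts.

(* A maximal independent family is a basis. *)
Lemma ext_basis_exists (K : fieldType) (E S : set K) (bound : nat) :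
  (forall a b, S a -> S b -> b != 0 -> S (- a / b)) ->
  (forall m (b : 'I_m -> K), (forall i, E (b i)) -> (forall c : 'I_m -> K, (forall i, S (c i)) ->
     \sum_i c i * b i = 0 -> forall i, c i = 0) -> (m <= bound)%N) ->
  exists b : 'I_(ext_degree E S) -> K, [/\ forall i, E (b i),
    forall z, E z -> exists c, (forall i, S (c i)) /\ z = \sum_i c i * b i
    & forall c : 'I_(ext_degree E S) -> K, (forall i, S (c i)) ->
        \sum_i c i * b i = 0 -> forall i, c i = 0].
Proof.
move=> Sq bd.
pose ind m := exists b : 'I_m -> K, (forall i, E (b i)) /\ forall c : 'I_m -> K,
  (forall i, S (c i)) -> \sum_i c i * b i = 0 -> forall i, c i = 0.
have h0 : exists m, `[< ind m >] by exists 0%N; apply/asboolP; exists (fun=> 0); split=> [[]|c _ _ []].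
have hb m : `[< ind m >] -> (m <= bound)%N by move=> /asboolP [b [Eb ib]]; exact: bd Eb ib.
pose X m := exists b : 'I_m -> K, [/\ forall i, E (b i),
    forall z, E z -> exists c, (forall i, S (c i)) /\ z = \sum_i c i * b i
    & forall c : 'I_m -> K, (forall i, S (c i)) ->
        \sum_i c i * b i = 0 -> forall i, c i = 0].
suff hX : X (ex_maxn h0 hb) by have hX' := xgetI 0%N hX; exact: hX'.
case: ex_maxnP => m /asboolP [b [Eb ib]] mx; exists b; split=> // z Ez.
apply: contrapT => nz; suff /mx : `[< ind m.+1 >] by rewrite ltnn.
apply/asboolP; exists (fun i => if unlift ord0 i is Some l then b l else z).
split=> [i|c Sc]; first by case: unlift.
rewrite big_ord_recl unlift_none; under eq_bigr do rewrite liftK.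
move=> e; have c0 : c ord0 = 0.
  apply: contrapT => /eqP c0; apply: nz; exists (fun l => - c (lift ord0 l) / c ord0).
  split=> [l|]; first exact: Sq.
  apply: (mulfI c0); rewrite (_ : c ord0 * z = - \sum_(i < m) c (lift ord0 i) * b i); last first.
    by apply/eqP; rewrite -addr_eq0 e.
  rewrite -sumrN mulr_sumr; apply: eq_bigr => l _; by field.
move=> i; case: (unliftP ord0 i) => [l ->|-> //].
by apply: (ib (fun l => c (lift ord0 l))) => [l'|]; [exact: Sc|rewrite -[RHS]e c0 mul0r add0r].
Qed.

(** * The degree of the map, by forms independent over the image *)

Section Degree.
Variables (k : closedFieldType) (N d : nat) (f : N.+3.-tuple {mpoly k[N.+2]}).
Hypothesis fd : forall i, tnth f i \is d.-homog.
Hypothesis d0 : (0 < d)%N.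
Local Notation A := {mpoly k[N.+2]}.
Local Notation B := {mpoly k[N.+3]}.
Local Notation P := (eq_ideal f).
Local Notation "x %:F" := (tofrac x).
Variable H : B.
Hypothesis hH : is_image_equation f H.
Variable j0 : 'I_N.+3.
Hypothesis fj0 : tnth f j0 != 0.

(** Linear independence over the function field of the image, once coefficients are brought to a
    common denominator and so to forms of one degree. *)
Definition forms_indep r (p : 'I_r -> A) := forall t (g : 'I_r -> B),
  (forall i, g i \is t.-homog) -> \sum_i (g i \mPo f) * p i = 0 -> forall i, P (g i).

(** The products of the [p i] with the monomials of degree [t] in the independent generators are
    linearly independent over [k], too many for their degree if [r] is large. The bound does not
    involve [e], so it holds for all independent families and shows that the extension has finite
    degree. *)
Lemma forms_indep_bound r (p : 'I_r -> A) e : (forall i, p i \is e.-homog) ->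
  forms_indep p -> (r <= (1 + N.+1 * d) ^ N.+1)%N.
Proof.
move=> hp ip; rewrite leqNgt; apply/negP => lt.
have [x [t0 [_ _]]] := @ppoint_of k N.+2 (fun=> 1) (ex_intro _ ord0 (oner_neq0 _)).
have [i0 [v0 _]] := normP x.
have [j hj] := independent_generators fd d0 hH.
(* There are [s ^ N.+1] exponents [al]: [N.+1] free entries less than [s], the first one completing
   the degree to [t]. With this [s], forms of degree [t * d + e] have size at most
   [(1 + N.+1 * d) * s] in the chart. *)
pose s := e.+1; pose t := (N.+1 * s)%N.
pose al (a : {ffun 'I_N.+1 -> 'I_s}) : 'X_{1..N.+2} :=
  [multinom (if unlift ord0 i is Some l then a l : nat else t - \sum_l a l)%N | i < N.+2].
have al_lift a l : al a (lift ord0 l) = a l by rewrite mnmE liftK.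
have dal a : mdeg (al a) = t.
  rewrite mdegE big_ord_recl {1}/al mnmE unlift_none.
  rewrite [X in (_ + X)%N](eq_bigr (fun l => a l : nat)) => [|l _]; last exact: al_lift.
  apply: subnK; rewrite /t -[X in (_ <= X * s)%N]card_ord -sum_nat_const.
  by apply: leq_sum => l _; apply: ltnW.
have ial : injective al.
  move=> a b /mnmP eab; apply/ffunP => l; apply: val_inj.
  by have := eab (lift ord0 l); rewrite !mnmE liftK.
pose g (a : {ffun 'I_N.+1 -> 'I_s}) : B := unelim j 'X_[al a].
have hg a : g a \is t.-homog.
  rewrite /g /unelim mmapX -(dal a) /mmap1 mdegE.
  apply: homog_prod => l; exact: homogX.
pose w (ia : 'I_r * {ffun 'I_N.+1 -> 'I_s}) := (g ia.2 \mPo f) * p ia.1.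
have hw ia : w ia \is (t * d + e).-homog by apply: dhomogM => //; apply: comp_homog.
have [|c [[[i1 a1] ci1] ec]] := @lin_dep k N.+1 _ (fun ia => chart x i0 (w ia)) (t * d + e).+1
  (fun ia => chart_msize x i0 (hw ia)).
  rewrite card_prod card_ffun !card_ord.
  have -> : (t * d + e).+1 = ((1 + N.+1 * d) * s)%N by rewrite /t /s; lia.
  by rewrite expnMn ltn_pmul2r // expn_gt0.
have e1 : \sum_ia c ia *: w ia = 0.
  apply: (@chart_inj _ _ x i0 v0 (t * d + e)).
    by apply: rpred_sum => ia _; apply: rpredZ; exact: hw.
  rewrite (raddf_sum (chart x i0)) -[RHS]ec; apply: eq_bigr => ia _; exact: chartZ.
pose F i : {mpoly k[N.+2]} := \sum_a c (i, a) *: 'X_[al a].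
have eF i : unelim j (F i) = \sum_a c (i, a) *: g a.
  by rewrite (raddf_sum (unelim j)); apply: eq_bigr => a _; exact: unelimZ.
have : P (unelim j (F i1)).
  apply: (ip t (fun i => unelim j (F i))) => [i|].
    by rewrite eF; apply: rpred_sum => a _; apply: rpredZ; exact: hg.
  have e2 : \sum_i \sum_a c (i, a) *: w (i, a) = 0.
    by rewrite pair_bigA -[RHS]e1; apply: eq_bigr => -[].
  rewrite -[RHS]e2; apply: eq_bigr => i _.
  rewrite eF (raddf_sum (comp_mpoly f)) mulr_suml; apply: eq_bigr => a _.
  by rewrite /= comp_mpolyZ; exact: esym (scalerAl _ _ _).
move/hj => /(congr1 (mcoeff (al a1))); rewrite mcoeff0 (raddf_sum (mcoeff _)) (bigD1 a1) //=.
rewrite mcoeffZ mcoeffX eqxx mulr1 big1 ?addr0; first by move/eqP; apply/negP.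
move=> a na; rewrite mcoeffZ mcoeffX; case: (_ =P al a1) => [/ial ea|_]; last by rewrite mulr0.
by rewrite ea eqxx in na.
Qed.

Lemma comp_neq0 (Q : B) : Q \mPo f != 0 <-> ~ P Q.
Proof. by split=> [/eqP //|h]; apply/eqP. Qed.

Lemma Xj0_notin t : ~ P ('X_j0 ^+ t).
Proof.
apply: (primeN_exp (eq_idealP f)) => /eqP; rewrite comp_mpolyXU -tnth_nth; exact/negP.
Qed.

Lemma neg_quot_image a b : image_function_field f a -> image_function_field f b -> b != 0 ->
  image_function_field f (- a / b).
Proof.
move=> [e [p [q [hp hq q0 ->]]]] [e' [p' [q' [hp' hq' q0' ->]]]] nz.
have p0' : p' \mPo f != 0.
  by apply: contraNneq nz => z; apply/eqP/(tofrac_div_eq0 _ q0').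
exists (e + e')%N, (- (p * q')), (q * p'); split.
- by rewrite rpredN; apply: dhomogM.
- by apply: dhomogM.
- by rewrite (rmorphM (comp_mpoly f)) mulf_neq0.
have -> : (- (p * q')) \mPo f = - ((p \mPo f) * (q' \mPo f)).
  by rewrite (rmorphN (comp_mpoly f)) (rmorphM (comp_mpoly f)).
rewrite (rmorphM (comp_mpoly f)); exact: tofrac_quot.
Qed.

Lemma function_field_bound m (b : 'I_m -> {fraction A}) : (forall i, function_field (b i)) ->
  (forall c : 'I_m -> {fraction A}, (forall i, image_function_field f (c i)) ->
     \sum_i c i * b i = 0 -> forall i, c i = 0) ->
  exists D u p, [/\ u != 0, u \is D.-homog, forall i, p i \is D.-homog,
     forall i, b i = (p i)%:F / u%:F & forms_indep p].
Proof.
move=> Eb ib.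
have h i : exists aq : A * A, [/\ exists e, aq.1 \is e.-homog /\ aq.2 \is e.-homog, aq.2 != 0
   & b i = aq.1%:F / aq.2%:F].
  by have [e [a [q [h1 h2 h3 h4]]]] := Eb i; exists (a, q); split=> //; exists e.
have [aq haq] := choice h.
have [|D [p [hu hp epu]]] := @homog_denominators k N.+2 _ (fun i => (aq i).1) (fun i => (aq i).2).
  by move=> i; case: (haq i).
set u := \prod_i _ in hu epu.
have u0 : u != 0 by apply/prodf_neq0 => i _; case: (haq i).
have bE i : b i = (p i)%:F / u%:F.
  have [_ q0 ->] := haq i; apply/(tofrac_div_eq _ _ q0 u0); exact: epu.
exists D, u, p; split=> // t g hg e0 i.
have xt0 : ('X_j0 ^+ t) \mPo f != 0 by apply/comp_neq0; exact: Xj0_notin.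
suff : (g i \mPo f)%:F / (('X_j0 ^+ t) \mPo f)%:F = 0 by move/(tofrac_div_eq0 _ xt0).
apply: (ib (fun i => (g i \mPo f)%:F / (('X_j0 ^+ t) \mPo f)%:F)).
  by move=> l; exists t, (g l), ('X_j0 ^+ t); split=> //; apply: homogX.
transitivity (\sum_l (g l \mPo f)%:F / (('X_j0 ^+ t) \mPo f)%:F * ((p l)%:F / u%:F)).
  by apply: eq_bigr => l _; rewrite bE.
apply: (etrans (tofrac_comb _ _ xt0 u0)); rewrite e0.
by apply/tofrac_div_eq0 => //; rewrite mulf_neq0.
Qed.

(** A basis of the function field over that of the image, written with a common denominator [u]. The
    fraction of [a] by [h * u] has degree zero; expanding it and clearing the denominators of its
    coordinates gives the last identity. *)
Lemma degree_basis : exists e (u : A) (p : 'I_(lambda_degree f) -> A),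
  [/\ u != 0, u \is e.-homog, forall i, p i \is e.-homog, forms_indep p
   & forall D a h, a \is (D + e).-homog -> h \is D.-homog -> h != 0 ->
       exists t Q g, [/\ Q \is t.-homog, ~ P Q, forall i, g i \is t.-homog
         & (Q \mPo f) * a = h * \sum_i (g i \mPo f) * p i]].
Proof.
have [b [Eb sb ib]] : exists b : 'I_(lambda_degree f) -> {fraction A},
   [/\ forall i, function_field (b i),
    forall z, function_field z -> exists c, (forall i, image_function_field f (c i)) /\ z = \sum_i c i * b i
    & forall c : 'I_(lambda_degree f) -> _, (forall i, image_function_field f (c i)) ->
        \sum_i c i * b i = 0 -> forall i, c i = 0].
  apply: (@ext_basis_exists _ _ _ ((1 + N.+1 * d) ^ N.+1)); first exact: neg_quot_image.
  move=> m b Eb ib; have [D [u [p [_ _ hp _ ip]]]] := function_field_bound Eb ib.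
  exact: forms_indep_bound hp ip.
have [e [u [p [u0 hu hp bE ip]]]] := function_field_bound Eb ib.
exists e, u, p; split=> // D a h ha hh h0.
have hu0 : h * u != 0 by rewrite mulf_neq0.
have [c [Fc ec]] : exists c, (forall i, image_function_field f (c i)) /\
    a%:F / (h * u)%:F = \sum_i c i * b i.
  by apply: sb; exists (D + e)%N, a, (h * u); split=> //; apply: dhomogM.
have hc i : exists gq : B * B, [/\ exists e, gq.1 \is e.-homog /\ gq.2 \is e.-homog, ~ P gq.2
   & c i = (gq.1 \mPo f)%:F / (gq.2 \mPo f)%:F].
  by have [t [g [q [h1 h2 h3 h4]]]] := Fc i; exists (g, q); split=> //; [exists t|exact/comp_neq0].
have [gq hgq] := choice hc.
have [|t [g [hQ hg eg]]] := @homog_denominators k N.+3 _ (fun i => (gq i).1) (fun i => (gq i).2).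
  by move=> i; case: (hgq i).
set Q := \prod_i _ in hQ eg.
have PQ : ~ P Q by apply: (primeN_prod (eq_idealP f)) => i _; case: (hgq i).
have Q0 : Q \mPo f != 0 by apply/comp_neq0.
exists t, Q, g; split=> //.
have cE i : c i = (g i \mPo f)%:F / (Q \mPo f)%:F.
  have [_ /comp_neq0 q0 ->] := hgq i; apply/(tofrac_div_eq _ _ q0 Q0).
  by rewrite -!(rmorphM (comp_mpoly f)) eg.
have : a%:F / (h * u)%:F = (\sum_i (g i \mPo f) * p i)%:F / ((Q \mPo f) * u)%:F.
  rewrite ec -(tofrac_comb _ _ Q0 u0); apply: eq_bigr => i _; by rewrite cE bE.
have Qu0 : (Q \mPo f) * u != 0 by rewrite mulf_neq0.
move/(tofrac_div_eq _ _ hu0 Qu0) => e2; apply: (mulIf u0).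
by rewrite -mulrA mulrCA e2; ring.
Qed.

Lemma lambda_degree_gt0 : (0 < lambda_degree f)%N.
Proof.
have [e [u [p [u0 hu hp ip sp]]]] := degree_basis.
rewrite lt0n; apply/eqP => z.
have [||t [Q [g [hQ PQ hg eQ]]]] := sp 0%N u 1 hu; [exact: dhomog1|exact: oner_neq0|].
move: eQ; rewrite big1 => [/eqP|[i im] _]; last by exfalso; move: im; rewrite z.
by rewrite mulr0 mulf_eq0 (negbTE u0) orbF => /eqP.
Qed.

End Degree.

Section CongruenceFacts.
Variables (R : comNzRingType) (E : set R).
Hypothesis iE : is_ideal setT E.

Lemma kernel_comb v w w' a x y z s t : E (v - w) -> E (x * w - y * w') -> E (s * w' - z * a) ->
  E (y * z * (t * a)) -> E (x * s * t * v).
Proof.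
move=> h1 h2 h3 h4.
have -> : x * s * t * v =
  x * s * t * (v - w) + s * t * (x * w - y * w') + y * t * (s * w' - z * a) + y * z * (t * a) by ring.
apply: (idealD iE _ h4); apply: (idealD iE); last exact: (idealMl _ iE h3).
by apply: (idealD iE); [exact: (idealMl _ iE h1)|exact: (idealMl _ iE h2)].
Qed.

Lemma divide_comb u a b b' x y u0 p l : E (x * b - y * b') -> E (u0 * y - x * (p * l)) ->
  u = l * a + b -> E (x * u0 * u - l * (x * u0 * a + x * (p * b'))).
Proof.
move=> h1 h2 ->.
have -> : x * u0 * (l * a + b) - l * (x * u0 * a + x * (p * b')) =
  u0 * (x * b - y * b') + b' * (u0 * y - x * (p * l)) by ring.
by apply: (idealD iE); [exact: (idealMl _ iE h1)|exact: (idealMl _ iE h2)].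
Qed.

Lemma step_comb u a a' s s' l r : E (s * u - l * a) -> E (s' * a - r * a') ->
  E (s * s' * u - l * r * a').
Proof.
move=> h1 h2; have -> : s * s' * u - l * r * a' = s' * (s * u - l * a) + l * (s' * a - r * a') by ring.
by apply: (idealD iE); [exact: (idealMl _ iE h1)|exact: (idealMl _ iE h2)].
Qed.

End CongruenceFacts.

Lemma swap_comb (R : comNzRingType) (x y z g F : R) :
  x * (F * y) - z * (F * g) = - F * (g * z - x * y).
Proof. by ring. Qed.

Lemma push_comb (R : comNzRingType) (x z a s w : R) :
  x * (z * a) = s * (x * w) - x * (s * w - z * a).
Proof. by ring. Qed.

Lemma exp_swap (R : comNzRingType) (a b : R) D r :
  a ^+ (D + r) * b ^+ (D + r) = (a ^+ r * b ^+ D) * (a ^+ D * b ^+ r).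
Proof. by rewrite !exprD; ring. Qed.

Lemma mulrA4 (R : comNzRingType) (x y z a : R) : x * (y * z) * a = x * (y * (z * a)).
Proof. by rewrite -!mulrA. Qed.

Lemma exp_split (R : comNzRingType) (a b : R) i m r : (i <= m)%N -> (i <= r)%N ->
  a ^+ m * b ^+ r = (a ^+ (m - i) * b ^+ (r - i)) * (a ^+ i * b ^+ i).
Proof. by move=> im ir; rewrite -{1}(subnK im) -{1}(subnK ir) !exprD; ring. Qed.

Lemma scale_comb (L : fieldType) (V : lmodType L) (T : finType) (g : T -> L) (y : T -> V) x Q s :
  Q != 0 -> s != 0 ->
  x - \sum_i (g i / Q) *: y i = (s * Q)^-1 *: (s *: (Q *: x - \sum_i g i *: y i)).
Proof.
move=> Q0 s0; rewrite scalerA invfM mulrAC mulVf // mul1r scalerBr scalerA mulVf // scale1r.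
congr (_ - _); rewrite scaler_sumr; apply: eq_bigr => i _.
by rewrite scalerA mulrC.
Qed.

Section ImagePrime.
Variables (k : closedFieldType) (N d : nat) (f : N.+3.-tuple {mpoly k[N.+2]}).
Hypothesis fd : forall i, tnth f i \is d.-homog.
Hypothesis finX : finite_set (base_points f).
Hypothesis d0 : (0 < d)%N.
Local Notation A := {mpoly k[N.+2]}.
Local Notation B := {mpoly k[N.+3]}.
Local Notation AB := {mpoly B[N.+2]}.
Local Notation I := (lin (tnth f)).
Local Notation X := (base_points f).
Local Notation J := (sym_ideal f).
Local Notation P := (eq_ideal f).
Local Notation RP := (loc_ring P).
Local Notation mP := (loc_max P).
Local Notation up := (@poly_ext k N.+3 N.+2).
Local Notation tf := (@tf k N.+3 N.+2).
Local Notation "x %:F" := (tofrac x).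
Variable H : B.
Hypothesis hH : is_image_equation f H.
Variable j0 : 'I_N.+3.
Hypothesis fj0 : tnth f j0 != 0.
Variable l : A.
Hypothesis hl : l \is 1.-homog.
Hypothesis lX : forall x, X x -> mev l (pcoord x) != 0.
Hypothesis l0 : l != 0.
Variable L : ppoint k N.+2 -> B.
Hypothesis hL : forall x, non_lci_points f x -> is_relation_form f x d (L x).
Local Notation Xm m := (('X_j0 : B) ^+ m).
Local Notation fm m := (tnth f j0 ^+ m).

Let iJ := sym_ideal_ideal f.
Let pP := eq_idealP f.
Let RPl := loc_ring_local pP.

Lemma koszul_powC D (b : B) : b \is D.-homog ->
  J (b%:MP * up (fm D) - (Xm D)%:MP * up (b \mPo f)).
Proof. by rewrite !mul_mpolyC; apply: koszul_pow. Qed.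

Lemma pihomog_scaleC (b : B) e (u : AB) : pihomog mdeg e (b%:MP * u) = b%:MP * pihomog mdeg e u.
Proof. by rewrite !mul_mpolyC linearZ. Qed.

Lemma pihomogB e (u v : AB) : pihomog mdeg e (u - v) = pihomog mdeg e u - pihomog mdeg e v.
Proof. exact: raddfB. Qed.

Lemma tfB (u v : AB) : tf (u - v) = tf u - tf v.
Proof. exact: (raddfB tf). Qed.

Lemma tf_sumZ (T : finType) (a : T -> B) (y : T -> AB) :
  tf (\sum_i a i *: y i) = \sum_i (a i)%:F *: tf (y i).
Proof. by rewrite (raddf_sum tf); apply: eq_bigr => i _; exact: tfZ. Qed.

(** A product of [m] of the [f_i] is traded by [koszul_powC] for the monomial in the [T_i], at the
    cost of a power of [T_j0], which is invertible at the prime of the image. *)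
Lemma pow_swap m nu (u : AB) : coefs_in (idealX setT I m) u -> u \is nu.-homog -> (m * d <= nu)%N ->
  exists2 u' : AB, u' \is (nu - m * d).-homog & J ((Xm m)%:MP * u - up (fm m) * u').
Proof.
move=> hu hnu le.
have [u0 hu0] : [set u | exists u0 : AB, J ((Xm m)%:MP * u - up (fm m) * u0)] u.
  move: hu; apply: coefs_in_min => [|a ha].
    apply/idealP; split=> [|v w [v0 hv] [w0 hw]|v w [w0 hw]].
    - by exists 0; rewrite !mulr0 subrr; apply: ideal0.
    - by exists (v0 + w0); rewrite !mulrDr opprD addrACA; apply: (idealD iJ).
    exists (v * w0); have -> : (Xm m)%:MP * (v * w) - up (fm m) * (v * w0) =
      v * ((Xm m)%:MP * w - up (fm m) * w0) by ring.
    exact: (idealMl _ iJ).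
  have [F hF ->] := (idealX_linP _ _ _).1 ha.
  exists (\sum_(al <- msupp F) up F@_al * ('X_[al] : B)%:MP).
  rewrite meval_msupp (raddf_sum up) !mulr_sumr -sumrB big_seq; apply: (ideal_sum _ iJ) => al alF /=.
  have dal : mdeg al = m by apply: (dhomogP _ _ _ hF).
  have e1 : mmap1 (tnth f) al = 'X_[al] \mPo f.
    by rewrite comp_mpolyX; apply: eq_bigr => i _.
  have hX : ('X_[al] : B) \is m.-homog by rewrite dhomogX /= dal.
  have h := koszul_powC hX.
  rewrite e1 (rmorphM up) swap_comb.
  exact: (idealMl _ iJ).
exists (pihomog mdeg (nu - m * d) u0); first exact: pihomogP.
have := sym_graded fd nu hu0; rewrite pihomogB pihomog_scaleC (pihomog_dE hnu).
rewrite (pihomogM_homog (d := m * d)) //; apply: up_homog; rewrite mulnC; exact: dhomogMn.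
Qed.

(** Up to a multiple of [l], [u] lies in the power [D] of [I]; [pow_swap] makes it a multiple of
    [fm D], and [u0] times [fm D] becomes [Xm D] times the value of [u0], which [l] divides by
    [divisible_value]. *)
Lemma l_divides : exists nu0, forall nu (u : AB), (nu0 <= nu)%N -> u \is nu.+1.-homog ->
  exists s a, [/\ ~ P s, a \is nu.-homog & J (s%:MP * u - up l * a)].
Proof.
have [D [u0 [p [hu0 Pu0 ep]]]] := divisible_value fd d0 hH hl l0.
have [e he] := large_degree_up fd hl lX.
exists (e * (1 + D) + D * d)%N => nu u le hu.
have [|a [b [eu ha hb]]] := he 1%N D nu.+1 u _ hu; first by rewrite ltnS; apply: leq_trans le; apply: leq_addr.
rewrite subn1 /= expr1 in ha eu.
have hb' : b \is nu.+1.-homog.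
  have -> : b = u - up l * a by rewrite eu addrC addKr.
  have hla : up l * a \is (1 + nu).-homog by apply: dhomogM => //; apply: up_homog.
  by rewrite rpredB.
have [|b' _ hbb] := pow_swap hb hb'; first by apply: leq_trans (leqW le); apply: leq_addl.
have hk := koszul_powC hu0; rewrite ep (rmorphM up) in hk.
have h := divide_comb iJ hbb hk eu.
have eX : (Xm D)%:MP * u0%:MP = (Xm D * u0)%:MP :> AB by rewrite rmorphM.
rewrite eX in h.
exists (Xm D * u0), (pihomog mdeg nu ((Xm D * u0)%:MP * a + (Xm D)%:MP * (up p * b'))); split.
- by apply: (primeN_mul pP) => //; apply: Xj0_notin.
- exact: pihomogP.
have := sym_graded fd nu.+1 h; rewrite pihomogB pihomog_scaleC (pihomog_dE hu) (pihomogM_homog (d := 1)) ?subn1 //.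
exact: up_homog.
Qed.

Lemma l_divides_iter : exists nu0, forall nu1 r (u : AB), (nu0 <= nu1)%N -> u \is (r + nu1).-homog ->
  exists s a, [/\ ~ P s, a \is nu1.-homog & J (s%:MP * u - up (l ^+ r) * a)].
Proof.
have [nu0 h] := l_divides; exists nu0 => nu1 r u le; elim: r u => [|r IH] u hu.
  exists 1, u; split=> //; first exact: (primeN1 pP).
  by rewrite expr0 !rmorph1 !mul1r subrr; apply: ideal0.
have [|s [a [Ps ha hJ]]] := h (r + nu1)%N u _ hu; first by apply: leq_trans le (leq_addl _ _).
have [s' [a' [Ps' ha' hJ']]] := IH a ha.
exists (s * s'), a'; split; [exact: (primeN_mul pP)|exact: ha'|].
have := step_comb iJ hJ hJ'.
by rewrite exprS (rmorphM up) (rmorphM (@mpolyC N.+2 B)).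
Qed.

Lemma loc_ring_frac (b : B) : RP b%:F.
Proof. by exists b, 1; rewrite tofrac1 divr1; split=> //; exact: (primeN1 pP). Qed.

Lemma piece_of E nu (u : AB) : u \is nu.-homog -> E u -> piece P E nu (tf u).
Proof.
move=> hu Eu; apply/pieceP; exists 1, u; split=> //; first exact: (primeN1 pP).
by rewrite tofrac1 invr1 scale1r.
Qed.

Lemma homog_symE m nu u : u \is nu.-homog -> symE f m u ->
  exists j c, [/\ u = j + c, J j, j \is nu.-homog, c \is nu.-homog & coefs_in (idealX setT I m) c].
Proof.
move=> hu [j Jj hc]; have iI := @idealX_ideal _ I m.
have gI : graded (idealX setT I m).
  by apply: graded_idealX; apply: graded_lin => i; exists d.
exists (pihomog mdeg nu j), (pihomog mdeg nu (u - j)); split.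
- apply: etrans (esym (pihomog_dE hu)) _; rewrite -(raddfD (pihomog mdeg nu)).
  by congr (pihomog _ _ _); rewrite addrC subrK.
- exact: (sym_graded fd).
- exact: pihomogP.
- exact: pihomogP.
exact: (graded_coefs_in gI).
Qed.

Lemma piece_symE_min m nu M : is_submodule RP M -> piece P J nu `<=` M ->
  (forall a, a \is nu.-homog -> idealX setT I m a -> M (tf (up a))) ->
  piece P (symE f m) nu `<=` M.
Proof.
move=> sM JM aM _ /pieceP [s [u [Ps hu Eu ->]]].
have [j [c [-> Jj hj hc Ic]]] := homog_symE hu Eu.
have [MD MZ] : (forall u v, M u -> M v -> M (u + v)) /\ (forall r u, RP r -> M u -> M (r *: u)).
  by case: sM.
apply: (MZ); first by exists 1, s; rewrite tofrac1 div1r; split.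
rewrite (raddfD tf); apply: (MD); first exact/JM/piece_of.
have [al ->] := up_decomp c; rewrite (raddf_sum tf); apply: (submod_sum sM) => m' _.
have eZ : tf ('X_[m'] *: up (cf m' c)) = ('X_[m'])%:F *: tf (up (cf m' c)) by exact: tfZ.
apply: (@eq_ind_r _ _ M _ _ eZ).
apply: (MZ); first exact: loc_ring_frac.
by apply: aM; [exact: cf_homog|exact: Ic].
Qed.

(** In degree [nu] the quotient is generated by the forms of the power [m] of [I], a space of finite
    dimension over [k], and it is killed by the prime. *)
Lemma symE_gens_length m nu : (forall b u, P b -> symE f m u -> J (b *: u)) ->
  exists c, clen RP mP (piece P J nu) (piece P (symE f m) nu) c.
Proof.
move=> hk; have iI := @idealX_ideal _ I m; have iE := symE_ideal f m.
pose V : set A := [set a | a \is nu.-homog /\ idealX setT I m a].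
have sV : is_submodule (@setT k) V.
  split=> [|u v [hu Iu] [hv Iv]|a v _ [hv Iv]]; first by split; [exact: dhomog0|exact: ideal0].
    by split; [exact: rpredD|exact: (idealD iI)].
  by split; [exact: rpredZ|exact: (idealZ _ iI)].
have s0 : is_submodule (@setT k) [set 0 : A].
  by split=> [//|u v -> ->|a v _ ->] /=; rewrite ?addr0 ?scaler0.
have h0 : [set 0 : A] `<=` @homset k N.+2 nu by move=> _ ->; exact: dhomog0.
have hV0 : [set 0 : A] `<=` V by move=> _ ->; case: sV.
have hV : V `<=` @homset k N.+2 nu by move=> a [].
have [c0 [_ [cV _ _]]] := clen_split (field_local k) (dim_homog_quot s0 h0) sV hV0 hV.
have [v [vV _]] := (dimqP _ _ s0).1 cV.
have sJ := piece_submod pP nu iJ.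
pose s := [seq tf (up (v i)) | i <- enum 'I_c0].
have Vv i : V (v i).
  apply/vV; exists (fun l => (l == i)%:R) => /=.
  rewrite (bigD1 i) //= eqxx scale1r big1 ?addr0 ?subrr // => l' /negbTE ->.
  by rewrite scale0r.
have [_ /mapP [i _ ->] r mr|c cc] := @clen_killed _ _ RP mP RPl _ s sJ.
  case: mr => a [t [Pa Pt ->]]; have [hv Iv] := Vv i.
  apply/pieceP; exists t, (a *: up (v i)); split.
  - exact: Pt.
  - by apply: rpredZ; apply: up_homog.
  - by apply: hk => //; apply: symE_coefs; apply: coefs_in_up.
  by rewrite tfZ scalerA mulrC.
exists c; move: cc; congr (clen _ _ _ _ _); apply/seteqP; split.
  apply: (adjoins_min (piece_submod pP nu iE)).
    exact: (piece_mono pP (@symE_sym _ _ f m)).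
  move=> _ /mapP [i _ ->]; have [hv Iv] := Vv i.
  by apply: piece_of; [exact: up_homog|apply: symE_coefs; apply: coefs_in_up].
have sM := adjoins_submod RPl s sJ.
apply: piece_symE_min => //; first exact: (adjoins_sub RPl).
move=> a ha Ia; have [b eb] := (vV a).1 (conj ha Ia).
have -> : a = \sum_i b i *: v i by apply/eqP; rewrite -subr_eq0; apply/eqP.
rewrite (raddf_sum up) (raddf_sum tf); apply: (submod_sum sM) => i _.
have eZ : tf (up (b i *: v i)) = ((b i)%:MP)%:F *: tf (up (v i)).
  by rewrite -tfZ; congr (tf _); exact: upZ.
apply: (@eq_ind_r _ _ _ _ _ eZ).
apply: (submodZ sM); first exact: loc_ring_frac.
by apply: (adjoins_mem RPl) => //; apply: map_f; rewrite mem_enum.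
Qed.

Section Kernel.
Variables (nu0 c0 : nat).
Hypothesis hdiv : forall nu1 r (u : AB), (nu0 <= nu1)%N -> u \is (r + nu1).-homog ->
  exists s a, [/\ ~ P s, a \is nu1.-homog & J (s%:MP * u - up (l ^+ r) * a)].
Hypothesis cJ : clen RP mP (piece P J nu0) (piece P setT nu0) c0.

(* The submodules killed by the powers of [f_j0 l] stabilise; an element of
   [I^m] divides by such a power, at the cost of a power of [T_j0]. *)
Lemma evT_kernel_symE : exists m2, forall m, (m2 <= m)%N -> exists nu2, forall nu, (nu2 <= nu)%N ->
  forall v, v \is nu.-homog -> symE f m v -> evT f v = 0 -> exists2 s, ~ P s & J (s%:MP * v).
Proof.
pose K r : set AB := [set u | J (up (fm r * l ^+ r) * u)].
have iK r : is_ideal setT (K r) by exact: (colon_ideal _ iJ).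
have [|r|r|i hi] := @clen_stable _ _ _ _ RPl _ _ _ (fun r => piece P (K r) nu0) cJ.
- by move=> r; apply: (piece_submod pP).
- by split; apply: (piece_mono pP) => // u hu; apply: (idealMl _ iJ).
- apply: (piece_mono pP) => u; rewrite /K /= => hu.
  have -> : up (fm r.+1 * l ^+ r.+1) * u = up (tnth f j0 * l) * (up (fm r * l ^+ r) * u).
    have e : fm r.+1 * l ^+ r.+1 = (tnth f j0 * l) * (fm r * l ^+ r) by rewrite !exprS mulrACA.
    by rewrite e (rmorphM up) -mulrA.
  exact: (idealMl _ iJ).
exists i => m im; exists (m * d + (i + nu0))%N => nu le v hv Ev ev0.
have [j [w [ev Jj hj hw Iw]]] := homog_symE hv Ev.
have [|w' hw' hJw] := pow_swap Iw hw; first by apply: leq_trans le; apply: leq_addr.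
have evw : evT f w = 0 by move: ev0; rewrite ev (rmorphD (evT f)) /= (sym_evT Jj) add0r.
have evw' : evT f w' = 0.
  have := sym_evT hJw; rewrite (rmorphB (evT f)) !(rmorphM (evT f)) /= evw mulr0 sub0r evT_up.
  move/eqP; rewrite oppr_eq0 mulf_eq0 expf_eq0 (negbTE fj0) andbF => /eqP //.
have [D hD] := evT_kernel fd j0 d0 hw' evw'.
pose r := (nu - m * d - nu0)%N.
have er : (nu - m * d = r + nu0)%N by rewrite /r; lia.
have ir : (i <= r)%N by rewrite /r; lia.
rewrite er in hw'; have [s [a [Ps ha hJa]]] := hdiv (leqnn nu0) hw'.
have hR : K (D + r)%N a.
  rewrite /K /=; have -> : up (fm (D + r) * l ^+ (D + r)) * a =
    up (fm r * l ^+ D) * (up (fm D) * (up (l ^+ r) * a)).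
    have eM (y z : A) : up (y * z) = up y * up z by exact: (rmorphM up).
    have e : up (fm (D + r) * l ^+ (D + r)) = up (fm r * l ^+ D) * (up (fm D) * up (l ^+ r)).
      rewrite (exp_swap (tnth f j0) l D r).
      by apply: (etrans (eM _ _)); exact: (congr1 (fun z => up (fm r * l ^+ D) * z) (eM _ _)).
    rewrite e; exact: mulrA4.
  apply: (idealMl _ iJ).
  by rewrite (push_comb _ _ a s%:MP w'); apply: (idealB iJ); apply: (idealMl _ iJ).
have /(hi (D + r)%N) : piece P (K (D + r)%N) nu0 (tf a) by apply: piece_of.
have -> : tf a = ((1 : B)%:F)^-1 *: tf a by rewrite tofrac1 invr1 scale1r.
move=> /(piece_tf pP (iK i) (primeN1 pP) ha) [t Pt ht].
exists (Xm m * s * t).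
  by do 2![apply: (primeN_mul pP) => //]; apply: Xj0_notin.
rewrite !(rmorphM (@mpolyC N.+2 B)); apply: (kernel_comb iJ _ hJw hJa).
  by rewrite ev addrK.
have -> : up (fm m) * up (l ^+ r) * (t%:MP * a) =
   up (fm (m - i) * l ^+ (r - i)) * (up (fm i * l ^+ i) * (t%:MP * a)).
  have e : up (fm m) * up (l ^+ r) = up (fm (m - i) * l ^+ (r - i)) * up (fm i * l ^+ i).
    have eM (y z : A) : up (y * z) = up y * up z by exact: (rmorphM up).
    apply: (etrans (esym (eM _ _))).
    by rewrite (exp_split (tnth f j0) l im ir); exact: eM.
  by apply: (etrans (congr1 (fun z => z * (t%:MP * a)) e)); exact: esym (mulrA _ _ _).
by apply: (idealMl _ iJ); move: ht; rewrite -mul_mpolyC.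
Qed.

End Kernel.

Lemma evTB (u v : AB) : evT f (u - v) = evT f u - evT f v.
Proof. exact: (rmorphB (evT f)). Qed.

Lemma evT_sumZ (T : finType) (g : T -> B) (y : T -> AB) :
  evT f (\sum_i g i *: y i) = \sum_i (g i \mPo f) * evT f (y i).
Proof. by rewrite (rmorph_sum (evT f)); apply: eq_bigr => i _; exact: evTZ. Qed.

Lemma loc_denominators m (c : 'I_m -> {fraction B}) : (forall i, RP (c i)) ->
  exists s (a : 'I_m -> B), ~ P s /\ forall i, c i = (a i)%:F / s%:F.
Proof.
move=> hc.
have h i : exists as_ : B * B, ~ P as_.2 /\ c i = as_.1%:F / as_.2%:F.
  by have [a [s [Ps ->]]] := hc i; exists (a, s).
have [q hq] := choice h.
exists (\prod_i (q i).2), (fun i => (q i).1 * \prod_(l | l != i) (q l).2).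
have PS : ~ P (\prod_i (q i).2) by apply: (primeN_prod pP) => i _; case: (hq i).
split=> // i; have [Pi ->] := hq i.
have nz s : ~ P s -> s != 0 by move=> Ps; apply/eqP => e; apply: Ps; rewrite e; exact: ideal0 (prime_ideal pP).
apply/(tofrac_div_eq _ _ (nz _ Pi) (nz _ PS)).
by rewrite (bigD1 i) //= [(q i).2 * _]mulrC mulrA.
Qed.

(** The numerators [p i], multiplied by one form [h] of the power [m] of [I], give a basis over the
    residue field. They are independent because [evT] maps them to the [h * p i]; they generate by
    [degree_basis], since [evT] is injective on the quotient up to elements outside of the prime. *)
Lemma symE_degree_length m nu e (u : A) (p : 'I_(lambda_degree f) -> A) :
  (forall b u, P b -> symE f m u -> J (b *: u)) ->
  (forall v, v \is nu.-homog -> symE f m v -> evT f v = 0 -> exists2 s, ~ P s & J (s%:MP * v)) ->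
  (m * d + e <= nu)%N -> (forall i, p i \is e.-homog) -> forms_indep f p ->
  (forall D a h, a \is (D + e).-homog -> h \is D.-homog -> h != 0 ->
       exists t Q g, [/\ Q \is t.-homog, ~ P Q, forall i, g i \is t.-homog
         & (Q \mPo f) * a = h * \sum_i (g i \mPo f) * p i]) ->
  clen RP mP (piece P J nu) (piece P (symE f m) nu) (lambda_degree f).
Proof.
move=> hk hker le hp ip sp.
have iI := @idealX_ideal _ I m; have iE := symE_ideal f m.
(* Any nonzero form of degree [nu - e] in the power [m] of [I] would do. *)
pose D := (nu - e)%N; pose h := fm m * l ^+ (D - m * d).
have eD : nu = (D + e)%N by rewrite /D; lia.
have hh : h \is D.-homog.
  have -> : D = (d * m + (D - m * d))%N by rewrite /D; lia.
  by apply: dhomogM; [exact: dhomogMn|exact: homogXn].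
have h0 : h != 0 by rewrite mulf_neq0 // expf_neq0.
have Im y : idealX setT I m (h * y).
  by rewrite /h -mulrA; apply: (idealMr _ iI); apply: idealX_mem; exact: lin_gen.
pose be i : AB := up (h * p i).
have hbe i : be i \is nu.-homog by apply: up_homog; rewrite eD; apply: dhomogM.
have Ebe i : symE f m (be i) by apply: symE_coefs; apply: coefs_in_up.
have sJ := piece_submod pP nu iJ; have sE := piece_submod pP nu iE.
apply: (@clen_basis _ _ RP mP RPl _ _ _ (fun i => tf (be i))).
- exact: loc_max1.
- exact: sJ.
- move=> i _ [a [t [Pa Pt ->]]]; apply/pieceP; exists t, (a *: be i); split.
  + exact: Pt.
  + by apply: rpredZ; apply: hbe.
  + by apply: hk => //; apply: Ebe.
  by rewrite tfZ scalerA mulrC.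
- move=> c /loc_denominators [s [a [Ps ec]]] hc i.
  rewrite ec; exists (a i), s; split=> //.
  have e1 : \sum_i c i *: tf (be i) = (s%:F)^-1 *: tf (\sum_i a i *: be i).
    rewrite tf_sumZ scaler_sumr; apply: eq_bigr => i' _.
    by rewrite ec scalerA [_^-1 * _]mulrC.
  move: hc; rewrite e1 => /(piece_tf pP iJ Ps) [|t Pt].
    by apply: rpred_sum => i' _; apply: rpredZ; exact: hbe.
  move/sym_evT; rewrite evTZ => /eqP; rewrite mulf_eq0 => /orP [/eqP //|/eqP e2].
  have e3 : \sum_i (a i \mPo f) * p i = 0.
    apply: (mulfI h0); rewrite mulr0 mulr_sumr -[RHS]e2 evT_sumZ; apply: eq_bigr => i' _.
    by rewrite evT_up mulrCA.
  apply: eq_ideal_comp => t'.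
  apply: (ip t' (fun i => pihomog mdeg t' (a i))) => [i'|]; first exact: pihomogP.
  have := congr1 (pihomog mdeg (t' * d + e)) e3; rewrite raddf0 (raddf_sum (pihomog mdeg _)) => e4.
  rewrite -[RHS]e4; apply: eq_bigr => i' _.
  by rewrite -(pihomog_comp fd) // [RHS]/= mulrC [in RHS]mulrC (pihomogM_homog (d := e)) ?addnK // leq_addl.
move=> y; split; last first.
  move=> [c [Rc hc]].
  have -> : y = (y - \sum_i c i *: tf (be i)) + \sum_i c i *: tf (be i) by rewrite subrK.
  apply: (submodD sE); first exact: (piece_mono pP (@symE_sym _ _ f m)).
  apply: (submod_sum sE) => i _; apply: (submodZ sE) => //; exact: piece_of.
pose M := [set y | exists c : 'I_(lambda_degree f) -> {fraction B},
  (forall i, RP (c i)) /\ piece P J nu (y - \sum_i c i *: tf (be i))].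
suff : piece P (symE f m) nu `<=` M by apply.
have sR := local_subring RPl.
apply: piece_symE_min.
- split.
  + exists (fun=> 0); split=> [i|]; first exact: (subring0 RPl).
    by rewrite big1 ?subr0 => [|i _]; [exact: submod0 sJ|rewrite scale0r].
  + move=> y1 y2 [c1 [R1 h1]] [c2 [R2 h2]]; exists (fun i => c1 i + c2 i); split=> [i|].
      exact: (subringD RPl).
    have -> : y1 + y2 - \sum_i (c1 i + c2 i) *: tf (be i) =
      (y1 - \sum_i c1 i *: tf (be i)) + (y2 - \sum_i c2 i *: tf (be i)).
      rewrite addrACA -opprD -big_split; congr (_ - _); apply: eq_bigr => i _; exact: scalerDl.
    exact: (submodD sJ).
  move=> r y1 Rr [c1 [R1 h1]]; exists (fun i => r * c1 i); split=> [i|].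
    exact: (subringM RPl).
  have -> : r *: y1 - \sum_i (r * c1 i) *: tf (be i) = r *: (y1 - \sum_i c1 i *: tf (be i)).
    rewrite scalerBr scaler_sumr; congr (_ - _); apply: eq_bigr => i _; exact: esym (scalerA _ _ _).
  exact: (submodZ sJ).
- move=> y1 h1; exists (fun=> 0); split=> [i|]; first exact: (subring0 RPl).
  by rewrite big1 ?subr0 // => i _; rewrite scale0r.
move=> a ha Ia; have ha' := ha; rewrite eD in ha'.
have [t [Q [g [hQ PQ hg eQ]]]] := sp D a h ha' hh h0.
have [|||s Ps hs] := hker (Q *: up a - \sum_i g i *: be i).
- apply: rpredB; first by apply: rpredZ; apply: up_homog.
  by apply: rpred_sum => i _; apply: rpredZ; exact: hbe.
- apply: (idealB iE).
    by apply: (idealZ _ iE); apply: symE_coefs; apply: coefs_in_up.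
  by apply: (ideal_sum _ iE) => i _; apply: (idealZ _ iE); exact: Ebe.
- rewrite evTB evTZ evT_up eQ mulr_sumr evT_sumZ.
  apply/eqP; rewrite subr_eq0; apply/eqP; apply: eq_bigr => i _.
  by rewrite evT_up mulrCA.
have nz b : ~ P b -> b%:F != 0 by exact: (denom_neq0 pP).
exists (fun i => (g i)%:F / Q%:F); split=> [i|]; first by exists (g i), Q.
rewrite (scale_comb _ _ _ (nz _ PQ) (nz _ Ps)); apply/pieceP.
exists (s * Q), (s *: (Q *: up a - \sum_i g i *: be i)); split.
- exact: (primeN_mul pP).
- apply: rpredZ; apply: rpredB; first by apply: rpredZ; apply: up_homog.
  by apply: rpred_sum => i _; apply: rpredZ; exact: hbe.
- by rewrite -mul_mpolyC.
rewrite tofracM tfZ; congr (_ *: (_ *: _)); by rewrite tfB tf_sumZ tfZ.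
Qed.

Lemma image_prime_length xs : height_one P -> uniq xs ->
  (forall x, x \in xs <-> non_lci_points f x /\ P (L x)) ->
  exists nu1, forall nu, (nu1 <= nu)%N -> clen RP mP (piece P J nu) (piece P setT nu)
    (lambda_degree f + \sum_(x <- xs) (local_multiplicity f x - local_degree f x)).
Proof.
move=> hP uxs hxs.
have [m0 hk] := symE_kill fd d0.
have [m1 hm1] := symE_length fd finX d0 hl lX hL hP uxs hxs.
have [nuD hD] := l_divides_iter.
have [nuE hE] := hm1 (maxn m0 m1) (leq_maxr _ _).
(* A crude finite length at the first admissible [m] lets [evT_kernel_symE] bound its torsion; the
   exact length is then computed at a larger [m]. *)
have [c0 cJ0] := symE_gens_length (maxn nuD nuE) (hk _ (leq_maxl m0 m1)).
have cJ := clen_cat cJ0 (hE _ (leq_maxr nuD nuE)).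
have [|m2 hm2] := evT_kernel_symE _ cJ.
  by move=> nu1 r u le; apply: hD; apply: leq_trans le; apply: leq_maxl.
pose m := maxn (maxn m0 m1) m2.
have [nu2 hnu2] := hm2 m (leq_maxr _ _).
have [nu3 hnu3] : exists nu1, forall nu, (nu1 <= nu)%N -> clen RP mP (piece P (symE f m) nu)
   (piece P setT nu) (\sum_(x <- xs) (local_multiplicity f x - local_degree f x)).
  by apply: hm1; rewrite /m -maxnA leq_max [(m1 <= maxn m1 m2)%N]leq_maxl orbT.
have [e [u [p [u0 hu hp ip sp]]]] := degree_basis fd d0 hH fj0.
exists (m * d + e + (nu2 + nu3))%N => nu le.
apply: (clen_cat _ (hnu3 nu _)); last by lia.
apply: (symE_degree_length u _ _ _ hp ip sp); [|apply: hnu2; lia|lia].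
by apply: hk; rewrite /m -maxnA leq_maxl.
Qed.

Lemma other_prime_length q xs : height_one q -> (exists2 b, P b & ~ q b) -> uniq xs ->
  (forall x, x \in xs <-> non_lci_points f x /\ q (L x)) ->
  exists nu1, forall nu, (nu1 <= nu)%N ->
  clen (loc_ring q) (loc_max q) (piece q J nu) (piece q setT nu)
    (\sum_(x <- xs) (local_multiplicity f x - local_degree f x)).
Proof.
move=> hq [b Pb qb] uxs hxs; have pq : is_prime_ideal q by case: hq.
have [m0 hk] := symE_kill fd d0.
have [m1 hm1] := symE_length fd finX d0 hl lX hL hq uxs hxs.
have [nuE hE] := hm1 (maxn m0 m1) (leq_maxr _ _).
exists nuE => nu /hE; congr (clen _ _ _ _ _); apply/seteqP; split.
  apply: (piece_sub pq) => u hu Eu; exists b => //.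
  exact: (hk _ (leq_maxl m0 m1)).
exact: (piece_mono pq (@symE_sym _ _ f (maxn m0 m1))).
Qed.

End ImagePrime.

(** * The extraneous factor *)

Definition principal (R : comNzRingType) (a : R) : set R := [set s | exists b, s = b * a].

Section PrincipalIdeals.
Variable R : comNzRingType.
Implicit Types (a b : R) (q E : set R).

Lemma principalP a : gen_ideal setT [set a] = principal a.
Proof. by apply/seteqP; split=> s /=; rewrite gen_ideal1P. Qed.

Lemma principal_ideal a : is_ideal setT (principal a).
Proof. rewrite -principalP; exact: gen_ideal_ideal. Qed.

Lemma principal_mem a : principal a a. Proof. by exists 1; rewrite mul1r. Qed.

Lemma principal_sub a E : is_ideal setT E -> E a -> principal a `<=` E.
Proof. by move=> iE Ea _ [b ->]; exact: (idealMl _ iE). Qed.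

Lemma principal1 : principal (1 : R) = setT.
Proof. by apply/seteqP; split=> // s _; exists s; rewrite mulr1. Qed.

Lemma principalM a b : idealM setT (principal a) (principal b) = principal (a * b).
Proof.
apply/seteqP; split.
  apply: idealM_min; first exact: principal_ideal.
  by move=> _ _ [c ->] [e ->]; exists (c * e); rewrite mulrACA.
apply: principal_sub; first exact: idealM_ideal.
by apply: idealM_mem; exact: principal_mem.
Qed.

Lemma idealX_principal_sum (T : eqType) (s : seq T) (Q : pred T) (L : T -> R) (w : T -> nat) q :
  (forall x, x \in s -> Q x -> q = principal (L x)) ->
  idealX setT q (\sum_(x <- s | Q x) w x) = principal (\prod_(x <- s | Q x) L x ^+ w x).
Proof.
elim: s => [|x s IH] h; first by rewrite !big_nil principal1.
have {}IH := IH (fun y ys => h y (mem_behead (s := x :: s) ys)).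
rewrite !big_cons; case: ifP => // Qx; rewrite idealXD IH -principalM; congr (idealM _ _ _).
rewrite (h x (mem_head _ _) Qx); elim: (w x) => [|n IHn]; first by rewrite expr0 principal1.
by rewrite idealXS IHn principalM exprS.
Qed.

Lemma idealX_proper q n : is_prime_ideal q -> (0 < n)%N -> idealX setT q n <> setT.
Proof.
case: n => // n pq _ e; apply: (primeN1 pq).
have : idealX setT q n.+1 1 by rewrite e.
rewrite idealXS idealMC; apply: idealM_subr; exact: prime_ideal pq.
Qed.

Lemma prod_idealM (T : Type) (s : seq T) (g : T -> R) (E : T -> set R) :
  (forall q : T, is_ideal setT (E q)) ->
  \big[idealM setT/setT]_(q <- s) idealM setT (principal (g q)) (E q) =
  idealM setT (principal (\prod_(q <- s) g q)) (\big[idealM setT/setT]_(q <- s) E q).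
Proof.
move=> iE; elim: s => [|q s IH]; first by rewrite !big_nil principal1 idealMT.
rewrite !big_cons IH -principalM -!idealMA; congr (idealM _ _ _).
by rewrite !idealMA; congr (idealM _ _ _); rewrite idealMC.
Qed.

Lemma prod_ideal_pick (T : eqType) (s : seq T) (p : T) (E : set R) : is_ideal setT E -> uniq s ->
  \big[idealM setT/setT]_(q <- s) (if q == p then E else setT) = if p \in s then E else setT.
Proof.
move=> iE; elim: s => [|q s IH] /=; first by rewrite big_nil.
move=> /andP [qs us]; rewrite big_cons IH // inE [p == q]eq_sym.
case: (q =P p) => [ep|_] /=; last by apply: idealMT; case: ifP.
by rewrite -ep (negbTE qs) idealMC idealMT.
Qed.

End PrincipalIdeals.

Section PrimeFactors.
Variables (R : idomainType) (T : eqType) (L : T -> R) (w : T -> nat).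

Lemma cancel_prime_power (l b g r : R) n : is_prime_ideal (principal l) -> l != 0 ->
  ~ principal l b -> b * g = l ^+ n * r -> exists g', b * g' = r.
Proof.
move=> pl l0 nb; elim: n g => [|n IH] g; first by rewrite expr0 mul1r => e; exists g.
move=> e; have : principal l (b * g) by exists (l ^+ n * r); rewrite e exprSr mulrAC.
have [_ _ pm] := pl; case/pm => [//|[c ec]]; apply: (IH c); apply: (mulfI l0).
by rewrite [RHS]mulrA -exprS -e ec; ring.
Qed.

Lemma unit_of_prime_factors (s : seq T) b g : (forall x, x \in s -> is_prime_ideal (principal (L x)) /\ L x != 0) ->
  (forall x, x \in s -> ~ principal (L x) b) -> b * g = \prod_(x <- s) L x ^+ w x ->
  b \is a GRing.unit.
Proof.
elim: s g => [|x s IH] g hs nb.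
  by rewrite big_nil => e; apply/unitrPr; exists g.
rewrite big_cons => e; have [px x0] := hs x (mem_head _ _).
have [g' e'] := cancel_prime_power px x0 (nb x (mem_head _ _)) e.
by apply: (IH g') => // y ys; [apply: hs|apply: nb]; rewrite inE ys orbT.
Qed.

Variables (s : seq T) (P : set R) (G H : R) (de : nat).
Hypothesis hs : forall x, x \in s -> is_prime_ideal (principal (L x)) /\ L x != 0.
Hypothesis hH : irreducible_elt H.
Hypothesis PH : P H.
Hypothesis iP : is_ideal setT P.
Local Notation La := (\prod_(x <- s) L x ^+ w x).

Lemma prod_primes_neq0 : La != 0.
Proof. by rewrite prodf_seq_neq0; apply/allP => x xs; rewrite expf_neq0 //; case: (hs xs). Qed.

Lemma associated_factor x : x \in s -> principal (L x) H ->
  P (L x) /\ principal (L x) = principal H.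
Proof.
move=> xs [c ec]; have [px x0] := hs xs; have [H0 _ irr] := hH.
have [cu|xu] := irr _ _ ec; last first.
  by case: (primeN1 px); exists (L x)^-1; rewrite mulVr.
have ex : L x = c^-1 * H by rewrite ec mulKr.
split; first by rewrite ex; exact: (idealMl _ iP).
apply/seteqP; split; apply: principal_sub; try exact: principal_ideal.
  by exists c^-1.
by exists c.
Qed.

(** Comparing the ideals gives [La = b * G] and [H ^+ de = c * b]. If no [L x] divides [b], then
    [b], a divisor of a product of powers of these primes, is a unit. Otherwise that [L x] divides
    [H] and is associated to it; being nonzero in a prime of height one it generates [P], so all
    ideals at hand are principal and can be compared directly. *)
Lemma height_one_factor : height_one P ->
  principal (G * H ^+ de) = idealM setT (principal La) (idealX setT P de) ->
  exists2 c, c \is a GRing.unit & G = c * La.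
Proof.
move=> [pP _ minP] e; have [H0 _ _] := hH; have La0 := prod_primes_neq0.
have Hd0 : H ^+ de != 0 by apply: expf_neq0.
have [b eb] : principal (G * H ^+ de) (La * H ^+ de).
  by rewrite e; apply: idealM_mem; [exact: principal_mem|exact: idealX_mem].
have eL : La = b * G by apply: (mulIf Hd0); rewrite eb mulrA.
have G0 : G != 0 by apply: contraNneq La0 => z; rewrite eL z mulr0.
have [c ec] : principal La (G * H ^+ de).
  have : principal (G * H ^+ de) (G * H ^+ de) by exact: principal_mem.
  by rewrite e idealMC; apply: idealM_subr; exact: principal_ideal.
have eH : H ^+ de = c * b by apply: (mulfI G0); rewrite ec eL; ring.
case: (pselect (exists2 x, x \in s & principal (L x) b)) => [[x xs [b' eb']]|nb]; last first.
  have bu : b \is a GRing.unit.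
    apply: (@unit_of_prime_factors s b G hs _ (esym eL)) => x xs xb.
    by apply: nb; exists x.
  by exists b^-1; rewrite ?unitrV // eL mulKr.
have [px x0] := hs xs.
have xH : principal (L x) H.
  have : principal (L x) (H ^+ de) by exists (c * b'); rewrite eH eb' mulrA.
  by apply: contraPP => nH; exact: (primeN_exp px).
have [Px eP] := associated_factor xs xH.
have ePx : principal (L x) = P.
  apply: contrapT => ne; have : principal (L x) = [set 0].
    apply: minP => //; split; first exact: (principal_sub iP).
    by move=> sub; apply: ne; apply/seteqP; split=> //; exact: (principal_sub iP).
  move=> z; have : principal (L x) (L x) by exact: principal_mem.
  by rewrite z => /eqP; rewrite (negbTE x0).
have eX : idealX setT P de = principal (H ^+ de).
  rewrite -ePx eP; have := @idealX_principal_sum R unit [:: tt] xpredT (fun=> H) (fun=> de) (principal H).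
  by rewrite !big_seq1; apply.
have [c' ec'] : principal (La * H ^+ de) (G * H ^+ de).
  by rewrite -principalM -eX -e; exact: principal_mem.
have eG : G = c' * La by apply: (mulIf Hd0); rewrite ec' mulrA.
exists c' => //; apply/unitrPr; exists b; apply: (mulIf G0).
by rewrite mul1r [RHS]eG eL mulrA.
Qed.

(** [H] divides [La]. If some [L x] divides [H], they are associated and [P] is generated by [L x],
    which is excluded; if none does, [H] is a unit, against irreducibility. *)
Lemma not_height_one_factor : (0 < de)%N -> (forall x, x \in s -> P <> principal (L x)) ->
  (forall x, x \in s -> principal (L x) H -> P `<=` principal (L x)) ->
  principal (G * H ^+ de) = principal La -> False.
Proof.
move=> de0 nP rad e; have [H0 Hu _] := hH.
have [c ec] : principal (G * H ^+ de) La by rewrite e; exact: principal_mem.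
case: (pselect (exists2 x, x \in s & principal (L x) H)) => [[x xs xH]|nH].
  have [Px _] := associated_factor xs xH; apply: (nP x xs); apply/seteqP; split.
    exact: rad.
  exact: (principal_sub iP).
case/negP: Hu; apply: (@unit_of_prime_factors s H (c * G * H ^+ de.-1) hs).
  by move=> x xs xH; apply: nH; exists x.
by rewrite ec -[in RHS](prednK de0) exprS; ring.
Qed.

End PrimeFactors.

Section Extraneous.
Variables (k : closedFieldType) (N d : nat) (f : N.+3.-tuple {mpoly k[N.+2]}).
Hypothesis fd : forall i, tnth f i \is d.-homog.
Hypothesis finX : finite_set (base_points f).
Hypothesis d0 : (0 < d)%N.
Local Notation A := {mpoly k[N.+2]}.
Local Notation B := {mpoly k[N.+3]}.
Local Notation AB := {mpoly B[N.+2]}.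
Local Notation X := (base_points f).
Local Notation J := (sym_ideal f).
Local Notation P := (eq_ideal f).
Local Notation tf := (@tf k N.+3 N.+2).
Local Notation "x %:F" := (tofrac x).
Variable H : B.
Hypothesis hH : is_image_equation f H.
Variable j0 : 'I_N.+3.
Hypothesis fj0 : tnth f j0 != 0.
Variable L : ppoint k N.+2 -> B.
Hypothesis hL : forall x, non_lci_points f x -> is_relation_form f x d (L x).
Local Notation w x := (local_multiplicity f x - local_degree f x)%N.
Local Notation Q x := (principal (L x)).
Let pP := eq_idealP f.

Lemma linear_form : exists l : A, [/\ l \is 1.-homog, l != 0
  & forall x, X x -> mev l (pcoord x) != 0].
Proof.
have [l hl lX] := nonvanishing_form finX.
case: (eqVneq l 0) => [l0|l0]; last by exists l.
exists 'X_ord0; split; first by rewrite dhomogX /= mdeg1.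
  exact: mpolyX_neq0.
by move=> x /lX; rewrite l0 /mev meval0 eqxx.
Qed.

Lemma relation_linform x : non_lci_points f x -> exists i0 t v,
  [/\ pcoord x 0 i0 = 1, t != 0, spec_rel f x i0 v, exists i, v i != 0 & linform v = t *: L x].
Proof.
move=> nx; have [i0 [v0 _]] := normP x.
by have [t [v [h1 h2 h3 h4]]] := relation_form_spec v0 fd (hL nx); exists i0, t, v.
Qed.

Lemma principal_linform x t v : t != 0 -> linform v = t *: L x ->
  [set s : B | exists b, s = b * linform v] = Q x.
Proof.
move=> t0 e; apply/seteqP; split=> _ [b ->].
  by exists (t *: b); rewrite e -scalerAr scalerAl.
by exists (t^-1 *: b); rewrite e -scalerAl -scalerAr scalerA mulVf // scale1r.
Qed.

Lemma relation_prime x : non_lci_points f x -> is_prime_ideal (Q x) /\ L x != 0.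
Proof.
move=> nx; have [i0 [t [v [_ t0 _ [j vj] e]]]] := relation_linform nx.
rewrite -(principal_linform t0 e); split; first exact: linform_prime vj.
by apply: contraNneq (linform_neq0 vj) => z; rewrite e z scaler0.
Qed.

Lemma relation_height_one q x : height_one q -> non_lci_points f x -> q (L x) -> q = Q x.
Proof.
move=> hq nx qx; have [i0 [t [v [_ t0 _ [j vj] e]]]] := relation_linform nx.
rewrite -(principal_linform t0 e); apply: (height_one_linform hq vj).
by case: hq => pq _ _; rewrite e -mul_mpolyC; exact: (idealMl _ (prime_ideal pq)).
Qed.

Lemma principal_height_one x : non_lci_points f x -> height_one (Q x).
Proof.
move=> nx; have [px x0] := relation_prime nx.
have [i0 [t [v [_ t0 _ [j vj] e]]]] := relation_linform nx.
split=> // [z|p pp [sub nsub]].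
  have : Q x (L x) by exact: principal_mem.
  by rewrite z => /eqP; rewrite (negbTE x0).
apply/seteqP; split=> [s ps|_ ->]; last exact: ideal0 (prime_ideal pp).
apply: contrapT => /eqP s0; have [a [s' [es ns']]] := linform_val vj s0.
move: ps; rewrite es; have [ip _ pm] := pp; case/pm => [pv|/sub]; last first.
  by rewrite -(principal_linform t0 e).
apply: nsub; rewrite -(principal_linform t0 e); apply: (principal_sub ip).
by apply: contrapT => npv; apply: (primeN_exp pp npv) pv.
Qed.

Variable xs : seq (ppoint k N.+2).
Hypothesis uxs : uniq xs.
Hypothesis hxs : forall x, x \in xs <-> non_lci_points f x.

Lemma avoids0 : avoids f L [set 0].
Proof. by move=> x nx /= z; have [_] := relation_prime nx; rewrite z eqxx. Qed.

Lemma image_eq_neq0 : H != 0. Proof. by case: hH => -[]. Qed.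

Lemma sym_gens_piece q nu : loc_mod q (@sym_gens k N.+2 nu) = piece q setT nu.
Proof.
apply/seteqP; split=> v [s [_ [ns [u hu <-] ->]]]; exists s, (tf u); split=> //; exists u => //.
by case: hu.
Qed.

(** The length of [Sym_nu] at [q] for large [nu]. Both terms can be present, when [P] is generated
    by one of the [L x]. *)
Definition extraneous_length (q : set B) : nat :=
  ((if `[< q = P >] then lambda_degree f else 0) + \sum_(x <- xs | `[< q (L x) >]) w x)%N.

Lemma extraneous_length_at q : exists nu0, height_one q -> forall nu, (nu0 <= nu)%N ->
  clen (loc_ring q) (loc_max q) (piece q J nu) (piece q setT nu) (extraneous_length q).
Proof.
case: (pselect (height_one q)) => hq; last by exists 0%N.
have [l [hl l0 lX]] := linear_form.
have uf : uniq [seq x <- xs | `[< q (L x) >]] by apply: filter_uniq.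
have hf x : x \in [seq x <- xs | `[< q (L x) >]] <-> non_lci_points f x /\ q (L x).
  rewrite mem_filter; split=> [/andP [/asboolP ? /hxs]|[/hxs ? ?]] //.
  by apply/andP; split=> //; apply/asboolP.
rewrite /extraneous_length -big_filter; case: asboolP => [eq|ne].
  rewrite eq in hq hf uf *.
  have [nu0 h] := image_prime_length fd finX d0 hH fj0 hl lX l0 hL hq uf hf.
  by exists nu0.
have [nu0 h] : exists nu0, forall nu, (nu0 <= nu)%N ->
    clen (loc_ring q) (loc_max q) (piece q J nu) (piece q setT nu)
      (\sum_(x <- [seq x <- xs | `[< q (L x) >]]) w x); last by exists nu0.
apply: (other_prime_length fd finX d0 hl lX hL hq _ uf hf).
apply: contrapT => nb; have sub : P `<=` q.
  by move=> b Pb; apply: contrapT => qb; apply: nb; exists b.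
have [_ _ qmin] := hq; have : P = [set 0].
  by apply: qmin => //; split=> // sub'; apply: ne; apply/seteqP.
move=> e0; have := image_eq_mem fd d0 hH; rewrite e0 => /= e.
by case/eqP: image_eq_neq0.
Qed.

(** Primes other than [P] and those generated by an [L x] are settled together by [kill_sym], whose
    bound does not depend on them; finitely many bounds remain to be added up. Torsion is the case
    of the zero prime. *)
Lemma sym_lengths : exists nu0, forall nu, (nu0 <= nu)%N ->
  is_torsion (@sym_gens k N.+2 nu) (sym_rels f nu) /\ forall q, height_one q ->
    mod_length (loc_ring q) (loc_mod q (@sym_gens k N.+2 nu)) (loc_mod q (sym_rels f nu)) =
    extraneous_length q.
Proof.
have [l [hl l0 lX]] := linear_form.
have [nuK hK] := kill_sym fd finX d0 hl lX hL.
have [nu_ hnu] := choice extraneous_length_at.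
exists (nuK + nu_ P + \sum_(x <- xs) nu_ (Q x))%N => nu le; split.
  move=> _ [u hu <-].
  have [||s /eqP s0 hs] := hK nu _ [set 0] (zero_thin k N.+2) avoids0; first by lia.
    by exists H; [exact: (image_eq_mem fd d0 hH)|move=> /= e; case/eqP: image_eq_neq0].
  exists s; split; first exact: s0.
  by exists (s *: u); [split; [exact: rpredZ|exact: hs]|exact: tfZ].
move=> q hq; have pq : is_prime_ideal q by case: hq.
have Rl := loc_ring_local pq.
rewrite sym_gens_piece; apply: (clen_mod_length Rl (m := loc_max q)).
case: (pselect (q = P)) => [eq|nP].
  by rewrite eq in hq *; apply: hnu => //; lia.
case: (pselect (exists2 x, x \in xs & q (L x))) => [[x xx qx]|nx].
  have eq := relation_height_one hq ((hxs x).1 xx) qx; rewrite eq in hq *; apply: hnu => //.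
  by move: le; rewrite (big_rem x) //=; lia.
have -> : extraneous_length q = 0%N.
  rewrite /extraneous_length; case: asboolP => // _; rewrite big1_seq // => x /andP [/asboolP qx xx].
  by case: nx; exists x.
have [|||s ns hs] := hK nu _ q (height_one_thin hq); [by lia| | |].
- by move=> x /hxs xx qx; apply: nx; exists x.
- apply: contrapT => nb; have sub : P `<=` q.
    by move=> b Pb; apply: contrapT => qb; apply: nb; exists b.
  have [_ _ qmin] := hq; have e0 : P = [set 0].
    by apply: qmin => //; split=> // sub'; apply: nP; apply/seteqP.
  by have := image_eq_mem fd d0 hH; rewrite e0 => /= e; case/eqP: image_eq_neq0.
have -> : piece q setT nu = piece q J nu.
  apply/seteqP; split; last exact: (piece_mono pq).
  by apply: (piece_sub pq) => u hu _; exists s => //; apply: hs.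
by apply: clen_nil; apply: piece_submod => //; exact: sym_ideal_ideal.
Qed.

Local Notation La := (\prod_(x <- xs) L x ^+ w x).

(** Each local factor is split into powers of the [L x] contained in [q] and a power of [P]. After
    exchanging the products, an [L x] with positive exponent is met at exactly one prime of the
    finite support, the one it generates. *)
Lemma sym_macrae_eq : exists nu0, forall nu, (nu0 <= nu)%N ->
  sym_macrae f nu = idealM setT (principal La)
    (if `[< height_one P >] then idealX setT P (lambda_degree f) else setT).
Proof.
have [nu0 h] := sym_lengths; exists nu0 => nu /h [tor len].
rewrite /sym_macrae /macrae asboolT //.
set F := fun q => idealX setT q _.
have FE q : height_one q -> F q = idealX setT q (extraneous_length q) by move=> hq; rewrite /F len.
pose g q := \prod_(x <- xs | `[< q (L x) >]) L x ^+ w x.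
pose E q : set B := if q == P then idealX setT P (lambda_degree f) else setT.
have iE q : is_ideal setT (E q) by rewrite /E; case: ifP => // _; exact: idealX_ideal.
have FgE q : height_one q -> F q = idealM setT (principal (g q)) (E q).
  move=> hq; rewrite FE // /extraneous_length idealXD idealMC.
  have -> : idealX setT q (\sum_(x <- xs | `[< q (L x) >]) w x) = principal (g q).
    apply: (idealX_principal_sum (L := L)) => x /hxs nx /asboolP; exact: relation_height_one.
  congr (idealM _ _ _); rewrite /E; case: eqP => [->|nq]; first by rewrite asboolT.
  by rewrite asboolF.
have finS : finite_set (@height_one B `&` F @^-1` [set~ setT]).
  apply: (sub_finite_set _ (finite_seq (P :: [seq Q x | x <- xs]))) => q [hq /= nq].
  rewrite inE; case: eqP => //= nP; apply/mapP; apply: contrapT => nx; apply: nq.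
  rewrite FE // /extraneous_length asboolF // big1_seq // => x /andP [/asboolP qx xx].
  by case: nx; exists x => //; apply: (relation_height_one hq) => //; apply/hxs.
set s := finite_support _ _ _.
have us : uniq s by exact: finite_support_uniq.
have ms q : q \in s <-> height_one q /\ F q <> setT.
  by rewrite (in_finite_support finS); split=> [/set_mem|/mem_set].
have ms_pos q : height_one q -> (0 < extraneous_length q)%N -> q \in s.
  move=> hq lq; apply/ms; split=> //; rewrite FE //; apply: idealX_proper => //.
  by case: hq.
rewrite (eq_big_seq (fun q => idealM setT (principal (g q)) (E q))); last first.
  by move=> q /ms [hq _]; exact: FgE.
rewrite prod_idealM //; congr (idealM _ _ _); last first.
  rewrite prod_ideal_pick //; last exact: idealX_ideal.
  have de0 := lambda_degree_gt0 fd d0 hH fj0.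
  case: asboolP => hP; last by rewrite ifF //; apply/negbTE/negP => /ms [].
  by rewrite ms_pos // /extraneous_length asboolT // addn_gt0 de0.
congr principal; rewrite /g.
rewrite (exchange_big_dep xpredT) //=; apply: eq_big_seq => x xx.
have nx := (hxs x).1 xx; case: (posnP (w x)) => [->|wx].
  by rewrite big1.
have hQ := principal_height_one nx.
have Qs : Q x \in s.
  apply: ms_pos => //; rewrite /extraneous_length addn_gt0; apply/orP; right.
  rewrite (big_rem x) //= asboolT ?addn_gt0 ?wx //; exact: principal_mem.
rewrite big_mkcond (bigD1_seq (Q x)) //= asboolT; last exact: principal_mem.
rewrite big1_seq ?mulr1 // => q /andP [nq /ms [hq _]]; case: asboolP => // qx.
by case/eqP: nq; exact: (relation_height_one hq).
Qed.

Lemma image_eq_sub x : is_prime_ideal (Q x) -> Q x H -> P `<=` Q x.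
Proof.
move=> px xH p Pp; have [K ->] := pihomog_expand p.
apply: (ideal_sum _ (prime_ideal px)) => e _.
have [r [b eb]] := image_eq_rad hH (pihomogP mdeg e p) (eq_ideal_graded fd d0 e Pp).
apply: contrapT => np; apply: (primeN_exp px (r := r) np).
by rewrite eb; apply: (idealMl _ (prime_ideal px)).
Qed.

Lemma extraneous_factor G : (exists nu0, forall nu, (nu0 <= nu)%N ->
    sym_macrae f nu = gen_ideal setT [set G * H ^+ lambda_degree f]) ->
  exists c : k, c != 0 /\ G = c *: La.
Proof.
move=> [nu1 h1]; have [nu0 h0] := sym_macrae_eq.
have := h0 _ (leq_maxl nu0 nu1); rewrite (h1 _ (leq_maxr nu0 nu1)) principalP.
have hs x : x \in xs -> is_prime_ideal (Q x) /\ L x != 0.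
  by move=> /hxs; exact: relation_prime.
have [irrH _ _] := hH; have PH := image_eq_mem fd d0 hH; have iP := prime_ideal pP.
case: asboolP => hP e.
  have [c cu eG] := height_one_factor hs irrH PH iP hP e.
  move: cu; rewrite unfold_in /= => /andP [/eqP ec cu].
  exists c@_0; split; last by rewrite eG {1}ec mul_mpolyC.
  by rewrite -unitfE.
exfalso; rewrite idealMC idealMT in e; last exact: principal_ideal.
apply: (not_height_one_factor hs irrH PH iP _ _ _ e).
- exact: (lambda_degree_gt0 fd d0 hH fj0).
- by move=> x /hxs nx eP; apply: hP; rewrite eP; exact: principal_height_one.
by move=> x xx; apply: image_eq_sub; case: (hs x xx).
Qed.

Lemma multiplicity_ge_degree x : non_lci_points f x -> (local_degree f x <= local_multiplicity f x)%N.
Proof.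
move=> nx; have [i0 [t [v [v0 t0 sv [j vj] e]]]] := relation_linform nx.
by have [] := point_dataP fd finX nx.1 v0 vj vj (fun i => mulrC _ _) sv.
Qed.

Lemma specialize_linform (a : 'I_N.+3 -> A) (v : 'rV[k]_N.+2) : specialize a v = linform (fun i => mev (a i) v).
Proof. by []. Qed.

Lemma syzygy_multiple x a : non_lci_points f x -> is_syzygy f a ->
  exists c : k, specialize a (pcoord x) = c *: L x.
Proof.
move=> nx sa; have [i0 [t [v [v0 t0 sv [j vj] e]]]] := relation_linform nx.
have [c mphi] := chart_nilpotent fd finX v0 nx.1.
have sw := spec_rel_syzygy x i0 sa.
have h := non_lci_minors v0 fd nx.1 mphi nx.2 sw sv.
exists (mev (a j) (pcoord x) / v j * t); rewrite specialize_linform -scalerA -e scaler_sumr.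
apply: eq_bigr => i _; rewrite scalerA; congr (_ *: _).
by apply: (mulIf vj); rewrite h mulrAC divfK.
Qed.

(** A syzygy may mix degrees, so its value at a multiple of the normalised coordinates is reached by
    substituting [t *: 'X_i] for the variables; homogeneity of the [f i] keeps it a syzygy. *)
Lemma syzygy_scale a (t : k) : is_syzygy f a -> t != 0 ->
  is_syzygy f (fun i => a i \mPo [tuple t *: 'X_i | i < N.+2]).
Proof.
move=> sa t0; pose s : {rmorphism A -> A} := comp_mpoly [tuple t *: 'X_i | i < N.+2].
have sf i : s (tnth f i) = t ^+ d *: tnth f i.
  rewrite /s /= {1}[tnth f i]mpolyE (raddf_sum (comp_mpoly _)) [in RHS](mpolyE (tnth f i)) scaler_sumr.
  rewrite !big_seq; apply: eq_bigr => m mf /=; rewrite comp_mpolyZ scalerA mulrC -scalerA; congr (_ *: _).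
  have dm : mdeg m = d by apply: (dhomogP _ _ _ (fd i)).
  rewrite comp_mpolyX.
  transitivity (\prod_(l < N.+2) (t ^+ m l *: ('X_l : A) ^+ m l)).
    by apply: eq_bigr => l _; rewrite tnth_mktuple exprZn.
  by rewrite scaler_prod -dm mdegE (big_morph (fun e => t ^+ e) (exprD t) (expr0 t)) -mpolyXE_id.
have := congr1 s sa; rewrite rmorph0 (rmorph_sum s) => e; apply: (scalerI (expf_neq0 d t0)).
rewrite scaler0 -[RHS]e scaler_sumr; apply: eq_bigr => i _.
by rewrite (rmorphM s) sf -scalerAr.
Qed.

Lemma specializations x v : non_lci_points f x -> homog_coords x v ->
  (forall a, is_syzygy f a -> exists c : k, specialize a v = c *: L x) /\
  (exists a, is_syzygy f a /\ specialize a v != 0).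
Proof.
move=> nx [t [t0 ev]]; split=> [a sa|].
  have [c ec] := syzygy_multiple nx (syzygy_scale sa t0); exists c; rewrite -ec.
  apply: eq_bigr => i _; congr (_ *: _); rewrite /mev comp_mpoly_meval; apply: meval_eq => l.
  by rewrite tnth_mktuple mevalZ mevalXU ev mxE.
have [i0 [t' [u [u0 t'0 su [j uj] e]]]] := relation_linform nx.
have [e' [a [ha sa ea]]] := spec_rel_homog u0 fd su.
exists a; split=> //; apply: contraTneq uj => z; rewrite negbK.
have := congr1 (mcoeff U_(j)) z; rewrite specialize_linform linform_coef mcoeff0.
have -> : mev (a j) v = t ^+ e' * mev (a j) (pcoord x).
  by rewrite /mev -(homog_scale _ _ (ha j)); apply: meval_eq => l; rewrite ev mxE.
by rewrite ea => /eqP; rewrite mulf_eq0 expf_eq0 (negbTE t0) andbF.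
Qed.

End Extraneous.

Theorem proposition5 (k : closedFieldType) (n d : nat)
    (f : n.+1.-tuple {mpoly k[n]}) (H G : {mpoly k[n.+1]})
    (L : ppoint k n -> {mpoly k[n.+1]}) :
  (2 <= n)%N -> (1 <= d)%N ->
  (forall i, tnth f i \is d.-homog) ->
  (exists i, tnth f i != 0) ->
  generically_finite f ->
  finite_set (base_points f) ->
  (forall x, base_points f x -> locally_generated f x n) ->
  is_image_equation f H ->
  (exists D, G \is D.-homog) ->
  (forall nu, (eta f d <= nu)%N ->
     sym_macrae f nu = gen_ideal setT [set G * H ^+ lambda_degree f]) ->
  (forall x, non_lci_points f x -> is_relation_form f x d (L x)) ->
  [/\ forall x, non_lci_points f x ->
        (local_degree f x <= local_multiplicity f x)%N,
      exists c : k, c != 0 /\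
        G = c *: \big[*%R/1]_(x \in non_lci_points f)
                   L x ^+ (local_multiplicity f x - local_degree f x)
    & forall x, non_lci_points f x -> forall v, homog_coords x v ->
        (forall a, is_syzygy f a -> exists c : k, specialize a v = c *: L x)
        /\ (exists a, is_syzygy f a /\ specialize a v != 0)].
Proof.
case: n f H G L => [|[|N]] // f H G L _ d0 fd [j0 fj0] _ finX _ hH _ hM hL.
have [xs0 [uxs0 hxs0]] := base_seq finX.
pose xs := [seq x <- xs0 | `[< non_lci_points f x >]].
have uxs : uniq xs by apply: filter_uniq.
have hxs x : x \in xs <-> non_lci_points f x.
  rewrite mem_filter; split=> [/andP [/asboolP //]|nx]; apply/andP; split; first exact/asboolP.
  by apply/hxs0; case: nx.
split.
- by move=> x; exact: (multiplicity_ge_degree fd finX hL).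
- have -> : non_lci_points f = [set` xs] by apply/seteqP; split=> x /hxs.
  rewrite -fsbig_seq //; apply: (extraneous_factor fd finX d0 hH fj0 hL uxs hxs).
  by exists (eta f d).
move=> x nx v; exact: (specializations fd finX hL nx).
Qed.
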